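(* Let $\Omega_+\subset\mathbb{R}^2$ be a bounded simply connected domain with smooth boundary $L$, and $\Omega_-=\mathbb{R}^2\setminus(\Omega_+\cup L)$. Let $G,g$ be $\mathbb{R}_{0,2}$-valued functions of class $C^{0,\nu}(L)$, where the odd part of $G$ is null, i.e. $G=G_0$, and $G(\underline{x})\neq 0$ for all $\underline{x}\in L$. Consider the Riemann boundary value problem: find $\Phi$, with values in $\mathbb{R}_{0,2}$, monogenic on $\mathbb{R}^2\setminus L$, continuously extendable from $\Omega_\pm$ to $L$, with boundary values $\Phi^\pm$ satisfying $$\Phi^{+}(\underline{x})-G(\underline{x})\Phi^{-}(\underline{x})=g(\underline{x}),\qquad \underline{x}\in L,$$ under the condition $\Phi^-(\infty)=0$. Let $\aleph=\mathrm{Ind}(G):=\mathrm{Ind}(\widehat{G}_0)$, and let $X,\Psi_0,\Psi_1$ be the functions defined in the context. (i) If $\aleph\le 0$, the solution $\Phi$ is given by $$\Phi(\underline{x})=\beta^{-1}\big(\overline{\Upsilon_0(z)}\big)+e_1\,\beta^{-1}\big(\Upsilon_1(z)\big),\qquad z=x_1+ix_2,\ \underline{x}=x_1e_1+x_2e_2,\qquad ( * )$$ where $$\Upsilon_0(z)=X(z)\big[\Psi_0(z)+P^0_{-\aleph-1}(z)\big],\qquad \Upsilon_1(z)=X(z)\big[\Psi_1(z)+P^1_{-\aleph-1}(z)\big].$$ Here $P^0_{-\aleph-1},P^1_{-\aleph-1}$ are two polynomials of degree $-\aleph-1$; for $\aleph=0$ one puts $P^0_{-\aleph-1}\equiv 0$,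 $P^1_{-\aleph-1}\equiv 0$; and the solution depends on $-4\aleph$ real constants. (ii) If $\aleph>0$, then when the following $2\aleph$ solubility conditions $$\int_L\frac{\overline{\widehat{g}_0(\tau)}}{X^+(\tau)}\tau^{k-1}\,d\tau=0,\qquad \int_L\frac{\widehat{g}_1(\tau)}{X^+(\tau)}\tau^{k-1}\,d\tau=0,\qquad k=1,2,\dots,\aleph,$$ are fulfilled, $( * )$ is the solution, with $\Upsilon_0,\Upsilon_1$ given by the same formulas where $P^0_{-\aleph-1}\equiv 0$, $P^1_{-\aleph-1}\equiv 0$.
   Context: $\mathbb{R}_{0,2}$ is the real Clifford algebra generated by $e_1,e_2$ with $e_ie_j+e_je_i=-2\delta_{ij}$ and identity $1$; $\mathbb{R}^2$ is identified with $\{x_1e_1+x_2e_2\}$. The even subalgebra is $\mathbb{R}^+_{0,2}=\mathrm{span}_{\mathbb{R}}(1,e_1e_2)$, and $\mathbb{R}_{0,2}=\mathbb{R}^+_{0,2}\oplus e_1\mathbb{R}^+_{0,2}$. Every $\mathbb{R}_{0,2}$-valued function $a$ is written uniquely $a=a_0+e_1a_1$ with $a_0,a_1$ valued in $\mathbb{R}^+_{0,2}$, called its even and odd part. Thus $G=G_0+e_1G_1$, $g=g_0+e_1g_1$. A $C^1$ function $\Phi$ on an open set is monogenic if $\partial_2\Phi:=e_1\frac{\partial\Phi}{\partial x_1}+e_2\frac{\partial\Phi}{\partial x_2}=0$. $\Phi^-(\infty)=0$ means that $\Phi$ vanishes at infinity. $C^{0,\nu}(L)$ is the class of Hölder continuous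 functions with exponent $\nu$ on $L$. $\alpha:\mathbb{C}\to\mathbb{R}^2$ is $\alpha(x_1+ix_2)=x_1e_1+x_2e_2$; $\beta:\mathbb{R}^+_{0,2}\to\mathbb{C}$ is the algebra isomorphism with $\beta(1)=1$, $\beta(e_1e_2)=i$. For an $\mathbb{R}^+_{0,2}$-valued function $u$, put $\widehat{u}(z)=\beta(u(\alpha(z)))$. Via $\alpha$, the sets $L,\Omega_\pm$ are also regarded as subsets of $\mathbb{C}$, with $L$ traversed counterclockwise. The bar on complex quantities is complex conjugation. $\mathrm{Ind}(h)$, for a continuous nowhere vanishing $h:L\to\mathbb{C}$, is the increment of $\arg h$ along $L$ divided by $2\pi$. With $\aleph=\mathrm{Ind}(\widehat{G}_0)$ (so $\mathrm{Ind}(\overline{\widehat{G}_0})=-\aleph$), set $$\Gamma(z)=\frac{1}{2\pi i}\int_L\frac{\ln[\tau^{\aleph}\,\overline{\widehat{G}_0(\tau)}]}{\tau-z}\,d\tau,\qquad X^+(z)=e^{\Gamma(z)},\qquad X^-(z)=z^{\aleph}e^{\Gamma(z)},$$ where $X=X^+$ in $\Omega_+$ and $X=X^-$ in $\Omega_-$, and $X^+(\tau)$ for $\tau\in L$ is the boundary value from $\Omega_+$. Finally, $$\Psi_0(z)=\frac{1}{2\pi i}\int_L\frac{\overline{\widehat{g}_0(\tau)}}{X^+(\tau)}\frac{d\tau}{\tau-z},\qquad \Psi_1(z)=\frac{1}{2\pi i}\int_L\frac{\widehat{g}_1(\tau)}{X^+(\tau)}\frac{d\tau}{\tau-z}.$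$
   Formalization: When ℵ ≠ 0 the origin is assumed to lie in Ω₊: otherwise ln[τ^ℵ·conj(Ĝ₀)] has no continuous branch on L, so Γ and X are not defined as intended. *)

(* Defs.v *)
From Stdlib Require Import Reals ZArith List Lra Ring ClassicalEpsilon.
From Coquelicot Require Import Coquelicot.
Open Scope R_scope.

(* (s, p, q, t) stands for s + p e1 + q e2 + t e1 e2.  As a product of copies
   of R it inherits from Coquelicot the structure of a real normed module, with
   the Euclidean norm. *)
Definition Cl : Type := (R * R * R * R)%type.

Definition cl_one : Cl := (1, 0, 0, 0).
Definition e1 : Cl := (0, 1, 0, 0).
Definition e2 : Cl := (0, 0, 1, 0).
Definition e12 : Cl := (0, 0, 0, 1).

Definition cl_mul (a b : Cl) : Cl :=
  let '(a0, a1, a2, a3) := a in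
  let '(b0, b1, b2, b3) := b in
  (a0 * b0 - a1 * b1 - a2 * b2 - a3 * b3,
   a0 * b1 + a1 * b0 + a2 * b3 - a3 * b2,
   a0 * b2 + a2 * b0 - a1 * b3 + a3 * b1,
   a0 * b3 + a3 * b0 + a1 * b2 - a2 * b1).

(* The even and odd part of a, i.e. the a_0 and a_1 in span(1, e1 e2) such that
   a = a_0 + e1 a_1.  The sign comes from e1 (e1 e2) = - e2. *)
Definition even_part (a : Cl) : Cl := let '(s, p, q, t) := a in (s, 0, 0, t).
Definition odd_part (a : Cl) : Cl := let '(s, p, q, t) := a in (p, 0, 0, - q).

Definition is_even (a : Cl) : Prop := exists s t : R, a = (s, 0, 0, t).

Ltac cl_solve :=
  repeat match goal with a : Cl |- _ => destruct a as [[[? ?] ?] ?] end;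
  unfold cl_mul, cl_one, e1, e2, e12, even_part, odd_part, plus, opp, zero, scal,
    mult; simpl;
  unfold prod_plus, prod_zero, prod_scal, plus, zero, scal, mult; simpl;
  repeat apply (f_equal2 pair); unfold plus, zero, scal, mult; simpl; ring.

Lemma cl_e1_e1 : cl_mul e1 e1 = (- 1, 0, 0, 0). Proof. cl_solve. Qed.
Lemma cl_e2_e2 : cl_mul e2 e2 = (- 1, 0, 0, 0). Proof. cl_solve. Qed.
Lemma cl_e1_e2 : cl_mul e1 e2 = e12. Proof. cl_solve. Qed.
Lemma cl_e2_e1 : cl_mul e2 e1 = (0, 0, 0, - 1). Proof. cl_solve. Qed.
Lemma cl_mul_1_l (a : Cl) : cl_mul cl_one a = a. Proof. cl_solve. Qed.
Lemma cl_mul_1_r (a : Cl) : cl_mul a cl_one = a. Proof. cl_solve. Qed.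
Lemma cl_mul_assoc (a b c : Cl) :
  cl_mul a (cl_mul b c) = cl_mul (cl_mul a b) c.
Proof. cl_solve. Qed.
Lemma cl_mul_plus_l (a b c : Cl) :
  cl_mul a (plus b c) = plus (cl_mul a b) (cl_mul a c).
Proof. cl_solve. Qed.
Lemma cl_mul_plus_r (a b c : Cl) :
  cl_mul (plus a b) c = plus (cl_mul a c) (cl_mul b c).
Proof. cl_solve. Qed.

Lemma cl_decomp (a : Cl) :
  is_even (even_part a) /\ is_even (odd_part a) /\
  a = plus (even_part a) (cl_mul e1 (odd_part a)).
Proof.
split; [|split].
- destruct a as [[[s p] q] t]; now exists s, t.
- destruct a as [[[s p] q] t]; now exists p, (- q).
- cl_solve.
Qed.

(* The point (x1, x2) of R2 is the vector x1 e1 + x2 e2. *)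
Definition R2 : Type := (R * R)%type.

Definition alpha (z : C) : R2 := (Re z, Im z).
Definition alpha_inv (x : R2) : C := (fst x, snd x).

(* Only used on even elements; the components on e1 and e2 are discarded. *)
Definition beta (a : Cl) : C := let '(s, p, q, t) := a in (s, t).
Definition beta_inv (w : C) : Cl := (Re w, 0, 0, Im w).

Lemma beta_mul (a b : Cl) :
  is_even a -> is_even b -> beta (cl_mul a b) = Cmult (beta a) (beta b).
Proof.
intros [s [t ->]] [s' [t' ->]]; unfold cl_mul, beta, Cmult; simpl.
apply (f_equal2 pair); ring.
Qed.

Definition hat (u : R2 -> Cl) (z : C) : C := beta (u (alpha z)).

Definition onC (D : R2 -> Prop) (z : C) : Prop := D (alpha z).

Definition unit_interval (t : R) : Prop := 0 <= t <= 1.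

Definition boundary (D : R2 -> Prop) (x : R2) : Prop :=
  forall V : R2 -> Prop, locally x V ->
    (exists y, V y /\ D y) /\ (exists y, V y /\ ~ D y).

Definition exterior (D : R2 -> Prop) (x : R2) : Prop := ~ D x /\ ~ boundary D x.

Definition connected_set (D : R2 -> Prop) : Prop :=
  forall U V : R2 -> Prop, open U -> open V ->
    (forall x, D x -> U x \/ V x) ->
    (exists x, D x /\ U x) -> (exists x, D x /\ V x) ->
    exists x, D x /\ U x /\ V x.

Definition domain (D : R2 -> Prop) : Prop :=
  open D /\ (exists x, D x) /\ connected_set D.

Definition bounded_set (D : R2 -> Prop) : Prop :=
  exists M : R, forall x, D x -> norm x <= M.

(* Every loop in D is homotopic in D, through loops, to a constant loop. *)
Definition loops_contractible (D : R2 -> Prop) : Prop :=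
  forall c : R -> R2,
    continuous_on unit_interval c -> c 0 = c 1 ->
    (forall t, unit_interval t -> D (c t)) ->
    exists (H : R * R -> R2) (p : R2),
      continuous_on (fun st => unit_interval (fst st) /\ unit_interval (snd st)) H /\
      (forall s t, unit_interval s -> unit_interval t -> D (H (s, t))) /\
      (forall t, unit_interval t -> H (0, t) = c t) /\
      (forall t, unit_interval t -> H (1, t) = p) /\
      (forall s, unit_interval s -> H (s, 0) = H (s, 1)).

Definition simply_connected_domain (D : R2 -> Prop) : Prop :=
  domain D /\ loops_contractible D.

Definition velocity (gam : R -> C) (t : R) : C :=
  (Derive (fun s => Re (gam s)) t, Derive (fun s => Im (gam s)) t).

(* A smooth (regular, of class C^1) simple closed curve, as a 1-periodic
   function on R so that smoothness also holds at the closing point. *)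
Definition smooth_closed_curve (gam : R -> C) : Prop :=
  (forall t, gam (t + 1) = gam t) /\
  (forall t, ex_derive (fun s => Re (gam s)) t /\
             ex_derive (fun s => Im (gam s)) t) /\
  (forall t, continuous (velocity gam) t) /\
  (forall t, velocity gam t <> RtoC 0) /\
  (forall s t, 0 <= s < 1 -> 0 <= t < 1 -> gam s = gam t -> s = t).

Definition continuous_arg (gam : R -> C) (h : C -> C) (theta : R -> R) : Prop :=
  continuous_on unit_interval theta /\
  forall t, unit_interval t ->
    h (gam t) = Cmult (RtoC (Cmod (h (gam t)))) (cos (theta t), sin (theta t)).

(* The increment of arg h along the curve divided by 2 pi; meaningful when h is
   continuous and nowhere zero on the curve. *)
Definition Ind (gam : R -> C) (h : C -> C) : Z :=
  epsilon (inhabits 0%Z) (fun n : Z => exists theta : R -> R,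
    continuous_arg gam h theta /\ (theta 1 - theta 0) / (2 * PI) = IZR n).

(* gam is a parametrization of the boundary of D, traversed counterclockwise:
   it winds once in the positive sense around every point of D. *)
Definition smooth_boundary_param (D : R2 -> Prop) (gam : R -> C) : Prop :=
  smooth_closed_curve gam /\
  (forall z : C, onC (boundary D) z <-> exists t, unit_interval t /\ gam t = z) /\
  (forall z : C, onC D z -> Ind gam (fun tau => Cminus tau z) = 1%Z).

Definition cint (gam : R -> C) (f : C -> C) : C :=
  RInt (V := C_R_CompleteNormedModule)
    (fun t => Cmult (f (gam t)) (velocity gam t)) 0 1.

Definition cauchy_int (gam : R -> C) (f : C -> C) (z : C) : C :=
  Cmult (Cinv (Cmult (RtoC (2 * PI)) Ci))
    (cint gam (fun tau => Cdiv (f tau) (Cminus tau z))).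

Definition Cexp (z : C) : C := (exp (Re z) * cos (Im z), exp (Re z) * sin (Im z)).

Definition Czpow (z : C) (n : Z) : C :=
  if (0 <=? n)%Z then Cpow z (Z.to_nat n) else Cinv (Cpow z (Z.to_nat (- n))).

(* A branch of ln h that is continuous on L; two of them differ by a constant
   in 2 pi i Z when L is connected. *)
Definition log_branch (L : C -> Prop) (h : C -> C) : C -> C :=
  epsilon (inhabits (fun _ : C => RtoC 0)) (fun lam : C -> C =>
    continuous_on L lam /\ forall tau, L tau -> Cexp (lam tau) = h tau).

(* The polynomial with coefficients l in order of increasing degree; lists of
   length n give the polynomials of degree at most n - 1, and only 0 if n = 0. *)
Definition Cpoly (l : list C) (z : C) : C :=
  fold_right (fun a r => Cplus a (Cmult z r)) (RtoC 0) l.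

Definition aleph (gam : R -> C) (G : R2 -> Cl) : Z :=
  Ind gam (hat (fun x => even_part (G x))).

Definition Gamma (D : R2 -> Prop) (gam : R -> C) (G : R2 -> Cl) : C -> C :=
  cauchy_int gam (log_branch (onC (boundary D)) (fun tau =>
    Cmult (Czpow tau (aleph gam G))
      (Cconj (hat (fun x => even_part (G x)) tau)))).

Definition Xplus (D : R2 -> Prop) (gam : R -> C) (G : R2 -> Cl) (z : C) : C :=
  Cexp (Gamma D gam G z).

Definition Xminus (D : R2 -> Prop) (gam : R -> C) (G : R2 -> Cl) (z : C) : C :=
  Cmult (Czpow z (aleph gam G)) (Cexp (Gamma D gam G z)).

Definition X (D : R2 -> Prop) (gam : R -> C) (G : R2 -> Cl) (z : C) : C :=
  if excluded_middle_informative (onC D z) then Xplus D gam G z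
  else Xminus D gam G z.

Definition Xplus_bv (D : R2 -> Prop) (gam : R -> C) (G : R2 -> Cl) (tau : C) : C :=
  epsilon (inhabits (RtoC 0)) (fun v : C =>
    filterlim (Xplus D gam G) (within (onC D) (locally tau)) (locally v)).

Definition density0 (D : R2 -> Prop) (gam : R -> C) (G g : R2 -> Cl) (tau : C) : C :=
  Cdiv (Cconj (hat (fun x => even_part (g x)) tau)) (Xplus_bv D gam G tau).

Definition density1 (D : R2 -> Prop) (gam : R -> C) (G g : R2 -> Cl) (tau : C) : C :=
  Cdiv (hat (fun x => odd_part (g x)) tau) (Xplus_bv D gam G tau).

Definition Psi0 (D : R2 -> Prop) (gam : R -> C) (G g : R2 -> Cl) : C -> C :=
  cauchy_int gam (density0 D gam G g).

Definition Psi1 (D : R2 -> Prop) (gam : R -> C) (G g : R2 -> Cl) : C -> C :=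
  cauchy_int gam (density1 D gam G g).

Definition Upsilon0 (D : R2 -> Prop) (gam : R -> C) (G g : R2 -> Cl)
    (P0 : list C) (z : C) : C :=
  Cmult (X D gam G z) (Cplus (Psi0 D gam G g z) (Cpoly P0 z)).

Definition Upsilon1 (D : R2 -> Prop) (gam : R -> C) (G g : R2 -> Cl)
    (P1 : list C) (z : C) : C :=
  Cmult (X D gam G z) (Cplus (Psi1 D gam G g z) (Cpoly P1 z)).

Definition Phi_formula (D : R2 -> Prop) (gam : R -> C) (G g : R2 -> Cl)
    (P0 P1 : list C) (x : R2) : Cl :=
  plus (beta_inv (Cconj (Upsilon0 D gam G g P0 (alpha_inv x))))
       (cl_mul e1 (beta_inv (Upsilon1 D gam G g P1 (alpha_inv x)))).

Definition holder_on (nu : R) (L : R2 -> Prop) (f : R2 -> Cl) : Prop :=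
  exists K : R, forall x y : R2, L x -> L y -> x <> y ->
    norm (minus (f x) (f y)) <= K * Rpower (norm (minus x y)) nu.

Definition monogenic_on (U : R2 -> Prop) (Phi : R2 -> Cl) : Prop :=
  exists d1 d2 : R2 -> Cl,
    continuous_on U d1 /\ continuous_on U d2 /\
    forall x : R2, U x ->
      is_derive (fun t => Phi (t, snd x)) (fst x) (d1 x) /\
      is_derive (fun t => Phi (fst x, t)) (snd x) (d2 x) /\
      plus (cl_mul e1 (d1 x)) (cl_mul e2 (d2 x)) = zero.

Definition continuous_extension (U L : R2 -> Prop) (Phi Psi : R2 -> Cl) : Prop :=
  continuous_on (fun x => U x \/ L x) Psi /\ forall x, U x -> Psi x = Phi x.

Definition vanishes_at_infinity (U : R2 -> Prop) (Phi : R2 -> Cl) : Prop :=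
  forall eps : R, 0 < eps -> exists M : R, forall x : R2,
    U x -> M < norm x -> norm (Phi x) < eps.

(* This does not depend on the values of Phi on the boundary of D. *)
Definition is_solution (D : R2 -> Prop) (G g : R2 -> Cl) (Phi : R2 -> Cl) : Prop :=
  monogenic_on (fun x => ~ boundary D x) Phi /\
  vanishes_at_infinity (exterior D) Phi /\
  exists PhiP PhiM : R2 -> Cl,
    continuous_extension D (boundary D) Phi PhiP /\
    continuous_extension (exterior D) (boundary D) Phi PhiM /\
    forall x : R2, boundary D x ->
      minus (PhiP x) (cl_mul (G x) (PhiM x)) = g x.

(* The functions satisfying S, restricted to U, form a real affine space of
   dimension d: Phi_* + c_1 B_1 + ... + c_d B_d with independent B_1, ..., B_d. *)
Definition depends_on_real_constants (U : R2 -> Prop) (S : (R2 -> Cl) -> Prop)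
    (d : nat) : Prop :=
  exists (Phi_star : R2 -> Cl) (B : nat -> R2 -> Cl),
    (forall Phi : R2 -> Cl, S Phi <->
       exists c : nat -> R, forall x : R2, U x ->
         Phi x = plus (Phi_star x) (sum_n_m (fun k => scal (c k) (B k x)) 1 d)) /\
    (forall c : nat -> R,
       (forall x : R2, U x -> sum_n_m (fun k => scal (c k) (B k x)) 1 d = zero) ->
       forall k : nat, (1 <= k <= d)%nat -> c k = 0).

(* Main.v *)
(** Writing [Phi = conj w0 + e1 w1] with complex-valued [w0], [w1], monogenicity of
    [Phi] means that [w0] and [w1] are holomorphic, and since [G] is even the boundary
    condition splits into two scalar problems [w+ - (conj G0) w- = q].  For these, the
    logarithm of [tau ^ aleph * conj G0] is single-valued on [L] and Hoelder
    continuous, so the Sokhotski-Plemelj formulas give [X+ = (conj G0) X-], and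
    [w / X - Psi] takes the same boundary values from both sides.  It is therefore
    entire by Painleve's theorem, and a polynomial of degree less than [- aleph] by
    Liouville's theorem.

    The Sokhotski-Plemelj formulas come from the modulus of continuity of
    [int (phi tau - phi t) / (tau - z) dtau], where [t] is a point of [L] nearest to
    [z], together with the winding number of [L], which is [1] inside and [0] outside:
    it is locally constant off [L] and jumps across [L], and [L] has only two sides
    locally.  Painleve's theorem is Morera's theorem in the coordinates
    [(s, y) |-> gam s + i gam'(s0) y], in which [L] is the line [y = 0]. *)
Require Import Defs.
From Stdlib Require Import Reals ZArith List Lra Lia Psatz Classical ClassicalEpsilon
  FunctionalExtensionality.
From Coquelicot Require Import Coquelicot.
Open Scope R_scope.

(** * Continuity and derivatives of complex-valued functions *)

(** The densities of [Psi0] and [Psi1] contain the boundary value of [X], which is itself the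
    exponential of a Cauchy integral. Continuous boundary values are therefore not enough: they must
    be Hoelder again, and one estimate, uniform in the point and in the parameter, supplies both
    their existence and their regularity. Principal values never occur: after subtracting [phi s0]
    from the density the singularity is integrable, and the subtracted constant contributes exactly
    a winding number.

    The curve is only of class C^1, so nothing may differentiate its tangent; local coordinates
    therefore use the normal direction frozen at one point. The exterior is not known to be
    connected in advance, so its winding number is found by following the curve rather than by a
    path to infinity.

    Densities are handled as 1-periodic functions of the parameter, and the chord-arc inequality
    converts distances in the plane into distances of parameters. Quantities chosen by [epsilon] are
    identified by uniqueness: the index through continuous arguments, the boundary value of [X]
    through limits. *)

Notation Cdiff := (@is_derive C_AbsRing (AbsRing_NormedModule C_AbsRing)).
Notation Rdiff := (@is_derive R_AbsRing C_R_NormedModule).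
Definition cI (f : R -> C) (a b : R) : C := RInt (V := C_R_CompleteNormedModule) f a b.
Notation is_cI := (is_RInt (V := C_R_NormedModule)).
Notation ex_cI := (ex_RInt (V := C_R_NormedModule)).
Notation Rcont := (@continuous R_UniformSpace C_UniformSpace).
Notation Ccont := (@continuous C_UniformSpace C_UniformSpace).

Lemma Cmod_sub_sym (z w : C) : Cmod (z - w) = Cmod (w - z).
Proof. rewrite <- Cmod_opp; f_equal; ring. Qed.

Lemma Cmod_triangle_sub (x y z : C) : Cmod (x - z) <= Cmod (x - y) + Cmod (y - z).
Proof. replace (x - z)%C with ((x - y) + (y - z))%C by ring. apply Cmod_triangle. Qed.

Lemma Cmod_sub_ge (x y : C) : Cmod x - Cmod y <= Cmod (x - y).
Proof.
generalize (Cmod_triangle (x - y) y); replace (x - y + y)%C with x by ring; lra.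
Qed.

Lemma Cmod_sub_le (x y : C) : Cmod (x - y) <= Cmod x + Cmod y.
Proof.
generalize (Cmod_triangle x (- y)); rewrite Cmod_opp; auto.
Qed.

Lemma Csub_neq0 (x y : C) : x <> y -> (x - y)%C <> RtoC 0.
Proof. intros H E; apply H. replace x with (x - y + y)%C by ring; rewrite E; ring. Qed.

Lemma Cmod_sub_gt0 (x y : C) : x <> y -> 0 < Cmod (x - y).
Proof. intros; now apply Cmod_gt_0, Csub_neq0. Qed.

Lemma Cmod_le_ReIm (z : C) : Cmod z <= Rabs (Re z) + Rabs (Im z).
Proof.
replace z with (RtoC (Re z) + RtoC (Im z) * Ci)%C at 1.
- eapply Rle_trans; [apply Cmod_triangle|].
  rewrite Cmod_mult, Cmod_Ci, !Cmod_R; lra.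
- destruct z; unfold RtoC, Ci, Cplus, Cmult; simpl; f_equal; ring.
Qed.

Lemma im_le_Cmod (z : C) : Rabs (Im z) <= Cmod z.
Proof. eapply Rle_trans; [|apply Rmax_Cmod]; apply Rmax_r. Qed.

Lemma C_eq (z w : C) : Re z = Re w -> Im z = Im w -> z = w.
Proof. destruct z, w; simpl; now intros -> ->. Qed.

Lemma Cmod_lt_all (z w : C) : (forall eps, 0 < eps -> Cmod (z - w) < eps) -> z = w.
Proof.
intros H; destruct (classic (z = w)) as [E|E]; auto.
apply Cmod_sub_gt0 in E; specialize (H _ E); lra.
Qed.

Lemma locally_R_iff (x : R) (P : R -> Prop) :
  locally x P <-> exists d, 0 < d /\ forall y, Rabs (y - x) < d -> P y.
Proof.
split.
- intros [d H]; exists d; split; [apply cond_pos|]; intros y Hy; apply H; exact Hy.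
- intros [d [Hd H]]; exists (mkposreal d Hd); intros y Hy; apply H; exact Hy.
Qed.

(** The balls of the uniform structure on [C] are squares; with discs the estimates can be carried
    out with [Cmod]. *)
Lemma locally_C_iff (z : C) (P : C -> Prop) :
  locally (T := C_UniformSpace) z P <->
  exists d, 0 < d /\ forall w, Cmod (w - z) < d -> P w.
Proof.
split.
- intros H; apply locally_C in H; destruct H as [d H].
  exists d; split; [apply cond_pos|]; intros y Hy; apply H; exact Hy.
- intros [d [Hd H]]; apply locally_C; exists (mkposreal d Hd); intros y Hy; apply H; exact Hy.
Qed.

Lemma locally_RC_iff (t : R) (z : C) (P : R * C -> Prop) :
  locally (T := prod_UniformSpace R_UniformSpace C_UniformSpace) (t, z) P <->
  exists d, 0 < d /\ forall s w, Rabs (s - t) < d -> Cmod (w - z) < d -> P (s, w).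
Proof.
split.
- intros [d H].
  assert (Hz : locally (T := C_UniformSpace) z (ball z d)) by apply locally_ball.
  apply locally_C_iff in Hz; destruct Hz as [d' [Hd' Hz]].
  exists (Rmin d d'); split.
  + apply Rmin_pos; [apply cond_pos|auto].
  + intros s w Hs Hw; apply H; split; simpl.
    * apply (Rlt_le_trans _ _ _ Hs), Rmin_l.
    * apply Hz, (Rlt_le_trans _ _ _ Hw), Rmin_r.
- intros [d [Hd H]].
  assert (Hz : locally (T := C_UniformSpace) z (fun w => Cmod (w - z) < d)).
  { apply locally_C_iff; exists d; auto. }
  destruct Hz as [d' Hz].
  assert (Hm : 0 < Rmin d d') by (apply Rmin_pos; [auto|apply cond_pos]).
  exists (mkposreal _ Hm); intros [s w] [Hs Hw]; apply H.
  + apply (Rlt_le_trans _ _ _ Hs), Rmin_l.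
  + apply Hz; eapply ball_le; [|exact Hw]; apply Rmin_r.
Qed.

Lemma filterlim_C_iff {T : Type} (F : (T -> Prop) -> Prop) {FF : Filter F} (f : T -> C) (l : C) :
  filterlim f F (locally (T := C_UniformSpace) l) <->
  forall eps, 0 < eps -> F (fun y => Cmod (f y - l) < eps).
Proof.
split.
- intros H eps He. apply (H (fun z => Cmod (z - l) < eps)), locally_C_iff; exists eps; auto.
- intros H P HP; apply locally_C_iff in HP; destruct HP as [d [Hd HP]].
  unfold filtermap; generalize (H d Hd); apply filter_imp; auto.
Qed.

Lemma continuous_C_iff {U : UniformSpace} (f : U -> C) (x : U) :
  @continuous U C_UniformSpace f x <->
  forall eps, 0 < eps -> locally x (fun y => Cmod (f y - f x) < eps).
Proof. apply filterlim_C_iff; typeclasses eauto. Qed.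

Lemma Rcont_iff (f : R -> C) (x : R) :
  Rcont f x <-> forall eps, 0 < eps ->
    exists d, 0 < d /\ forall y, Rabs (y - x) < d -> Cmod (f y - f x) < eps.
Proof.
rewrite continuous_C_iff; split; intros H eps He; generalize (H eps He);
rewrite locally_R_iff; auto.
Qed.

Lemma Ccont_iff (f : C -> C) (z : C) :
  Ccont f z <-> forall eps, 0 < eps ->
    exists d, 0 < d /\ forall w, Cmod (w - z) < d -> Cmod (f w - f z) < eps.
Proof.
rewrite continuous_C_iff; split; intros H eps He; generalize (H eps He);
rewrite locally_C_iff; auto.
Qed.

Section ContinuityCombinators.
Context {U : UniformSpace}.
Notation cont := (@continuous U C_UniformSpace).

Lemma cont_Cplus (f g : U -> C) x : cont f x -> cont g x -> cont (fun y => f y + g y)%C x.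
Proof.
intros Hf Hg. exact (continuous_plus (K := R_AbsRing) (V := C_R_NormedModule) f g x Hf Hg).
Qed.

Lemma cont_Copp (f : U -> C) x : cont f x -> cont (fun y => - f y)%C x.
Proof. intros Hf. exact (continuous_opp (K := R_AbsRing) (V := C_R_NormedModule) f x Hf). Qed.

Lemma cont_Cminus (f g : U -> C) x : cont f x -> cont g x -> cont (fun y => f y - g y)%C x.
Proof. intros Hf Hg. apply cont_Cplus; [auto|now apply cont_Copp]. Qed.

Lemma cont_Re (f : U -> C) x : cont f x -> @continuous U R_UniformSpace (fun y => Re (f y)) x.
Proof. intros Hf. apply (continuous_comp f fst); [exact Hf|]. apply continuous_fst. Qed.

Lemma cont_Im (f : U -> C) x : cont f x -> @continuous U R_UniformSpace (fun y => Im (f y)) x.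
Proof. intros Hf. apply (continuous_comp f snd); [exact Hf|]. apply continuous_snd. Qed.

Lemma cont_pair (f g : U -> R) x : @continuous U R_UniformSpace f x ->
  @continuous U R_UniformSpace g x -> cont (fun y => (f y, g y)) x.
Proof.
intros Hf Hg P [d HP].
assert (H1 : locally x (fun y => ball (f x) d (f y))) by exact (Hf _ (locally_ball _ _)).
assert (H2 : locally x (fun y => ball (g x) d (g y))) by exact (Hg _ (locally_ball _ _)).
unfold filtermap; generalize (filter_and _ _ H1 H2).
apply filter_imp; intros y [H3 H4]; apply HP; split; auto.
Qed.

Lemma cont_ReIm (f : U -> C) x : @continuous U R_UniformSpace (fun y => Re (f y)) x ->
  @continuous U R_UniformSpace (fun y => Im (f y)) x -> cont f x.
Proof.
intros H1 H2. apply (continuous_ext (fun y => (Re (f y), Im (f y)))).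
- intros y; destruct (f y); reflexivity.
- now apply cont_pair.
Qed.

Lemma contR_plus (f g : U -> R) x : @continuous U R_UniformSpace f x ->
  @continuous U R_UniformSpace g x -> @continuous U R_UniformSpace (fun y => f y + g y) x.
Proof. intros; now apply (continuous_plus (K := R_AbsRing) (V := R_NormedModule)). Qed.
Lemma contR_minus (f g : U -> R) x : @continuous U R_UniformSpace f x ->
  @continuous U R_UniformSpace g x -> @continuous U R_UniformSpace (fun y => f y - g y) x.
Proof. intros; now apply (continuous_minus (K := R_AbsRing) (V := R_NormedModule)). Qed.
Lemma contR_mult (f g : U -> R) x : @continuous U R_UniformSpace f x ->
  @continuous U R_UniformSpace g x -> @continuous U R_UniformSpace (fun y => f y * g y) x.
Proof. intros; now apply (continuous_mult (K := R_AbsRing)). Qed.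

Lemma cont_Cmult (f g : U -> C) x : cont f x -> cont g x -> cont (fun y => f y * g y)%C x.
Proof.
intros Hf Hg. apply cont_ReIm; simpl.
- apply contR_minus; apply contR_mult; auto using cont_Re, cont_Im.
- apply contR_plus; apply contR_mult; auto using cont_Re, cont_Im.
Qed.

Lemma cont_const (c : C) x : cont (fun _ => c) x.
Proof. apply continuous_const. Qed.

Lemma cont_Cinv (f : U -> C) x : cont f x -> f x <> RtoC 0 -> cont (fun y => / f y)%C x.
Proof.
intros Hf H0. apply continuous_C_iff; intros eps He.
assert (Hm := proj1 (Cmod_gt_0 _) H0). set (m := Cmod (f x)) in *.
(* Within [m / 2] of [f x] the modulus of [f y] exceeds [m / 2], so inversion enlarges differences
   at most by the factor [2 / (m * m)]. *)
assert (Hd : 0 < Rmin (m / 2) (eps * (m * m / 2))).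
{ apply Rmin_pos; [lra|]. apply Rmult_lt_0_compat; nra. }
generalize (proj1 (continuous_C_iff f x) Hf _ Hd); apply filter_imp.
intros y Hy.
assert (H1 : Cmod (f y - f x) < m / 2) by (eapply Rlt_le_trans; [exact Hy|apply Rmin_l]).
assert (H2 : Cmod (f y - f x) < eps * (m * m / 2)) by (eapply Rlt_le_trans; [exact Hy|apply Rmin_r]).
assert (H3 : m / 2 < Cmod (f y)).
{ generalize (Cmod_sub_ge (f x) (f y)); rewrite Cmod_sub_sym; fold m; lra. }
assert (H4 : f y <> RtoC 0) by (apply Cmod_gt_0; lra).
replace (/ f y - / f x)%C with ((f x - f y) / (f y * f x))%C by (field; auto).
rewrite Cmod_div, Cmod_mult, Cmod_sub_sym by (apply Cmult_neq_0; auto). fold m.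
apply (Rmult_lt_reg_r (Cmod (f y) * m)); [nra|].
replace (Cmod (f y - f x) / (Cmod (f y) * m) * (Cmod (f y) * m)) with (Cmod (f y - f x)) by (field; lra).
eapply Rlt_trans; [exact H2|]. apply Rmult_lt_compat_l; nra.
Qed.

Lemma cont_Cdiv (f g : U -> C) x : cont f x -> cont g x -> g x <> RtoC 0 -> cont (fun y => f y / g y)%C x.
Proof. intros. apply cont_Cmult; auto. now apply cont_Cinv. Qed.

Lemma cont_Cpow (f : U -> C) n x : cont f x -> cont (fun y => f y ^ n)%C x.
Proof. intros H. induction n; simpl; [apply cont_const|now apply cont_Cmult]. Qed.

Lemma cont_RtoC (f : U -> R) x : @continuous U R_UniformSpace f x -> cont (fun y => RtoC (f y)) x.
Proof. intros. apply cont_pair; [auto|apply continuous_const]. Qed.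

Lemma cont_Cconj (f : U -> C) x : cont f x -> cont (fun y => Cconj (f y)) x.
Proof.
intros. apply cont_pair; [now apply cont_Re|].
apply (continuous_opp (K := R_AbsRing) (V := R_NormedModule)). now apply cont_Im.
Qed.

Lemma contR_Cmod (f : U -> C) x : cont f x -> @continuous U R_UniformSpace (fun y => Cmod (f y)) x.
Proof.
intros Hf P [d HP]. unfold filtermap.
generalize (proj1 (continuous_C_iff f x) Hf d (cond_pos d)); apply filter_imp.
intros y Hy; apply HP; change (Rabs (Cmod (f y) - Cmod (f x)) < d).
generalize (Cmod_sub_ge (f y) (f x)) (Cmod_sub_ge (f x) (f y)); rewrite (Cmod_sub_sym (f x) (f y)).
intros; apply Rabs_def1; lra.
Qed.

Lemma cont_comp (g : U -> C) (h : C -> C) x : cont g x -> Ccont h (g x) -> cont (fun y => h (g y)) x.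
Proof. intros Hg Hh. exact (continuous_comp (V := C_UniformSpace) (W := C_UniformSpace) g h x Hg Hh). Qed.

Lemma cont_compR (g : U -> R) (h : R -> C) x : @continuous U R_UniformSpace g x -> Rcont h (g x) -> cont (fun y => h (g y)) x.
Proof. intros Hg Hh. exact (continuous_comp (V := R_UniformSpace) (W := C_UniformSpace) g h x Hg Hh). Qed.

End ContinuityCombinators.

Notation RC := (prod_UniformSpace R_UniformSpace C_UniformSpace).

Lemma cont_fst (t : R) (z : C) : @continuous RC R_UniformSpace fst (t, z).
Proof. apply continuous_fst. Qed.

Lemma cont_snd (t : R) (z : C) : @continuous RC C_UniformSpace snd (t, z).
Proof. apply continuous_snd. Qed.


(** * Complex and real differentiability as first-order estimates *)

Lemma Cdiff_iff (f : C -> C) (z l : C) :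
  Cdiff f z l <-> forall eps, 0 < eps -> exists d, 0 < d /\
    forall w, Cmod (w - z) < d -> Cmod (f w - f z - l * (w - z)) <= eps * Cmod (w - z).
Proof.
split.
- intros [_ H] eps He.
  destruct (H z (fun P HP => HP) (mkposreal eps He)) as [d Hd].
  exists d; split; [apply cond_pos|]; intros w Hw. specialize (Hd w Hw). simpl in Hd.
  replace (l * (w - z))%C with ((w - z) * l)%C by ring. exact Hd.
- intros H; split; [apply is_linear_scal_l|].
  intros x Hx eps. apply (is_filter_lim_locally_unique (K := C_AbsRing) (V := AbsRing_NormedModule C_AbsRing)) in Hx; subst x.
  destruct (H eps (cond_pos eps)) as [d [Hd H1]].
  exists (mkposreal d Hd); intros w Hw. specialize (H1 w Hw).
  replace (l * (w - z))%C with ((w - z) * l)%C in H1 by ring. exact H1.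
Qed.

Lemma Rdiff_iff (f : R -> C) (t : R) (l : C) :
  Rdiff f t l <-> forall eps, 0 < eps -> exists d, 0 < d /\
    forall s, Rabs (s - t) < d -> Cmod (f s - f t - l * RtoC (s - t)) <= eps * Rabs (s - t).
Proof.
assert (E : forall s, norm (minus (minus (f s) (f t)) (scal (minus s t) l) : C_R_NormedModule)
   = Cmod (f s - f t - l * RtoC (s - t))).
{ intros s. rewrite <- Cmod_norm. f_equal. unfold RtoC.
  apply C_eq; simpl; unfold minus, scal, plus, opp; simpl; unfold mult; simpl; ring. }
split.
- intros [_ H] eps He.
  destruct (H t (fun P HP => HP) (mkposreal eps He)) as [d Hd].
  exists d; split; [apply cond_pos|]; intros w Hw. specialize (Hd w Hw).
  rewrite <- E. exact Hd.
- intros H; split; [apply is_linear_scal_l|].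
  intros x Hx eps. apply (is_filter_lim_locally_unique (K := R_AbsRing) (V := R_NormedModule)) in Hx; subst x.
  destruct (H eps (cond_pos eps)) as [d [Hd H1]].
  exists (mkposreal d Hd); intros w Hw. specialize (H1 w Hw).
  rewrite <- E in H1. exact H1.
Qed.

Lemma Cdiff_cont (f : C -> C) z l : Cdiff f z l -> Ccont f z.
Proof.
intros H. apply Ccont_iff; intros eps He.
destruct (proj1 (Cdiff_iff f z l) H 1 Rlt_0_1) as [d [Hd H1]].
assert (Hm : 0 < 1 + Cmod l) by (generalize (Cmod_ge_0 l); lra).
exists (Rmin d (eps / (1 + Cmod l))); split.
{ apply Rmin_pos; auto. now apply Rdiv_lt_0_compat. }
intros w Hw.
specialize (H1 w (Rlt_le_trans _ _ _ Hw (Rmin_l _ _))).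
assert (H2 := Rlt_le_trans _ _ _ Hw (Rmin_r _ _)).
apply (Rmult_lt_compat_r (1 + Cmod l)) in H2; auto.
replace (eps / (1 + Cmod l) * (1 + Cmod l)) with eps in H2 by (field; lra).
replace (f w - f z)%C with ((f w - f z - l * (w - z)) + l * (w - z))%C by ring.
eapply Rle_lt_trans; [apply Cmod_triangle|]. rewrite Cmod_mult. lra.
Qed.

Lemma Cdiff_const (c z : C) : Cdiff (fun _ => c) z (RtoC 0).
Proof. exact (is_derive_const (K := C_AbsRing) (V := AbsRing_NormedModule C_AbsRing) c z). Qed.

Lemma Cdiff_id (z : C) : Cdiff (fun w => w) z (RtoC 1).
Proof. exact (is_derive_id (K := C_AbsRing) z). Qed.

Lemma Cdiff_plus (f g : C -> C) z lf lg : Cdiff f z lf -> Cdiff g z lg ->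
  Cdiff (fun w => f w + g w)%C z (lf + lg)%C.
Proof. exact (is_derive_plus (K := C_AbsRing) (V := AbsRing_NormedModule C_AbsRing) f g z lf lg). Qed.

Lemma Cdiff_minus (f g : C -> C) z lf lg : Cdiff f z lf -> Cdiff g z lg ->
  Cdiff (fun w => f w - g w)%C z (lf - lg)%C.
Proof. exact (is_derive_minus (K := C_AbsRing) (V := AbsRing_NormedModule C_AbsRing) f g z lf lg). Qed.

Lemma Cdiff_mult (f g : C -> C) z lf lg : Cdiff f z lf -> Cdiff g z lg ->
  Cdiff (fun w => f w * g w)%C z (lf * g z + f z * lg)%C.
Proof. intros Hf Hg; exact (is_derive_mult (K := C_AbsRing) f g z lf lg Hf Hg Cmult_comm). Qed.

Lemma Cdiff_comp (f g : C -> C) z lf lg : Cdiff f (g z) lf -> Cdiff g z lg ->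
  Cdiff (fun w => f (g w)) z (lf * lg)%C.
Proof.
intros Hf Hg. rewrite Cmult_comm.
exact (is_derive_comp (K := C_AbsRing) (V := AbsRing_NormedModule C_AbsRing) f g z lf lg Hf Hg).
Qed.

Lemma Cdiff_val (f : C -> C) (z l l' : C) : Cdiff f z l -> l = l' -> Cdiff f z l'.
Proof. now intros H <-. Qed.

Lemma Cdiff_ext_loc (f g : C -> C) z l d : 0 < d ->
  (forall w, Cmod (w - z) < d -> f w = g w) -> Cdiff f z l -> Cdiff g z l.
Proof.
intros Hd E H. apply Cdiff_iff; intros eps He.
destruct (proj1 (Cdiff_iff f z l) H eps He) as [d' [Hd' H1]].
exists (Rmin d d'); split; [now apply Rmin_pos|]. intros w Hw.
rewrite <- (E w), <- (E z).
- apply H1. apply (Rlt_le_trans _ _ _ Hw), Rmin_r.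
- replace (z - z)%C with (RtoC 0) by ring. now rewrite Cmod_0.
- apply (Rlt_le_trans _ _ _ Hw), Rmin_l.
Qed.

Lemma Cdiff_ext (f g : C -> C) z l : (forall w, f w = g w) -> Cdiff f z l -> Cdiff g z l.
Proof. intros E; apply (Cdiff_ext_loc _ _ _ _ 1 Rlt_0_1); auto. Qed.

Lemma Cdiff_inv (z : C) : z <> RtoC 0 -> Cdiff (fun w => / w)%C z (- / (z * z))%C.
Proof.
intros Hz. apply Cdiff_iff; intros eps He.
assert (Hm := proj1 (Cmod_gt_0 _) Hz). set (m := Cmod z) in *.
exists (Rmin (m / 2) (eps * (m * m * m / 2))); split.
{ apply Rmin_pos; [lra|]. apply Rmult_lt_0_compat; [auto|]. assert (0 < m * m) by nra. nra. }
intros w Hw.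
assert (H1 := Rlt_le_trans _ _ _ Hw (Rmin_l _ _)).
assert (H2 := Rlt_le_trans _ _ _ Hw (Rmin_r _ _)).
assert (H3 : m / 2 < Cmod w).
{ generalize (Cmod_sub_ge z w); rewrite Cmod_sub_sym; fold m; lra. }
assert (H4 : w <> RtoC 0) by (apply Cmod_gt_0; lra).
replace (/ w - / z - - / (z * z) * (w - z))%C with ((w - z) * ((w - z) / (w * (z * z))))%C by (field; auto).
rewrite Cmod_mult, Rmult_comm. apply Rmult_le_compat_r; [apply Cmod_ge_0|].
rewrite Cmod_div, !Cmod_mult by (repeat apply Cmult_neq_0; auto). fold m.
assert (H5 : 0 < m * m) by nra.
apply Rlt_le, (Rmult_lt_reg_r (Cmod w * (m * m))); [nra|].
replace (Cmod (w - z) / (Cmod w * (m * m)) * (Cmod w * (m * m))) with (Cmod (w - z)) by (field; lra).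
eapply Rlt_trans; [exact H2|]. apply Rmult_lt_compat_l; nra.
Qed.

Lemma Cdiff_pow (f : C -> C) n z l : Cdiff f z l ->
  Cdiff (fun w => f w ^ n)%C z (RtoC (INR n) * f z ^ (pred n) * l)%C.
Proof.
intros H. induction n as [|n IH].
- replace (RtoC (INR 0) * f z ^ Nat.pred 0 * l)%C with (RtoC 0) by (simpl; unfold Re, Im; ring).
  apply (Cdiff_ext (fun _ => RtoC 1)); [reflexivity|apply Cdiff_const].
- apply (Cdiff_ext (fun w => f w * f w ^ n)%C); [reflexivity|].
  eapply Cdiff_val; [apply Cdiff_mult; [exact H|exact IH]|].
  rewrite S_INR, RtoC_plus. destruct n; simpl Nat.pred; [simpl|rewrite !Cpow_S]; ring.
Qed.

Lemma Rdiff_cont (p : R -> C) t v : Rdiff p t v -> Rcont p t.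
Proof.
intros H. apply (ex_derive_continuous (K := R_AbsRing) (V := C_R_NormedModule)). now exists v.
Qed.

Lemma Rdiff_val (f : R -> C) (z : R) (l l' : C) : Rdiff f z l -> l = l' -> Rdiff f z l'.
Proof. now intros H <-. Qed.

Lemma Rdiff_const (c : C) t : Rdiff (fun _ => c) t (RtoC 0).
Proof. exact (is_derive_const (K := R_AbsRing) (V := C_R_NormedModule) c t). Qed.

Lemma is_derive_eps (f : R -> R) (t l : R) :
  is_derive f t l <-> forall eps, 0 < eps -> exists d, 0 < d /\
    forall s, Rabs (s - t) < d -> Rabs (f s - f t - l * (s - t)) <= eps * Rabs (s - t).
Proof.
split.
- intros [_ H] eps He.
  destruct (H t (fun P HP => HP) (mkposreal eps He)) as [d Hd].
  exists d; split; [apply cond_pos|]; intros w Hw. specialize (Hd w Hw). simpl in Hd.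
  rewrite (Rmult_comm l). exact Hd.
- intros H; split; [apply is_linear_scal_l|].
  intros x Hx eps. apply (is_filter_lim_locally_unique (K := R_AbsRing) (V := R_NormedModule)) in Hx; subst x.
  destruct (H eps (cond_pos eps)) as [d [Hd H1]].
  exists (mkposreal d Hd); intros w Hw. specialize (H1 w Hw).
  rewrite (Rmult_comm l) in H1. exact H1.
Qed.

Lemma Rdiff_ReIm (p : R -> C) (t : R) (v : C) : Rdiff p t v <->
  is_derive (fun s => Re (p s)) t (Re v) /\ is_derive (fun s => Im (p s)) t (Im v).
Proof.
split.
- intros H; split; apply is_derive_eps; intros eps He;
    destruct (proj1 (Rdiff_iff _ _ _) H eps He) as [d [Hd H1]];
    exists d; split; auto; intros s Hs; (eapply Rle_trans; [|exact (H1 s Hs)]).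
  + eapply Rle_trans; [|apply re_le_Cmod]. right; f_equal; simpl; unfold Re, Im; ring.
  + eapply Rle_trans; [|apply im_le_Cmod]. right; f_equal; simpl; unfold Re, Im; ring.
- intros [H1 H2]. apply Rdiff_iff; intros eps He.
  assert (He2 : 0 < eps / 2) by lra.
  destruct (proj1 (is_derive_eps _ _ _) H1 _ He2) as [d1 [Hd1 A1]].
  destruct (proj1 (is_derive_eps _ _ _) H2 _ He2) as [d2 [Hd2 A2]].
  exists (Rmin d1 d2); split; [now apply Rmin_pos|]. intros s Hs.
  specialize (A1 s (Rlt_le_trans _ _ _ Hs (Rmin_l _ _))).
  specialize (A2 s (Rlt_le_trans _ _ _ Hs (Rmin_r _ _))).
  eapply Rle_trans; [apply Cmod_le_ReIm|].
  replace (Re (p s - p t - v * RtoC (s - t))) with (Re (p s) - Re (p t) - Re v * (s - t))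
    by (simpl; unfold Re, Im; ring).
  replace (Im (p s - p t - v * RtoC (s - t))) with (Im (p s) - Im (p t) - Im v * (s - t))
    by (simpl; unfold Re, Im; ring).
  lra.
Qed.

Lemma Rdiff_plus (f g : R -> C) t lf lg : Rdiff f t lf -> Rdiff g t lg ->
  Rdiff (fun s => f s + g s)%C t (lf + lg)%C.
Proof. exact (is_derive_plus (K := R_AbsRing) (V := C_R_NormedModule) f g t lf lg). Qed.

Lemma Rdiff_minus (f g : R -> C) t lf lg : Rdiff f t lf -> Rdiff g t lg ->
  Rdiff (fun s => f s - g s)%C t (lf - lg)%C.
Proof. exact (is_derive_minus (K := R_AbsRing) (V := C_R_NormedModule) f g t lf lg). Qed.

Lemma Rdiff_mult (f g : R -> C) t lf lg : Rdiff f t lf -> Rdiff g t lg ->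
  Rdiff (fun s => f s * g s)%C t (lf * g t + f t * lg)%C.
Proof.
intros Hf Hg. apply Rdiff_ReIm in Hf; apply Rdiff_ReIm in Hg.
destruct Hf as [F1 F2], Hg as [G1 G2]. apply Rdiff_ReIm; split; simpl.
- evar_last. apply (is_derive_minus (K := R_AbsRing) (V := R_NormedModule));
    apply (is_derive_mult (K := R_AbsRing)); [exact F1|exact G1|exact Rmult_comm|exact F2|exact G2|exact Rmult_comm].
  unfold minus, plus, opp, mult; simpl. unfold Re, Im; ring.
- evar_last. apply (is_derive_plus (K := R_AbsRing) (V := R_NormedModule));
    apply (is_derive_mult (K := R_AbsRing)); [exact F1|exact G2|exact Rmult_comm|exact F2|exact G1|exact Rmult_comm].
  unfold minus, plus, opp, mult; simpl. unfold Re, Im; ring.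
Qed.

Lemma Rdiff_RtoC (t : R) : Rdiff RtoC t (RtoC 1).
Proof.
apply Rdiff_ReIm; simpl; split.
- apply (is_derive_id (K := R_AbsRing)).
- apply (is_derive_const (K := R_AbsRing) (V := R_NormedModule)).
Qed.

(** The outer derivative is over [C] and the inner one over [R], so a chain rule over a single ring
    does not apply; the two remainders are combined by hand. *)
Lemma Rdiff_comp (f : C -> C) (p : R -> C) t l v : Cdiff f (p t) l -> Rdiff p t v ->
  Rdiff (fun s => f (p s)) t (l * v)%C.
Proof.
intros Hf Hp. apply Rdiff_iff; intros eps He.
assert (Hl := Cmod_ge_0 l). assert (Hv := Cmod_ge_0 v).
set (e2 := eps / (2 * (1 + Cmod l))).
assert (He2 : 0 < e2) by (apply Rdiv_lt_0_compat; lra).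
(* [e1] depends on [e2]: the outer remainder is [e1] times the increment of [p], which is at most
   [(Cmod v + e2) * Rabs (s - t)]. *)
set (e1 := eps / (2 * (1 + Cmod v + e2))).
assert (He1 : 0 < e1) by (apply Rdiv_lt_0_compat; lra).
destruct (proj1 (Cdiff_iff _ _ _) Hf e1 He1) as [d1 [Hd1 H1]].
destruct (proj1 (Rdiff_iff _ _ _) Hp e2 He2) as [d2 [Hd2 H2]].
destruct (proj1 (Rcont_iff _ _) (Rdiff_cont _ _ _ Hp) d1 Hd1) as [d3 [Hd3 H3]].
exists (Rmin d2 d3); split; [now apply Rmin_pos|]. intros s Hs.
specialize (H2 s (Rlt_le_trans _ _ _ Hs (Rmin_l _ _))).
specialize (H3 s (Rlt_le_trans _ _ _ Hs (Rmin_r _ _))).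
specialize (H1 _ H3).
replace (f (p s) - f (p t) - l * v * RtoC (s - t))%C with
  ((f (p s) - f (p t) - l * (p s - p t)) + l * (p s - p t - v * RtoC (s - t)))%C by ring.
assert (H4 : Cmod (p s - p t) <= (Cmod v + e2) * Rabs (s - t)).
{ replace (p s - p t)%C with ((p s - p t - v * RtoC (s - t)) + v * RtoC (s - t))%C by ring.
  eapply Rle_trans; [apply Cmod_triangle|]. rewrite Cmod_mult, Cmod_R. lra. }
eapply Rle_trans; [apply Cmod_triangle|]. rewrite Cmod_mult.
assert (Ha := Rabs_pos (s - t)).
apply Rle_trans with (e1 * ((Cmod v + e2) * Rabs (s - t)) + Cmod l * (e2 * Rabs (s - t))).
{ apply Rplus_le_compat.
  - eapply Rle_trans; [exact H1|]. apply Rmult_le_compat_l; lra.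
  - apply Rmult_le_compat_l; lra. }
replace (e1 * ((Cmod v + e2) * Rabs (s - t)) + Cmod l * (e2 * Rabs (s - t)))
 with ((e1 * (Cmod v + e2) + Cmod l * e2) * Rabs (s - t)) by ring.
apply Rmult_le_compat_r; [auto|].
assert (E1 : e1 * (1 + Cmod v + e2) = eps / 2) by (unfold e1; field; lra).
assert (E2 : e2 * (1 + Cmod l) = eps / 2) by (unfold e2; field; lra).
nra.
Qed.

Lemma Rdiff_line (a v : C) t : Rdiff (fun s => a + RtoC s * v)%C t v.
Proof.
eapply Rdiff_val.
- apply Rdiff_plus; [apply Rdiff_const|]. apply Rdiff_mult; [apply Rdiff_RtoC|apply Rdiff_const].
- cbv beta; ring.
Qed.

(** A mean value point exists only for real functions. The theorem is applied to the projection of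
    [f t - t * l] on the direction of the total error [v], whose increment is [Cmod v ^ 2]. *)
Lemma Rdiff_mvt (f df : R -> C) (a b : R) (l : C) (eps : R) : a <= b ->
  (forall t, a <= t <= b -> Rcont f t) ->
  (forall t, a < t < b -> Rdiff f t (df t)) ->
  (forall t, a <= t <= b -> Cmod (df t - l) <= eps) ->
  Cmod (f b - f a - l * RtoC (b - a)) <= eps * (b - a).
Proof.
intros Hab Hc Hd He.
set (v := (f b - f a - l * RtoC (b - a))%C).
set (h := fun t => (Cconj v * (f t - (RtoC 0 + RtoC t * l)))%C).
destruct (MVT_gen (fun t => Re (h t)) a b (fun t => Re (Cconj v * (df t - l)))) as [c [Hc1 Hc2]].
- rewrite Rmin_left, Rmax_right by auto. intros t Ht.
  refine (proj1 (proj1 (Rdiff_ReIm h t (Cconj v * (df t - l))%C) _)).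
  eapply Rdiff_val.
  + apply Rdiff_mult; [apply Rdiff_const|]. apply Rdiff_minus; [now apply Hd|apply Rdiff_line].
  + cbv beta; ring.
- rewrite Rmin_left, Rmax_right by auto. intros t Ht.
  apply continuity_pt_filterlim. apply cont_Re.
  apply cont_Cmult; [apply cont_const|]. apply cont_Cminus; [now apply Hc|].
  apply (Rdiff_cont _ _ l), Rdiff_line.
- rewrite Rmin_left, Rmax_right in Hc1 by auto.
  assert (E : Re (h b) - Re (h a) = Cmod v * Cmod v).
  { replace (Re (h b) - Re (h a)) with (Re (Cconj v * v)).
    - rewrite Cmult_comm, <- Cmod2_conj. simpl. ring.
    - unfold h, v. rewrite RtoC_minus.
      replace (Cconj (f b - f a - l * (RtoC b - RtoC a)) * (f b - f a - l * (RtoC b - RtoC a)))%C with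
       (Cconj (f b - f a - l * (RtoC b - RtoC a)) * (f b - (RtoC 0 + RtoC b * l)) -
        Cconj (f b - f a - l * (RtoC b - RtoC a)) * (f a - (RtoC 0 + RtoC a * l)))%C by ring.
      reflexivity. }
  rewrite E in Hc2.
  assert (H1 : Re (Cconj v * (df c - l)) <= Cmod v * eps).
  { eapply Rle_trans; [apply Rle_abs|]. eapply Rle_trans; [apply re_le_Cmod|].
    rewrite Cmod_mult, Cmod_conj. apply Rmult_le_compat_l; [apply Cmod_ge_0|auto]. }
  assert (Hv := Cmod_ge_0 v).
  destruct (Req_dec (Cmod v) 0) as [Z|NZ].
  + rewrite Z. apply Rmult_le_pos; [|lra].
    eapply Rle_trans; [apply Cmod_ge_0|apply (He a); lra].
  + apply (Rmult_le_reg_l (Cmod v)); [lra|]. rewrite Hc2.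
    apply Rle_trans with (Cmod v * eps * (b - a)); [|lra].
    apply Rmult_le_compat_r; lra.
Qed.

Lemma Rdiff_zero_const (f : R -> C) (a b : R) : a <= b ->
  (forall t, a <= t <= b -> Rcont f t) ->
  (forall t, a < t < b -> Rdiff f t (RtoC 0)) -> f b = f a.
Proof.
intros Hab Hc Hd.
assert (H := Rdiff_mvt f (fun _ => RtoC 0) a b (RtoC 0) 0 Hab Hc Hd).
apply Cmod_lt_all; intros eps He.
replace (f b - f a)%C with (f b - f a - RtoC 0 * RtoC (b - a))%C by ring.
eapply Rle_lt_trans; [apply H|lra].
intros; replace (RtoC 0 - RtoC 0)%C with (RtoC 0) by ring. rewrite Cmod_0; lra.
Qed.

Lemma Cdiff_mvt (f df : C -> C) (z w l : C) (eps : R) :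
  (forall t, 0 <= t <= 1 -> Cdiff f (z + RtoC t * (w - z))%C (df (z + RtoC t * (w - z))%C)) ->
  (forall t, 0 <= t <= 1 -> Cmod (df (z + RtoC t * (w - z))%C - l) <= eps) ->
  Cmod (f w - f z - l * (w - z)) <= eps * Cmod (w - z).
Proof.
intros Hd He.
generalize (Rdiff_mvt (fun t => f (z + RtoC t * (w - z)))%C
  (fun t => df (z + RtoC t * (w - z)) * (w - z))%C 0 1 (l * (w - z))%C (eps * Cmod (w - z)) Rle_0_1).
assert (E1 : (z + RtoC 1 * (w - z))%C = w) by ring.
assert (E0 : (z + RtoC 0 * (w - z))%C = z) by ring.
assert (D : forall t, 0 <= t <= 1 -> Rdiff (fun t => f (z + RtoC t * (w - z)))%C t
  (df (z + RtoC t * (w - z)) * (w - z))%C).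
{ intros t Ht. apply (Rdiff_comp f (fun t => z + RtoC t * (w - z))%C); [now apply Hd|apply Rdiff_line]. }
rewrite E1, E0. intros H.
replace (l * (w - z))%C with (l * (w - z) * RtoC (1 - 0))%C by (replace (1 - 0) with 1 by ring; ring).
replace (eps * Cmod (w - z)) with (eps * Cmod (w - z) * (1 - 0)) by ring.
apply H.
- intros t Ht. eapply Rdiff_cont. now apply D.
- intros t Ht. apply D; lra.
- intros t Ht. replace (df (z + RtoC t * (w - z)) * (w - z) - l * (w - z))%C with
   ((df (z + RtoC t * (w - z)) - l) * (w - z))%C by ring.
  rewrite Cmod_mult. apply Rmult_le_compat_r; [apply Cmod_ge_0|auto].
Qed.

(** * Integrals of complex-valued functions *)

(** Continuity is two-sided at the end points too, which is the form that integrability of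
    continuous functions expects. *)
Definition contI (f : R -> C) (a b : R) : Prop := forall t, a <= t <= b -> Rcont f t.

Lemma contI_sub f a b a' b' : contI f a b -> a <= a' -> b' <= b -> contI f a' b'.
Proof. intros H H1 H2 t Ht; apply H; lra. Qed.

Lemma contI_ex f a b : a <= b -> contI f a b -> ex_cI f a b.
Proof.
intros Hab H. apply (ex_RInt_continuous (V := C_R_CompleteNormedModule)).
rewrite Rmin_left, Rmax_right by auto. exact H.
Qed.

Lemma cI_is f a b : a <= b -> contI f a b -> is_cI f a b (cI f a b).
Proof. intros Hab H. apply (RInt_correct (V := C_R_CompleteNormedModule)). now apply contI_ex. Qed.

Lemma is_cI_uniq f a b l : is_cI f a b l -> cI f a b = l.
Proof. exact (is_RInt_unique (V := C_R_CompleteNormedModule) f a b l). Qed.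

Lemma cI_ext f g a b : a <= b -> (forall t, a < t < b -> f t = g t) -> cI f a b = cI g a b.
Proof.
intros Hab H. apply (RInt_ext (V := C_R_CompleteNormedModule)).
rewrite Rmin_left, Rmax_right by auto. exact H.
Qed.

(** The module structure behind [is_cI] is real, so a complex factor has to be distributed over real
    and imaginary parts. *)
Lemma is_cI_scal (c : C) f a b l : is_cI f a b l -> is_cI (fun t => c * f t)%C a b (c * l)%C.
Proof.
intros H.
assert (H1 := is_RInt_fct_extend_fst (U := R_NormedModule) (V := R_NormedModule) f a b l H).
assert (H2 := is_RInt_fct_extend_snd (U := R_NormedModule) (V := R_NormedModule) f a b l H).
apply (is_RInt_fct_extend_pair (U := R_NormedModule) (V := R_NormedModule) (fun t => c * f t)%C a b); simpl.
- apply (is_RInt_minus (V := R_NormedModule) (fun t => fst c * fst (f t)) (fun t => snd c * snd (f t)));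
  now apply (is_RInt_scal (V := R_NormedModule)).
- apply (is_RInt_plus (V := R_NormedModule) (fun t => fst c * snd (f t)) (fun t => snd c * fst (f t)));
  now apply (is_RInt_scal (V := R_NormedModule)).
Qed.

Lemma cI_scal (c : C) f a b : a <= b -> contI f a b -> cI (fun t => c * f t)%C a b = (c * cI f a b)%C.
Proof. intros. apply is_cI_uniq, is_cI_scal. now apply cI_is. Qed.

Lemma cI_minus f g a b : a <= b -> contI f a b -> contI g a b ->
  cI (fun t => f t - g t)%C a b = (cI f a b - cI g a b)%C.
Proof.
intros. apply is_cI_uniq, (is_RInt_minus (V := C_R_NormedModule)); now apply cI_is.
Qed.

Lemma cI_Chasles f a b c : a <= b -> b <= c -> contI f a c ->
  cI f a c = (cI f a b + cI f b c)%C.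
Proof.
intros H1 H2 H. apply is_cI_uniq, (is_RInt_Chasles (V := C_R_NormedModule) f a b c).
- apply cI_is; auto. apply (contI_sub _ _ _ _ _ H); lra.
- apply cI_is; auto. apply (contI_sub _ _ _ _ _ H); lra.
Qed.

Lemma cI_point f a : cI f a a = RtoC 0.
Proof. exact (RInt_point (V := C_R_CompleteNormedModule) a f). Qed.

Lemma cI_le_const f a b M : a <= b -> contI f a b -> (forall t, a <= t <= b -> Cmod (f t) <= M) ->
  Cmod (cI f a b) <= (b - a) * M.
Proof.
intros Hab Hc HM. rewrite Cmod_norm.
apply (norm_RInt_le_const (V := C_R_NormedModule) f a b _ M Hab); [|now apply cI_is].
intros t Ht. generalize (HM t Ht); now rewrite Cmod_norm.
Qed.

Lemma cI_le f a b (F g : R -> R) : a <= b -> contI f a b ->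
  (forall t, a <= t <= b -> is_derive F t (g t)) ->
  (forall t, a <= t <= b -> continuous g t) ->
  (forall t, a <= t <= b -> Cmod (f t) <= g t) ->
  Cmod (cI f a b) <= F b - F a.
Proof.
intros Hab Hc HF Hg HM. rewrite Cmod_norm.
apply (norm_RInt_le (V := C_R_NormedModule) f g a b (cI f a b) (F b - F a) Hab); [|now apply cI_is|].
- intros t Ht. generalize (HM t Ht); now rewrite Cmod_norm.
- apply (is_RInt_derive (V := R_CompleteNormedModule) F g);
  rewrite Rmin_left, Rmax_right by auto; auto.
Qed.

Lemma cI_FTC (F f : R -> C) a b : a <= b -> (forall t, a <= t <= b -> Rdiff F t (f t)) ->
  contI f a b -> cI f a b = (F b - F a)%C.
Proof.
intros Hab HF Hc. apply is_cI_uniq.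
apply (is_RInt_derive (V := C_R_CompleteNormedModule) F f);
  rewrite Rmin_left, Rmax_right by auto; auto.
Qed.

Lemma cI_deriv f a b : a < b -> contI f a b -> forall t, a < t < b ->
  Rdiff (fun s => cI f a s) t (f t).
Proof.
intros Hab Hc t Ht.
apply (is_derive_RInt (V := C_R_NormedModule) f (fun s => cI f a s) a t).
- assert (Hm : 0 < Rmin (t - a) (b - t)) by (apply Rmin_pos; lra).
  exists (mkposreal _ Hm). intros s Hs.
  assert (Hs1 : Rabs (s - t) < Rmin (t - a) (b - t)) by exact Hs.
  assert (H1 := Rlt_le_trans _ _ _ Hs1 (Rmin_l _ _)).
  assert (H2 := Rlt_le_trans _ _ _ Hs1 (Rmin_r _ _)).
  apply Rabs_def2 in H1; apply Rabs_def2 in H2.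
  apply cI_is; [lra|]. apply (contI_sub _ _ _ _ _ Hc); lra.
- apply Hc; lra.
Qed.

Lemma contI_bound f a b : contI f a b -> exists M, 0 < M /\ forall t, a <= t <= b -> Cmod (f t) <= M.
Proof.
intros H. destruct (Rle_dec a b) as [Hab|Hab].
- destruct (continuity_ab_maj (fun t => Cmod (f t)) a b Hab) as [m [Hm _]].
  + intros t Ht. apply continuity_pt_filterlim. apply (contR_Cmod (U := R_UniformSpace)). now apply H.
  + exists (Cmod (f m) + 1); split; [generalize (Cmod_ge_0 (f m)); lra|].
    intros t Ht; generalize (Hm t Ht); lra.
- exists 1; split; [lra|]. intros; lra.
Qed.

(** The parameter [d] of [P] is at once a tolerance and the radius of the neighbourhood where it is
    valid. Compactness turns a choice of such radii into one common value, as [P] persists when [d]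
    decreases. *)
Lemma compact_uniform (P : R -> R -> Prop) a b :
  (forall t d d', P t d -> 0 < d' <= d -> P t d') ->
  (forall t, a <= t <= b -> exists d, 0 < d /\ forall s, a <= s <= b -> Rabs (s - t) < d -> P s d) ->
  exists d, 0 < d /\ forall s, a <= s <= b -> P s d.
Proof.
intros Hm HP.
(* Only points of [[a, b]] are consulted; the value 1 elsewhere makes the gauge total. *)
set (delta := fun t => match excluded_middle_informative (a <= t <= b) with
  | left Ht => let (d, Hd) := constructive_indefinite_description _ (HP t Ht) in mkposreal d (proj1 Hd)
  | right _ => mkposreal 1 Rlt_0_1 end).
destruct (compactness_value_1d a b delta) as [d Hd].
exists d; split; [apply cond_pos|]. intros s Hs.
specialize (Hd s Hs). apply NNPP in Hd. destruct Hd as [t [Ht [H1 H2]]].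
unfold delta in H1, H2.
destruct (excluded_middle_informative (a <= t <= b)) as [Ht'|]; [|tauto].
destruct (constructive_indefinite_description _ (HP t Ht')) as [d' Hd'].
simpl in H1, H2. apply (Hm s d'); [now apply Hd'|]. split; [apply cond_pos|auto].
Qed.

Lemma compact_uniform2 (P : R -> R -> R -> Prop) a b a' b' :
  (forall s t d d', P s t d -> 0 < d' <= d -> P s t d') ->
  (forall s t, a <= s <= b -> a' <= t <= b' -> exists d, 0 < d /\
     forall s' t', a <= s' <= b -> a' <= t' <= b' -> Rabs (s' - s) < d -> Rabs (t' - t) < d -> P s' t' d) ->
  exists d, 0 < d /\ forall s t, a <= s <= b -> a' <= t <= b' -> P s t d.
Proof.
intros Hm HP.
set (delta := fun s t => match excluded_middle_informative (a <= s <= b /\ a' <= t <= b') with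
  | left Ht => let (d, Hd) := constructive_indefinite_description _ (HP s t (proj1 Ht) (proj2 Ht)) in mkposreal d (proj1 Hd)
  | right _ => mkposreal 1 Rlt_0_1 end).
destruct (compactness_value_2d a b a' b' delta) as [d Hd].
exists d; split; [apply cond_pos|]. intros s t Hs Ht.
specialize (Hd s t Hs Ht). apply NNPP in Hd. destruct Hd as [u [v [Hu [Hv [H1 [H2 H3]]]]]].
unfold delta in H1, H2, H3.
destruct (excluded_middle_informative (a <= u <= b /\ a' <= v <= b')) as [Ht'|]; [|tauto].
destruct (constructive_indefinite_description _ (HP u v (proj1 Ht') (proj2 Ht'))) as [d' Hd'].
simpl in H1, H2, H3. apply (Hm s t d'); [now apply Hd'|]. split; [apply cond_pos|auto].
Qed.

Lemma contI_unif f a b : contI f a b -> forall eps, 0 < eps -> exists d, 0 < d /\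
  forall s t, a <= s <= b -> a <= t <= b -> Rabs (t - s) < d -> Cmod (f t - f s) < eps.
Proof.
intros Hc eps He.
destruct (compact_uniform (fun s d => forall t, a <= t <= b -> Rabs (t - s) < d -> Cmod (f t - f s) < eps) a b)
  as [d [Hd H]].
- intros s d d' H Hd' t Ht Hts; apply H; lra.
- intros t Ht. assert (He2 : 0 < eps / 2) by lra.
  destruct (proj1 (Rcont_iff f t) (Hc t Ht) _ He2) as [d [Hd H]].
  exists (d / 2); split; [lra|]. intros s Hs Hst u Hu Hus.
  eapply Rle_lt_trans; [apply (Cmod_triangle_sub _ (f t))|]. rewrite (Cmod_sub_sym (f t)).
  assert (Rabs (u - t) < d).
  { replace (u - t) with ((u - s) + (s - t)) by ring.
    eapply Rle_lt_trans; [apply Rabs_triang|lra]. }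
  generalize (H u ltac:(lra)) (H s ltac:(lra)); lra.
- exists d; split; auto.
Qed.

(** * Integrals depending on a complex parameter *)

Notation RCcont D t z := (@continuous (prod_UniformSpace R_UniformSpace C_UniformSpace) C_UniformSpace
   (fun p : R * C => D (fst p) (snd p)) (t, z)).

Lemma RCcont_iff (D : R -> C -> C) t z : RCcont D t z <-> forall eps, 0 < eps ->
  exists d, 0 < d /\ forall s w, Rabs (s - t) < d -> Cmod (w - z) < d -> Cmod (D s w - D t z) < eps.
Proof.
rewrite continuous_C_iff; split; intros H eps He; generalize (H eps He);
rewrite locally_RC_iff; auto.
Qed.

Lemma RCcont_slice (D : R -> C -> C) t z : RCcont D t z -> Rcont (fun s => D s z) t.
Proof.
intros H. apply Rcont_iff; intros eps He.
destruct (proj1 (RCcont_iff D t z) H eps He) as [d [Hd H1]].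
exists d; split; auto. intros s Hs; apply H1; auto.
replace (z - z)%C with (RtoC 0) by ring. now rewrite Cmod_0.
Qed.

(** Compactness of [[a, b]] turns joint continuity along the slice [z = z0] into a bound uniform in
    [t] on a tube around it. *)
Lemma RCcont_unif (D : R -> C -> C) a b z0 : (forall t, a <= t <= b -> RCcont D t z0) ->
  forall eps, 0 < eps -> exists d, 0 < d /\ forall t z, a <= t <= b -> Cmod (z - z0) < d ->
    Cmod (D t z - D t z0) < eps.
Proof.
intros Hc eps He.
destruct (compact_uniform (fun t d => forall z, Cmod (z - z0) < d -> Cmod (D t z - D t z0) < eps) a b)
  as [d [Hd H]].
- intros s d d' H Hd' z Hz; apply H; lra.
- intros t Ht. assert (He2 : 0 < eps / 2) by lra.
  destruct (proj1 (RCcont_iff D t z0) (Hc t Ht) _ He2) as [d [Hd H]].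
  exists d; split; [auto|]. intros s Hs Hst z Hz.
  eapply Rle_lt_trans; [apply (Cmod_triangle_sub _ (D t z0))|]. rewrite (Cmod_sub_sym (D t z0)).
  assert (Cmod (z0 - z0) < d) by (replace (z0 - z0)%C with (RtoC 0) by ring; now rewrite Cmod_0).
  generalize (H s z Hst Hz) (H s z0 Hst ltac:(auto)); lra.
- exists d; split; auto.
Qed.

Lemma cI_cont_param (f : R -> C -> C) a b z0 rho : a <= b -> 0 < rho ->
  (forall t z, a <= t <= b -> Cmod (z - z0) < rho -> Rcont (fun s => f s z) t) ->
  (forall t, a <= t <= b -> RCcont f t z0) ->
  Ccont (fun z => cI (fun t => f t z) a b) z0.
Proof.
intros Hab Hr Hs Hc. apply Ccont_iff; intros eps He.
(* The [+ 1] covers the case [a = b]. *)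
assert (He' : 0 < eps / (b - a + 1)) by (apply Rdiv_lt_0_compat; lra).
destruct (RCcont_unif f a b z0 Hc _ He') as [d [Hd H]].
exists (Rmin d rho); split; [now apply Rmin_pos|]. intros w Hw.
assert (H1 := Rlt_le_trans _ _ _ Hw (Rmin_l _ _)).
assert (H2 := Rlt_le_trans _ _ _ Hw (Rmin_r _ _)).
assert (C1 : contI (fun t => f t w) a b) by (intros t Ht; now apply Hs).
assert (C2 : contI (fun t => f t z0) a b) by (intros t Ht; now apply RCcont_slice, Hc).
rewrite <- cI_minus by auto.
eapply Rle_lt_trans; [apply (cI_le_const _ a b (eps / (b - a + 1)) Hab)|].
- intros t Ht. apply cont_Cminus; auto.
- intros t Ht. apply Rlt_le, H; auto.
- apply (Rmult_lt_reg_r (b - a + 1)); [lra|].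
  replace ((b - a) * (eps / (b - a + 1)) * (b - a + 1)) with ((b - a) * eps) by (field; lra). nra.
Qed.

(** The error of the linear approximation of each [f t] is controlled by the oscillation of [D t] on
    the segment from [z0] to [w], which is small uniformly in [t]; integration preserves such a
    bound. *)
Lemma Cdiff_cI_param (f D : R -> C -> C) a b z0 rho : a <= b -> 0 < rho ->
  (forall t z, a <= t <= b -> Cmod (z - z0) < rho -> Cdiff (f t) z (D t z)) ->
  (forall t z, a <= t <= b -> Cmod (z - z0) < rho -> Rcont (fun s => f s z) t) ->
  (forall t, a <= t <= b -> RCcont D t z0) ->
  Cdiff (fun z => cI (fun t => f t z) a b) z0 (cI (fun t => D t z0) a b).
Proof.
intros Hab Hr HD Hs Hc. apply Cdiff_iff; intros eps He.
assert (He' : 0 < eps / (b - a + 1)) by (apply Rdiv_lt_0_compat; lra).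
destruct (RCcont_unif D a b z0 Hc _ He') as [d [Hd H]].
exists (Rmin d rho); split; [now apply Rmin_pos|]. intros w Hw.
assert (H1 := Rlt_le_trans _ _ _ Hw (Rmin_l _ _)).
assert (H2 := Rlt_le_trans _ _ _ Hw (Rmin_r _ _)).
assert (C0 : Cmod (z0 - z0) < rho) by (replace (z0 - z0)%C with (RtoC 0) by ring; now rewrite Cmod_0).
assert (C1 : contI (fun t => f t w) a b) by (intros t Ht; now apply Hs).
assert (C2 : contI (fun t => f t z0) a b) by (intros t Ht; now apply Hs).
assert (C3 : contI (fun t => D t z0) a b) by (intros t Ht; now apply RCcont_slice, Hc).
assert (C4 : contI (fun t => (w - z0) * D t z0)%C a b)
  by (intros t Ht; apply cont_Cmult; [apply cont_const|auto]).
assert (C5 : contI (fun t => f t w - f t z0)%C a b) by (intros t Ht; apply cont_Cminus; auto).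
rewrite <- cI_minus, (Cmult_comm _ (w - z0)), <- cI_scal, <- cI_minus by auto.
eapply Rle_trans; [apply (cI_le_const _ a b (eps / (b - a + 1) * Cmod (w - z0)) Hab)|].
- intros t Ht. apply cont_Cminus; auto.
- intros t Ht. rewrite (Cmult_comm (w - z0)).
  assert (Hseg : forall u, 0 <= u <= 1 -> Cmod (z0 + RtoC u * (w - z0) - z0) <= Cmod (w - z0)).
  { intros u Hu. replace (z0 + RtoC u * (w - z0) - z0)%C with (RtoC u * (w - z0))%C by ring.
    rewrite Cmod_mult, Cmod_R, Rabs_pos_eq by lra. generalize (Cmod_ge_0 (w - z0)); nra. }
  apply (Cdiff_mvt (f t) (D t)).
  + intros u Hu. apply HD; auto. specialize (Hseg u Hu); lra.
  + intros u Hu. apply Rlt_le, H; auto. specialize (Hseg u Hu); lra.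
- rewrite <- Rmult_assoc. apply Rmult_le_compat_r; [apply Cmod_ge_0|].
  apply (Rmult_le_reg_r (b - a + 1)); [lra|].
  replace ((b - a) * (eps / (b - a + 1)) * (b - a + 1)) with ((b - a) * eps) by (field; lra). nra.
Qed.

Lemma cI_shift f a b s : a <= b -> contI f (a + s) (b + s) ->
  cI (fun t => f (t + s)) a b = cI f (a + s) (b + s).
Proof.
intros Hab H.
assert (H1 : is_cI f (1 * a + s) (1 * b + s) (cI f (a + s) (b + s))).
{ rewrite !Rmult_1_l. apply cI_is; auto; lra. }
apply (is_RInt_comp_lin (V := C_R_NormedModule)) in H1.
apply is_cI_uniq. eapply is_RInt_ext; [|exact H1].
intros x _. simpl. rewrite (scal_one (K := R_AbsRing)). now rewrite Rmult_1_l.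
Qed.

Lemma periodic_Z (f : R -> C) : (forall t, f (t + 1) = f t) -> forall (n : Z) t, f (t + IZR n) = f t.
Proof.
intros Hp.
assert (Hn : forall (n : nat) t, f (t + INR n) = f t).
{ induction n as [|n IH]; intros t; [simpl; now rewrite Rplus_0_r|].
  rewrite S_INR, <- (IH t), <- (Hp (t + INR n)). f_equal; ring. }
intros n t. destruct (Z_le_dec 0 n) as [H|H].
- rewrite <- (Z2Nat.id n H), <- INR_IZR_INZ. apply Hn.
- rewrite <- (Hn (Z.to_nat (- n)) (t + IZR n)). f_equal.
  rewrite INR_IZR_INZ, Z2Nat.id, opp_IZR by lia. ring.
Qed.

Lemma reduce_mod1 (s c : R) : exists n : Z, c <= s + IZR n < c + 1.
Proof.
exists (- (up (s - c) - 1))%Z. rewrite opp_IZR, minus_IZR.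
destruct (archimed (s - c)); lra.
Qed.

Lemma cI_periodic f : (forall t, f (t + 1) = f t) -> (forall t, Rcont f t) ->
  forall s, cI f s (s + 1) = cI f 0 1.
Proof.
intros Hp Hc s.
destruct (reduce_mod1 s 0) as [n Hn]. set (r := s + IZR n) in *.
assert (Hall : forall a b, contI f a b) by (intros a b t _; apply Hc).
assert (E : cI f s (s + 1) = cI f r (r + 1)).
{ replace (r + 1) with ((s + 1) + IZR n) by (unfold r; ring). unfold r.
  rewrite <- cI_shift by (auto; lra). apply cI_ext; [lra|]. intros; symmetry; now apply periodic_Z. }
rewrite E, (cI_Chasles f 0 r 1) by (auto; lra).
rewrite (cI_Chasles f r 1 (r + 1)) by (auto; lra).
replace (cI f 1 (r + 1)) with (cI f 0 r); [ring|].
rewrite (cI_ext f (fun t => f (t + 1)) 0 r) by (auto; lra).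
rewrite cI_shift by (auto; lra). f_equal; ring.
Qed.

(** * The exponential and holomorphic functions *)

Lemma Rdiff_mvt_abs (f df : R -> C) (a b : R) (l : C) (eps : R) :
  (forall t, Rmin a b <= t <= Rmax a b -> Rdiff f t (df t) /\ Cmod (df t - l) <= eps) ->
  Cmod (f b - f a - l * RtoC (b - a)) <= eps * Rabs (b - a).
Proof.
intros H. destruct (Rle_dec a b) as [Hab|Hab].
- rewrite Rmin_left, Rmax_right in H by auto. rewrite Rabs_pos_eq by lra.
  apply (Rdiff_mvt f df); auto.
  + intros t Ht. eapply Rdiff_cont, H; auto.
  + intros t Ht. apply H; lra.
  + intros t Ht. now apply H.
- rewrite Rmin_right, Rmax_left in H by lra. rewrite Rabs_left by lra.
  replace (f b - f a - l * RtoC (b - a))%C with (- (f a - f b - l * RtoC (a - b)))%C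
    by (rewrite !RtoC_minus; ring).
  rewrite Cmod_opp. replace (- (b - a)) with (a - b) by ring.
  apply (Rdiff_mvt f df); auto; try lra.
  + intros t Ht. eapply Rdiff_cont, H; auto.
  + intros t Ht. apply H; lra.
  + intros t Ht. now apply H.
Qed.

Lemma between_abs a b t : Rmin a b <= t <= Rmax a b -> Rabs (t - a) <= Rabs (b - a).
Proof.
unfold Rmin, Rmax; destruct (Rle_dec a b); intros; unfold Rabs;
destruct (Rcase_abs (t - a)), (Rcase_abs (b - a)); lra.
Qed.

(** The increment is split into a vertical and a horizontal leg; on each one the mean value
    inequality compares the partial derivative with its value at [z]. *)
Lemma CR_Cdiff (f d1 : C -> C) z rho : 0 < rho ->
  (forall w, Cmod (w - z) < rho ->
     Rdiff (fun t => f (t, Im w)) (Re w) (d1 w) /\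
     Rdiff (fun t => f (Re w, t)) (Im w) (Ci * d1 w)%C) ->
  Ccont d1 z -> Cdiff f z (d1 z).
Proof.
intros Hr HD Hc. apply Cdiff_iff; intros eps He.
assert (He2 : 0 < eps / 2) by lra.
destruct (proj1 (Ccont_iff d1 z) Hc _ He2) as [d [Hd H1]].
set (e := Rmin d rho). assert (Hpe : 0 < e) by (now apply Rmin_pos).
(* Each leg is at most [Cmod (w - z)] long, so the whole path stays within [2 * Cmod (w - z) < e] of
   [z]. *)
exists (e / 2); split; [lra|]. intros w Hw.
assert (Hx := re_le_Cmod (w - z)). assert (Hy := im_le_Cmod (w - z)).
replace (Re (w - z)) with (Re w - Re z) in Hx by (destruct w, z; simpl; ring).
replace (Im (w - z)) with (Im w - Im z) in Hy by (destruct w, z; simpl; ring).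
assert (Hnear : forall x y, Rabs (x - Re z) <= Rabs (Re w - Re z) ->
  Rabs (y - Im z) <= Rabs (Im w - Im z) -> Cmod ((x, y) - z) < e).
{ intros x y Hx1 Hy1. eapply Rle_lt_trans; [apply Cmod_le_ReIm|].
  replace (Re ((x, y) - z)) with (x - Re z) by (destruct z; simpl; ring).
  replace (Im ((x, y) - z)) with (y - Im z) by (destruct z; simpl; ring). lra. }
assert (A : Cmod (f (Re w, Im w) - f (Re z, Im w) - d1 z * RtoC (Re w - Re z))
   <= eps / 2 * Rabs (Re w - Re z)).
{ apply (Rdiff_mvt_abs (fun t => f (t, Im w)) (fun t => d1 (t, Im w))).
  intros t Ht. apply between_abs in Ht.
  assert (Hn := Hnear t (Im w) Ht (Rle_refl _)). split.
  - apply (HD (t, Im w)). eapply Rlt_le_trans; [exact Hn|apply Rmin_r].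
  - apply Rlt_le, H1. eapply Rlt_le_trans; [exact Hn|apply Rmin_l]. }
assert (B : Cmod (f (Re z, Im w) - f (Re z, Im z) - Ci * d1 z * RtoC (Im w - Im z))
   <= eps / 2 * Rabs (Im w - Im z)).
{ apply (Rdiff_mvt_abs (fun t => f (Re z, t)) (fun t => Ci * d1 (Re z, t))%C).
  intros t Ht. apply between_abs in Ht.
  assert (Hn : Cmod ((Re z, t) - z) < e).
  { apply Hnear; auto. replace (Re z - Re z) with 0 by ring. rewrite Rabs_R0. apply Rabs_pos. }
  split.
  - apply (HD (Re z, t)). eapply Rlt_le_trans; [exact Hn|apply Rmin_r].
  - replace (Ci * d1 (Re z, t) - Ci * d1 z)%C with (Ci * (d1 (Re z, t) - d1 z))%C by ring.
    rewrite Cmod_mult, Cmod_Ci, Rmult_1_l. apply Rlt_le, H1. eapply Rlt_le_trans; [exact Hn|apply Rmin_l]. }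
replace (f w) with (f (Re w, Im w)) by (destruct w; reflexivity).
replace (f z) with (f (Re z, Im z)) by (destruct z; reflexivity).
replace (f (Re w, Im w) - f (Re z, Im z) - d1 z * (w - z))%C with
 ((f (Re w, Im w) - f (Re z, Im w) - d1 z * RtoC (Re w - Re z)) +
  (f (Re z, Im w) - f (Re z, Im z) - Ci * d1 z * RtoC (Im w - Im z)))%C.
- eapply Rle_trans; [apply Cmod_triangle|].
  assert (Ha := Cmod_ge_0 (w - z)). nra.
- replace (w - z)%C with (RtoC (Re w - Re z) + Ci * RtoC (Im w - Im z))%C; [ring|].
  destruct w, z; apply C_eq; simpl; ring.
Qed.

Lemma Cinv_neq0 z : z <> RtoC 0 -> (/ z)%C <> RtoC 0.
Proof.
intros Hz E. assert (H := Cinv_r z Hz). rewrite E, Cmult_0_r in H. apply RtoC_inj in H; lra.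
Qed.

Lemma Cexp_plus z w : Cexp (z + w) = (Cexp z * Cexp w)%C.
Proof.
destruct z as [a b], w as [c d]. unfold Cexp, Cplus, Cmult; simpl.
rewrite exp_plus, cos_plus, sin_plus. f_equal; ring.
Qed.

Lemma Cexp_0 : Cexp (RtoC 0) = RtoC 1.
Proof. unfold Cexp, RtoC; simpl. rewrite exp_0, cos_0, sin_0. f_equal; ring. Qed.

Lemma Cexp_opp z : (Cexp z * Cexp (- z))%C = RtoC 1.
Proof. rewrite <- Cexp_plus. replace (z + - z)%C with (RtoC 0) by ring. apply Cexp_0. Qed.

Lemma Cexp_neq0 z : Cexp z <> RtoC 0.
Proof.
intros E. generalize (Cexp_opp z). rewrite E, Cmult_0_l. intros H.
apply RtoC_inj in H. lra.
Qed.

Lemma Cexp_minus z w : Cexp (z - w) = (Cexp z / Cexp w)%C.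
Proof.
unfold Cminus. rewrite Cexp_plus. unfold Cdiv. f_equal.
assert (H := Cexp_opp w). assert (Hn := Cexp_neq0 w).
replace (Cexp (- w)) with (Cexp w * Cexp (- w) * / Cexp w)%C by (field; auto).
rewrite H; ring.
Qed.

Lemma Cmod_Cexp z : Cmod (Cexp z) = exp (Re z).
Proof.
unfold Cexp, Cmod; simpl.
replace (exp (Re z) * cos (Im z) * (exp (Re z) * cos (Im z) * 1) +
   exp (Re z) * sin (Im z) * (exp (Re z) * sin (Im z) * 1)) with
  ((exp (Re z))² * ((sin (Im z))² + (cos (Im z))²)) by (unfold Rsqr; ring).
rewrite sin2_cos2, Rmult_1_r. apply sqrt_Rsqr, Rlt_le, exp_pos.
Qed.

Lemma contR_comp (U : UniformSpace) (f : U -> R) (h : R -> R) x :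
  @continuous U R_UniformSpace f x -> (forall y, ex_derive h y) ->
  @continuous U R_UniformSpace (fun y => h (f y)) x.
Proof.
intros Hf Hh. apply (continuous_comp f h); [exact Hf|].
apply (ex_derive_continuous (K := R_AbsRing) (V := R_NormedModule)), Hh.
Qed.

Lemma cont_Cexp {U : UniformSpace} (f : U -> C) x :
  @continuous U C_UniformSpace f x -> @continuous U C_UniformSpace (fun y => Cexp (f y)) x.
Proof.
intros Hf. assert (HR := cont_Re f x Hf). assert (HI := cont_Im f x Hf).
apply cont_pair; apply contR_mult.
- apply (contR_comp _ _ exp); auto. intros y; auto_derive; auto.
- apply (contR_comp _ _ cos); auto. intros y; auto_derive; auto.
- apply (contR_comp _ _ exp); auto. intros y; auto_derive; auto.
- apply (contR_comp _ _ sin); auto. intros y; auto_derive; auto.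
Qed.

Lemma Cdiff_Cexp z : Cdiff Cexp z (Cexp z).
Proof.
apply (CR_Cdiff Cexp Cexp z 1 Rlt_0_1); [|apply cont_Cexp, continuous_id].
intros w _. split; apply Rdiff_ReIm; unfold Cexp; simpl; split; auto_derive; auto; ring.
Qed.

(** The derivative at 0 is 1, so the remainder is at most half of [Cmod w]. This Lipschitz bound for
    a local logarithm carries Hoelder continuity from [Cexp (l t)] to [l]. *)
Lemma Cexp_small_inv : exists r, 0 < r /\ forall w, Cmod w < r -> Cmod w <= 2 * Cmod (Cexp w - RtoC 1).
Proof.
assert (He : 0 < 1 / 2) by lra.
destruct (proj1 (Cdiff_iff _ _ _) (Cdiff_Cexp (RtoC 0)) _ He) as [d [Hd H]].
exists d; split; auto. intros w Hw.
specialize (H w). replace (w - RtoC 0)%C with w in H by ring. specialize (H Hw).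
rewrite Cexp_0 in H.
assert (H1 : Cmod w <= Cmod (Cexp w - RtoC 1 - RtoC 1 * w) + Cmod (Cexp w - RtoC 1)).
{ rewrite <- (Cmod_opp (Cexp w - RtoC 1 - RtoC 1 * w)).
  replace w with (- (Cexp w - RtoC 1 - RtoC 1 * w) + (Cexp w - RtoC 1))%C at 1 by ring.
  apply Cmod_triangle. }
lra.
Qed.

Lemma exp_le_mono x y : x <= y -> exp x <= exp y.
Proof. intros [H | ->]; [now apply Rlt_le, exp_increasing|lra]. Qed.

Lemma Cexp_lip M z w : Cmod z <= M -> Cmod w <= M -> Cmod (Cexp w - Cexp z) <= exp M * Cmod (w - z).
Proof.
intros Hz Hw.
replace (Cexp w - Cexp z)%C with (Cexp w - Cexp z - RtoC 0 * (w - z))%C by ring.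
apply (Cdiff_mvt Cexp Cexp).
- intros; apply Cdiff_Cexp.
- intros t Ht. replace (Cexp (z + RtoC t * (w - z)) - RtoC 0)%C with (Cexp (z + RtoC t * (w - z))) by ring.
  rewrite Cmod_Cexp. apply exp_le_mono.
  eapply Rle_trans; [apply Rle_abs|]. eapply Rle_trans; [apply re_le_Cmod|].
  replace (z + RtoC t * (w - z))%C with (RtoC (1 - t) * z + RtoC t * w)%C by (rewrite RtoC_minus; ring).
  eapply Rle_trans; [apply Cmod_triangle|]. rewrite !Cmod_mult, !Cmod_R, !Rabs_pos_eq by lra. nra.
Qed.

(** Continuity of the derivative belongs to the notion, as it does for monogenic functions; Cauchy's
    formula can then be proved by differentiation under the integral sign, without Goursat's
    argument. *)
Definition holo (U : C -> Prop) (f : C -> C) : Prop :=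
  exists f' : C -> C, forall z, U z -> Cdiff f z (f' z) /\ Ccont f' z.

Lemma Cdiff_unique f z (l l' : C) : Cdiff f z l -> Cdiff f z l' -> l = l'.
Proof.
intros H H'. apply Cmod_lt_all; intros eps He. assert (He4 : 0 < eps / 4) by lra.
destruct (proj1 (Cdiff_iff _ _ _) H _ He4) as [d [Hd H1]].
destruct (proj1 (Cdiff_iff _ _ _) H' _ He4) as [d' [Hd' H2]].
set (r := Rmin d d' / 2). assert (Hm : 0 < Rmin d d') by (now apply Rmin_pos).
assert (Hmod : Cmod (z + RtoC r - z) = r).
{ replace (z + RtoC r - z)%C with (RtoC r) by ring. rewrite Cmod_R, Rabs_pos_eq; unfold r; lra. }
specialize (H1 (z + RtoC r)%C). specialize (H2 (z + RtoC r)%C). rewrite Hmod in H1, H2.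
specialize (H1 ltac:(generalize (Rmin_l d d'); unfold r; lra)).
specialize (H2 ltac:(generalize (Rmin_r d d'); unfold r; lra)).
assert (H3 : Cmod ((l - l') * RtoC r) <= eps / 2 * r).
{ replace ((l - l') * RtoC r)%C with
   ((f (z + RtoC r)%C - f z - l' * (z + RtoC r - z)) - (f (z + RtoC r)%C - f z - l * (z + RtoC r - z)))%C by ring.
  eapply Rle_trans; [apply Cmod_sub_le|]. lra. }
rewrite Cmod_mult, Cmod_R, Rabs_pos_eq in H3 by (unfold r; lra).
assert (0 < r) by (unfold r; lra).
apply Rmult_le_reg_r in H3; lra.
Qed.

Lemma Ccont_ext_loc (f g : C -> C) z d : 0 < d -> (forall w, Cmod (w - z) < d -> f w = g w) ->
  Ccont f z -> Ccont g z.
Proof.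
intros Hd E H. apply (continuous_ext_loc g f z); [|exact H].
apply locally_C_iff; exists d; auto.
Qed.

(** Local derivatives are glued by choosing at each point a derivative there; by uniqueness the
    choice agrees with every local one. *)
Lemma holo_loc (U : C -> Prop) f :
  (forall z, U z -> exists d, 0 < d /\ exists f1 : C -> C, forall w, Cmod (w - z) < d -> Cdiff f w (f1 w) /\ Ccont f1 w) ->
  holo U f.
Proof.
intros H. exists (fun z => epsilon (inhabits (RtoC 0)) (fun l => Cdiff f z l)). intros z Hz.
destruct (H z Hz) as [d [Hd [f1 Hf]]].
assert (E : forall w, Cmod (w - z) < d -> f1 w = epsilon (inhabits (RtoC 0)) (fun l => Cdiff f w l)).
{ intros w Hw. apply (Cdiff_unique f w); [now apply Hf|].
  apply epsilon_spec. exists (f1 w). now apply Hf. }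
assert (H0 : Cmod (z - z) < d) by (replace (z - z)%C with (RtoC 0) by ring; now rewrite Cmod_0).
split.
- rewrite <- E by auto. now apply Hf.
- apply (Ccont_ext_loc f1 _ z d); auto. now apply Hf.
Qed.

Lemma holo_cont U f z : holo U f -> U z -> Ccont f z.
Proof. intros [f' H] Hz. eapply Cdiff_cont, H; auto. Qed.

Lemma Ccont_id z : Ccont (fun w => w) z.
Proof. apply continuous_id. Qed.

Lemma holo_const U c : holo U (fun _ => c).
Proof. exists (fun _ => RtoC 0); intros z _; split; [apply Cdiff_const|apply cont_const]. Qed.

Lemma holo_id U : holo U (fun z => z).
Proof. exists (fun _ => RtoC 1); intros z _; split; [apply Cdiff_id|apply cont_const]. Qed.

Lemma holo_plus U f g : holo U f -> holo U g -> holo U (fun z => f z + g z)%C.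
Proof.
intros [f' Hf] [g' Hg]. exists (fun z => f' z + g' z)%C. intros z Hz.
destruct (Hf z Hz), (Hg z Hz). split; [now apply Cdiff_plus|now apply cont_Cplus].
Qed.

Lemma holo_minus U f g : holo U f -> holo U g -> holo U (fun z => f z - g z)%C.
Proof.
intros [f' Hf] [g' Hg]. exists (fun z => f' z - g' z)%C. intros z Hz.
destruct (Hf z Hz), (Hg z Hz). split; [now apply Cdiff_minus|now apply cont_Cminus].
Qed.

Lemma holo_mult U f g : holo U f -> holo U g -> holo U (fun z => f z * g z)%C.
Proof.
intros Hf0 Hg0. generalize Hf0 Hg0; intros [f' Hf] [g' Hg].
exists (fun z => f' z * g z + f z * g' z)%C. intros z Hz.
destruct (Hf z Hz), (Hg z Hz). split; [now apply Cdiff_mult|].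
apply cont_Cplus; apply cont_Cmult; auto; eapply holo_cont; eauto.
Qed.

Lemma holo_comp_exp U f : holo U f -> holo U (fun z => Cexp (f z)).
Proof.
intros Hf0. generalize Hf0; intros [f' Hf].
exists (fun z => Cexp (f z) * f' z)%C. intros z Hz.
destruct (Hf z Hz). split; [apply Cdiff_comp; auto; apply Cdiff_Cexp|].
apply cont_Cmult; auto. apply cont_Cexp. eapply holo_cont; eauto.
Qed.

Lemma holo_inv U f : holo U f -> (forall z, U z -> f z <> RtoC 0) -> holo U (fun z => / f z)%C.
Proof.
intros Hf0 Hn. generalize Hf0; intros [f' Hf].
exists (fun z => - / (f z * f z) * f' z)%C. intros z Hz.
destruct (Hf z Hz). assert (Hc := holo_cont _ _ _ Hf0 Hz). assert (Hnz := Hn z Hz).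
split; [apply (Cdiff_comp (fun w => / w)%C); auto; now apply Cdiff_inv|].
apply cont_Cmult; auto. apply cont_Copp, cont_Cinv; [now apply cont_Cmult|now apply Cmult_neq_0].
Qed.

Lemma holo_pow U f n : holo U f -> holo U (fun z => f z ^ n)%C.
Proof.
intros Hf. induction n as [|n IH]; [exact (holo_const U (RtoC 1))|].
exact (holo_mult U f (fun z => f z ^ n)%C Hf IH).
Qed.

Lemma holo_ext (U : C -> Prop) f g : (forall z, U z -> exists d, 0 < d /\ forall w, Cmod (w - z) < d -> U w) ->
  (forall z, U z -> f z = g z) -> holo U f -> holo U g.
Proof.
intros HU E [f' H]. exists f'. intros z Hz. destruct (H z Hz); split; auto.
destruct (HU z Hz) as [d [Hd Hw]]. apply (Cdiff_ext_loc f g z _ d); auto.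
Qed.

Lemma holo_poly U l : holo U (Cpoly l).
Proof.
induction l as [|a l IH]; simpl; [apply holo_const|].
apply holo_plus; [apply holo_const|]. apply holo_mult; [apply holo_id|exact IH].
Qed.

(** * Cauchy's formula and Liouville's theorem *)

(** Cauchy-type integrals whose density [psi] already contains the velocity. Arbitrary powers [n]
    make the family closed under differentiation in [z]. *)
Definition kernel (psi k : R -> C) (n : nat) (z : C) : C :=
  cI (fun t => psi t / (k t - z) ^ n)%C 0 1.

Lemma dist_curve k z : contI k 0 1 -> (forall t, 0 <= t <= 1 -> k t <> z) ->
  exists r, 0 < r /\ forall t, 0 <= t <= 1 -> r <= Cmod (k t - z).
Proof.
intros Hc Hn. destruct (continuity_ab_min (fun t => Cmod (k t - z)) 0 1 Rle_0_1) as [m [Hm Hm1]].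
- intros t Ht. apply continuity_pt_filterlim. apply (contR_Cmod (U := R_UniformSpace) (fun t => k t - z)%C).
  apply cont_Cminus; [now apply Hc|apply cont_const].
- exists (Cmod (k m - z)). split; [apply Cmod_sub_gt0; now apply Hn|auto].
Qed.

Lemma kernel_contI psi k n z : contI psi 0 1 -> contI k 0 1 -> (forall t, 0 <= t <= 1 -> k t <> z) ->
  contI (fun t => psi t / (k t - z) ^ n)%C 0 1.
Proof.
intros Hp Hk Hn t Ht. apply cont_Cdiv; [now apply Hp| |].
- apply cont_Cpow, cont_Cminus; [now apply Hk|apply cont_const].
- now apply Cpow_nz, Csub_neq0, Hn.
Qed.

Lemma Cdiff_kernel_pt a b n z : a <> z ->
  Cdiff (fun w => b / (a - w) ^ n)%C z (RtoC (INR n) * (b / (a - z) ^ (S n)))%C.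
Proof.
intros Hz. apply Csub_neq0 in Hz.
assert (Hn := Cpow_nz _ n Hz).
eapply Cdiff_val.
- apply (Cdiff_mult (fun _ => b) (fun w => / (a - w) ^ n)%C); [apply Cdiff_const|].
  apply (Cdiff_comp (fun w => / w)%C (fun w => (a - w) ^ n)%C); [now apply Cdiff_inv|].
  apply Cdiff_pow, Cdiff_minus; [apply Cdiff_const|apply Cdiff_id].
- cbv beta. destruct n as [|n]; [simpl; field; auto|].
  simpl Nat.pred. rewrite Cpow_S in Hn |- *. rewrite !Cpow_S.
  assert (Hn1 : ((a - z) ^ n)%C <> RtoC 0) by now apply Cpow_nz.
  field; auto.
Qed.

Lemma kernel_diff psi k n z : contI psi 0 1 -> contI k 0 1 -> (forall t, 0 <= t <= 1 -> k t <> z) ->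
  Cdiff (kernel psi k n) z (RtoC (INR n) * kernel psi k (S n) z)%C.
Proof.
intros Hp Hk Hn.
destruct (dist_curve k z Hk Hn) as [r [Hr H1]].
assert (Hnear : forall t w, 0 <= t <= 1 -> Cmod (w - z) < r -> k t <> w).
{ intros t w Ht Hw E. specialize (H1 t Ht). rewrite E in H1. lra. }
unfold kernel. rewrite <- cI_scal; [|lra|now apply kernel_contI].
apply (Cdiff_cI_param (fun t w => psi t / (k t - w) ^ n)%C
  (fun t w => RtoC (INR n) * (psi t / (k t - w) ^ (S n)))%C 0 1 z r Rle_0_1 Hr).
- intros t w Ht Hw. apply Cdiff_kernel_pt; auto.
- intros t w Ht Hw. apply (kernel_contI psi k n w); auto.
- intros t Ht.
  assert (Hk' : RCcont (fun t (_ : C) => k t) t z).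
  { exact (cont_compR fst k (t, z) (cont_fst t z) (Hk t Ht)). }
  assert (Hp' : RCcont (fun t (_ : C) => psi t) t z).
  { exact (cont_compR fst psi (t, z) (cont_fst t z) (Hp t Ht)). }
  apply cont_Cmult; [apply cont_const|]. apply cont_Cdiv; [exact Hp'| |].
  + apply cont_Cpow, cont_Cminus; [exact Hk'|apply cont_snd].
  + now apply Cpow_nz, Csub_neq0, Hn.
Qed.

Lemma kernel_cont psi k n z : contI psi 0 1 -> contI k 0 1 -> (forall t, 0 <= t <= 1 -> k t <> z) ->
  Ccont (kernel psi k n) z.
Proof. intros; eapply Cdiff_cont, kernel_diff; auto. Qed.

Lemma kernel_holo (U : C -> Prop) psi k n : contI psi 0 1 -> contI k 0 1 ->
  (forall t z, 0 <= t <= 1 -> U z -> k t <> z) -> holo U (kernel psi k n).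
Proof.
intros Hp Hk Hn. exists (fun z => RtoC (INR n) * kernel psi k (S n) z)%C. intros z Hz. split.
- apply kernel_diff; auto.
- apply cont_Cmult; [apply cont_const|]. apply kernel_cont; auto.
Qed.

(** The integrand is the derivative of [- / (k t - z)], which has equal values at both ends. The
    integral is also the derivative in [z] of [kernel k' k 1 z], whence the local constancy of
    winding numbers. *)
Lemma kernel2_closed k k' z : (forall t, 0 <= t <= 1 -> Rdiff k t (k' t)) -> contI k' 0 1 -> k 1 = k 0 ->
  (forall t, 0 <= t <= 1 -> k t <> z) -> kernel k' k 2 z = RtoC 0.
Proof.
intros Hk Hk' Hcl Hn. unfold kernel.
rewrite (cI_FTC (fun t => - / (k t - z))%C); [rewrite Hcl; ring|lra| |].
- intros t Ht. assert (Hz := Csub_neq0 _ _ (Hn t Ht)).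
  eapply Rdiff_val.
  + apply (Rdiff_comp (fun w => - / w)%C (fun t => k t - z)%C).
    * apply (Cdiff_ext (fun w => RtoC 0 - / w)%C); [intros; ring|].
      apply Cdiff_minus; [apply Cdiff_const|now apply Cdiff_inv].
    * apply Rdiff_minus; [now apply Hk|apply Rdiff_const].
  + cbv beta. simpl. field; auto.
- apply kernel_contI; auto. intros t Ht. eapply Rdiff_cont, Hk; auto.
Qed.

Definition circ (c : C) (r : R) (t : R) : C := (c + RtoC r * Cexp (RtoC t * (RtoC (2 * PI) * Ci)))%C.
Definition circ' (r : R) (t : R) : C := (RtoC r * (RtoC (2 * PI) * Ci) * Cexp (RtoC t * (RtoC (2 * PI) * Ci)))%C.

Lemma twopii_neq0 : (RtoC (2 * PI) * Ci)%C <> RtoC 0.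
Proof.
apply Cmult_neq_0.
- intros E; apply RtoC_inj in E. generalize PI_RGT_0; lra.
- intros E. apply (f_equal Im) in E. simpl in E. lra.
Qed.

Lemma Cmod_twopii : Cmod (RtoC (2 * PI) * Ci) = 2 * PI.
Proof. rewrite Cmod_mult, Cmod_R, Cmod_Ci, Rabs_pos_eq; [ring|generalize PI_RGT_0; lra]. Qed.

Lemma circ_diff c r t : Rdiff (circ c r) t (circ' r t).
Proof.
unfold circ. eapply Rdiff_val.
- apply Rdiff_plus; [apply Rdiff_const|]. apply Rdiff_mult; [apply Rdiff_const|].
  apply (Rdiff_comp Cexp (fun t => RtoC t * (RtoC (2 * PI) * Ci))%C); [apply Cdiff_Cexp|].
  apply Rdiff_mult; [apply Rdiff_RtoC|apply Rdiff_const].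
- cbv beta. unfold circ'. ring.
Qed.

Lemma Rcont_RtoC t : Rcont RtoC t.
Proof. eapply Rdiff_cont, Rdiff_RtoC. Qed.

Lemma circ'_cont r t : Rcont (circ' r) t.
Proof.
apply cont_Cmult; [apply cont_const|]. apply cont_Cexp, cont_Cmult; [apply Rcont_RtoC|apply cont_const].
Qed.

Lemma circ_cont c r t : Rcont (circ c r) t.
Proof. eapply Rdiff_cont, circ_diff. Qed.

Lemma Cmod_unit t : Cmod (Cexp (RtoC t * (RtoC (2 * PI) * Ci))) = 1.
Proof. rewrite Cmod_Cexp. replace (Re _) with 0 by (simpl; ring). apply exp_0. Qed.

Lemma circ_mod c r t : 0 <= r -> Cmod (circ c r t - c) = r.
Proof.
intros Hr. unfold circ. replace (c + _ - c)%C with (RtoC r * Cexp (RtoC t * (RtoC (2 * PI) * Ci)))%C by ring.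
rewrite Cmod_mult, Cmod_unit, Cmod_R, Rabs_pos_eq; lra.
Qed.

Lemma circ'_mod r t : 0 <= r -> Cmod (circ' r t) = 2 * PI * r.
Proof.
intros Hr. unfold circ'. rewrite !Cmod_mult, Cmod_unit, Cmod_Ci, !Cmod_R, !Rabs_pos_eq; try lra.
generalize PI_RGT_0; lra.
Qed.

Lemma circ_closed c r : circ c r 1 = circ c r 0.
Proof.
unfold circ. do 2 f_equal.
replace (RtoC 0 * (RtoC (2 * PI) * Ci))%C with (RtoC 0) by ring. rewrite Cexp_0, Cmult_1_l.
unfold Cexp; simpl. replace (2 * PI * 0 - 0 * 1) with 0 by ring. replace (2 * PI * 1 + 0 * 0) with (2 * PI) by ring.
rewrite exp_0, cos_2PI, sin_2PI. unfold RtoC; f_equal; ring.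
Qed.

Lemma circ_avoid c r z t : Cmod (z - c) < r -> circ c r t <> z.
Proof.
intros Hz E. assert (Hr : 0 <= r) by (generalize (Cmod_ge_0 (z - c)); lra).
generalize (circ_mod c r t Hr); rewrite E; lra.
Qed.

Lemma disc_seg c z w (r u : R) : Cmod (z - c) < r -> Cmod (w - c) < r -> 0 <= u <= 1 ->
  Cmod (z + RtoC u * (w - z) - c) < r.
Proof.
intros Hz Hw Hu.
replace (z + RtoC u * (w - z) - c)%C with (RtoC (1 - u) * (z - c) + RtoC u * (w - c))%C by (rewrite RtoC_minus; ring).
eapply Rle_lt_trans; [apply Cmod_triangle|]. rewrite !Cmod_mult, !Cmod_R, !Rabs_pos_eq by lra.
assert (Hm : Rmax (Cmod (z - c)) (Cmod (w - c)) < r) by (now apply Rmax_lub_lt).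
assert (H1 := Rmax_l (Cmod (z - c)) (Cmod (w - c))). assert (H2 := Rmax_r (Cmod (z - c)) (Cmod (w - c))).
nra.
Qed.

(** At the centre the integrand is the constant [2 pi i], and along the segment from the centre to
    [z] the integral has derivative 0. *)
Lemma circ_wind c r z : Cmod (z - c) < r -> kernel (circ' r) (circ c r) 1 z = (RtoC (2 * PI) * Ci)%C.
Proof.
intros Hz.
assert (Hr : 0 < r) by (generalize (Cmod_ge_0 (z - c)); lra).
assert (Hc0 : Cmod (c - c) < r) by (replace (c - c)%C with (RtoC 0) by ring; now rewrite Cmod_0).
assert (Hk : contI (circ c r) 0 1) by (intros t _; apply circ_cont).
assert (Hk' : contI (circ' r) 0 1) by (intros t _; apply circ'_cont).
transitivity (kernel (circ' r) (circ c r) 1 c).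
- assert (HD : forall t, 0 <= t <= 1 -> Rdiff (fun t => kernel (circ' r) (circ c r) 1 (c + RtoC t * (z - c))) t (RtoC 0)).
  { intros t Ht.
    assert (Ha : forall s, 0 <= s <= 1 -> circ c r s <> (c + RtoC t * (z - c))%C)
      by (intros s _; now apply circ_avoid, disc_seg).
    eapply Rdiff_val.
    - apply (Rdiff_comp (kernel (circ' r) (circ c r) 1) (fun t => c + RtoC t * (z - c))%C); [|apply Rdiff_line].
      now apply kernel_diff.
    - cbv beta. rewrite kernel2_closed; auto; [ring| |apply circ_closed].
      intros; apply circ_diff. }
  assert (H := Rdiff_zero_const (fun t => kernel (circ' r) (circ c r) 1 (c + RtoC t * (z - c))) 0 1 Rle_0_1).
  cbv beta in H. replace (c + RtoC 1 * (z - c))%C with z in H by ring.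
  replace (c + RtoC 0 * (z - c))%C with c in H by ring. apply H.
  + intros t Ht. eapply Rdiff_cont; now apply HD.
  + intros t Ht. apply HD; lra.
- transitivity (cI (fun _ => RtoC (2 * PI) * Ci)%C 0 1).
  { apply cI_ext; [lra|]. intros t _.
    assert (Hn := Cexp_neq0 (RtoC t * (RtoC (2 * PI) * Ci))).
    assert (Hr' : RtoC r <> RtoC 0) by (intros E; apply RtoC_inj in E; lra).
    assert (Ht := circ_avoid c r c t Hc0). apply Csub_neq0 in Ht.
    unfold circ', circ in *; simpl. field; auto. }
  rewrite (cI_FTC (fun t => RtoC 0 + RtoC t * (RtoC (2 * PI) * Ci))%C).
  + ring.
  + lra.
  + intros t _. apply Rdiff_line.
  + intros t _. apply cont_const.
Qed.

(* The integral of [f (z + l (zeta - z)) / (zeta - z)] over the circle does not depend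
   on [l]: its [l]-derivative is the integral of an exact differential. *)
Lemma Cauchy_formula (f f' : C -> C) (c : C) (rho r : R) (z : C) : r < rho -> Cmod (z - c) < r ->
  (forall w, Cmod (w - c) < rho -> Cdiff f w (f' w) /\ Ccont f' w) ->
  (RtoC (2 * PI) * Ci * f z)%C = kernel (fun t => f (circ c r t) * circ' r t)%C (circ c r) 1 z.
Proof.
intros Hrr Hz Hf.
assert (Hr : 0 < r) by (generalize (Cmod_ge_0 (z - c)); lra).
set (k := circ c r). set (k' := circ' r).
assert (Hk : forall t, Rcont k t) by (intros t; apply circ_cont).
assert (Hk' : forall t, Rcont k' t) by (intros t; apply circ'_cont).
assert (Hkz : forall t, (k t - z)%C <> RtoC 0) by (intros t; now apply Csub_neq0, circ_avoid).
assert (Hkm : forall t, Cmod (k t - z) <= 2 * r).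
{ intros t. eapply Rle_trans; [apply (Cmod_triangle_sub _ c)|].
  unfold k. rewrite circ_mod, (Cmod_sub_sym c) by lra. lra. }
set (F := fun (t : R) (l : C) => (f (z + l * (k t - z)) * (k' t / (k t - z)))%C).
set (D := fun (t : R) (l : C) => (f' (z + l * (k t - z)) * k' t)%C).
set (g := fun l => cI (fun t => F t l) 0 1).
(* For real [l] in [[0, 1]] the point lies in the closed disc of radius [r]. As
   [Cmod (k t - z) <= 2 * r], a complex perturbation of [l] below [(rho - r) / (2 * r)] keeps it in
   the larger disc. *)
assert (Hdisc : forall t u l, 0 <= u <= 1 -> Cmod (l - RtoC u) < (rho - r) / (2 * r) ->
  Cmod (z + l * (k t - z) - c) < rho).
{ intros t u l Hu Hl.
  replace (z + l * (k t - z) - c)%C with ((RtoC (1 - u) * (z - c) + RtoC u * (k t - c)) + (l - RtoC u) * (k t - z))%C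
    by (rewrite RtoC_minus; ring).
  eapply Rle_lt_trans; [apply Cmod_triangle|].
  assert (A : Cmod (RtoC (1 - u) * (z - c) + RtoC u * (k t - c)) <= r).
  { eapply Rle_trans; [apply Cmod_triangle|]. rewrite !Cmod_mult, !Cmod_R, !Rabs_pos_eq by lra.
    unfold k at 1; rewrite circ_mod by lra. nra. }
  rewrite Cmod_mult.
  assert (B : Cmod (l - RtoC u) * Cmod (k t - z) < (rho - r) / (2 * r) * (2 * r)).
  { apply Rle_lt_trans with (Cmod (l - RtoC u) * (2 * r)).
    - apply Rmult_le_compat_l; [apply Cmod_ge_0|auto].
    - apply Rmult_lt_compat_r; lra. }
  replace ((rho - r) / (2 * r) * (2 * r)) with (rho - r) in B by (field; lra). lra. }
assert (Hrho : 0 < (rho - r) / (2 * r)) by (apply Rdiv_lt_0_compat; lra).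
assert (Hz0 : forall u, Cmod (RtoC u - RtoC u) < (rho - r) / (2 * r))
  by (intros u; replace (RtoC u - RtoC u)%C with (RtoC 0) by ring; now rewrite Cmod_0).
assert (HD : forall u, 0 <= u <= 1 -> Cdiff g (RtoC u) (cI (fun t => D t (RtoC u)) 0 1)).
{ intros u Hu. apply (Cdiff_cI_param F D 0 1 (RtoC u) _ Rle_0_1 Hrho).
  - intros t l Ht Hl. specialize (Hdisc t u l Hu Hl). unfold F, D.
    eapply Cdiff_val.
    + apply (Cdiff_mult (fun l => f (z + l * (k t - z)))%C); [|apply Cdiff_const].
      apply (Cdiff_comp f (fun l => z + l * (k t - z))%C); [apply Hf; auto|].
      apply Cdiff_plus; [apply Cdiff_const|]. apply Cdiff_mult; [apply Cdiff_id|apply Cdiff_const].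
    + cbv beta. field; auto.
  - intros t l Ht Hl. specialize (Hdisc t u l Hu Hl). unfold F.
    apply cont_Cmult.
    + apply (cont_comp (fun t => z + l * (k t - z))%C f).
      * apply cont_Cplus; [apply cont_const|]. apply cont_Cmult; [apply cont_const|].
        apply cont_Cminus; [apply Hk|apply cont_const].
      * eapply Cdiff_cont; apply Hf; auto.
    + apply cont_Cdiv; [apply Hk'| |auto]. apply cont_Cminus; [apply Hk|apply cont_const].
  - intros t Ht. specialize (Hdisc t u (RtoC u) Hu (Hz0 u)). unfold D.
    apply cont_Cmult.
    + refine (cont_comp (fun p : RC => z + snd p * (k (fst p) - z))%C f' (t, RtoC u) _ _).
      * apply cont_Cplus; [apply cont_const|]. apply cont_Cmult; [apply cont_snd|].
        apply cont_Cminus; [|apply cont_const].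
        exact (cont_compR fst k (t, RtoC u) (cont_fst _ _) (Hk t)).
      * simpl. apply Hf; auto.
    + exact (cont_compR fst k' (t, RtoC u) (cont_fst _ _) (Hk' t)). }
(* The antiderivative carries the factor [/ RtoC u], so [u = 0] is left out; constancy on [[0, 1]]
   asks for the derivative only at interior points. *)
assert (HD0 : forall u, 0 < u <= 1 -> cI (fun t => D t (RtoC u)) 0 1 = RtoC 0).
{ intros u Hu. assert (Hu0 : RtoC u <> RtoC 0) by (intros E; apply RtoC_inj in E; lra).
  assert (Hu' : 0 <= u <= 1) by lra.
  rewrite (cI_FTC (fun t => f (z + RtoC u * (k t - z)) * / RtoC u)%C).
  - unfold k; rewrite circ_closed; ring.
  - lra.
  - intros t _. unfold D. eapply Rdiff_val.
    + apply (Rdiff_mult (fun t => f (z + RtoC u * (k t - z)))%C); [|apply Rdiff_const].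
      apply (Rdiff_comp f (fun t => z + RtoC u * (k t - z))%C).
      * apply Hf. apply (Hdisc t u); auto.
      * apply Rdiff_plus; [apply Rdiff_const|]. apply Rdiff_mult; [apply Rdiff_const|].
        apply Rdiff_minus; [apply circ_diff|apply Rdiff_const].
    + cbv beta. unfold k'. field; auto.
  - intros t _. unfold D. apply cont_Cmult; [|apply Hk'].
    apply (cont_comp (fun t => z + RtoC u * (k t - z))%C f').
    + apply cont_Cplus; [apply cont_const|]. apply cont_Cmult; [apply cont_const|].
      apply cont_Cminus; [apply Hk|apply cont_const].
    + apply Hf. apply (Hdisc t u); auto. }
assert (E : g (RtoC 1) = g (RtoC 0)).
{ assert (HR : forall u, 0 <= u <= 1 -> Rdiff (fun u => g (RtoC u)) u (cI (fun t => D t (RtoC u)) 0 1)).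
  { intros u Hu. eapply Rdiff_val; [apply (Rdiff_comp g RtoC); [now apply HD|apply Rdiff_RtoC]|].
    cbv beta; ring. }
  apply (Rdiff_zero_const (fun u => g (RtoC u)) 0 1); [lra| |].
  - intros u Hu. eapply Rdiff_cont. now apply HR.
  - intros u Hu. rewrite <- (HD0 u) by lra. apply HR; lra. }
assert (Hkc : contI k 0 1) by (intros t _; apply Hk).
assert (Hkc' : contI k' 0 1) by (intros t _; apply Hk').
rewrite <- (circ_wind c r z Hz), Cmult_comm. fold k k'.
unfold kernel at 1. rewrite <- cI_scal; [|lra|apply kernel_contI; auto; intros t _; now apply circ_avoid].
transitivity (cI (fun t => F t (RtoC 0)) 0 1); [|transitivity (cI (fun t => F t (RtoC 1)) 0 1)].
- apply cI_ext; [lra|]. intros t _; unfold F.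
  simpl. replace (z + RtoC 0 * (k t - z))%C with z by ring. field; auto.
- symmetry; exact E.
- apply cI_ext; [lra|]. intros t _; unfold F.
  simpl. replace (z + RtoC 1 * (k t - z))%C with (k t) by ring. unfold k, k'. field; apply Hkz.
Qed.

(** Cauchy's formula represents [f] near [c] by an integral over a circle, and this integral can be
    differentiated once more. *)
Lemma holo_deriv (U : C -> Prop) (f f' : C -> C) : (forall z, U z -> exists d, 0 < d /\ forall w, Cmod (w - z) < d -> U w) ->
  (forall z, U z -> Cdiff f z (f' z) /\ Ccont f' z) -> holo U f'.
Proof.
intros HU Hf. apply holo_loc. intros c Hc. destruct (HU c Hc) as [rho [Hrho Hd]].
set (r := rho / 2). set (psi := fun t => (f (circ c r t) * circ' r t)%C).
assert (Hrr : r < rho) by (unfold r; lra).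
assert (Hpsi : contI psi 0 1).
{ intros t _. apply cont_Cmult; [|apply circ'_cont].
  apply (cont_comp (circ c r) f); [apply circ_cont|].
  eapply Cdiff_cont; apply Hf, Hd. rewrite circ_mod; unfold r; lra. }
assert (Hk : contI (circ c r) 0 1) by (intros t _; apply circ_cont).
assert (Hn := twopii_neq0).
assert (Hav : forall w, Cmod (w - c) < r -> forall t, 0 <= t <= 1 -> circ c r t <> w)
  by (intros; now apply circ_avoid).
assert (E : forall w, Cmod (w - c) < r -> f w = (/ (RtoC (2 * PI) * Ci) * kernel psi (circ c r) 1 w)%C).
{ intros w Hw. unfold psi. rewrite <- (Cauchy_formula f f' c rho r w); auto. now rewrite Cmult_assoc, Cinv_l, Cmult_1_l. }
assert (Hopen : forall w, Cmod (w - c) < r -> forall v, Cmod (v - w) < r - Cmod (w - c) -> Cmod (v - c) < r).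
{ intros w Hw v Hv. generalize (Cmod_triangle_sub v w c); lra. }
assert (E' : forall w, Cmod (w - c) < r -> f' w = (/ (RtoC (2 * PI) * Ci) * kernel psi (circ c r) 2 w)%C).
{ intros w Hw. apply (Cdiff_unique f w); [apply Hf, Hd; unfold r in Hw; generalize (Cmod_ge_0 (w - c)); lra|].
  apply (Cdiff_ext_loc (fun w => / (RtoC (2 * PI) * Ci) * kernel psi (circ c r) 1 w)%C _ _ _ (r - Cmod (w - c))); [lra| |].
  - intros v Hv. symmetry; apply E; eapply Hopen; eauto.
  - eapply Cdiff_val; [apply Cdiff_mult; [apply Cdiff_const|apply kernel_diff; auto]|].
    cbv beta. simpl INR. ring. }
exists r; split; [unfold r; lra|].
exists (fun w => / (RtoC (2 * PI) * Ci) * (RtoC (INR 2) * kernel psi (circ c r) 3 w))%C.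
intros w Hw. split.
- apply (Cdiff_ext_loc (fun w => / (RtoC (2 * PI) * Ci) * kernel psi (circ c r) 2 w)%C _ _ _ (r - Cmod (w - c))); [lra| |].
  + intros v Hv. symmetry; apply E'; eapply Hopen; eauto.
  + eapply Cdiff_val; [apply Cdiff_mult; [apply Cdiff_const|apply kernel_diff; auto]|].
    cbv beta. ring.
- apply cont_Cmult; [apply cont_const|]. apply cont_Cmult; [apply cont_const|]. apply kernel_cont; auto.
Qed.

Definition everywhere (z : C) : Prop := True.

Lemma Liouville_zero (V : C -> C) : holo everywhere V ->
  (forall eps, 0 < eps -> exists M, forall z, M < Cmod z -> Cmod (V z) <= eps) -> forall z, V z = RtoC 0.
Proof.
intros [V' HV] HM z. apply Cmod_lt_all; intros eps He. assert (He3 : 0 < eps / 3) by lra.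
destruct (HM _ He3) as [M HM'].
(* The circle lies beyond [M], and [z] lies in the disc of half the radius, so
   [Cmod (zeta - z) >= r / 2] for [zeta] on the circle. *)
set (r := 2 * Cmod z + Rabs M + 1).
assert (H0 := Cmod_ge_0 z). assert (H1 := Rle_abs M). assert (H2 := Rabs_pos M).
assert (Hz : Cmod (z - RtoC 0) < r) by (replace (z - RtoC 0)%C with z by ring; unfold r; lra).
assert (Hr : 0 < r) by (unfold r; lra).
assert (HC := Cauchy_formula V V' (RtoC 0) (r + 1) r z ltac:(lra) Hz ltac:(intros w _; now apply HV)).
assert (Hcm : forall t, Cmod (circ (RtoC 0) r t) = r).
{ intros t. generalize (circ_mod (RtoC 0) r t (Rlt_le _ _ Hr)).
  replace (circ (RtoC 0) r t - RtoC 0)%C with (circ (RtoC 0) r t) by ring. auto. }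
assert (HP := PI_RGT_0).
assert (HB : Cmod (RtoC (2 * PI) * Ci * V z) <= (1 - 0) * (2 * (2 * PI) * (eps / 3))).
{ rewrite HC. unfold kernel. apply cI_le_const; [lra| |].
  - apply kernel_contI; [|intros t _; apply circ_cont|intros t _; now apply circ_avoid].
    intros t _. apply cont_Cmult; [|apply circ'_cont].
    apply (cont_comp (circ (RtoC 0) r) V); [apply circ_cont|]. eapply Cdiff_cont; now apply HV.
  - intros t _. assert (Hne := Csub_neq0 _ _ (circ_avoid (RtoC 0) r z t Hz)).
    rewrite Cmod_div by (now apply Cpow_nz). rewrite Cmod_mult, Cmod_pow, pow_1, circ'_mod by lra.
    assert (Hg : r / 2 <= Cmod (circ (RtoC 0) r t - z)).
    { generalize (Cmod_sub_ge (circ (RtoC 0) r t) z). rewrite Hcm. unfold r; lra. }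
    assert (HV1 : Cmod (V (circ (RtoC 0) r t)) <= eps / 3) by (apply HM'; rewrite Hcm; unfold r; lra).
    assert (HV0 := Cmod_ge_0 (V (circ (RtoC 0) r t))).
    apply (Rmult_le_reg_r (Cmod (circ (RtoC 0) r t - z))); [lra|].
    unfold Rdiv at 1. rewrite Rmult_assoc, Rinv_l, Rmult_1_r by lra.
    apply Rle_trans with (eps / 3 * (2 * PI * r)); [apply Rmult_le_compat_r; nra|].
    apply Rle_trans with (2 * (2 * PI) * (eps / 3) * (r / 2)); [right; field|].
    apply Rmult_le_compat_l; nra. }
rewrite Cmod_mult, Cmod_twopii in HB.
replace (V z - RtoC 0)%C with (V z) by ring.
assert (Cmod (V z) <= 2 * (eps / 3)); [|lra].
apply (Rmult_le_reg_l (2 * PI)); lra.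
Qed.

(** The quotient is written as the integral of [V' (t z)] over [[0, 1]], which makes sense at 0 as
    well; its derivative involves the second derivative of [V]. *)
Lemma holo_divide_z (V : C -> C) : holo everywhere V ->
  exists W, holo everywhere W /\ forall z, V z = (V (RtoC 0) + z * W z)%C.
Proof.
intros [V' HV].
assert (HV' : holo everywhere V') by (apply (holo_deriv everywhere V); [intros z _; exists 1; split; [lra|now intros]|auto]).
destruct HV' as [V2 HV2].
assert (Hcont : forall (h : C -> C) (t : R) (z : C), Ccont h (RtoC t * z)%C -> RCcont (fun t z => h (RtoC t * z)%C) t z).
{ intros h t z H. refine (cont_comp (fun p : RC => RtoC (fst p) * snd p)%C h (t, z) _ H).
  apply cont_Cmult; [|apply cont_snd].
  exact (cont_compR fst RtoC (t, z) (cont_fst _ _) (Rcont_RtoC t)). }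
assert (Hc' : forall z, contI (fun t => V' (RtoC t * z)%C) 0 1).
{ intros z t _. apply (RCcont_slice (fun t z => V' (RtoC t * z)%C)), Hcont. now apply HV. }
assert (HRC : forall t z, RCcont (fun t z => RtoC t * V2 (RtoC t * z))%C t z).
{ intros t z. apply cont_Cmult.
  - exact (cont_compR fst RtoC (t, z) (cont_fst _ _) (Rcont_RtoC t)).
  - apply (Hcont V2). now apply HV2. }
exists (fun z => cI (fun t => V' (RtoC t * z)%C) 0 1). split.
- exists (fun z => cI (fun t => RtoC t * V2 (RtoC t * z))%C 0 1). intros z _. split.
  + apply (Cdiff_cI_param (fun t z => V' (RtoC t * z)%C) (fun t z => RtoC t * V2 (RtoC t * z))%C 0 1 z 1); try lra.
    * intros t w _ _. eapply Cdiff_val.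
      -- apply (Cdiff_comp V' (fun w => RtoC t * w)%C); [now apply HV2|].
         apply Cdiff_mult; [apply Cdiff_const|apply Cdiff_id].
      -- cbv beta; ring.
    * intros t w Ht _. now apply Hc'.
    * intros; apply HRC.
  + apply (cI_cont_param (fun t z => RtoC t * V2 (RtoC t * z))%C 0 1 z 1); try lra; [|intros; apply HRC].
    intros t w _ _. apply (RCcont_slice (fun t z => RtoC t * V2 (RtoC t * z))%C), HRC.
- intros z. rewrite <- cI_scal by (lra || auto).
  rewrite (cI_FTC (fun t => V (RtoC t * z)%C)).
  + replace (RtoC 1 * z)%C with z by ring. replace (RtoC 0 * z)%C with (RtoC 0) by ring. ring.
  + lra.
  + intros t _. eapply Rdiff_val.
    * apply (Rdiff_comp V (fun t => RtoC t * z)%C); [now apply HV|].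
      apply Rdiff_mult; [apply Rdiff_RtoC|apply Rdiff_const].
    * cbv beta; ring.
  + intros t Ht. apply cont_Cmult; [apply cont_const|now apply Hc'].
Qed.

(** [N] counts coefficients: growth o(|z|^N) leaves degree at most [N - 1], and only 0 for [N = 0].
    Removing the constant term and dividing by [z] lowers the order of growth by one. *)
Lemma Liouville_poly N : forall V, holo everywhere V ->
  (forall eps, 0 < eps -> exists M, forall z, M < Cmod z -> Cmod (V z) <= eps * Cmod z ^ N) ->
  exists l, length l = N /\ forall z, V z = Cpoly l z.
Proof.
induction N as [|N IH]; intros V HV HM.
- exists nil; split; auto. simpl. apply Liouville_zero; auto.
  intros eps He. destruct (HM eps He) as [M H]. exists M. intros z Hz. specialize (H z Hz). simpl in H. lra.
- destruct (holo_divide_z V HV) as [W [HW HVW]].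
  destruct (IH W HW) as [l [Hl1 Hl2]].
  + intros eps He. assert (He2 : 0 < eps / 2) by lra. destruct (HM _ He2) as [M H].
    exists (Rmax M (Rmax 1 (2 * Cmod (V (RtoC 0)) / eps))). intros z Hz.
    assert (H1 := Rle_lt_trans _ _ _ (Rmax_l _ _) Hz).
    assert (H2 := Rle_lt_trans _ _ _ (Rmax_r _ _) Hz).
    assert (H3 := Rle_lt_trans _ _ _ (Rmax_l _ _) H2).
    assert (H4 := Rle_lt_trans _ _ _ (Rmax_r _ _) H2).
    specialize (H z H1).
    assert (H5 : 2 * Cmod (V (RtoC 0)) < eps * Cmod z).
    { apply (Rmult_lt_compat_r eps) in H4; auto. replace (2 * Cmod (V (RtoC 0)) / eps * eps) with (2 * Cmod (V (RtoC 0))) in H4 by (field; lra). lra. }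
    apply (Rmult_le_reg_l (Cmod z)); [lra|]. rewrite <- Cmod_mult.
    replace (z * W z)%C with (V z - V (RtoC 0))%C by (rewrite (HVW z); ring).
    eapply Rle_trans; [apply Cmod_sub_le|].
    assert (H6 : 1 <= Cmod z ^ N) by (apply pow_R1_Rle; lra).
    assert (H7 : eps * Cmod z * 1 <= eps * Cmod z * Cmod z ^ N) by (apply Rmult_le_compat_l; nra).
    simpl in H. lra.
  + exists (V (RtoC 0) :: l); split; [simpl; now rewrite Hl1|].
    intros z. simpl. now rewrite <- Hl2, <- HVW.
Qed.

(** * Geometry of a smooth closed curve *)

Lemma Cmod_0_sub (z : C) : Cmod (z - z) = 0.
Proof. replace (z - z)%C with (RtoC 0) by ring. apply Cmod_0. Qed.

(** Local constancy holds with a uniform radius by compactness, and the interval is crossed in steps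
    of half that radius. *)
Lemma interval_connected (Q : R -> Prop) a b : a <= b ->
  (forall t, a <= t <= b -> exists d, 0 < d /\ forall s, a <= s <= b -> Rabs (s - t) < d -> (Q s <-> Q t)) ->
  (Q a <-> Q b).
Proof.
intros Hab HQ.
destruct (compact_uniform (fun t d => forall s, a <= s <= b -> Rabs (s - t) < d -> (Q s <-> Q t)) a b) as [d [Hd H]].
- intros t d d' Ht Hd s Hs Hst. apply Ht; lra.
- intros t Ht. destruct (HQ t Ht) as [d [Hd H]]. exists (d / 2); split; [lra|].
  intros s Hs Hst u Hu Hus.
  rewrite (H s Hs) by lra. apply H; auto.
  replace (u - t) with ((u - s) + (s - t)) by ring. eapply Rle_lt_trans; [apply Rabs_triang|lra].
- assert (Hn : forall n t, a <= t <= b -> t <= a + INR n * (d / 2) -> (Q a <-> Q t)).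
  { induction n as [|n IH]; intros t Ht Htn.
    - simpl in Htn. replace t with a by lra. tauto.
    - rewrite S_INR in Htn. destruct (Rle_dec t (a + INR n * (d / 2))) as [Hl|Hl]; [now apply IH|].
      assert (Hr : a <= Rmax a (t - d / 2) <= b).
      { split; [apply Rmax_l|apply Rmax_lub; lra]. }
      assert (E1 : Q a <-> Q (Rmax a (t - d / 2))).
      { apply IH; auto. apply Rmax_lub; [|lra]. assert (0 <= INR n) by apply pos_INR. nra. }
      rewrite E1. apply H; auto.
      unfold Rmax; destruct (Rle_dec a (t - d / 2)); apply Rabs_def1; lra. }
  destruct (nfloor_ex ((b - a) / (d / 2))) as [n Hn'].
  { apply Rdiv_le_0_compat; lra. }
  apply (Hn (S n)); [lra|]. rewrite S_INR.
  destruct Hn' as [_ Hn']. apply (Rmult_lt_compat_r (d / 2)) in Hn'; [|lra].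
  replace ((b - a) / (d / 2) * (d / 2)) with (b - a) in Hn' by (field; lra). lra.
Qed.

Definition off (gam : R -> C) (z : C) : Prop := forall t, gam t <> z.

(** Stated for predicates, so that one path argument serves membership in the domain, membership in
    the exterior, and equality of the winding number with a given value. *)
Definition locconst (gam : R -> C) (P : C -> Prop) : Prop :=
  forall z, off gam z -> exists d, 0 < d /\ forall w, Cmod (w - z) < d -> (P w <-> P z).

Lemma path_locconst gam P p a b : locconst gam P -> a <= b -> contI p a b ->
  (forall t, a <= t <= b -> off gam (p t)) -> (P (p a) <-> P (p b)).
Proof.
intros HP Hab Hc Hoff. apply (interval_connected (fun t => P (p t)) a b Hab).
intros t Ht. destruct (HP _ (Hoff t Ht)) as [d [Hd H]].
destruct (proj1 (Rcont_iff p t) (Hc t Ht) d Hd) as [d' [Hd' H']].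
exists d'; split; auto.
Qed.

Section Curve.
Variables (gam : R -> C) (Hg : smooth_closed_curve gam).
Notation v := (velocity gam).

Lemma gam_per t : gam (t + 1) = gam t.
Proof. apply Hg. Qed.

Lemma gam_perZ (n : Z) t : gam (t + IZR n) = gam t.
Proof. apply periodic_Z, gam_per. Qed.

Lemma gam_diff t : Rdiff gam t (v t).
Proof.
destruct Hg as [_ [H _]]. destruct (H t) as [H1 H2].
apply Rdiff_ReIm; split; now apply Derive_correct.
Qed.

Lemma v_cont t : Rcont v t.
Proof. apply Hg. Qed.

Lemma gam_cont t : Rcont gam t.
Proof. eapply Rdiff_cont, gam_diff. Qed.

Lemma v_neq0 t : v t <> RtoC 0.
Proof. apply Hg. Qed.

Lemma v_per t : v (t + 1) = v t.
Proof.
assert (E : forall f : R -> R, (forall s, f (s + 1) = f s) -> ex_derive f (t + 1) ->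
  Derive f (t + 1) = Derive f t).
{ intros f Hf Hd. symmetry. apply is_derive_unique.
  apply (is_derive_ext (fun s => f (s + 1))); [exact Hf|].
  evar_last.
  - apply (is_derive_comp (K := R_AbsRing) (V := R_NormedModule) f (fun s => s + 1)); [apply Derive_correct, Hd|].
    auto_derive; [auto|reflexivity].
  - unfold scal; simpl; unfold mult; simpl; ring. }
destruct Hg as [Hp [H _]]. destruct (H (t + 1)) as [H1 H2].
unfold velocity. f_equal; apply E; auto; intros s; now rewrite Hp.
Qed.

Lemma v_perZ (n : Z) t : v (t + IZR n) = v t.
Proof. apply periodic_Z, v_per. Qed.

Lemma gam_inj s t : Rabs (s - t) < 1 -> gam s = gam t -> s = t.
Proof.
intros Hst E. destruct Hg as [Hp [_ [_ [_ Hinj]]]].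
destruct (reduce_mod1 s 0) as [n Hn]. destruct (reduce_mod1 t 0) as [m Hm].
assert (E2 : s + IZR n = t + IZR m) by (apply Hinj; [lra|lra|rewrite !gam_perZ; auto]).
assert (E3 : s - t = IZR (m - n)) by (rewrite minus_IZR; lra).
rewrite E3 in Hst. rewrite <- abs_IZR in Hst. apply lt_IZR in Hst.
assert ((m - n)%Z = 0%Z) by lia. rewrite H in E3. lra.
Qed.

Lemma v_bound : exists M, 0 < M /\ forall t, Cmod (v t) <= M.
Proof.
destruct (contI_bound v 0 1) as [M [HM H]]; [intros t _; apply v_cont|].
exists M; split; auto. intros t. destruct (reduce_mod1 t 0) as [n Hn].
rewrite <- (v_perZ n). apply H; lra.
Qed.

Lemma gam_bound : exists M, 0 < M /\ forall t, Cmod (gam t) <= M.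
Proof.
destruct (contI_bound gam 0 1) as [M [HM H]]; [intros t _; apply gam_cont|].
exists M; split; auto. intros t. destruct (reduce_mod1 t 0) as [n Hn].
rewrite <- (gam_perZ n). apply H; lra.
Qed.

Lemma gam_lin s t l e : (forall u, Rmin t s <= u <= Rmax t s -> Cmod (v u - l) <= e) ->
  Cmod (gam s - gam t - l * RtoC (s - t)) <= e * Rabs (s - t).
Proof.
intros H. apply (Rdiff_mvt_abs gam v). intros u Hu; split; [apply gam_diff|auto].
Qed.

Lemma gam_lip : exists M, 0 < M /\ forall s t, Cmod (gam s - gam t) <= M * Rabs (s - t).
Proof.
destruct v_bound as [M [HM H]]. exists M; split; auto. intros s t.
replace (gam s - gam t)%C with (gam s - gam t - RtoC 0 * RtoC (s - t))%C by ring.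
apply gam_lin. intros u _. replace (v u - RtoC 0)%C with (v u) by ring. auto.
Qed.

Lemma v_near t e : 0 < e -> exists d, 0 < d /\ forall s, Rabs (s - t) < d -> Cmod (v s - v t) < e.
Proof. apply Rcont_iff, v_cont. Qed.

Lemma between_center a b t0 d u : Rabs (a - t0) < d -> Rabs (b - t0) < d -> Rmin a b <= u <= Rmax a b ->
  Rabs (u - t0) < d.
Proof.
intros Ha Hb. apply Rabs_def2 in Ha; apply Rabs_def2 in Hb.
unfold Rmin, Rmax; destruct (Rle_dec a b); intros; apply Rabs_def1; lra.
Qed.

(* The bound 3/4 instead of 1/2 leaves room to move the centre of a period window. *)
Lemma chord_arc : exists c, 0 < c /\ forall s t, Rabs (s - t) <= 3 / 4 -> c * Rabs (s - t) <= Cmod (gam s - gam t).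
Proof.
destruct (compact_uniform2 (fun t h d => d * Rabs h <= Cmod (gam (t + h) - gam t)) 0 1 (- (3 / 4)) (3 / 4)) as [c [Hc H]].
- intros t h d d' H Hd. eapply Rle_trans; [|exact H]. apply Rmult_le_compat_r; [apply Rabs_pos|lra].
(* For [h0 = 0] the chord is compared with the tangent vector [v t0]; otherwise injectivity gives a
   positive chord, and continuity keeps it from shrinking. *)
- intros t0 h0 Ht0 Hh0. destruct (Req_dec h0 0) as [E|E].
  + subst h0. assert (Hv := proj1 (Cmod_gt_0 _) (v_neq0 t0)). set (m := Cmod (v t0)) in *.
    destruct (v_near t0 (m / 2)) as [d [Hd H]]; [lra|].
    exists (Rmin (d / 2) (m / 2)); split; [apply Rmin_pos; lra|].
    intros t h Ht Hh Htt Hhh. rewrite Rminus_0_r in Hhh.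
    assert (A1 := Rmin_l (d / 2) (m / 2)). assert (A2 := Rmin_r (d / 2) (m / 2)).
    assert (HL : Cmod (gam (t + h) - gam t - v t0 * RtoC (t + h - t)) <= m / 2 * Rabs (t + h - t)).
    { apply gam_lin. intros u Hu. apply Rlt_le, H. apply (between_center t (t + h)); auto; [lra|].
      replace (t + h - t0) with ((t - t0) + h) by ring. eapply Rle_lt_trans; [apply Rabs_triang|lra]. }
    replace (t + h - t) with h in HL by ring.
    assert (HT : m * Rabs h <= Cmod (gam (t + h) - gam t) + Cmod (gam (t + h) - gam t - v t0 * RtoC h)).
    { unfold m. rewrite <- (Cmod_R h), <- Cmod_mult.
      replace (v t0 * RtoC h)%C with ((gam (t + h) - gam t) - (gam (t + h) - gam t - v t0 * RtoC h))%C at 1 by ring.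
      apply Cmod_sub_le. }
    assert (Hh0' := Rabs_pos h). nra.
  + assert (Hne : gam (t0 + h0) <> gam t0).
    { intros E2. apply gam_inj in E2; [lra|]. replace (t0 + h0 - t0) with h0 by ring. apply Rabs_def1; lra. }
    apply Cmod_sub_gt0 in Hne. set (m := Cmod (gam (t0 + h0) - gam t0)) in *.
    destruct (proj1 (Rcont_iff gam (t0 + h0)) (gam_cont _) (m / 4)) as [d1 [Hd1 H1]]; [lra|].
    destruct (proj1 (Rcont_iff gam t0) (gam_cont _) (m / 4)) as [d2 [Hd2 H2]]; [lra|].
    set (d := Rmin (Rmin (d1 / 2) d2) (m / 2)).
    assert (B1 : d <= d1 / 2) by (eapply Rle_trans; [apply Rmin_l|apply Rmin_l]).
    assert (B2 : d <= d2) by (eapply Rle_trans; [apply Rmin_l|apply Rmin_r]).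
    assert (B3 : d <= m / 2) by apply Rmin_r.
    assert (B0 : 0 < d) by (repeat apply Rmin_pos; lra).
    exists d; split; auto. intros t h Ht Hh Htt Hhh.
    assert (C1 : Cmod (gam (t + h) - gam (t0 + h0)) < m / 4).
    { apply H1. replace (t + h - (t0 + h0)) with ((t - t0) + (h - h0)) by ring.
      eapply Rle_lt_trans; [apply Rabs_triang|lra]. }
    assert (C2 : Cmod (gam t - gam t0) < m / 4) by (apply H2; lra).
    assert (C3 : m <= Cmod (gam (t + h) - gam t) + Cmod (gam (t + h) - gam (t0 + h0)) + Cmod (gam t - gam t0)).
    { unfold m. replace (gam (t0 + h0) - gam t0)%C with
        ((gam (t + h) - gam t) - (gam (t + h) - gam (t0 + h0)) + (gam t - gam t0))%C by ring.
      eapply Rle_trans; [apply Cmod_triangle|]. apply Rplus_le_compat_r. apply Cmod_sub_le. }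
    assert (C4 : Rabs h <= 1) by (apply Rabs_le; lra).
    assert (C5 := Rabs_pos h). nra.
- exists c; split; auto. intros s t Hst.
  destruct (reduce_mod1 t 0) as [n Hn].
  specialize (H (t + IZR n) (s - t)).
  rewrite <- (gam_perZ n s), <- (gam_perZ n t).
  replace (s + IZR n) with (t + IZR n + (s - t)) by ring. apply H; [lra|].
  apply Rabs_le_between in Hst; lra.
Qed.

Lemma off_dist z : off gam z -> exists r, 0 < r /\ forall t, r <= Cmod (gam t - z).
Proof.
intros Hz. destruct (dist_curve gam z) as [r [Hr H]]; [intros t _; apply gam_cont|intros t _; apply Hz|].
exists r; split; auto. intros t. destruct (reduce_mod1 t 0) as [n Hn].
rewrite <- (gam_perZ n). apply H; lra.
Qed.

Lemma off_open z : off gam z -> exists d, 0 < d /\ forall w, Cmod (w - z) < d -> off gam w.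
Proof.
intros Hz. destruct (off_dist z Hz) as [r [Hr H]]. exists r; split; auto.
intros w Hw t E. specialize (H t). rewrite E in H. lra.
Qed.

Lemma nearest z : exists s0, forall s, Cmod (gam s0 - z) <= Cmod (gam s - z).
Proof.
destruct (continuity_ab_min (fun t => Cmod (gam t - z)) 0 1 Rle_0_1) as [m [Hm Hm1]].
- intros t Ht. apply continuity_pt_filterlim. apply (contR_Cmod (U := R_UniformSpace) (fun t => gam t - z)%C).
  apply cont_Cminus; [apply gam_cont|apply cont_const].
- exists m. intros s. destruct (reduce_mod1 s 0) as [n Hn]. rewrite <- (gam_perZ n s). apply Hm; lra.
Qed.

Definition wind (z : C) : C := (/ (RtoC (2 * PI) * Ci) * kernel v gam 1 z)%C.

Lemma wind_loc z : off gam z -> exists d, 0 < d /\ forall w, Cmod (w - z) < d -> wind w = wind z.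
Proof.
intros Hz. destruct (off_open z Hz) as [d [Hd H]]. exists d; split; [exact Hd|]. intros w Hw.
unfold wind. f_equal.
assert (HD : forall t, 0 <= t <= 1 -> Rdiff (fun t => kernel v gam 1 (z + RtoC t * (w - z))) t (RtoC 0)).
{ intros t Ht.
  assert (Ha : off gam (z + RtoC t * (w - z))%C).
  { apply H. apply disc_seg; auto. now rewrite Cmod_0_sub. }
  eapply Rdiff_val.
  - apply (Rdiff_comp (kernel v gam 1) (fun t => z + RtoC t * (w - z))%C); [|apply Rdiff_line].
    apply kernel_diff; [intros u _; apply v_cont|intros u _; apply gam_cont|intros u _; apply Ha].
  - cbv beta. rewrite kernel2_closed; [ring| | | |].
    + intros; apply gam_diff.
    + intros u _; apply v_cont.
    + replace 1 with (0 + 1) by ring. apply gam_per.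
    + intros u _; apply Ha. }
assert (HH := Rdiff_zero_const (fun t => kernel v gam 1 (z + RtoC t * (w - z))) 0 1 Rle_0_1).
cbv beta in HH. replace (z + RtoC 1 * (w - z))%C with w in HH by ring.
replace (z + RtoC 0 * (w - z))%C with z in HH by ring. apply HH.
- intros t Ht. eapply Rdiff_cont; now apply HD.
- intros t Ht. apply HD; lra.
Qed.

Lemma wind_locconst k : locconst gam (fun z => wind z = k).
Proof.
intros z Hz. destruct (wind_loc z Hz) as [d [Hd H]]. exists d; split; auto.
intros w Hw. now rewrite (H w Hw).
Qed.

(** The normal direction is frozen at [s0]: with [v s] in its place the map need not be
    differentiable in [s], the curve being only of class C^1. *)
Definition chart (s0 s y : R) : C := (gam s + Ci * v s0 * RtoC y)%C.

Lemma abs_ReIm_le z : Rabs (Re z) + Rabs (Im z) <= 2 * Cmod z.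
Proof. generalize (re_le_Cmod z) (im_le_Cmod z); lra. Qed.

(** While [v] stays within a quarter of [Cmod (v s0)] of [v s0], the chart is, up to translation, a
    small perturbation of the linear map [v s0 * (s + i y)], whence the lower bound. This bound
    keeps nearby arcs away from points with [y <> 0]; [chord_arc] keeps remote arcs away. *)
Lemma local_chart s0 : exists d r rho, 0 < d <= 1 / 4 /\ 0 < r /\ 0 < rho /\
  (forall s, Rabs (s - s0) <= d -> Cmod (v s - v s0) <= Cmod (v s0) / 4) /\
  (forall s y s' y', Rabs (s - s0) <= d -> Rabs (s' - s0) <= d ->
     Cmod (v s0) / 4 * (Rabs (s - s') + Rabs (y - y')) <= Cmod (chart s0 s y - chart s0 s' y')) /\
  (forall s y, Rabs (s - s0) <= d -> 0 < Rabs y <= r -> off gam (chart s0 s y)) /\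
  (forall z, Cmod (z - gam s0) < rho -> exists s y,
     Rabs (s - s0) <= d /\ Rabs y <= r /\ z = chart s0 s y).
Proof.
set (b := v s0). assert (Hb := v_neq0 s0). fold b in Hb. assert (Hm := proj1 (Cmod_gt_0 _) Hb).
destruct (v_near s0 (Cmod b / 4)) as [d1 [Hd1 H1]]; [lra|].
destruct chord_arc as [c [Hc Hca]].
set (D := Rmin (d1 / 2) (1 / 4)).
assert (HD : 0 < D) by (apply Rmin_pos; lra).
assert (HD1 : D <= d1 / 2) by apply Rmin_l. assert (HD2 : D <= 1 / 4) by apply Rmin_r.
assert (Hv : forall s, Rabs (s - s0) <= D -> Cmod (v s - b) <= Cmod b / 4).
{ intros s Hs. apply Rlt_le, H1. lra. }
assert (Hlin : forall s s', Rabs (s - s0) <= D -> Rabs (s' - s0) <= D ->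
  Cmod (gam s - gam s' - b * RtoC (s - s')) <= Cmod b / 4 * Rabs (s - s')).
{ intros s s' Hs Hs'. apply gam_lin. intros u Hu. apply Rlt_le, H1.
  apply (between_center s' s); auto; lra. }
assert (Hlow : forall s y s' y', Rabs (s - s0) <= D -> Rabs (s' - s0) <= D ->
     Cmod b / 4 * (Rabs (s - s') + Rabs (y - y')) <= Cmod (chart s0 s y - chart s0 s' y')).
{ intros s y s' y' Hs Hs'. specialize (Hlin s s' Hs Hs'). unfold chart. fold b.
  set (e := (gam s - gam s' - b * RtoC (s - s'))%C) in *.
  replace (gam s + Ci * b * RtoC y - (gam s' + Ci * b * RtoC y'))%C with
    (b * (RtoC (s - s') + Ci * RtoC (y - y')) - (- e))%C by (unfold e; rewrite !RtoC_minus; ring).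
  (* The linear part yields [Cmod b / 2] times the sum of the coordinate differences; the nonlinear
     error removes at most [Cmod b / 4] times it. *)
  eapply Rle_trans; [|apply Cmod_sub_ge]. rewrite Cmod_opp, Cmod_mult.
  assert (A := abs_ReIm_le (RtoC (s - s') + Ci * RtoC (y - y'))).
  replace (Re (RtoC (s - s') + Ci * RtoC (y - y'))) with (s - s') in A by (simpl; ring).
  replace (Im (RtoC (s - s') + Ci * RtoC (y - y'))) with (y - y') in A by (simpl; ring).
  assert (P1 := Rabs_pos (s - s')). assert (P2 := Rabs_pos (y - y')). nra. }
(* If a point of height at most [r] over [gam s] were [gam s'], the chord would be at most
   [c * (D / 2)], so [chord_arc] would force [s'] within [D / 2] of [s], inside the window of radius
   [D]. *)
set (r := c * (D / 2) / Cmod b).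
assert (Hr : 0 < r) by (apply Rdiv_lt_0_compat; nra).
(* [3 * D / 8] is [D / 2] reduced by the relative error [1 / 4], the range guaranteed to the
   intermediate value theorem; the other bound yields [Rabs y <= r]. *)
set (rho := Rmin (Cmod b * (3 * D / 8)) (Cmod b * r / 4)).
assert (Hrho : 0 < rho) by (apply Rmin_pos; nra).
exists (D / 2), r, rho. repeat split; auto; try lra.
- intros s Hs. apply Hv; lra.
- intros s y s' y' Hs Hs'. apply Hlow; lra.
- intros s y Hs Hy s1 E.
  destruct (reduce_mod1 s1 (s - 1 / 2)) as [n Hn]. set (s' := s1 + IZR n) in *.
  rewrite <- (gam_perZ n) in E. fold s' in E.
  assert (Hss : Rabs (s' - s) <= 1 / 2) by (apply Rabs_le; lra).
  assert (A : Cmod (gam s' - gam s) = Cmod b * Rabs y).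
  { rewrite E. unfold chart. fold b. replace (gam s + Ci * b * RtoC y - gam s)%C with (Ci * b * RtoC y)%C by ring.
    rewrite !Cmod_mult, Cmod_Ci, Cmod_R. ring. }
  assert (B := Hca s' s ltac:(lra)). rewrite A in B.
  assert (B2 : c * Rabs (s' - s) <= c * (D / 2)).
  { eapply Rle_trans; [exact B|]. replace (c * (D / 2)) with (Cmod b * r) by (unfold r; field; lra).
    apply Rmult_le_compat_l; lra. }
  apply Rmult_le_reg_l in B2; auto.
  assert (Hs' : Rabs (s' - s0) <= D).
  { replace (s' - s0) with ((s' - s) + (s - s0)) by ring. eapply Rle_trans; [apply Rabs_triang|lra]. }
  assert (L := Hlow s y s' 0 ltac:(lra) Hs').
  replace (chart s0 s' 0) with (gam s') in L by (unfold chart; ring).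
  rewrite E, Cmod_0_sub in L. rewrite Rminus_0_r in L.
  assert (P1 := Rabs_pos (s - s')). nra.
- intros z Hz.
  assert (Hz1 := Rlt_le_trans _ _ _ Hz (Rmin_l _ _)). assert (Hz2 := Rlt_le_trans _ _ _ Hz (Rmin_r _ _)).
  (* The parameter [s] is sought so that [(z - gam s) / b] is purely imaginary; its imaginary part
     is then the height [y]. *)
  set (x := Re ((z - gam s0) / b)).
  assert (Hx : Rabs x < 3 * D / 8).
  { eapply Rle_lt_trans; [apply re_le_Cmod|]. rewrite Cmod_div by auto.
    apply (Rmult_lt_reg_r (Cmod b)); auto. unfold Rdiv at 1. rewrite Rmult_assoc, Rinv_l by lra. lra. }
  set (p := fun s => Re ((gam s - gam s0) / b) - x).
  assert (Hp : forall s, Rabs (s - s0) <= D -> Rabs (Re ((gam s - gam s0) / b) - (s - s0)) <= / 4 * Rabs (s - s0)).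
  { intros s Hs. assert (A := Hlin s s0 Hs ltac:(rewrite Rminus_diag, Rabs_R0; lra)).
    replace (Re ((gam s - gam s0) / b) - (s - s0)) with (Re ((gam s - gam s0 - b * RtoC (s - s0)) / b)).
    - eapply Rle_trans; [apply re_le_Cmod|]. rewrite Cmod_div by auto.
      apply (Rmult_le_reg_r (Cmod b)); auto. unfold Rdiv at 1. rewrite Rmult_assoc, Rinv_l by lra. lra.
    - replace ((gam s - gam s0 - b * RtoC (s - s0)) / b)%C with ((gam s - gam s0) / b - RtoC (s - s0))%C by (field; auto).
      reflexivity. }
  assert (Hpc : continuity p).
  { intros s. apply continuity_pt_filterlim. apply (contR_minus (U := R_UniformSpace)).
    - apply cont_Re. apply cont_Cdiv; [|apply cont_const|auto].
      apply cont_Cminus; [apply gam_cont|apply cont_const].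
    - apply continuous_const. }
  apply Rabs_def2 in Hx.
  assert (Q1 := Hp (s0 - D / 2) ltac:(replace (s0 - D / 2 - s0) with (- (D / 2)) by ring; rewrite Rabs_left by lra; lra)).
  assert (Q2 := Hp (s0 + D / 2) ltac:(replace (s0 + D / 2 - s0) with (D / 2) by ring; rewrite Rabs_pos_eq by lra; lra)).
  replace (s0 - D / 2 - s0) with (- (D / 2)) in Q1 by ring. rewrite (Rabs_left (- (D / 2))) in Q1 by lra.
  replace (s0 + D / 2 - s0) with (D / 2) in Q2 by ring. rewrite (Rabs_pos_eq (D / 2)) in Q2 by lra.
  apply Rabs_le_between in Q1; apply Rabs_le_between in Q2.
  destruct (IVT_cor p (s0 - D / 2) (s0 + D / 2) Hpc ltac:(lra)) as [s [Hs Es]].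
  { unfold p. nra. }
  set (y := Im ((z - gam s) / b)).
  assert (Ez : z = chart s0 s y).
  { assert (E : ((z - gam s) / b)%C = (Ci * RtoC y)%C).
    { apply C_eq.
      - replace (Re (Ci * RtoC y)) with 0 by (simpl; ring).
        replace ((z - gam s) / b)%C with ((z - gam s0) / b - (gam s - gam s0) / b)%C by (field; auto).
        change (Re ((z - gam s0) / b) - Re ((gam s - gam s0) / b) = 0).
        unfold p, x in Es. lra.
      - replace (Im (Ci * RtoC y)) with y by (simpl; ring). reflexivity. }
    unfold chart. fold b. replace (Ci * b * RtoC y)%C with (b * (Ci * RtoC y))%C by ring.
    rewrite <- E. field; auto. }
  assert (Hss : Rabs (s - s0) <= D / 2) by (apply Rabs_le; lra).
  exists s, y. repeat split; auto.
  assert (L := Hlow s y s0 0 ltac:(lra) ltac:(rewrite Rminus_diag, Rabs_R0; lra)).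
  rewrite <- Ez in L. replace (chart s0 s0 0) with (gam s0) in L by (unfold chart; ring).
  rewrite Rminus_0_r in L. assert (P1 := Rabs_pos (s - s0)).
  assert (Cmod b / 4 * Rabs y <= Cmod b / 4 * r) by nra.
  apply Rmult_le_reg_l in H; lra.
Qed.

(** In the coordinates, the points whose heights have one sign form a convex half-rectangle, so the
    segment between the two points stays off the curve. *)
Lemma chart_path s0 P d r s y s' y' : locconst gam P ->
  (forall s y, Rabs (s - s0) <= d -> 0 < Rabs y <= r -> off gam (chart s0 s y)) ->
  Rabs (s - s0) <= d -> Rabs (s' - s0) <= d -> 0 < Rabs y <= r -> 0 < Rabs y' <= r -> 0 < y * y' ->
  (P (chart s0 s y) <-> P (chart s0 s' y')).
Proof.
intros HP Hoff Hs Hs' Hy Hy' Hyy.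
assert (A := path_locconst gam P (fun t => chart s0 (s + t * (s' - s)) (y + t * (y' - y))) 0 1 HP Rle_0_1).
cbv beta in A. replace (s + 1 * (s' - s)) with s' in A by ring. replace (y + 1 * (y' - y)) with y' in A by ring.
replace (s + 0 * (s' - s)) with s in A by ring. replace (y + 0 * (y' - y)) with y in A by ring.
apply A.
- intros t _. unfold chart. apply cont_Cplus.
  + apply (cont_compR (fun t => s + t * (s' - s)) gam); [|apply gam_cont].
    apply (ex_derive_continuous (K := R_AbsRing) (V := R_NormedModule)). auto_derive; auto.
  + apply cont_Cmult; [apply cont_const|]. apply cont_RtoC.
    apply (ex_derive_continuous (K := R_AbsRing) (V := R_NormedModule)). auto_derive; auto.
- intros t Ht. apply Hoff.
  + apply Rabs_le_between in Hs; apply Rabs_le_between in Hs'. apply Rabs_le.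
    replace (s + t * (s' - s) - s0) with ((1 - t) * (s - s0) + t * (s' - s0)) by ring. nra.
  + replace (y + t * (y' - y)) with ((1 - t) * y + t * y') by ring.
    destruct (Rlt_dec 0 y) as [H|H].
    * assert (0 < y') by nra. rewrite (Rabs_pos_eq y) in Hy by lra. rewrite (Rabs_pos_eq y') in Hy' by lra.
      rewrite Rabs_pos_eq by nra. split; nra.
    * assert (y <> 0) by (intros ->; rewrite Rabs_R0 in Hy; lra). assert (y < 0) by lra. assert (y' < 0) by nra.
      rewrite (Rabs_left y) in Hy by lra. rewrite (Rabs_left y') in Hy' by lra.
      assert ((1 - t) * y + t * y' < 0) by nra.
      rewrite Rabs_left by auto. split; nra.
Qed.

End Curve.

(** * The jump of the winding number *)

Lemma cI_Re_ge f a b m : a <= b -> contI f a b -> (forall t, a <= t <= b -> m <= Re (f t)) ->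
  (b - a) * m <= Re (cI f a b).
Proof.
intros Hab Hc Hm.
assert (H := is_RInt_fct_extend_fst (U := R_NormedModule) (V := R_NormedModule) f a b _ (cI_is f a b Hab Hc)).
apply (is_RInt_le (fun _ => m) (fun t => fst (f t)) a b); auto.
- apply (is_RInt_const (V := R_NormedModule)).
- intros t Ht. apply Hm; lra.
Qed.

Lemma Re_div (n d : C) : d <> RtoC 0 -> Re (n / d) = Re (n * Cconj d) / (Cmod d ^ 2).
Proof.
intros Hd. rewrite Cmod2_alt. destruct n as [a b], d as [x y]. unfold Cdiv, Cinv, Cmult, Cconj, Re, Im; simpl.
assert (Hn : x * x + y * y <> 0).
{ intros E. apply Hd. assert (x = 0) by nra. assert (y = 0) by nra. now subst. }
field. nra.
Qed.

(** For [sg = t] and [sg' = 1] the quotient is [1 / (t^2 + y^2)]. Relative errors of a quarter leave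
    its real part nonnegative, and of order [1 / y^2] where [Rabs t <= y]. *)
Lemma jump_integrand (u sg sg' : C) (y t : R) : u = (sg * sg + RtoC (y * y))%C -> u <> RtoC 0 ->
  Cmod (sg - RtoC t) <= / 4 * Rabs t -> Cmod (sg' - RtoC 1) <= / 4 ->
  0 <= Re (sg' / u) /\ (Rabs t <= y -> 0 < y -> / 25 / (y * y) <= Re (sg' / u)).
Proof.
intros Eu Hu H1 H2. rewrite Re_div by auto.
assert (Hm : 0 < Cmod u ^ 2) by (apply pow_lt; now apply Cmod_gt_0).
assert (A1 := re_le_Cmod (sg - RtoC t)). assert (A2 := im_le_Cmod (sg - RtoC t)).
assert (B1 := re_le_Cmod (sg' - RtoC 1)). assert (B2 := im_le_Cmod (sg' - RtoC 1)).
(* With [sg = x + i w] and [sg' = p + i q] the real part is [p (x^2 - w^2 + y^2) + 2 x w q].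
   Relative to [t^2] the first term gives [3/4 (9/16 - 1/16) = 24/64], and the second loses at most
   [10/64]. *)
assert (HN : 14 / 64 * (t * t + y * y) <= Re (sg' * Cconj u)).
{ subst u. destruct sg as [x w], sg' as [p q]. unfold Re, Im in *. simpl in *.
  assert (Ha : Rabs (x + - t) <= / 4 * Rabs t) by lra. assert (Hb : Rabs (w + - 0) <= / 4 * Rabs t) by lra.
  assert (Hc : Rabs (p + - (1)) <= / 4) by lra. assert (Hd : Rabs (q + - 0) <= / 4) by lra.
  clear A1 A2 B1 B2 H1 H2 Hm Hu.
  replace (w + - 0) with w in Hb by ring. replace (q + - 0) with q in Hd by ring.
  assert (T : t * t = Rabs t * Rabs t) by (rewrite <- Rabs_mult, Rabs_pos_eq; nra).
  assert (T0 := Rabs_pos t).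
  assert (X : Rabs x >= 3 / 4 * Rabs t).
  { generalize (Rabs_triang x (- (x + - t))). rewrite Rabs_Ropp.
    replace (x + - (x + - t)) with t by ring. lra. }
  assert (X2 : Rabs x <= 5 / 4 * Rabs t).
  { replace x with (t + (x + - t)) at 1 by ring. eapply Rle_trans; [apply Rabs_triang|lra]. }
  assert (XX : x * x = Rabs x * Rabs x) by (rewrite <- Rabs_mult, Rabs_pos_eq; nra).
  assert (WW : w * w = Rabs w * Rabs w) by (rewrite <- Rabs_mult, Rabs_pos_eq; nra).
  assert (W0 := Rabs_pos w). assert (X0 := Rabs_pos x). assert (Q0 := Rabs_pos q).
  assert (Hp : 3 / 4 <= p) by (apply Rabs_le_between in Hc; lra).
  assert (XWQ : Rabs (x * w * q) <= 5 / 4 * Rabs t * (/ 4 * Rabs t) * / 4).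
  { rewrite !Rabs_mult. apply Rmult_le_compat; auto; [nra|]. apply Rmult_le_compat; auto. }
  apply Rabs_le_between in XWQ.
  assert (S1 : 9 / 16 * (t * t) <= x * x) by nra.
  assert (S2 : w * w <= / 16 * (t * t)) by nra.
  assert (S3 : 0 <= t * t) by nra. assert (S4 : 0 <= y * y) by nra.
  assert (S5 : 3 / 4 * (x * x - w * w + y * y) <= p * (x * x - w * w + y * y)) by (apply Rmult_le_compat_r; lra).
  nra. }
split.
- apply Rdiv_le_0_compat; auto. nra.
- intros Hty Hy.
  assert (HU : Cmod u <= 25 / 16 * (t * t) + y * y).
  { subst u. eapply Rle_trans; [apply Cmod_triangle|]. rewrite Cmod_mult, Cmod_R, (Rabs_pos_eq (y * y)) by nra.
    assert (Cmod sg <= 5 / 4 * Rabs t).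
    { replace sg with ((sg - RtoC t) + RtoC t)%C by ring. eapply Rle_trans; [apply Cmod_triangle|]. rewrite Cmod_R; lra. }
    assert (T : t * t = Rabs t * Rabs t) by (rewrite <- Rabs_mult, Rabs_pos_eq; nra).
    assert (0 <= Cmod sg) by apply Cmod_ge_0. assert (T0 := Rabs_pos t). nra. }
  assert (T : t * t <= y * y).
  { assert (T : t * t = Rabs t * Rabs t) by (rewrite <- Rabs_mult, Rabs_pos_eq; nra).
    rewrite T. assert (T0 := Rabs_pos t). nra. }
  (* The constant [/ 25] comes from here: [(25/16)^2 / 25], doubled because
     [t * t + y * y <= 2 * (y * y)], is [50/256], below [14/64]. *)
  assert (HC : forall K, 0 <= K -> Cmod u ^ 2 <= (25 / 16 * (t * t + y * y)) ^ 2).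
  { intros. apply pow_incr. split; [apply Cmod_ge_0|]. nra. }
  specialize (HC 0 ltac:(lra)).
  apply (Rmult_le_reg_r (Cmod u ^ 2)); auto. unfold Rdiv at 2. rewrite Rmult_assoc, Rinv_l, Rmult_1_r by lra.
  eapply Rle_trans; [|exact HN].
  assert (Y : 0 < y * y) by nra.
  apply (Rmult_le_reg_r (y * y)); auto.
  replace (/ 25 / (y * y) * Cmod u ^ 2 * (y * y)) with (/ 25 * Cmod u ^ 2) by (field; nra).
  assert (0 <= t * t) by nra. simpl in HC |- *. simpl in HC. nra.
Qed.

Section Winding.
Variables (gam : R -> C) (Hg : smooth_closed_curve gam).
Notation v := (velocity gam).

(** Periodicity allows any period as domain of integration; centring it puts the almost singular
    parameter in the middle. *)
Lemma kernel_window psi z n s0 : off gam z -> (forall t, psi (t + 1) = psi t) -> (forall t, Rcont psi t) ->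
  kernel psi gam n z = cI (fun t => psi t / (gam t - z) ^ n)%C (s0 - 1 / 2) (s0 + 1 / 2).
Proof.
intros Hz Hp Hc. unfold kernel. replace (s0 + 1 / 2) with (s0 - 1 / 2 + 1) by field.
symmetry. apply (cI_periodic (fun t => psi t / (gam t - z) ^ n)%C).
- intros t. now rewrite Hp, gam_per.
- intros t. apply cont_Cdiv; [apply Hc| |now apply Cpow_nz, Csub_neq0, Hz].
  apply cont_Cpow, cont_Cminus; [now apply gam_cont|apply cont_const].
Qed.

(* With [sg = (gam - gam s0) / b] and [b = gam' s0], the difference of the two winding
   numbers at [gam s0 +- i b y] is [1 / pi] times the integral of
   [y sg' / (sg^2 + y^2)], whose real part stays away from 0 as [y] tends to 0. *)
Lemma jump s0 d r : 0 < d <= 1 / 4 -> 0 < r ->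
  (forall s, Rabs (s - s0) <= d -> Cmod (v s - v s0) <= Cmod (v s0) / 4) ->
  (forall s y, Rabs (s - s0) <= d -> 0 < Rabs y <= r -> off gam (chart gam s0 s y)) ->
  wind gam (chart gam s0 s0 r) <> wind gam (chart gam s0 s0 (- r)).
Proof.
intros Hd Hr Hv Hoff E.
set (b := v s0) in *. assert (Hb : b <> RtoC 0) by now apply v_neq0. assert (Hm := proj1 (Cmod_gt_0 _) Hb).
assert (Hs0 : Rabs (s0 - s0) <= d) by (rewrite Rminus_diag, Rabs_R0; lra).
destruct (chord_arc gam Hg) as [c [Hc Hca]].
destruct (v_bound gam Hg) as [M [HM HvM]].
(* For parameters at distance at least [d] from [s0], [k] bounds [Cmod (sg s)] from below and [K]
   bounds the integrand. *)
set (k := c * d / Cmod b). assert (Hk : 0 < k) by (apply Rdiv_lt_0_compat; nra).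
set (K := 2 * (M / Cmod b) / (k * k)).
assert (HK : 0 < K). { apply Rdiv_lt_0_compat; [|nra]. apply Rmult_lt_0_compat; [lra|]. apply Rdiv_lt_0_compat; lra. }
(* [k / 2] keeps [u] away from 0 far from [s0]; [1 / (100 * K)] lets the part over
   [Rabs (s - s0) <= y], which is at least [2 / 25 / y], outweigh the far part, which is at least
   [- K]. *)
set (y := Rmin (Rmin r d) (Rmin (k / 2) (1 / (100 * K)))).
assert (Hy0 : 0 < y). { repeat apply Rmin_pos; try lra. apply Rdiv_lt_0_compat; lra. }
assert (Hy1 : y <= r) by (eapply Rle_trans; [apply Rmin_l|apply Rmin_l]).
assert (Hy2 : y <= d) by (eapply Rle_trans; [apply Rmin_l|apply Rmin_r]).
assert (Hy3 : y <= k / 2) by (eapply Rle_trans; [apply Rmin_r|apply Rmin_l]).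
assert (Hy4 : y <= 1 / (100 * K)) by (eapply Rle_trans; [apply Rmin_r|apply Rmin_r]).
set (zp := chart gam s0 s0 y). set (zm := chart gam s0 s0 (- y)).
assert (Op : off gam zp) by (apply Hoff; auto; rewrite Rabs_pos_eq; lra).
assert (Om : off gam zm) by (apply Hoff; auto; rewrite Rabs_Ropp, Rabs_pos_eq; lra).
(* The winding number is constant on each side, so the supposed equality at height [r] holds at the
   small height [y]. *)
assert (Ey : wind gam zp = wind gam zm).
{ transitivity (wind gam (chart gam s0 s0 r)); [|rewrite E; symmetry].
  - refine (proj1 (chart_path gam Hg s0 _ d r s0 r s0 y (wind_locconst gam Hg _) Hoff Hs0 Hs0 _ _ _) eq_refl);
      rewrite ?Rabs_pos_eq; nra.
  - refine (proj1 (chart_path gam Hg s0 _ d r s0 (- r) s0 (- y) (wind_locconst gam Hg _) Hoff Hs0 Hs0 _ _ _) eq_refl);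
      rewrite ?Rabs_Ropp, ?Rabs_pos_eq; nra. }
set (sg := fun s => ((gam s - gam s0) / b)%C). set (sg' := fun s => (v s / b)%C).
set (u := fun s => (sg s * sg s + RtoC (y * y))%C).
assert (Hu : forall s, u s = ((gam s - zp) * (gam s - zm) / (b * b))%C).
{ intros s. unfold u, sg, zp, zm, chart. fold b. rewrite RtoC_mult, RtoC_opp.
  assert (I : (Ci * Ci)%C = (- RtoC 1)%C) by (apply C_eq; simpl; ring).
  replace ((gam s - (gam s0 + Ci * b * RtoC y)) * (gam s - (gam s0 + Ci * b * - RtoC y)))%C with
   ((gam s - gam s0) * (gam s - gam s0) - (Ci * Ci) * (b * b * (RtoC y * RtoC y)))%C by ring.
  rewrite I. field; auto. }
assert (Hun : forall s, u s <> RtoC 0).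
{ intros s. rewrite Hu. apply Cmult_neq_0; [apply Cmult_neq_0; now apply Csub_neq0|].
  apply Cinv_neq0; now apply Cmult_neq_0. }
set (h := fun s => (sg' s / u s)%C).
assert (Hh : forall s, Rcont h s).
{ intros s. apply cont_Cdiv; [| |auto].
  - apply cont_Cdiv; [now apply v_cont|apply cont_const|auto].
  - assert (Rcont sg s).
    { apply cont_Cdiv; [|apply cont_const|auto]. apply cont_Cminus; [now apply gam_cont|apply cont_const]. }
    apply cont_Cplus; [now apply cont_Cmult|apply cont_const]. }
assert (HhI : forall a e, contI h a e) by (intros a e t _; apply Hh).
assert (HI0 : cI h (s0 - 1 / 2) (s0 + 1 / 2) = RtoC 0).
{ assert (K0 : kernel v gam 1 zp = kernel v gam 1 zm).
  { unfold wind in Ey. assert (N := twopii_neq0).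
    apply (f_equal (fun x => (RtoC (2 * PI) * Ci * x)%C)) in Ey.
    rewrite !Cmult_assoc, Cinv_r, !Cmult_1_l in Ey by auto. exact Ey. }
  assert (P : forall t, v (t + 1) = v t) by now apply v_per.
  assert (Vc : forall t, Rcont v t) by now apply v_cont.
  rewrite (kernel_window v zp 1 s0), (kernel_window v zm 1 s0) in K0 by auto.
  assert (KI : forall z, off gam z -> contI (fun t => v t / (gam t - z) ^ 1)%C (s0 - 1 / 2) (s0 + 1 / 2)).
  { intros z Hz t _. apply cont_Cdiv; [apply Vc| |now apply Cpow_nz, Csub_neq0, Hz].
    apply cont_Cpow, cont_Cminus; [now apply gam_cont|apply cont_const]. }
  assert (K1 : cI (fun t => v t / (gam t - zp) ^ 1 - v t / (gam t - zm) ^ 1)%C (s0 - 1 / 2) (s0 + 1 / 2) = RtoC 0).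
  { rewrite cI_minus by (auto; lra). rewrite K0; ring. }
  assert (Hyc : RtoC y <> RtoC 0) by (intros EE; apply RtoC_inj in EE; lra).
  assert (Hci : Ci <> RtoC 0) by (intros EE; apply (f_equal Im) in EE; simpl in EE; lra).
  assert (H2 : RtoC 2 <> RtoC 0) by (intros EE; apply RtoC_inj in EE; lra).
  rewrite (cI_ext h (fun t => / (RtoC 2 * Ci * RtoC y) * (v t / (gam t - zp) ^ 1 - v t / (gam t - zm) ^ 1))%C).
  - rewrite cI_scal, K1; [ring|lra|]. intros t Ht. apply cont_Cminus; apply KI; auto.
  - lra.
  - intros t _. unfold h. rewrite Hu. unfold sg'.
    assert (N1 := Csub_neq0 _ _ (Op t)). assert (N2 := Csub_neq0 _ _ (Om t)).
    assert (D : (zp - zm)%C = (RtoC 2 * Ci * b * RtoC y)%C).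
    { unfold zp, zm, chart. fold b. rewrite RtoC_opp. ring. }
    simpl. replace (v t / ((gam t - zp) * 1) - v t / ((gam t - zm) * 1))%C with
      (v t * (zp - zm) / ((gam t - zp) * (gam t - zm)))%C by (field; auto).
    rewrite D. field. repeat split; auto. }
assert (Hsg' : forall s, Rabs (s - s0) <= d -> Cmod (sg' s - RtoC 1) <= / 4).
{ intros s Hs. unfold sg'. replace (v s / b - RtoC 1)%C with ((v s - b) / b)%C by (field; auto).
  rewrite Cmod_div by auto. apply (Rmult_le_reg_r (Cmod b)); auto.
  unfold Rdiv at 1. rewrite Rmult_assoc, Rinv_l by lra. specialize (Hv s Hs). lra. }
assert (Hsg : forall s, Rabs (s - s0) <= d -> Cmod (sg s - RtoC (s - s0)) <= / 4 * Rabs (s - s0)).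
{ intros s Hs. unfold sg.
  replace ((gam s - gam s0) / b - RtoC (s - s0))%C with ((gam s - gam s0 - b * RtoC (s - s0)) / b)%C by (field; auto).
  rewrite Cmod_div by auto. apply (Rmult_le_reg_r (Cmod b)); auto.
  unfold Rdiv at 1. rewrite Rmult_assoc, Rinv_l by lra. rewrite Rmult_1_r.
  replace (/ 4 * Rabs (s - s0) * Cmod b) with (Cmod b / 4 * Rabs (s - s0)) by field.
  apply gam_lin; auto. intros x Hx. apply Hv.
  apply between_abs in Hx. lra. }
assert (Hnear : forall s, Rabs (s - s0) <= d -> 0 <= Re (h s) /\ (Rabs (s - s0) <= y -> 0 < y -> / 25 / (y * y) <= Re (h s))).
{ intros s Hs. apply (jump_integrand (u s) (sg s) (sg' s) y (s - s0)); auto. }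
assert (Hfar : forall s, d <= Rabs (s - s0) <= 1 / 2 -> - K <= Re (h s)).
{ intros s Hs. assert (A : Cmod (h s) <= K).
  { unfold h. rewrite Cmod_div by auto.
    assert (B1 : Cmod (sg' s) <= M / Cmod b).
    { unfold sg'. rewrite Cmod_div by auto. apply Rmult_le_compat_r; [apply Rlt_le, Rinv_0_lt_compat; auto|auto]. }
    assert (B2 : k <= Cmod (sg s)).
    { unfold sg, k. rewrite Cmod_div by auto. apply Rmult_le_compat_r; [apply Rlt_le, Rinv_0_lt_compat; auto|].
      eapply Rle_trans; [|apply Hca; lra]. apply Rmult_le_compat_l; lra. }
    assert (B3 : k * k / 2 <= Cmod (u s)).
    { unfold u. replace (sg s * sg s + RtoC (y * y))%C with (sg s * sg s - (- RtoC (y * y)))%C by ring.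
      eapply Rle_trans; [|apply Cmod_sub_ge]. rewrite Cmod_opp, Cmod_mult, Cmod_R, (Rabs_pos_eq (y * y)) by nra. nra. }
    assert (B4 : 0 < k * k) by nra.
    apply (Rmult_le_reg_r (Cmod (u s))); [lra|]. unfold Rdiv at 1. rewrite Rmult_assoc, Rinv_l, Rmult_1_r by lra.
    eapply Rle_trans; [exact B1|].
    apply Rle_trans with (K * (k * k / 2)); [right; unfold K; field; lra|]. apply Rmult_le_compat_l; lra. }
  assert (B := re_le_Cmod (h s)). assert (C0 := Rabs_le_between (Re (h s)) K). apply C0. lra. }
apply (f_equal Re) in HI0.
rewrite (cI_Chasles h (s0 - 1 / 2) (s0 - d)) in HI0 by (auto; lra).
rewrite (cI_Chasles h (s0 - d) (s0 - y)) in HI0 by (auto; lra).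
rewrite (cI_Chasles h (s0 - y) (s0 + y)) in HI0 by (auto; lra).
rewrite (cI_Chasles h (s0 + y) (s0 + d)) in HI0 by (auto; lra).
assert (I1 := cI_Re_ge h (s0 - 1 / 2) (s0 - d) (- K) ltac:(lra) (HhI _ _)
  ltac:(intros t Ht; apply Hfar; rewrite Rabs_left; lra)).
assert (I2 := cI_Re_ge h (s0 - d) (s0 - y) 0 ltac:(lra) (HhI _ _)
  ltac:(intros t Ht; apply Hnear; rewrite Rabs_left; lra)).
assert (I3 := cI_Re_ge h (s0 - y) (s0 + y) (/ 25 / (y * y)) ltac:(lra) (HhI _ _)
  ltac:(intros t Ht; apply Hnear; auto; apply Rabs_le; lra)).
assert (I4 := cI_Re_ge h (s0 + y) (s0 + d) 0 ltac:(lra) (HhI _ _)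
  ltac:(intros t Ht; apply Hnear; rewrite Rabs_pos_eq; lra)).
assert (I5 := cI_Re_ge h (s0 + d) (s0 + 1 / 2) (- K) ltac:(lra) (HhI _ _)
  ltac:(intros t Ht; apply Hfar; rewrite Rabs_pos_eq; lra)).
replace ((s0 + y - (s0 - y)) * (/ 25 / (y * y))) with (2 / 25 / y) in I3 by (field; lra).
assert (I6 : 8 * K <= 2 / 25 / y).
{ apply (Rmult_le_reg_r y); auto. replace (2 / 25 / y * y) with (2 / 25) by (field; lra).
  apply (Rmult_le_compat_l (8 * K)) in Hy4; [|lra].
  replace (8 * K * (1 / (100 * K))) with (2 / 25) in Hy4 by (field; lra). lra. }
change (Re (cI h (s0 - 1 / 2) (s0 - d)) + (Re (cI h (s0 - d) (s0 - y)) + (Re (cI h (s0 - y) (s0 + y)) +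
  (Re (cI h (s0 + y) (s0 + d)) + Re (cI h (s0 + d) (s0 + 1 / 2))))) = 0) in HI0.
nra.
Qed.

End Winding.

(** * Logarithms and the index *)

Lemma Cexp_eq1 w : Cexp w = RtoC 1 -> exists n : Z, w = (RtoC (2 * PI) * Ci * RtoC (IZR n))%C.
Proof.
intros E. assert (HR : Re w = 0).
{ apply (f_equal Cmod) in E. rewrite Cmod_Cexp, Cmod_1 in E.
  apply exp_inv. now rewrite exp_0. }
assert (HC : cos (Im w) = 1).
{ apply (f_equal Re) in E. unfold Cexp in E; simpl in E. rewrite HR, exp_0 in E. lra. }
assert (HS : sin (Im w / 2) = 0).
{ assert (A := cos_2a_sin (Im w / 2)). replace (2 * (Im w / 2)) with (Im w) in A by field. rewrite HC in A.
  assert (sin (Im w / 2) * sin (Im w / 2) = 0) by lra. now apply Rmult_integral in H as [|]. }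
destruct (sin_eq_0_0 _ HS) as [n Hn]. exists n.
apply C_eq; simpl; [rewrite HR; ring|lra].
Qed.

Lemma Cexp_eq1_small w : Cexp w = RtoC 1 -> Cmod w < 6 -> w = RtoC 0.
Proof.
intros E Hw. destruct (Cexp_eq1 w E) as [n ->].
rewrite Cmod_mult, Cmod_twopii, Cmod_R, <- abs_IZR in Hw.
(* This gives [6 < 2 * PI], so a nonzero period has modulus more than 6. *)
assert (HP := PI2_3_2). unfold PI2 in HP.
assert (Hn : IZR (Z.abs n) < 1).
{ apply (Rmult_lt_reg_l (2 * PI)); lra. }
apply lt_IZR in Hn. replace n with 0%Z by lia. ring.
Qed.

Lemma exp_rot_pi : Cexp (RtoC PI * Ci) = (- RtoC 1)%C.
Proof.
unfold Cexp. replace (Re (RtoC PI * Ci)) with 0 by (simpl; ring).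
replace (Im (RtoC PI * Ci)) with PI by (simpl; ring).
rewrite exp_0, cos_PI, sin_PI. apply C_eq; simpl; ring.
Qed.

Lemma exp_rot_pi2 : Cexp (RtoC (PI / 2) * Ci) = Ci.
Proof.
unfold Cexp. replace (Re (RtoC (PI / 2) * Ci)) with 0 by (simpl; ring).
replace (Im (RtoC (PI / 2) * Ci)) with (PI / 2) by (simpl; field).
rewrite exp_0, cos_PI2, sin_PI2. apply C_eq; simpl; ring.
Qed.

(** The principal logarithm on the right half-plane, where [atan] gives the argument. *)
Definition Clog (z : C) : C := (ln (Cmod z), atan (Im z / Re z)).

Lemma Cexp_Clog z : 0 < Re z -> Cexp (Clog z) = z.
Proof.
intros Hz.
assert (Hm : 0 < Cmod z) by (generalize (re_le_Cmod z); rewrite Rabs_pos_eq; lra).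
unfold Clog, Cexp; simpl. rewrite exp_ln by auto.
assert (Hq : sqrt (1 + (Im z / Re z)²) = Cmod z / Re z).
{ replace (Cmod z / Re z) with (sqrt ((Cmod z / Re z)²)).
  - f_equal. unfold Rsqr. assert (A := Cmod2_alt z). simpl in A.
    replace (Cmod z / Re z * (Cmod z / Re z)) with (Cmod z * (Cmod z * 1) / (Re z * Re z)) by (field; lra).
    rewrite A. field; lra.
  - apply sqrt_Rsqr. apply Rlt_le, Rdiv_lt_0_compat; auto. }
rewrite cos_atan, sin_atan, Hq. apply C_eq; simpl; field; lra.
Qed.

Lemma cont_Clog {U : UniformSpace} (f : U -> C) x : 0 < Re (f x) ->
  @continuous U C_UniformSpace f x -> @continuous U C_UniformSpace (fun y => Clog (f y)) x.
Proof.
intros Hx Hf.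
assert (Hm : 0 < Cmod (f x)) by (generalize (re_le_Cmod (f x)); rewrite Rabs_pos_eq; lra).
apply cont_pair.
- apply (continuous_comp (V := R_UniformSpace) (W := R_UniformSpace) (fun y => Cmod (f y)) ln); [now apply contR_Cmod|].
  apply (ex_derive_continuous (K := R_AbsRing) (V := R_NormedModule)). auto_derive; auto.
- apply (continuous_comp (V := R_UniformSpace) (W := R_UniformSpace) (fun y => Im (f y) / Re (f y)) atan).
  + apply contR_mult; [now apply cont_Im|].
    apply (continuous_comp (V := R_UniformSpace) (W := R_UniformSpace) (fun y => Re (f y)) Rinv); [now apply cont_Re|].
    apply (ex_derive_continuous (K := R_AbsRing) (V := R_NormedModule)). auto_derive; lra.
  + apply (ex_derive_continuous (K := R_AbsRing) (V := R_NormedModule)). auto_derive; auto.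
Qed.

(** A rotation by [PI] brings the left half-plane, and one by a quarter turn the imaginary axis, to
    the cases already settled. *)
Lemma Clog_ex z : z <> RtoC 0 -> exists w, Cexp w = z.
Proof.
intros Hz.
assert (HN : forall z, Re z < 0 -> exists w, Cexp w = z).
{ intros y Hy. exists (Clog (- y) + RtoC PI * Ci)%C. rewrite Cexp_plus, exp_rot_pi, Cexp_Clog by (simpl; unfold Re in Hy; lra). ring. }
assert (Hci : (Ci * Ci)%C = (- RtoC 1)%C) by (apply C_eq; simpl; ring).
destruct (Rtotal_order (Re z) 0) as [H|[H|H]].
- now apply HN.
- assert (H0 : Im z <> 0) by (intros H0; apply Hz, C_eq; auto).
  assert (HR : exists w, Cexp w = (- Ci * z)%C).
  { destruct (Rlt_dec 0 (Im z)).
    - exists (Clog (- Ci * z)). apply Cexp_Clog. simpl. unfold Re, Im in *. lra.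
    - apply HN. simpl. unfold Re, Im in *. lra. }
  destruct HR as [w Hw]. exists (w + RtoC (PI / 2) * Ci)%C. rewrite Cexp_plus, exp_rot_pi2, Hw.
  replace (- Ci * z * Ci)%C with (- (Ci * Ci) * z)%C by ring. rewrite Hci. ring.
- exists (Clog z). now apply Cexp_Clog.
Qed.

Lemma contR_clamp a k t : continuous (fun t => Rmax a (Rmin t k)) t.
Proof.
intros P [d HP]. exists d. intros s Hs. apply HP.
change (Rabs (Rmax a (Rmin s k) - Rmax a (Rmin t k)) < d). change (Rabs (s - t) < d) in Hs.
apply Rabs_def2 in Hs.
unfold Rmax, Rmin; destruct (Rle_dec s k), (Rle_dec t k); repeat (destruct Rle_dec); apply Rabs_def1; lra.
Qed.

(* [H t] is the product of the quotients [H (c (k + 1) t) / H (c k t)], where [c k]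
   truncates [t] at the k-th point of a fine subdivision; these quotients are close to 1,
   so the principal logarithm applies to each of them. *)
Lemma lift_log (H : R -> C) a b : a < b -> (forall t, Rcont H t) -> (forall t, H t <> RtoC 0) ->
  exists l : R -> C, (forall t, Rcont l t) /\ forall t, a <= t <= b -> Cexp (l t) = H t.
Proof.
intros Hab Hc Hn.
assert (Hm : exists m, 0 < m /\ forall t, a <= t <= b -> m <= Cmod (H t)).
{ destruct (continuity_ab_min (fun t => Cmod (H t)) a b (Rlt_le _ _ Hab)) as [m [Hm Hm1]].
  - intros t Ht. apply continuity_pt_filterlim. apply (contR_Cmod (U := R_UniformSpace)), Hc.
  - exists (Cmod (H m)); split; [apply Cmod_gt_0, Hn|auto]. }
destruct Hm as [m [Hm0 Hm]].
destruct (contI_unif H a b (fun t _ => Hc t) m Hm0) as [d [Hd Hu]].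
set (c := fun (k : nat) t => Rmax a (Rmin t (Rmin b (a + INR k * (d / 2))))).
assert (Hcb : forall k t, a <= c k t <= b).
{ intros k t. unfold c. split; [apply Rmax_l|]. apply Rmax_lub; [lra|].
  eapply Rle_trans; [apply Rmin_r|apply Rmin_l]. }
assert (Hcc : forall k t, continuous (c k) t) by (intros; apply contR_clamp).
assert (Hk : forall k, exists l : R -> C, (forall t, Rcont l t) /\ forall t, Cexp (l t) = H (c k t)).
{ induction k as [|k [l [Hl1 Hl2]]].
  - destruct (Clog_ex (H a) (Hn a)) as [w Hw]. exists (fun _ => w). split; [intros; apply cont_const|].
    intros t. rewrite Hw. f_equal. unfold c. simpl. rewrite Rmult_0_l, Rplus_0_r.
    unfold Rmax, Rmin; repeat destruct Rle_dec; lra.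
  (* Consecutive truncations differ by less than [d], so the quotient is at distance less than 1
     from 1, in the domain of the principal logarithm. *)
  - assert (Hre : forall t, 0 < Re (H (c (S k) t) / H (c k t))).
    { intros t.
      assert (A : Cmod (H (c (S k) t) - H (c k t)) < m).
      { apply Hu; auto. unfold c. rewrite S_INR. assert (0 <= INR k) by apply pos_INR.
        assert (0 <= INR k * (d / 2)) by nra.
        unfold Rmax, Rmin; repeat destruct Rle_dec; apply Rabs_def1; lra. }
      assert (B := Hm _ (Hcb k t)).
      assert (Cq : Cmod (H (c (S k) t) / H (c k t) - RtoC 1) < 1).
      { replace (H (c (S k) t) / H (c k t) - RtoC 1)%C with ((H (c (S k) t) - H (c k t)) / H (c k t))%C by (field; auto).
        rewrite Cmod_div by auto. apply (Rmult_lt_reg_r (Cmod (H (c k t)))); [lra|].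
        unfold Rdiv. rewrite Rmult_assoc, Rinv_l by lra. lra. }
      assert (E := re_le_Cmod (H (c (S k) t) / H (c k t) - RtoC 1)).
      change (Re (H (c (S k) t) / H (c k t) - RtoC 1)) with (Re (H (c (S k) t) / H (c k t)) - 1) in E.
      assert (F := Rle_lt_trans _ _ _ E Cq). apply Rabs_def2 in F. lra. }
    exists (fun t => l t + Clog (H (c (S k) t) / H (c k t)))%C. split.
    + intros t. apply cont_Cplus; auto. apply cont_Clog; auto.
      apply cont_Cdiv; auto; apply (cont_compR (U := R_UniformSpace)); auto.
    + intros t. rewrite Cexp_plus, Hl2, Cexp_Clog by auto. field; auto. }
destruct (nfloor_ex ((b - a) / (d / 2))) as [n [_ Hn']].
{ apply Rdiv_le_0_compat; lra. }
apply (Rmult_lt_compat_r (d / 2)) in Hn'; [|lra].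
replace ((b - a) / (d / 2) * (d / 2)) with (b - a) in Hn' by (field; lra).
destruct (Hk (S n)) as [l [Hl1 Hl2]]. exists l; split; auto.
intros t Ht. rewrite Hl2. f_equal. unfold c. rewrite S_INR.
unfold Rmax, Rmin; repeat destruct Rle_dec; lra.
Qed.

(** The values of [l] lie in the discrete set [2 pi i Z], so a continuous [l] cannot move. *)
Lemma exp_diff_const (l : R -> C) a b : a <= b -> contI l a b ->
  (forall t, a <= t <= b -> Cexp (l t) = RtoC 1) -> l b = l a.
Proof.
intros Hab Hc He. symmetry. apply (interval_connected (fun t => l a = l t) a b Hab); auto.
intros t Ht. destruct (proj1 (Rcont_iff l t) (Hc t Ht) 1 Rlt_0_1) as [d [Hd H]].
exists d; split; auto. intros s Hs Hst.
assert (E : (l s - l t)%C = RtoC 0).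
{ apply Cexp_eq1_small.
  - rewrite Cexp_minus, !He by auto. apply Cinv_r. intros E; apply RtoC_inj in E; lra.
  - generalize (H s Hst); lra. }
replace (l s) with (l t + (l s - l t))%C by ring. rewrite E, Cplus_0_r. tauto.
Qed.

Lemma continuous_on_unit (th : R -> R) : continuous_on unit_interval th ->
  forall t, unit_interval t -> forall eps, 0 < eps -> exists d, 0 < d /\
    forall s, unit_interval s -> Rabs (s - t) < d -> Rabs (th s - th t) < eps.
Proof.
intros H t Ht eps He.
assert (A := H t Ht (fun y => Rabs (y - th t) < eps) (locally_ball (th t) (mkposreal eps He))).
unfold filtermap, within in A. apply locally_R_iff in A. destruct A as [d [Hd A]].
exists d; split; auto.
Qed.

(** Two continuous arguments differ by a continuous function with values in [2 pi Z]. The integer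
    chosen by [epsilon] in [Ind] therefore does not depend on the argument behind it. *)
Lemma continuous_arg_diff gam h th th' : (forall t, unit_interval t -> h (gam t) <> RtoC 0) ->
  continuous_arg gam h th -> continuous_arg gam h th' -> th 1 - th 0 = th' 1 - th' 0.
Proof.
intros Hn [Hc He] [Hc' He'].
assert (Hex : forall t, unit_interval t -> Cexp (0, th t - th' t) = RtoC 1).
{ intros t Ht. assert (E := He t Ht). rewrite (He' t Ht) in E at 1.
  assert (Hm := proj1 (Cmod_gt_0 _) (Hn t Ht)). set (m := Cmod (h (gam t))) in *.
  assert (E1 := f_equal Re E). assert (E2 := f_equal Im E). simpl in E1, E2.
  assert (E3 : cos (th' t) = cos (th t)) by (apply (Rmult_eq_reg_l m); lra).
  assert (E4 : sin (th' t) = sin (th t)) by (apply (Rmult_eq_reg_l m); lra).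
  unfold Cexp; simpl. rewrite exp_0, cos_minus, sin_minus, E3, E4.
  assert (S := sin2_cos2 (th t)). unfold Rsqr in S. apply C_eq; simpl; lra. }
assert (E : th 0 - th' 0 = th 1 - th' 1); [|lra].
apply (interval_connected (fun t => th 0 - th' 0 = th t - th' t) 0 1); [lra| |reflexivity].
intros t Ht.
destruct (continuous_on_unit th Hc t Ht 1 Rlt_0_1) as [d [Hd H]].
destruct (continuous_on_unit th' Hc' t Ht 1 Rlt_0_1) as [d' [Hd' H']].
exists (Rmin d d'); split; [now apply Rmin_pos|]. intros s Hs Hst.
specialize (H s Hs (Rlt_le_trans _ _ _ Hst (Rmin_l _ _))).
specialize (H' s Hs (Rlt_le_trans _ _ _ Hst (Rmin_r _ _))).
apply Rabs_def2 in H; apply Rabs_def2 in H'.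
assert (E : Cminus (0, th s - th' s) (0, th t - th' t) = RtoC 0).
{ apply Cexp_eq1_small.
  - rewrite Cexp_minus, !Hex by auto. apply Cinv_r. intros E; apply RtoC_inj in E; lra.
  - eapply Rle_lt_trans; [apply Cmod_le_ReIm|]. simpl.
    replace (0 + - 0) with 0 by ring. rewrite Rabs_R0.
    assert (Rabs (th s - th' s + - (th t - th' t)) < 2) by (apply Rabs_def1; lra). lra. }
apply (f_equal Im) in E. simpl in E. split; intros; lra.
Qed.

Lemma arg_of_log gam h (l : R -> C) : contI l 0 1 -> (forall t, 0 <= t <= 1 -> Cexp (l t) = h (gam t)) ->
  continuous_arg gam h (fun t => Im (l t)).
Proof.
intros Hc He. split.
- intros t Ht. assert (Hi := cont_Im (U := R_UniformSpace) l t (Hc t Ht)).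
  intros P HP. unfold filtermap, within. generalize (Hi P HP). unfold filtermap.
  apply filter_imp. auto.
- intros t Ht. rewrite <- (He t Ht), Cmod_Cexp. unfold Cexp. apply C_eq; simpl; ring.
Qed.

(** This is how [Ind] is evaluated: the imaginary part of a continuous logarithm is an admissible
    argument, and every other one has the same increment. *)
Lemma Ind_log gam h (l : R -> C) : gam 1 = gam 0 -> contI l 0 1 ->
  (forall t, 0 <= t <= 1 -> Cexp (l t) = h (gam t)) ->
  (l 1 - l 0)%C = (RtoC (2 * PI) * Ci * RtoC (IZR (Ind gam h)))%C.
Proof.
intros Hcl Hc He.
destruct (Cexp_eq1 (l 1 - l 0)%C) as [n Hn].
{ rewrite Cexp_minus, !He by lra. rewrite Hcl. field. rewrite <- He by lra. apply Cexp_neq0. }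
enough (E : IZR n = IZR (Ind gam h)) by (rewrite Hn, E; reflexivity).
assert (Ha := arg_of_log gam h l Hc He).
assert (HP := PI_RGT_0).
assert (Hi : (Im (l 1) - Im (l 0)) / (2 * PI) = IZR n).
{ apply (f_equal Im) in Hn. simpl in Hn. unfold Im in *. field_simplify_eq; lra. }
assert (Hs := epsilon_spec (inhabits 0%Z) (fun n : Z => exists theta : R -> R,
    continuous_arg gam h theta /\ (theta 1 - theta 0) / (2 * PI) = IZR n)
    (ex_intro _ n (ex_intro _ _ (conj Ha Hi)))).
fold (Ind gam h) in Hs. destruct Hs as [th [Hth Hth']].
rewrite <- Hi, <- Hth'.
rewrite (continuous_arg_diff gam h th (fun t => Im (l t))); auto.
intros t Ht. rewrite <- He by auto. apply Cexp_neq0.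
Qed.

Section Index.
Variables (gam : R -> C) (Hg : smooth_closed_curve gam).
Notation v := (velocity gam).

Lemma gam_closed : gam 1 = gam 0.
Proof. replace 1 with (0 + 1) by ring. now apply gam_per. Qed.

(** Up to a constant, the primitive [J] of [v / (gam - z)] is a logarithm of [gam - z], because
    [Cexp (- J) * (gam - z)] has derivative 0. *)
Lemma Ind_wind z : off gam z -> wind gam z = RtoC (IZR (Ind gam (fun tau => tau - z)%C)).
Proof.
intros Hz. set (f := fun t => (v t / (gam t - z) ^ 1)%C).
assert (Hzz : forall t, (gam t - z)%C <> RtoC 0) by (intros t; now apply Csub_neq0).
assert (Hf : forall t, Rcont f t).
{ intros t. apply cont_Cdiv; [now apply v_cont| |now apply Cpow_nz].
  apply cont_Cpow, cont_Cminus; [now apply gam_cont|apply cont_const]. }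
assert (HfI : forall a b, contI f a b) by (intros a b t _; apply Hf).
(* Starting at [-1] puts [[0, 1]] strictly inside the interval where [cI_deriv] applies. *)
set (J := fun t => cI f (-1) t).
assert (HJ : forall t, 0 <= t <= 1 -> Rdiff J t (f t)) by (intros t Ht; apply (cI_deriv f (-1) 2); auto; lra).
set (E := fun t => (Cexp (RtoC 0 - J t) * (gam t - z))%C).
assert (HE : forall t, 0 <= t <= 1 -> Rdiff E t (RtoC 0)).
{ intros t Ht. eapply Rdiff_val.
  - apply Rdiff_mult.
    + apply (Rdiff_comp Cexp (fun t => RtoC 0 - J t)%C); [apply Cdiff_Cexp|].
      apply Rdiff_minus; [apply Rdiff_const|now apply HJ].
    + apply Rdiff_minus; [now apply gam_diff|apply Rdiff_const].
  - cbv beta. unfold f. simpl. field. auto. }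
assert (HE0 : forall t, 0 <= t <= 1 -> E t = E 0).
{ intros t Ht. apply (Rdiff_zero_const E 0 t); [lra| |].
  - intros s Hs. eapply Rdiff_cont, HE; lra.
  - intros s Hs. apply HE; lra. }
assert (HE00 : E 0 <> RtoC 0) by (apply Cmult_neq_0; [apply Cexp_neq0|auto]).
destruct (Clog_ex _ HE00) as [w Hw].
assert (HL := Ind_log gam (fun tau => tau - z)%C (fun t => J t + w)%C gam_closed).
unfold wind. replace (kernel v gam 1 z) with (J 1 + w - (J 0 + w))%C.
- rewrite HL.
  + rewrite Cmult_assoc, Cinv_l by apply twopii_neq0. ring.
  + intros t Ht. apply cont_Cplus; [|apply cont_const]. eapply Rdiff_cont; now apply HJ.
  + intros t Ht. rewrite Cexp_plus, Hw, <- (HE0 t Ht). unfold E.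
    rewrite Cmult_assoc, <- Cexp_plus. replace (J t + (RtoC 0 - J t))%C with (RtoC 0) by ring.
    rewrite Cexp_0. ring.
- unfold J. rewrite (cI_Chasles f (-1) 0 1) by (auto; lra). unfold kernel. fold f. ring.
Qed.

Lemma param_near c s0 tau : (forall s t, Rabs (s - t) <= 3 / 4 -> c * Rabs (s - t) <= Cmod (gam s - gam t)) ->
  (exists t, gam t = tau) -> exists s, gam s = tau /\ Rabs (s - s0) <= 1 / 2 /\ c * Rabs (s - s0) <= Cmod (tau - gam s0).
Proof.
intros Hca [t <-]. destruct (reduce_mod1 t (s0 - 1 / 2)) as [n Hn].
exists (t + IZR n). assert (Rabs (t + IZR n - s0) <= 1 / 2) by (apply Rabs_le; lra).
rewrite <- (gam_perZ gam Hg n t). repeat split; auto. apply Hca; lra.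
Qed.

(** Index 0 makes the logarithm lifted along the curve periodic, so it descends to a function on
    [L]. *)
Lemma log_branch_ex (L : C -> Prop) (h : C -> C) : (forall z, L z <-> exists t, gam t = z) ->
  (forall t, Rcont (fun s => h (gam s)) t) -> (forall t, h (gam t) <> RtoC 0) ->
  Ind gam h = 0%Z ->
  continuous_on L (log_branch L h) /\ forall tau, L tau -> Cexp (log_branch L h tau) = h tau.
Proof.
intros HL Hc Hn Hi. unfold log_branch. apply epsilon_spec.
destruct (lift_log (fun t => h (gam t)) (- 1) 3 ltac:(lra) Hc Hn) as [l [Hl1 Hl2]].
assert (H10 : l 1 = l 0).
{ assert (A := Ind_log gam h l gam_closed (fun t _ => Hl1 t) ltac:(intros; apply Hl2; lra)).
  rewrite Hi in A. replace (l 1) with (l 0 + (l 1 - l 0))%C by ring. rewrite A. ring. }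
assert (Hper : forall t, -1 <= t <= 2 -> l (t + 1) = l t).
{ set (D := fun t : R => (l (t + 1)%R - l t)%C).
  assert (HDc : forall t, Rcont D t).
  { intros t. apply cont_Cminus; auto. apply (cont_compR (U := R_UniformSpace) (fun t => t + 1) l); auto.
    apply (ex_derive_continuous (K := R_AbsRing) (V := R_NormedModule)). auto_derive; auto. }
  assert (HD1 : forall t, -1 <= t <= 2 -> Cexp (D t) = RtoC 1).
  { intros t Ht. unfold D. rewrite Cexp_minus, !Hl2 by lra. rewrite (gam_per gam Hg). field; auto. }
  assert (HD : forall t, -1 <= t <= 2 -> D t = D (-1)).
  { intros t Ht. apply exp_diff_const; [lra|intros s _; auto|intros s Hs; apply HD1; lra]. }
  intros t Ht. assert (A : D t = RtoC 0).
  { rewrite (HD t Ht), <- (HD 0) by lra. unfold D. rewrite Rplus_0_l, H10. ring. }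
  unfold D in A. replace (l (t + 1)) with (l t + (l (t + 1)%R - l t))%C by ring. rewrite A. ring. }
set (par := fun tau => epsilon (inhabits 0) (fun t => 0 <= t < 1 /\ gam t = tau)).
assert (Hpar : forall s, 0 <= par (gam s) < 1 /\ gam (par (gam s)) = gam s).
{ intros s. apply (epsilon_spec (inhabits 0) (fun t => 0 <= t < 1 /\ gam t = gam s)).
  destruct (reduce_mod1 s 0) as [n Hn0]. exists (s + IZR n). split; [lra|now apply gam_perZ]. }
(* [par] jumps at the closing point, but [l (par (gam s))] follows [l] on this wider window, which
   contains every parameter within [1 / 2] of [[0, 1)]; hence the longer interval of the lift. *)
assert (Hlp : forall s, - 1 / 2 <= s <= 3 / 2 -> l (par (gam s)) = l s).
{ intros s Hs. destruct (Hpar s) as [H1 H2]. set (p := par (gam s)) in *.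
  destruct (Rlt_dec s 0) as [Hs0|Hs0]; [|destruct (Rlt_dec s 1) as [Hs1|Hs1]].
  - assert (E : p = s + 1).
    { apply (proj2 (proj2 (proj2 (proj2 Hg)))); [auto|lra|]. rewrite H2. symmetry; now apply gam_per. }
    rewrite E. apply Hper; lra.
  - f_equal. apply (proj2 (proj2 (proj2 (proj2 Hg)))); [auto|lra|auto].
  - assert (E : s = p + 1).
    { assert (E : p = s - 1); [|lra]. apply (proj2 (proj2 (proj2 (proj2 Hg)))); [auto|lra|].
      rewrite H2. replace s with (s - 1 + 1) at 1 by ring. now apply gam_per. }
    rewrite E. symmetry. apply Hper; lra. }
exists (fun tau => l (par tau)). split.
- intros tau0 Ht0. apply HL in Ht0. destruct Ht0 as [t0 <-].
  destruct (Hpar t0) as [H1 H2]. set (s0 := par (gam t0)) in *. rewrite <- H2.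
  apply (filterlim_C_iff _ _ _); intros eps He. unfold within. apply locally_C_iff.
  destruct (proj1 (Rcont_iff l s0) (Hl1 s0) eps He) as [d [Hd H]].
  destruct (chord_arc gam Hg) as [c [Hc0 Hca]].
  exists (c * d); split; [nra|]. intros w Hw Lw. apply HL in Lw.
  destruct (param_near c s0 w Hca Lw) as [s [<- [Hs1 Hs2]]].
  apply Rabs_le_between in Hs1.
  rewrite !Hlp by lra. apply H. apply (Rmult_lt_reg_l c); lra.
- intros tau Ht. apply HL in Ht. destruct Ht as [t <-].
  destruct (Hpar t) as [H1 H2]. rewrite Hl2 by lra. now rewrite H2.
Qed.

End Index.

(** * Interior and exterior *)

Section Region.
Variables (Op : R2 -> Prop) (gam : R -> C).
Hypotheses (Hopen : open Op) (Hbd : bounded_set Op) (HL : smooth_boundary_param Op gam).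
Notation In := (onC Op).
Notation Ext := (onC (exterior Op)).

Lemma boundary_curve : smooth_closed_curve gam.
Proof. apply HL. Qed.

Lemma alpha_id (z : C) : alpha z = z.
Proof. now destruct z. Qed.

Lemma bd_iff z : onC (boundary Op) z <-> exists t, gam t = z.
Proof.
destruct HL as [Hg [H _]]. rewrite H. split.
- intros [t [_ E]]; now exists t.
- intros [t E]. destruct (reduce_mod1 t 0) as [n Hn]. exists (t + IZR n).
  split; [unfold unit_interval; lra|now rewrite gam_perZ].
Qed.

Lemma bd_gam t : boundary Op (gam t).
Proof. rewrite <- alpha_id. apply bd_iff. now exists t. Qed.

Lemma off_iff z : off gam z <-> ~ onC (boundary Op) z.
Proof.
rewrite bd_iff. split.
- intros H [t E]. now apply (H t).
- intros H t E. apply H. now exists t.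
Qed.

Lemma In_open z : In z -> exists d, 0 < d /\ forall w, Cmod (w - z) < d -> In w.
Proof.
intros Hz. unfold onC in *. rewrite alpha_id in Hz.
assert (A : locally (T := C_UniformSpace) z Op) by exact (Hopen z Hz).
apply locally_C_iff in A. destruct A as [d [Hd A]]. exists d; split; [exact Hd|].
intros w Hw. rewrite alpha_id. auto.
Qed.

Lemma In_off z : In z -> off gam z.
Proof.
intros Hz. apply off_iff. intros Hb. unfold onC in *.
destruct (Hb Op (Hopen _ Hz)) as [_ [y [Hy1 Hy2]]]. auto.
Qed.

Lemma notIn_open z : off gam z -> ~ In z -> exists d, 0 < d /\ forall w, Cmod (w - z) < d -> ~ In w.
Proof.
intros Hz Hn. apply off_iff in Hz. unfold onC in *. rewrite alpha_id in Hz, Hn.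
apply NNPP; intros Hc. apply Hz. intros V HV. split.
- assert (A : locally (T := C_UniformSpace) z V) by exact HV.
  apply locally_C_iff in A. destruct A as [d [Hd A]].
  apply NNPP; intros Hc'. apply Hc. exists d; split; auto. intros w Hw Hi.
  rewrite alpha_id in Hi. apply Hc'. exists w; auto.
- exists z; split; auto. now apply (locally_singleton (T := C_UniformSpace) z V).
Qed.

Lemma In_locconst : locconst gam In.
Proof.
intros z Hz. destruct (classic (In z)) as [H|H].
- destruct (In_open z H) as [d [Hd A]]. exists d; split; auto. intros w Hw. split; auto.
- destruct (notIn_open z Hz H) as [d [Hd A]]. exists d; split; auto.
  intros w Hw. specialize (A w Hw). tauto.
Qed.

Lemma Ext_iff z : Ext z <-> off gam z /\ ~ In z.
Proof. rewrite off_iff. unfold onC, exterior. tauto. Qed.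

Lemma Ext_locconst : locconst gam Ext.
Proof.
intros z Hz. destruct (In_locconst z Hz) as [d [Hd H]]. destruct (off_open gam boundary_curve z Hz) as [d' [Hd' H']].
exists (Rmin d d'); split; [now apply Rmin_pos|]. intros w Hw.
specialize (H w (Rlt_le_trans _ _ _ Hw (Rmin_l _ _))).
specialize (H' w (Rlt_le_trans _ _ _ Hw (Rmin_r _ _))).
rewrite !Ext_iff. tauto.
Qed.

Lemma wind_In z : In z -> wind gam z = RtoC 1.
Proof.
intros Hz. rewrite (Ind_wind gam boundary_curve z (In_off z Hz)).
destruct HL as [_ [_ H]]. now rewrite (H z Hz).
Qed.

Lemma In_adh s eps : 0 < eps -> exists z, In z /\ Cmod (z - gam s) < eps.
Proof.
intros He.
assert (A : locally (T := C_UniformSpace) (gam s) (fun z => Cmod (z - gam s) < eps)).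
{ apply locally_C_iff. exists eps; auto. }
destruct (bd_gam s _ A) as [[y [Hy1 Hy2]] _]. exists y. unfold onC. now rewrite alpha_id.
Qed.

Lemma Cmod_chart_0 s0 y : Cmod (chart gam s0 s0 y - gam s0) = Cmod (velocity gam s0) * Rabs y.
Proof.
unfold chart. replace (gam s0 + Ci * velocity gam s0 * RtoC y - gam s0)%C with (Ci * velocity gam s0 * RtoC y)%C by ring.
rewrite !Cmod_mult, Cmod_Ci, Cmod_R. ring.
Qed.

(** Off the curve a neighbourhood of [gam s0] is covered by two half-rectangles, on each of which
    membership and winding number are constant. One belongs to the domain; the jump forbids the
    other to do so, hence it is exterior. *)
Lemma two_sides s0 : exists rho k, 0 < rho /\
  (forall z, Ext z -> Cmod (z - gam s0) < rho -> wind gam z = k) /\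
  (forall eps, 0 < eps -> exists z, Ext z /\ Cmod (z - gam s0) < eps).
Proof.
destruct (local_chart gam boundary_curve s0) as [d [r [rho [Hd [Hr [Hrho [Hv [Hlow [Hoff Hsurj]]]]]]]]].
assert (Hs0 : Rabs (s0 - s0) <= d) by (rewrite Rminus_diag, Rabs_R0; lra).
set (zs := fun y => chart gam s0 s0 y).
assert (Hside : forall (P : C -> Prop) s y, locconst gam P -> Rabs (s - s0) <= d -> 0 < Rabs y <= r ->
   (P (chart gam s0 s y) <-> P (zs (if Rlt_dec 0 y then r else - r)))).
{ intros P s y HP Hs Hy. unfold zs. apply (chart_path gam boundary_curve s0 P d r); auto.
  - destruct (Rlt_dec 0 y); rewrite ?Rabs_Ropp, Rabs_pos_eq; lra.
  - assert (y <> 0) by (intros ->; rewrite Rabs_R0 in Hy; lra). destruct (Rlt_dec 0 y); nra. }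
(* The domain accumulates at its boundary point [gam s0], so it contains one of the two sides. *)
assert (Hex : exists e, (e = r \/ e = - r) /\ In (zs e)).
{ destruct (In_adh s0 rho Hrho) as [z [Hz1 Hz2]].
  destruct (Hsurj z Hz2) as [s [y [Hs [Hy Ez]]]].
  assert (Hy0 : y <> 0).
  { intros ->. apply (In_off z Hz1 s). rewrite Ez. unfold chart. ring. }
  exists (if Rlt_dec 0 y then r else - r). split; [destruct (Rlt_dec 0 y); auto|].
  apply (Hside In s y); auto; [apply In_locconst|split; [now apply Rabs_pos_lt|auto]|now rewrite <- Ez]. }
assert (Hj : wind gam (zs r) <> wind gam (zs (- r))) by (apply (jump gam boundary_curve s0 d r); auto).
destruct Hex as [e [He Hin]].
assert (Hae : Rabs (- e) = r) by (destruct He as [->| ->]; rewrite ?Ropp_involutive, ?Rabs_Ropp, Rabs_pos_eq; lra).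
(* Were the opposite side in the domain too, the winding number would be 1 on both sides, against
   [jump]. *)
assert (Hext : Ext (zs (- e))).
{ apply Ext_iff. split; [apply Hoff; auto; lra|]. intros Hin'.
  apply Hj. destruct He as [->| ->]; [|rewrite Ropp_involutive in Hin']; now rewrite !wind_In. }
exists rho, (wind gam (zs (- e))). split; [auto|]. split.
- intros z Hz1 Hz2. destruct (Hsurj z Hz2) as [s [y [Hs [Hy Ez]]]].
  assert (Hz := Hz1). apply Ext_iff in Hz. destruct Hz as [Ho Hn].
  assert (Hy0 : 0 < Rabs y <= r).
  { split; auto. apply Rabs_pos_lt. intros ->. apply (Ho s). rewrite Ez. unfold chart. ring. }
  assert (A1 := Hside In s y In_locconst Hs Hy0).
  assert (A2 := Hside _ s y (wind_locconst gam boundary_curve (wind gam (zs (- e)))) Hs Hy0).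
  rewrite <- Ez in A1, A2. cbv beta in A2. apply A2.
  destruct (Rlt_dec 0 y), He as [->| ->]; rewrite ?Ropp_involutive;
  first [reflexivity | exfalso; exact (Hn (proj2 A1 Hin))].
- intros eps He'.
  assert (Hm := proj1 (Cmod_gt_0 _) (v_neq0 gam boundary_curve s0)). set (m := Cmod (velocity gam s0)) in *.
  set (y := Rmin r (eps / (2 * m))).
  assert (Hy : 0 < y <= r) by (split; [apply Rmin_pos; auto; apply Rdiv_lt_0_compat; lra|apply Rmin_l]).
  assert (Hy2 : y <= eps / (2 * m)) by apply Rmin_r.
  exists (zs (if Rlt_dec 0 (- e) then y else - y)). split.
  + apply (Hside Ext s0 (if Rlt_dec 0 (- e) then y else - y)); auto.
    * apply Ext_locconst.
    * destruct (Rlt_dec 0 (- e)); rewrite ?Rabs_Ropp, Rabs_pos_eq; lra.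
    * destruct (Rlt_dec 0 (- e)); destruct He as [->| ->]; destruct (Rlt_dec 0 _); try lra;
      rewrite ?Ropp_involutive in *; auto.
  + unfold zs. rewrite Cmod_chart_0. fold m.
    replace (Rabs (if Rlt_dec 0 (- e) then y else - y)) with y
      by (destruct (Rlt_dec 0 (- e)); rewrite ?Rabs_Ropp, Rabs_pos_eq; lra).
    apply Rle_lt_trans with (m * (eps / (2 * m))); [apply Rmult_le_compat_l; lra|].
    replace (m * (eps / (2 * m))) with (eps / 2) by (field; lra). lra.
Qed.

Lemma Ext_adh s eps : 0 < eps -> exists z, Ext z /\ Cmod (z - gam s) < eps.
Proof. destruct (two_sides s) as [rho [k [_ [_ H]]]]. apply H. Qed.

Lemma far_Ext : exists M, forall z, M < Cmod z -> Ext z.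
Proof.
destruct Hbd as [M HM]. destruct (gam_bound gam boundary_curve) as [M' [HM' HgM]].
exists (Rmax M M'). intros z Hz.
assert (H1 := Rle_lt_trans _ _ _ (Rmax_l _ _) Hz). assert (H2 := Rle_lt_trans _ _ _ (Rmax_r _ _) Hz).
apply Ext_iff. split.
- intros t E. specialize (HgM t). rewrite E in HgM. lra.
- unfold onC. rewrite alpha_id. intros Hi. specialize (HM z Hi).
  assert (E : norm (z : R2) = Cmod z) by (symmetry; apply Cmod_norm). rewrite E in HM. lra.
Qed.

Lemma kernel_far psi : contI psi 0 1 -> forall eps, 0 < eps -> exists M, forall z, M < Cmod z ->
  Cmod (kernel psi gam 1 z) < eps.
Proof.
intros Hp eps He. destruct (contI_bound psi 0 1 Hp) as [K [HK HpK]].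
destruct (gam_bound gam boundary_curve) as [M' [HM' HgM]].
exists (M' + K / eps + 1). intros z Hz.
assert (HKe : 0 < K / eps) by (now apply Rdiv_lt_0_compat).
assert (Hge : forall t, K / eps + 1 <= Cmod (gam t - z)).
{ intros t. rewrite Cmod_sub_sym. generalize (Cmod_sub_ge z (gam t)) (HgM t). lra. }
assert (Hne : forall t, (gam t - z)%C <> RtoC 0) by (intros t; apply Cmod_gt_0; specialize (Hge t); lra).
apply Rle_lt_trans with ((1 - 0) * (K / (K / eps + 1))).
- apply cI_le_const; [lra| |].
  + apply kernel_contI; auto; [intros t _; apply gam_cont, boundary_curve|].
    intros t _ E. apply (Hne t). rewrite E; ring.
  + intros t Ht. rewrite Cmod_div, Cmod_pow, pow_1 by (now apply Cpow_nz).
    apply Rmult_le_compat; auto; [apply Cmod_ge_0|apply Rlt_le, Rinv_0_lt_compat; specialize (Hge t); lra|].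
    apply Rinv_le_contravar; auto; lra.
- rewrite Rminus_0_r, Rmult_1_l. apply (Rmult_lt_reg_r (K / eps + 1)); [lra|].
  replace (K / (K / eps + 1) * (K / eps + 1)) with K by (field; split; [lra|assert (0 < K + eps) by lra; lra]).
  replace (eps * (K / eps + 1)) with (K + eps) by (field; lra). lra.
Qed.

(** The exterior value near [gam s] is locally constant in [s], hence the same all along the curve.
    Every exterior point reaches the curve by the segment to a nearest point, so this value holds on
    the whole exterior; far away it is arbitrarily small, so it is 0. *)
Lemma wind_Ext z : Ext z -> wind gam z = RtoC 0.
Proof.
set (Q := fun k s => exists rho, 0 < rho /\ forall z, Ext z -> Cmod (z - gam s) < rho -> wind gam z = k).
assert (HQ : forall s, exists k, Q k s).
{ intros s. destruct (two_sides s) as [rho [k [Hr [H _]]]]. exists k, rho; auto. }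
assert (HQu : forall s k k', Q k s -> Q k' s -> k = k').
{ intros s k k' [rho [Hr H]] [rho' [Hr' H']].
  destruct (Ext_adh s (Rmin rho rho')) as [y [Hy1 Hy2]]; [now apply Rmin_pos|].
  rewrite <- (H y Hy1 (Rlt_le_trans _ _ _ Hy2 (Rmin_l _ _))).
  now rewrite <- (H' y Hy1 (Rlt_le_trans _ _ _ Hy2 (Rmin_r _ _))). }
assert (HQl : forall s, exists d, 0 < d /\ forall s', Rabs (s' - s) < d -> forall k, Q k s' <-> Q k s).
{ intros s. destruct (HQ s) as [k Hk]. assert (Hk0 := Hk). destruct Hk as [rho [Hr H]].
  assert (Hr2 : 0 < rho / 2) by lra.
  destruct (proj1 (Rcont_iff gam s) (gam_cont gam boundary_curve s) _ Hr2) as [d [Hd Hgd]].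
  exists d; split; auto. intros s' Hs'.
  assert (Hks' : Q k s').
  { exists (rho / 2). split; auto. intros y Hy1 Hy2. apply H; auto.
    generalize (Cmod_triangle_sub y (gam s') (gam s)) (Hgd s' Hs'). lra. }
  intros k'. split; intros Hk'.
  - now rewrite (HQu s' k' k Hk' Hks').
  - now rewrite (HQu s k' k Hk' Hk0). }
destruct (HQ 0) as [k Hk].
assert (Hall : forall s, Q k s).
{ assert (H01 : forall s, 0 <= s -> Q k s).
  { intros s Hs. apply (interval_connected (Q k) 0 s Hs); auto.
    intros t _. destruct (HQl t) as [d [Hd H]]. exists d; split; auto. }
  intros s. destruct (reduce_mod1 s 0) as [n Hn].
  destruct (H01 (s + IZR n) ltac:(lra)) as [rho [Hr H]]. exists rho; split; auto.
  rewrite (gam_perZ gam boundary_curve) in H. exact H. }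
assert (Hk1 : forall y, Ext y -> wind gam y = k).
{ intros y Hy. destruct (nearest gam boundary_curve y) as [s Hs].
  destruct (Hall s) as [rho [Hr H]].
  assert (Ho : off gam y) by now apply Ext_iff.
  assert (Hm : 0 < Cmod (gam s - y)) by apply Cmod_sub_gt0, Ho. set (m := Cmod (gam s - y)) in *.
  (* The segment towards [gam s] is stopped at distance at most [rho / 2] from its end, before it
     meets the curve. *)
  set (u := Rmax 0 (1 - rho / (2 * m))).
  assert (Hq : 0 < rho / (2 * m)) by (apply Rdiv_lt_0_compat; lra).
  assert (Hu : 0 <= u < 1) by (unfold u; split; [apply Rmax_l|apply Rmax_lub_lt; lra]).
  assert (Hu2 : 1 - rho / (2 * m) <= u) by apply Rmax_r.
  set (p := fun t => (y + RtoC t * (gam s - y))%C).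
  assert (Hpo : forall t, 0 <= t <= u -> off gam (p t)).
  { intros t Ht t' E. assert (A := Hs t'). fold m in A. rewrite E in A. unfold p in A.
    replace (y + RtoC t * (gam s - y) - y)%C with (RtoC t * (gam s - y))%C in A by ring.
    rewrite Cmod_mult, Cmod_R, Rabs_pos_eq in A by lra. fold m in A. nra. }
  assert (Hpc : contI p 0 u) by (intros t _; eapply Rdiff_cont, Rdiff_line).
  assert (P1 := path_locconst gam Ext p 0 u Ext_locconst (proj1 Hu) Hpc Hpo).
  assert (P2 := path_locconst gam _ p 0 u (wind_locconst gam boundary_curve k) (proj1 Hu) Hpc Hpo).
  cbv beta in P2. replace (p 0) with y in P1, P2 by (unfold p; ring).
  apply P2. apply H; [now apply P1|].
  unfold p. replace (y + RtoC u * (gam s - y) - gam s)%C with (RtoC (u - 1) * (gam s - y))%C by (rewrite RtoC_minus; ring).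
  rewrite Cmod_mult, Cmod_R, Rabs_left by lra. fold m.
  apply Rle_lt_trans with (rho / (2 * m) * m); [apply Rmult_le_compat_r; lra|].
  replace (rho / (2 * m) * m) with (rho / 2) by (field; lra). lra. }
intros Hz. rewrite (Hk1 z Hz). clear z Hz.
apply Cmod_lt_all. intros eps He. replace (k - RtoC 0)%C with k by ring.
destruct far_Ext as [M HM].
destruct (kernel_far (velocity gam) (fun t _ => v_cont gam boundary_curve t) eps He) as [M' HM'].
set (y := RtoC (Rabs M + Rabs M' + 1)).
assert (Hy : Cmod y = Rabs M + Rabs M' + 1).
{ unfold y. rewrite Cmod_R, Rabs_pos_eq; auto. generalize (Rabs_pos M) (Rabs_pos M'). lra. }
generalize (Rle_abs M) (Rle_abs M') (Rabs_pos M) (Rabs_pos M'); intros.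
rewrite <- (Hk1 y) by (apply HM; lra).
unfold wind. rewrite Cmod_mult, Cmod_inv, Cmod_twopii by apply twopii_neq0.
assert (A := HM' y ltac:(lra)).
assert (HP := PI2_3_2). unfold PI2 in HP.
assert (/ (2 * PI) < 1) by (rewrite <- Rinv_1; apply Rinv_lt_contravar; lra).
assert (0 < / (2 * PI)) by (apply Rinv_0_lt_compat; lra).
generalize (Cmod_ge_0 (kernel (velocity gam) gam 1 y)). intros. nra.
Qed.

End Region.

(** * Hoelder densities and the Cauchy integral near the curve *)

(* Only small [Rabs (s - t)] matter, the functions of interest being periodic.  At
   [s = t] the bound is harmless: [Rpower 0 mu = 1]. *)
Definition holder_with (phi : R -> C) (K mu d : R) : Prop :=
  0 < K /\ 0 < mu <= 1 /\ 0 < d <= 1 /\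
  forall s t, Rabs (s - t) < d -> Cmod (phi s - phi t) <= K * Rpower (Rabs (s - t)) mu.

Definition holder (phi : R -> C) : Prop := exists K mu d, holder_with phi K mu d.

Lemma Rpower_pos x y : 0 < Rpower x y.
Proof. apply exp_pos. Qed.

Lemma Rpower_le_exp x a b : 0 < x <= 1 -> b <= a -> Rpower x a <= Rpower x b.
Proof.
intros Hx Hab. unfold Rpower. apply exp_le_mono.
assert (ln x <= 0) by (rewrite <- ln_1; apply ln_le; lra). nra.
Qed.

Lemma Rpower_le_base x y a : 0 < x <= y -> 0 <= a -> Rpower x a <= Rpower y a.
Proof. intros H Ha. now apply Rle_Rpower_l. Qed.

Lemma Rpower_tendsto0 mu eps : 0 < mu -> 0 < eps -> exists e, 0 < e /\ forall x, 0 < x < e -> Rpower x mu < eps.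
Proof.
intros Hm He. exists (Rpower eps (/ mu)). split; [apply Rpower_pos|].
intros x Hx. replace eps with (Rpower (Rpower eps (/ mu)) mu).
- unfold Rpower at 1 2. apply exp_increasing. apply Rmult_lt_compat_l; auto. apply ln_increasing; lra.
- rewrite Rpower_mult, Rinv_l, Rpower_1; lra.
Qed.

Lemma pow_deriv nu s0 A s : 0 < nu -> s0 < s ->
  is_derive (fun s => A / nu * exp (nu * ln (s - s0))) s (A * (exp (nu * ln (s - s0)) / (s - s0))).
Proof. intros Hn Hs. auto_derive; [lra|unfold Rminus; field; lra]. Qed.

Lemma pow_deriv' nu s0 A s : 0 < nu -> s < s0 ->
  is_derive (fun s => - (A / nu * exp (nu * ln (s0 - s)))) s (A * (exp (nu * ln (s0 - s)) / (s0 - s))).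
Proof. intros Hn Hs. auto_derive; [lra|unfold Rminus; field; lra]. Qed.

Lemma le_eps_lim x y M : 0 < M -> (exists e0, 0 < e0 /\ forall e, 0 < e < e0 -> x <= y + e * M) -> x <= y.
Proof.
intros HM [e0 [He0 H]]. destruct (Rle_dec x y) as [|Hxy]; auto.
set (e := Rmin (e0 / 2) ((x - y) / (2 * M))).
assert (He : 0 < e). { apply Rmin_pos; [lra|]. apply Rdiv_lt_0_compat; lra. }
assert (H1 : e <= e0 / 2) by apply Rmin_l. assert (H2 : e <= (x - y) / (2 * M)) by apply Rmin_r.
specialize (H e ltac:(lra)). apply (Rmult_le_compat_r M) in H2; [|lra].
replace ((x - y) / (2 * M) * M) with ((x - y) / 2) in H2 by (field; lra). lra.
Qed.

(** The bound [(s - s0)^(nu - 1)] is integrable, but its antiderivative is in general not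
    differentiable at [s0]. The integral is cut at [s0 + e]; the short piece is at most [e * M], and
    [e] tends to 0. *)
Lemma singular_right f s0 b A nu rho : 0 < nu -> 0 <= A -> s0 <= b -> b - s0 <= rho -> 0 < rho -> contI f s0 b ->
  (forall s, s0 < s <= b -> Cmod (f s) <= A * (Rpower (s - s0) nu / (s - s0))) ->
  Cmod (cI f s0 b) <= A / nu * Rpower rho nu.
Proof.
intros Hn HA Hsb Hb Hrho Hc Hf.
assert (HAn : 0 <= A / nu) by (apply Rdiv_le_0_compat; lra).
destruct (Req_dec s0 b) as [->|Hne].
{ rewrite cI_point, Cmod_0. apply Rmult_le_pos; auto. apply Rlt_le, Rpower_pos. }
destruct (contI_bound f s0 b Hc) as [M [HM HfM]].
apply (le_eps_lim _ _ M HM). exists (b - s0). split; [lra|]. intros e He.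
rewrite (cI_Chasles f s0 (s0 + e) b) by (auto; lra).
eapply Rle_trans; [apply Cmod_triangle|]. rewrite Rplus_comm. apply Rplus_le_compat.
- eapply Rle_trans.
  + apply (cI_le f (s0 + e) b (fun s => A / nu * exp (nu * ln (s - s0))) (fun s => A * (exp (nu * ln (s - s0)) / (s - s0)))).
    * lra.
    * apply (contI_sub _ _ _ _ _ Hc); lra.
    * intros t Ht. apply pow_deriv; lra.
    * intros t Ht. apply (ex_derive_continuous (K := R_AbsRing) (V := R_NormedModule)). auto_derive; lra.
    * intros t Ht. apply Hf; lra.
  + cbv beta. fold (Rpower (b - s0) nu).
    assert (P := exp_pos (nu * ln (s0 + e - s0))). assert (Q := Rpower_le_base (b - s0) rho nu ltac:(lra) ltac:(lra)).
    assert (R1 : A / nu * Rpower (b - s0) nu <= A / nu * Rpower rho nu) by (apply Rmult_le_compat_l; auto).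
    assert (0 <= A / nu * exp (nu * ln (s0 + e - s0))) by (apply Rmult_le_pos; lra). lra.
- eapply Rle_trans; [apply cI_le_const|].
  + lra.
  + apply (contI_sub _ _ _ _ _ Hc); lra.
  + intros t Ht. apply HfM; lra.
  + right; ring.
Qed.

Lemma singular_left f s0 a A nu rho : 0 < nu -> 0 <= A -> a <= s0 -> s0 - a <= rho -> 0 < rho -> contI f a s0 ->
  (forall s, a <= s < s0 -> Cmod (f s) <= A * (Rpower (s0 - s) nu / (s0 - s))) ->
  Cmod (cI f a s0) <= A / nu * Rpower rho nu.
Proof.
intros Hn HA Hsb Hb Hrho Hc Hf.
assert (HAn : 0 <= A / nu) by (apply Rdiv_le_0_compat; lra).
destruct (Req_dec a s0) as [->|Hne].
{ rewrite cI_point, Cmod_0. apply Rmult_le_pos; auto. apply Rlt_le, Rpower_pos. }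
destruct (contI_bound f a s0 Hc) as [M [HM HfM]].
apply (le_eps_lim _ _ M HM). exists (s0 - a). split; [lra|]. intros e He.
rewrite (cI_Chasles f a (s0 - e) s0) by (auto; lra).
eapply Rle_trans; [apply Cmod_triangle|]. apply Rplus_le_compat.
- eapply Rle_trans.
  + apply (cI_le f a (s0 - e) (fun s => - (A / nu * exp (nu * ln (s0 - s)))) (fun s => A * (exp (nu * ln (s0 - s)) / (s0 - s)))).
    * lra.
    * apply (contI_sub _ _ _ _ _ Hc); lra.
    * intros t Ht. apply pow_deriv'; lra.
    * intros t Ht. apply (ex_derive_continuous (K := R_AbsRing) (V := R_NormedModule)). auto_derive; lra.
    * intros t Ht. apply Hf; lra.
  + cbv beta. fold (Rpower (s0 - a) nu).
    assert (P := exp_pos (nu * ln (s0 - (s0 - e)))). assert (Q := Rpower_le_base (s0 - a) rho nu ltac:(lra) ltac:(lra)).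
    assert (R1 : A / nu * Rpower (s0 - a) nu <= A / nu * Rpower rho nu) by (apply Rmult_le_compat_l; auto).
    assert (0 <= A / nu * exp (nu * ln (s0 - (s0 - e)))) by (apply Rmult_le_pos; lra). lra.
- eapply Rle_trans; [apply cI_le_const|].
  + lra.
  + apply (contI_sub _ _ _ _ _ Hc); lra.
  + intros t Ht. apply HfM; lra.
  + right; ring.
Qed.

Lemma singular_near f s0 a b A nu rho : 0 < nu -> 0 <= A -> a <= s0 <= b -> s0 - a <= rho -> b - s0 <= rho ->
  0 < rho -> contI f a b ->
  (forall s, a <= s <= b -> s <> s0 -> Cmod (f s) <= A * (Rpower (Rabs (s - s0)) nu / Rabs (s - s0))) ->
  Cmod (cI f a b) <= 2 * (A / nu * Rpower rho nu).
Proof.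
intros Hn HA Hs Ha Hb Hrho Hc Hf.
rewrite (cI_Chasles f a s0 b) by (auto; lra).
eapply Rle_trans; [apply Cmod_triangle|].
assert (H1 : Cmod (cI f a s0) <= A / nu * Rpower rho nu).
{ apply singular_left; auto; try lra; [apply (contI_sub _ _ _ _ _ Hc); lra|].
  intros s Hs'. specialize (Hf s ltac:(lra) ltac:(lra)). rewrite Rabs_left in Hf by lra.
  now replace (- (s - s0)) with (s0 - s) in Hf by ring. }
assert (H2 : Cmod (cI f s0 b) <= A / nu * Rpower rho nu).
{ apply singular_right; auto; try lra; [apply (contI_sub _ _ _ _ _ Hc); lra|].
  intros s Hs'. specialize (Hf s ltac:(lra) ltac:(lra)). now rewrite Rabs_pos_eq in Hf by lra. }
lra.
Qed.

(** * The Cauchy integral with its singularity subtracted *)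

Section Plemelj.
Variables (gam : R -> C) (Hg : smooth_closed_curve gam).
Notation v := (velocity gam).
Variables (phi : R -> C) (Hper : forall t, phi (t + 1) = phi t) (Hcont : forall t, Rcont phi t).

(* Satisfied when [gam s0] is a point of the curve nearest to [z]. *)
Definition near_pair (z : C) (s0 : R) : Prop :=
  off gam z /\ forall s, Cmod (gam s - gam s0) <= 2 * Cmod (gam s - z).

(** Near [s0] the difference [phi s - phi s0] offsets the pole, leaving a singularity of order
    [nu - 1], uniformly over near pairs. *)
Definition Ssub (z : C) (s0 : R) : C := kernel (fun s => (phi s - phi s0) * v s)%C gam 1 z.

Lemma phi_bound : exists B, 0 < B /\ forall t, Cmod (phi t) <= B.
Proof.
destruct (contI_bound phi 0 1) as [M [HM H]]; [intros t _; apply Hcont|].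
exists M; split; auto. intros t. destruct (reduce_mod1 t 0) as [n Hn].
rewrite <- (periodic_Z phi Hper n). apply H; lra.
Qed.

Lemma Ssub_window z s0 s1 : off gam z ->
  Ssub z s0 = cI (fun s => (phi s - phi s0) * v s / (gam s - z) ^ 1)%C (s1 - 1 / 2) (s1 + 1 / 2).
Proof.
intros Hz. unfold Ssub. rewrite (kernel_window gam Hg _ z 1 s1 Hz); auto.
- intros t. now rewrite Hper, v_per.
- intros t. apply cont_Cmult; [|now apply v_cont]. apply cont_Cminus; [apply Hcont|apply cont_const].
Qed.

(* Split at the distance [eta = de^(nu / 3)] from [s0]: the two near parts are
   O([eta^nu]), and far away the integrands differ by O([de^nu / eta + de / eta^2]). *)
Lemma Ssub_diff (Hh : holder phi) : exists C mu e0, 0 < C /\ 0 < mu <= 1 /\ 0 < e0 /\ forall z s0 z' s0' de,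
  near_pair z s0 -> near_pair z' s0' -> Cmod (z - z') <= de -> Rabs (s0 - s0') <= de -> 0 < de < e0 ->
  Cmod (Ssub z s0 - Ssub z' s0') <= C * Rpower de mu.
Proof.
destruct Hh as [K [nu [d [HK [Hnu [Hd Hh]]]]]].
destruct (chord_arc gam Hg) as [c [Hc Hca]].
destruct (v_bound gam Hg) as [M [HM HvM]].
destruct phi_bound as [B [HB HphiB]].
(* With [eta] of order [de^th], the near part has exponent [nu * th = mu], and the far parts have
   [nu - th] and [1 - 2 * th]; for [nu <= 1] both are at least [mu]. *)
set (th := nu / 3). set (mu := nu * nu / 3).
assert (Hth : 0 < th <= 1 / 3) by (unfold th; lra).
assert (Hmu : 0 < mu <= 1) by (unfold mu; nra).
set (e := Rmin (d / 4) (1 / 16)). assert (He : 0 < e) by (apply Rmin_pos; lra).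
assert (He1 : e <= d / 4) by apply Rmin_l. assert (He2 : e <= 1 / 16) by apply Rmin_r.
destruct (Rpower_tendsto0 th e) as [e1 [He1p Hpow]]; [lra|auto|].
(* For a near pair [Cmod (gam s - z) >= c * Rabs (s - s0) / 2], which accounts for the 2. *)
set (A := 2 * K * M / c). assert (HA : 0 < A) by (apply Rdiv_lt_0_compat; nra).
set (C1 := 8 * (A / nu)). set (C2 := 2 * K * M / c). set (C3 := 16 * B * M / (c * c)).
assert (HC1 : 0 < C1) by (apply Rmult_lt_0_compat; [lra|]; apply Rdiv_lt_0_compat; lra).
assert (HC2 : 0 < C2) by (apply Rdiv_lt_0_compat; nra).
assert (HC3 : 0 < C3) by (apply Rdiv_lt_0_compat; nra).
exists (C1 + C2 + C3), mu, (Rmin e1 (1 / 4)).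
split; [lra|]. split; [auto|]. split; [apply Rmin_pos; lra|].
intros z s0 z' s0' de [Hz Hzn] [Hz' Hzn'] Hzz Hss Hde.
assert (Hde1 : de < e1) by (eapply Rlt_le_trans; [apply Hde|apply Rmin_l]).
assert (Hde2 : de < 1 / 4) by (eapply Rlt_le_trans; [apply Hde|apply Rmin_r]).
set (eta := Rpower de th).
assert (Heta0 : 0 < eta) by apply Rpower_pos.
assert (Heta1 : eta < e) by (apply Hpow; lra).
(* Then [s0'] is within [eta / 2] of [s0]: the window of half-width [eta] around [s0] contains it
   and lies within [2 * eta] of it. *)
assert (Heta2 : 2 * de <= eta).
{ assert (X : Rpower de (1 - th) <= 1 / 2).
  { eapply Rle_trans; [apply (Rpower_le_exp de (1 - th) (/ 2)); lra|].
    rewrite Rpower_sqrt by lra. replace (1 / 2) with (sqrt ((1 / 2) * (1 / 2))) by (apply sqrt_square; lra).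
    apply sqrt_le_1_alt; lra. }
  assert (Y : eta * Rpower de (1 - th) = de).
  { unfold eta. rewrite <- Rpower_plus. replace (th + (1 - th)) with 1 by ring. apply Rpower_1; lra. }
  nra. }
set (I1 := fun s => ((phi s - phi s0) * v s / (gam s - z) ^ 1)%C).
set (I2 := fun s => ((phi s - phi s0') * v s / (gam s - z') ^ 1)%C).
assert (Hcs : forall z s0 t, off gam z -> Rcont (fun s => (phi s - phi s0) * v s / (gam s - z) ^ 1)%C t).
{ intros y s1 t Hy. apply cont_Cdiv.
  - apply cont_Cmult; [|now apply v_cont]. apply cont_Cminus; [apply Hcont|apply cont_const].
  - apply cont_Cpow, cont_Cminus; [now apply gam_cont|apply cont_const].
  - now apply Cpow_nz, Csub_neq0. }
assert (H1c : forall a b, contI I1 a b) by (intros a b t _; now apply Hcs).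
assert (H2c : forall a b, contI I2 a b) by (intros a b t _; now apply Hcs).
assert (Hbd : forall z s0 s, off gam z -> (forall s, Cmod (gam s - gam s0) <= 2 * Cmod (gam s - z)) ->
  Rabs (s - s0) < d -> Rabs (s - s0) <= 3 / 4 -> s <> s0 ->
  Cmod ((phi s - phi s0) * v s / (gam s - z) ^ 1) <= A * (Rpower (Rabs (s - s0)) nu / Rabs (s - s0))).
{ intros y s1 s Hy Hyn Hs1 Hs2 Hne.
  assert (Hp : 0 < Rabs (s - s1)) by (apply Rabs_pos_lt; lra).
  assert (Hl : c * Rabs (s - s1) / 2 <= Cmod (gam s - y)).
  { generalize (Hyn s) (Hca s s1 Hs2). lra. }
  assert (Hl0 : 0 < c * Rabs (s - s1)) by (now apply Rmult_lt_0_compat).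
  rewrite Cmod_div, Cmod_pow, pow_1, Cmod_mult by now apply Cpow_nz, Csub_neq0.
  assert (HP := Rpower_pos (Rabs (s - s1)) nu).
  assert (N : Cmod (phi s - phi s1) * Cmod (v s) <= K * Rpower (Rabs (s - s1)) nu * M).
  { apply Rmult_le_compat; auto using Cmod_ge_0. }
  apply (Rmult_le_reg_r (Cmod (gam s - y))); [lra|].
  unfold Rdiv at 1. rewrite Rmult_assoc, Rinv_l, Rmult_1_r by lra.
  eapply Rle_trans; [exact N|].
  apply Rle_trans with (A * (Rpower (Rabs (s - s1)) nu / Rabs (s - s1)) * (c * Rabs (s - s1) / 2)).
  - right. unfold A. field. lra.
  - apply Rmult_le_compat_l; auto. apply Rmult_le_pos; [lra|]. apply Rdiv_le_0_compat; lra. }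
assert (Hsm : Rpower (2 * eta) nu <= 2 * Rpower de mu).
{ rewrite <- Rpower_mult_distr by lra. unfold eta. rewrite Rpower_mult.
  replace (th * nu) with mu by (unfold th, mu; field).
  apply Rmult_le_compat_r; [apply Rlt_le, Rpower_pos|].
  replace 2 with (Rpower 2 1) at 2 by (apply Rpower_1; lra). apply Rle_Rpower; lra. }
apply Rabs_le_between in Hss.
assert (N1 : Cmod (cI I1 (s0 - eta) (s0 + eta)) <= 2 * (A / nu * Rpower (2 * eta) nu)).
{ apply (singular_near I1 s0); auto; try lra. intros s Hs Hne.
  assert (Rabs (s - s0) <= eta) by (apply Rabs_le; lra). apply Hbd; auto; lra. }
assert (N2 : Cmod (cI I2 (s0 - eta) (s0 + eta)) <= 2 * (A / nu * Rpower (2 * eta) nu)).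
{ apply (singular_near I2 s0'); auto; try lra. intros s Hs Hne.
  assert (Rabs (s - s0') <= 2 * eta) by (apply Rabs_le; lra). apply Hbd; auto; lra. }
set (D := (K * Rpower de nu * M * (2 / (c * eta)) + 2 * B * de * M * (8 / (c * eta * (c * eta))))).
assert (Hceta : 0 < c * eta) by nra.
assert (F : forall s, eta <= Rabs (s - s0) <= 1 / 2 -> Cmod (I1 s - I2 s) <= D).
{ intros s Hs.
  assert (Hs' : eta / 2 <= Rabs (s - s0') <= 3 / 4).
  { split.
    - replace (s - s0) with ((s - s0') + (s0' - s0)) in Hs by ring.
      assert (T := Rabs_triang (s - s0') (s0' - s0)).
      assert (Rabs (s0' - s0) <= de) by (apply Rabs_le; lra). lra.
    - replace (s - s0') with ((s - s0) + (s0 - s0')) by ring.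
      eapply Rle_trans; [apply Rabs_triang|]. assert (Rabs (s0 - s0') <= de) by (apply Rabs_le; lra). lra. }
  assert (L1 : c * eta / 2 <= Cmod (gam s - z)) by (generalize (Hzn s) (Hca s s0 ltac:(lra)); nra).
  assert (L2 : c * eta / 4 <= Cmod (gam s - z')) by (generalize (Hzn' s) (Hca s s0' ltac:(lra)); nra).
  assert (Z1 : (gam s - z)%C <> RtoC 0) by now apply Csub_neq0.
  assert (Z2 : (gam s - z')%C <> RtoC 0) by now apply Csub_neq0.
  (* The first term is the effect of changing the subtracted constant, the second that of moving the
     pole; they match the two summands of [D]. *)
  replace (I1 s - I2 s)%C with ((phi s0' - phi s0) * v s / (gam s - z) +
    (phi s - phi s0') * (z - z') * v s / ((gam s - z) * (gam s - z')))%C by (unfold I1, I2; simpl; field; auto).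
  eapply Rle_trans; [apply Cmod_triangle|]. unfold D. apply Rplus_le_compat.
  - rewrite Cmod_div, Cmod_mult by auto. unfold Rdiv at 1. apply Rmult_le_compat.
    + apply Rmult_le_pos; apply Cmod_ge_0.
    + apply Rlt_le, Rinv_0_lt_compat; lra.
    + apply Rmult_le_compat; auto using Cmod_ge_0.
      destruct (Req_dec s0' s0) as [->|Hne].
      * rewrite Cmod_0_sub. apply Rmult_le_pos; [lra|apply Rlt_le, Rpower_pos].
      * eapply Rle_trans; [apply Hh; apply Rabs_def1; lra|]. apply Rmult_le_compat_l; [lra|].
        apply Rpower_le_base; [|lra]. split; [apply Rabs_pos_lt; lra|apply Rabs_le; lra].
    + replace (2 / (c * eta)) with (/ (c * eta / 2)) by (field; lra). apply Rinv_le_contravar; lra.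
  - rewrite Cmod_div, !Cmod_mult by (now apply Cmult_neq_0). unfold Rdiv at 1. apply Rmult_le_compat.
    + repeat apply Rmult_le_pos; apply Cmod_ge_0.
    + apply Rlt_le, Rinv_0_lt_compat; nra.
    + apply Rmult_le_compat; auto using Cmod_ge_0; [apply Rmult_le_pos; apply Cmod_ge_0|].
      apply Rmult_le_compat; auto using Cmod_ge_0.
      eapply Rle_trans; [apply Cmod_sub_le|]. generalize (HphiB s) (HphiB s0'); lra.
    + replace (8 / (c * eta * (c * eta))) with (/ ((c * eta / 2) * (c * eta / 4))) by (field; lra).
      apply Rinv_le_contravar; [nra|]. apply Rmult_le_compat; lra. }
assert (HDp : 0 <= D).
{ unfold D. assert (P := Rpower_pos de nu). apply Rplus_le_le_0_compat; apply Rmult_le_pos.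
  - repeat apply Rmult_le_pos; lra.
  - apply Rdiv_le_0_compat; lra.
  - repeat apply Rmult_le_pos; lra.
  - apply Rdiv_le_0_compat; nra. }
assert (HIc : forall a b, contI (fun s => I1 s - I2 s)%C a b) by (intros a b t _; apply cont_Cminus; [eapply H1c|eapply H2c]; split; apply Rle_refl).
assert (F1 : Cmod (cI (fun s => I1 s - I2 s)%C (s0 - 1 / 2) (s0 - eta)) <= 1 / 2 * D).
{ eapply Rle_trans; [apply cI_le_const; [lra|auto|]|].
  - intros t Ht. apply F. rewrite Rabs_left; lra.
  - apply Rmult_le_compat_r; lra. }
assert (F2 : Cmod (cI (fun s => I1 s - I2 s)%C (s0 + eta) (s0 + 1 / 2)) <= 1 / 2 * D).
{ eapply Rle_trans; [apply cI_le_const; [lra|auto|]|].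
  - intros t Ht. apply F. rewrite Rabs_pos_eq; lra.
  - apply Rmult_le_compat_r; lra. }
assert (E : (Ssub z s0 - Ssub z' s0' = cI (fun s => I1 s - I2 s)%C (s0 - 1 / 2) (s0 - eta) +
   (cI I1 (s0 - eta) (s0 + eta) - cI I2 (s0 - eta) (s0 + eta) +
   cI (fun s => I1 s - I2 s)%C (s0 + eta) (s0 + 1 / 2)))%C).
{ rewrite (Ssub_window z s0 s0 Hz), (Ssub_window z' s0' s0 Hz'). fold I1 I2.
  rewrite !cI_minus by (auto; lra).
  rewrite (cI_Chasles I1 (s0 - 1 / 2) (s0 - eta) (s0 + 1 / 2)) by (auto; lra).
  rewrite (cI_Chasles I1 (s0 - eta) (s0 + eta) (s0 + 1 / 2)) by (auto; lra).
  rewrite (cI_Chasles I2 (s0 - 1 / 2) (s0 - eta) (s0 + 1 / 2)) by (auto; lra).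
  rewrite (cI_Chasles I2 (s0 - eta) (s0 + eta) (s0 + 1 / 2)) by (auto; lra).
  ring. }
rewrite E.
assert (HD : D <= (C2 + C3) * Rpower de mu).
{ unfold D. rewrite Rmult_plus_distr_r. apply Rplus_le_compat.
  - apply Rle_trans with (C2 * (Rpower de nu / eta)); [right; unfold C2; field; lra|].
    apply Rmult_le_compat_l; [lra|]. unfold eta, Rdiv. rewrite <- Rpower_Ropp, <- Rpower_plus.
    apply Rpower_le_exp; [lra|]. unfold th, mu. nra.
  - apply Rle_trans with (C3 * (de / (eta * eta))); [right; unfold C3; field; lra|].
    apply Rmult_le_compat_l; [lra|]. unfold eta, Rdiv.
    rewrite <- Rpower_plus, <- Rpower_Ropp.
    replace de with (Rpower de 1) at 1 by (apply Rpower_1; lra). rewrite <- Rpower_plus.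
    apply Rpower_le_exp; [lra|]. unfold th, mu. nra. }
assert (HN : 2 * (2 * (A / nu * Rpower (2 * eta) nu)) <= C1 * Rpower de mu).
{ unfold C1. assert (0 < A / nu) by (apply Rdiv_lt_0_compat; lra).
  assert (A / nu * Rpower (2 * eta) nu <= A / nu * (2 * Rpower de mu)) by (apply Rmult_le_compat_l; lra). lra. }
eapply Rle_trans; [apply Cmod_triangle|].
eapply Rle_trans; [apply Rplus_le_compat_l, Cmod_triangle|].
assert (G := Cmod_sub_le (cI I1 (s0 - eta) (s0 + eta)) (cI I2 (s0 - eta) (s0 + eta))).
lra.
Qed.

End Plemelj.

(** * Boundary values of the Cauchy integral and their regularity *)

Section BoundaryValues.
Variables (gam : R -> C) (Hg : smooth_closed_curve gam).
Notation v := (velocity gam).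
Variables (phi : R -> C) (Hper : forall t, phi (t + 1) = phi t) (Hcont : forall t, Rcont phi t) (Hh : holder phi).
Variable W : C -> Prop.
Hypotheses (W_off : forall z, W z -> off gam z) (W_wind : forall z, W z -> Cmod (wind gam z) <= 1)
  (W_adh : forall s eps, 0 < eps -> exists z, W z /\ Cmod (z - gam s) < eps).

Definition cauchyT (z : C) : C := (/ (RtoC (2 * PI) * Ci) * kernel (fun s => phi s * v s)%C gam 1 z)%C.

(** The subtracted constant integrates exactly to a winding number, whatever the choice of [s0];
    this takes the place of a principal value. *)
Lemma cauchy_decomp z s0 : off gam z ->
  cauchyT z = (/ (RtoC (2 * PI) * Ci) * Ssub gam phi z s0 + phi s0 * wind gam z)%C.
Proof.
intros Hz. unfold cauchyT, Ssub, wind.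
assert (Hv : forall t, Rcont v t) by now apply v_cont.
assert (K : forall psi, (forall t, Rcont psi t) -> contI (fun t => psi t / (gam t - z) ^ 1)%C 0 1).
{ intros psi Hp. apply kernel_contI; [intros t _; apply Hp|intros t _; now apply gam_cont|intros t _; apply Hz]. }
replace (kernel (fun s => (phi s - phi s0) * v s)%C gam 1 z) with
  (kernel (fun s => phi s * v s)%C gam 1 z - phi s0 * kernel v gam 1 z)%C; [ring|].
unfold kernel. rewrite <- cI_scal by (auto; lra). rewrite <- cI_minus; try lra.
- apply cI_ext; [lra|]. intros t _. assert (N := Csub_neq0 _ _ (Hz t)). simpl. field; auto.
- apply K. intros t. apply cont_Cmult; auto.
- intros t Ht. apply cont_Cmult; [apply cont_const|]. now apply K.
Qed.

Lemma near_ex c z s : (forall s t, Rabs (s - t) <= 3 / 4 -> c * Rabs (s - t) <= Cmod (gam s - gam t)) ->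
  off gam z -> exists s0, near_pair gam z s0 /\ c * Rabs (s0 - s) <= 2 * Cmod (z - gam s).
Proof.
intros Hca Hz. destruct (nearest gam Hg z) as [s1 Hs1].
destruct (param_near gam Hg c s (gam s1) Hca (ex_intro _ s1 eq_refl)) as [s0 [E [_ Hs0]]].
exists s0. split; [split; [exact Hz|]|].
- intros t. rewrite E. generalize (Cmod_triangle_sub (gam t) z (gam s1)) (Hs1 t).
  rewrite (Cmod_sub_sym z (gam s1)). lra.
- eapply Rle_trans; [exact Hs0|]. generalize (Cmod_triangle_sub (gam s1) z (gam s)) (Hs1 s).
  rewrite (Cmod_sub_sym (gam s) z). lra.
Qed.

(* Subtracting [phi s * wind] removes the jump, so that what remains has the same limit
   on both sides. *)
Definition cauchyT_rest (z : C) (s : R) : C := (cauchyT z - phi s * wind gam z)%C.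

(** The estimate for near pairs is transferred to any parameters whose curve points are within [de];
    [z] and [z'] may lie on different sides of the curve. *)
Lemma cauchyT_rest_diff : exists C mu e0, 0 < C /\ 0 < mu <= 1 /\ 0 < e0 <= 1 /\ forall z s z' s' de,
  W z -> W z' -> Cmod (z - gam s) <= de -> Cmod (z' - gam s') <= de -> Rabs (s - s') <= de -> 0 < de < e0 ->
  Cmod (cauchyT_rest z s - cauchyT_rest z' s') <= C * Rpower de mu.
Proof.
destruct (Ssub_diff gam Hg phi Hper Hcont Hh) as [C0 [mu [e0 [HC0 [Hmu [He0 HS]]]]]].
destruct Hh as [K [nu [d [HK [Hnu [Hd Hho]]]]]].
destruct (chord_arc gam Hg) as [c [Hc Hca]].
destruct (gam_lip gam Hg) as [M [HM HgM]].
(* [4 / c] accounts for the two nearest-point parameters, [M] for the displacement of [gam], and [3]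
   for the remaining distances, each at most [de]. *)
set (L := 4 / c + M + 3).
assert (H4c : 0 < 4 / c) by (apply Rdiv_lt_0_compat; lra).
assert (HL : 3 < L) by (unfold L; lra).
set (mu' := Rmin mu nu). assert (Hmu' : 0 < mu' <= 1) by (split; [apply Rmin_pos; lra|eapply Rle_trans; [apply Rmin_l|lra]]).
set (CC := (C0 + 2 * K) * Rpower L mu').
assert (HP2 := PI2_3_2). unfold PI2 in HP2.
exists CC, mu', (Rmin (Rmin e0 d) 1 / L).
split; [apply Rmult_lt_0_compat; [lra|apply Rpower_pos]|]. split; [auto|].
assert (Hmin : 0 < Rmin (Rmin e0 d) 1) by (repeat apply Rmin_pos; lra).
split.
{ split; [apply Rdiv_lt_0_compat; lra|]. apply (Rmult_le_reg_r L); [lra|].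
  unfold Rdiv. rewrite Rmult_assoc, Rinv_l by lra. generalize (Rmin_r (Rmin e0 d) 1). lra. }
intros z s z' s' de Wz Wz' Hz Hz' Hss [Hde0 Hde].
assert (HLde : L * de < Rmin (Rmin e0 d) 1).
{ apply (Rmult_lt_compat_l L) in Hde; [|lra]. replace (L * (Rmin (Rmin e0 d) 1 / L)) with (Rmin (Rmin e0 d) 1) in Hde by (field; lra). auto. }
assert (HLe : L * de < e0) by (eapply Rlt_le_trans; [exact HLde|eapply Rle_trans; apply Rmin_l]).
assert (HLd : L * de < d) by (eapply Rlt_le_trans; [exact HLde|eapply Rle_trans; [apply Rmin_l|apply Rmin_r]]).
assert (HL1 : L * de < 1) by (eapply Rlt_le_trans; [exact HLde|apply Rmin_r]).
destruct (near_ex c z s Hca (W_off z Wz)) as [s0 [Hn Hs0]].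
destruct (near_ex c z' s' Hca (W_off z' Wz')) as [s0' [Hn' Hs0']].
assert (Hclose : forall x r, c * r <= 2 * x -> x <= de -> r <= 2 / c * de).
{ intros x r H1 H2. apply (Rmult_le_reg_l c); auto. replace (c * (2 / c * de)) with (2 * de) by (field; lra). lra. }
assert (Q := Hclose _ _ Hs0 Hz). assert (Q' := Hclose _ _ Hs0' Hz').
replace (2 / c * de) with (4 / c * de / 2) in Q, Q' by (field; lra).
assert (P4 : 0 < 4 / c * de) by nra. assert (PM : 0 < M * de) by nra.
assert (EL : L * de = 4 / c * de + M * de + 3 * de) by (unfold L; ring).
assert (B1 : Rabs (s0 - s0') <= L * de).
{ replace (s0 - s0') with ((s0 - s) + (s - s') + (s' - s0')) by ring.
  eapply Rle_trans; [apply Rabs_triang|]. eapply Rle_trans; [apply Rplus_le_compat_r, Rabs_triang|].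
  rewrite (Rabs_minus_sym s' s0'). lra. }
assert (B2 : Cmod (z - z') <= L * de).
{ replace (z - z')%C with ((z - gam s) + (gam s - gam s') - (z' - gam s'))%C by ring.
  eapply Rle_trans; [apply Cmod_sub_le|]. eapply Rle_trans; [apply Rplus_le_compat_r, Cmod_triangle|].
  assert (M * Rabs (s - s') <= M * de) by (apply Rmult_le_compat_l; lra).
  generalize (HgM s s'). lra. }
assert (B3 := HS z s0 z' s0' (L * de) Hn Hn' B2 B1 ltac:(split; [nra|auto])).
assert (HLp : 0 < L * de) by nra.
assert (B4 : Rpower (L * de) mu <= Rpower (L * de) mu') by (apply Rpower_le_exp; [lra|apply Rmin_l]).
assert (Hphi : forall a b, Rabs (a - b) <= L * de -> Cmod (phi a - phi b) <= K * Rpower (L * de) mu').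
{ intros a b Hab. destruct (Req_dec a b) as [->|Hne].
  - rewrite Cmod_0_sub. apply Rmult_le_pos; [lra|apply Rlt_le, Rpower_pos].
  - eapply Rle_trans; [apply Hho; lra|]. apply Rmult_le_compat_l; [lra|].
    eapply Rle_trans; [apply (Rpower_le_base _ (L * de)); [|lra]|].
    + split; auto. apply Rabs_pos_lt; lra.
    + apply Rpower_le_exp; [lra|apply Rmin_r]. }
unfold cauchyT_rest. rewrite (cauchy_decomp z s0 (W_off z Wz)), (cauchy_decomp z' s0' (W_off z' Wz')).
set (i := (/ (RtoC (2 * PI) * Ci))%C).
replace (i * Ssub gam phi z s0 + phi s0 * wind gam z - phi s * wind gam z -
   (i * Ssub gam phi z' s0' + phi s0' * wind gam z' - phi s' * wind gam z'))%C with
  (i * (Ssub gam phi z s0 - Ssub gam phi z' s0') + (phi s0 - phi s) * wind gam z - (phi s0' - phi s') * wind gam z')%C by ring.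
assert (Hi : Cmod i <= 1).
{ unfold i. rewrite Cmod_inv, Cmod_twopii by apply twopii_neq0. rewrite <- Rinv_1. apply Rinv_le_contravar; lra. }
assert (T1 : Cmod (i * (Ssub gam phi z s0 - Ssub gam phi z' s0')) <= C0 * Rpower (L * de) mu').
{ rewrite Cmod_mult. apply Rle_trans with (1 * (C0 * Rpower (L * de) mu)).
  - apply Rmult_le_compat; auto using Cmod_ge_0.
  - rewrite Rmult_1_l. apply Rmult_le_compat_l; lra. }
assert (T : forall x y a, W x -> Rabs (y - a) <= L * de -> Cmod ((phi y - phi a) * wind gam x) <= K * Rpower (L * de) mu').
{ intros x y a Hx Hya. rewrite Cmod_mult. rewrite <- (Rmult_1_r (K * Rpower (L * de) mu')).
  apply Rmult_le_compat; auto using Cmod_ge_0. }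
assert (T2 := T z s0 s Wz ltac:(lra)). assert (T3 := T z' s0' s' Wz' ltac:(lra)).
eapply Rle_trans; [apply Cmod_sub_le|]. eapply Rle_trans; [apply Rplus_le_compat_r, Cmod_triangle|].
unfold CC. rewrite Rmult_assoc, Rpower_mult_distr by lra. lra.
Qed.

Definition is_bv (s : R) (b : C) : Prop :=
  forall eps, 0 < eps -> exists d, 0 < d /\ forall z, W z -> Cmod (z - gam s) < d -> Cmod (cauchyT_rest z s - b) < eps.

Lemma is_bv_unique s b b' : is_bv s b -> is_bv s b' -> b = b'.
Proof.
intros H H'. apply Cmod_lt_all. intros eps He. assert (He2 : 0 < eps / 2) by lra.
destruct (H _ He2) as [d [Hd H1]]. destruct (H' _ He2) as [d' [Hd' H1']].
destruct (W_adh s (Rmin d d')) as [z [Wz Hz]]; [now apply Rmin_pos|].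
specialize (H1 z Wz (Rlt_le_trans _ _ _ Hz (Rmin_l _ _))).
specialize (H1' z Wz (Rlt_le_trans _ _ _ Hz (Rmin_r _ _))).
rewrite Cmod_sub_sym in H1. generalize (Cmod_triangle_sub b (cauchyT_rest z s) b'). lra.
Qed.

(** [cauchyT_rest_diff] with equal parameters is the Cauchy criterion for the points of [W]
    approaching [gam s]. *)
Lemma is_bv_ex s : exists b, is_bv s b.
Proof.
destruct cauchyT_rest_diff as [K [mu [e0 [HK [Hmu [He0 H]]]]]].
set (F := within W (locally (T := C_UniformSpace) (gam s))).
assert (HF : ProperFilter F).
{ split.
  - intros P HP. unfold F, within in HP. apply locally_C_iff in HP. destruct HP as [d [Hd HP]].
    destruct (W_adh s d Hd) as [z [Wz Hz]]. exists z; auto.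
  - apply within_filter, locally_filter. }
destruct (proj1 (filterlim_locally_cauchy (U := C_R_CompleteNormedModule) (F := F) (fun z => cauchyT_rest z s))) as [b Hb].
- intros eps.
  destruct (Rpower_tendsto0 mu (eps / K)) as [e1 [He1 Hp]]; [lra|apply Rdiv_lt_0_compat; [apply cond_pos|auto]|].
  set (de := Rmin e0 e1 / 2). assert (Hm : 0 < Rmin e0 e1) by (apply Rmin_pos; lra).
  assert (Hde0 : de < e0) by (unfold de; generalize (Rmin_l e0 e1); lra).
  assert (Hde1 : de < e1) by (unfold de; generalize (Rmin_r e0 e1); lra).
  assert (Hdep : 0 < de) by (unfold de; lra).
  exists (fun z => W z /\ Cmod (z - gam s) < de). split.
  + unfold F, within. apply locally_C_iff. exists de; auto.
  + intros u w [Wu Hu] [Ww Hw]. apply C_NormedModule_mixin_compat1.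
    change (Cmod (cauchyT_rest w s - cauchyT_rest u s) < eps).
    eapply Rle_lt_trans; [apply (H w s u s de); auto; try lra; rewrite Rminus_diag, Rabs_R0; lra|].
    apply (Rmult_lt_reg_l (/ K)); [now apply Rinv_0_lt_compat|]. rewrite <- Rmult_assoc, Rinv_l, Rmult_1_l by lra.
    rewrite Rmult_comm. apply Hp; lra.
- exists b. intros eps He.
  assert (A := proj1 (filterlim_C_iff F (fun z => cauchyT_rest z s) b) Hb eps He).
  unfold F, within in A. apply locally_C_iff in A. destruct A as [d [Hd A]]. exists d; split; auto.
Qed.

Definition bval (s : R) : C := epsilon (inhabits (RtoC 0)) (is_bv s).

Lemma bval_spec s : is_bv s (bval s).
Proof. unfold bval. apply epsilon_spec, is_bv_ex. Qed.

Lemma bval_per s : bval (s + 1) = bval s.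
Proof.
apply (is_bv_unique s); [|apply bval_spec].
intros eps He. destruct (bval_spec (s + 1) eps He) as [d [Hd H]]. exists d; split; auto.
intros z Wz Hz. specialize (H z Wz). rewrite gam_per in H by auto. specialize (H Hz).
unfold cauchyT_rest in *. now rewrite Hper in H.
Qed.

(** The estimate that proves existence of the limits passes to the limits themselves. It makes the
    boundary value of [X] Hoelder, so that it may enter further densities. *)
Lemma bval_holder : holder bval.
Proof.
destruct cauchyT_rest_diff as [K [mu [e0 [HK [Hmu [He0 H]]]]]].
exists K, mu, e0. split; [auto|]. split; [auto|]. split; [auto|].
intros s s' Hss. destruct (Req_dec s s') as [->|Hne].
{ rewrite Cmod_0_sub. apply Rmult_le_pos; [lra|apply Rlt_le, Rpower_pos]. }
set (de := Rabs (s - s')) in *. assert (Hde : 0 < de) by (apply Rabs_pos_lt; lra).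
destruct (Rle_dec (Cmod (bval s - bval s')) (K * Rpower de mu)) as [|Hgt]; auto. exfalso.
set (ep := (Cmod (bval s - bval s') - K * Rpower de mu) / 2). assert (Hep : 0 < ep) by (unfold ep; lra).
destruct (bval_spec s ep Hep) as [d1 [Hd1 H1]]. destruct (bval_spec s' ep Hep) as [d2 [Hd2 H2]].
destruct (W_adh s (Rmin d1 de)) as [z [Wz Hz]]; [now apply Rmin_pos|].
destruct (W_adh s' (Rmin d2 de)) as [z' [Wz' Hz']]; [now apply Rmin_pos|].
specialize (H1 z Wz (Rlt_le_trans _ _ _ Hz (Rmin_l _ _))).
specialize (H2 z' Wz' (Rlt_le_trans _ _ _ Hz' (Rmin_l _ _))).
assert (Hz2 := Rlt_le_trans _ _ _ Hz (Rmin_r _ _)). assert (Hz2' := Rlt_le_trans _ _ _ Hz' (Rmin_r _ _)).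
assert (A := H z s z' s' de Wz Wz' ltac:(lra) ltac:(lra) ltac:(unfold de; lra) ltac:(lra)).
assert (T : Cmod (bval s - bval s') <= Cmod (cauchyT_rest z s - bval s) + Cmod (cauchyT_rest z s - cauchyT_rest z' s') + Cmod (cauchyT_rest z' s' - bval s')).
{ replace (bval s - bval s')%C with (- (cauchyT_rest z s - bval s) + (cauchyT_rest z s - cauchyT_rest z' s') + (cauchyT_rest z' s' - bval s'))%C by ring.
  eapply Rle_trans; [apply Cmod_triangle|]. apply Rplus_le_compat_r.
  eapply Rle_trans; [apply Cmod_triangle|]. rewrite Cmod_opp. lra. }
unfold ep in *. lra.
Qed.

End BoundaryValues.

(** * Calculus of Hoelder functions *)

Lemma holder_cont phi : holder phi -> forall t, Rcont phi t.
Proof.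
intros [K [mu [d [HK [Hmu [Hd H]]]]]] t. apply Rcont_iff. intros eps He.
destruct (Rpower_tendsto0 mu (eps / K)) as [e1 [He1 Hp]]; [lra|now apply Rdiv_lt_0_compat|].
exists (Rmin d e1). split; [apply Rmin_pos; lra|]. intros s Hs.
destruct (Req_dec s t) as [->|Hne]; [now rewrite Cmod_0_sub|].
eapply Rle_lt_trans; [apply H; eapply Rlt_le_trans; [exact Hs|apply Rmin_l]|].
apply (Rmult_lt_reg_l (/ K)); [now apply Rinv_0_lt_compat|]. rewrite <- Rmult_assoc, Rinv_l, Rmult_1_l by lra.
rewrite Rmult_comm. apply Hp. split; [apply Rabs_pos_lt; lra|eapply Rlt_le_trans; [exact Hs|apply Rmin_r]].
Qed.

(** The closure rules below reduce to such a domination, which settles the different exponents and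
    radii once. *)
Lemma holder_dom (f g h : R -> C) A B : 0 <= A -> 0 <= B -> holder f -> holder g ->
  (exists d, 0 < d /\ forall s t, Rabs (s - t) < d -> Cmod (h s - h t) <= A * Cmod (f s - f t) + B * Cmod (g s - g t)) ->
  holder h.
Proof.
intros HA HB [K [mu [d [HK [Hmu [Hd H]]]]]] [K' [mu' [d' [HK' [Hmu' [Hd' H']]]]]] [d0 [Hd0 H0]].
set (m := Rmin mu mu'). assert (Hm : 0 < m) by (apply Rmin_pos; lra).
assert (Hm1 : m <= mu) by apply Rmin_l. assert (Hm2 : m <= mu') by apply Rmin_r.
set (e := Rmin (Rmin d d') d0).
assert (E1 : e <= d) by (eapply Rle_trans; [apply Rmin_l|apply Rmin_l]).
assert (E2 : e <= d') by (eapply Rle_trans; [apply Rmin_l|apply Rmin_r]).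
assert (E3 : e <= d0) by apply Rmin_r.
assert (E0 : 0 < e) by (repeat apply Rmin_pos; lra).
assert (HAK : 0 <= A * K) by (apply Rmult_le_pos; lra). assert (HBK : 0 <= B * K') by (apply Rmult_le_pos; lra).
(* The [+ 1] keeps the constant positive when [A] and [B] vanish. *)
exists (A * K + B * K' + 1), m, e. split; [lra|]. split; [lra|]. split; [lra|].
intros s t Hst. destruct (Req_dec s t) as [->|Hne].
{ rewrite Cmod_0_sub. apply Rmult_le_pos; [lra|apply Rlt_le, Rpower_pos]. }
assert (Hp : 0 < Rabs (s - t)) by (apply Rabs_pos_lt; lra).
eapply Rle_trans; [apply H0; lra|].
assert (P1 : Rpower (Rabs (s - t)) mu <= Rpower (Rabs (s - t)) m) by (apply Rpower_le_exp; lra).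
assert (P2 : Rpower (Rabs (s - t)) mu' <= Rpower (Rabs (s - t)) m) by (apply Rpower_le_exp; lra).
assert (P0 := Rpower_pos (Rabs (s - t)) m).
assert (Q1 : A * Cmod (f s - f t) <= A * (K * Rpower (Rabs (s - t)) m)).
{ apply Rmult_le_compat_l; auto. eapply Rle_trans; [apply H; lra|]. apply Rmult_le_compat_l; lra. }
assert (Q2 : B * Cmod (g s - g t) <= B * (K' * Rpower (Rabs (s - t)) m)).
{ apply Rmult_le_compat_l; auto. eapply Rle_trans; [apply H'; lra|]. apply Rmult_le_compat_l; lra. }
nra.
Qed.

Definition Cbounded (f : R -> C) : Prop := exists M, 0 < M /\ forall t, Cmod (f t) <= M.

Lemma periodic_bounded f : (forall t, f (t + 1) = f t) -> (forall t, Rcont f t) -> Cbounded f.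
Proof. intros; now apply phi_bound. Qed.

Lemma holder_const c : holder (fun _ => c).
Proof.
exists 1, 1, 1. split; [lra|]. split; [lra|]. split; [lra|]. intros s t _. rewrite Cmod_0_sub.
apply Rmult_le_pos; [lra|apply Rlt_le, Rpower_pos].
Qed.

Lemma holder_plus f g : holder f -> holder g -> holder (fun t => f t + g t)%C.
Proof.
intros Hf Hg. apply (holder_dom f g _ 1 1); auto; try lra. exists 1; split; [lra|]. intros s t _.
replace (f s + g s - (f t + g t))%C with ((f s - f t) + (g s - g t))%C by ring.
rewrite !Rmult_1_l. apply Cmod_triangle.
Qed.

Lemma holder_mult f g : Cbounded f -> Cbounded g -> holder f -> holder g -> holder (fun t => f t * g t)%C.
Proof.
intros [M [HM HfM]] [N [HN HgN]] Hf Hg. apply (holder_dom f g _ N M); auto; try lra. exists 1; split; [lra|]. intros s t _.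
replace (f s * g s - f t * g t)%C with ((f s - f t) * g s + f t * (g s - g t))%C by ring.
eapply Rle_trans; [apply Cmod_triangle|]. rewrite !Cmod_mult. apply Rplus_le_compat.
- rewrite Rmult_comm. apply Rmult_le_compat_r; [apply Cmod_ge_0|auto].
- apply Rmult_le_compat_r; [apply Cmod_ge_0|auto].
Qed.

Lemma holder_inv f m : 0 < m -> (forall t, m <= Cmod (f t)) -> holder f -> holder (fun t => / f t)%C.
Proof.
intros Hm Hfm Hf. assert (Hi : 0 < / (m * m)) by (apply Rinv_0_lt_compat; nra).
apply (holder_dom f f _ (/ (m * m)) 0); auto; try lra. exists 1; split; [lra|]. intros s t _.
assert (N : forall t, f t <> RtoC 0) by (intros u; apply Cmod_gt_0; specialize (Hfm u); lra).
replace (/ f s - / f t)%C with ((f t - f s) / (f s * f t))%C by (field; auto).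
rewrite Cmod_div, Cmod_mult, (Cmod_sub_sym (f t)) by (now apply Cmult_neq_0).
rewrite Rmult_0_l, Rplus_0_r, (Rmult_comm (/ (m * m))). apply Rmult_le_compat_l; [apply Cmod_ge_0|].
apply Rinv_le_contravar; [nra|]. apply Rmult_le_compat; auto; lra.
Qed.

Lemma holder_exp f : Cbounded f -> holder f -> holder (fun t => Cexp (f t)).
Proof.
intros [M [HM HfM]] Hf. assert (P := exp_pos M). apply (holder_dom f f _ (exp M) 0); auto; try lra.
exists 1; split; [lra|]. intros s t _. rewrite Rmult_0_l, Rplus_0_r. now apply Cexp_lip.
Qed.

Lemma holder_conj f : holder f -> holder (fun t => Cconj (f t)).
Proof.
intros Hf. apply (holder_dom f f _ 1 0); auto; try lra. exists 1; split; [lra|]. intros s t _.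
replace (Cconj (f s) - Cconj (f t))%C with (Cconj (f s - f t)) by (apply C_eq; simpl; ring).
rewrite Cmod_conj. lra.
Qed.

Lemma holder_lip f M : 0 < M -> (forall s t, Cmod (f s - f t) <= M * Rabs (s - t)) -> holder f.
Proof.
intros HM H. exists M, 1, 1. split; [lra|]. split; [lra|]. split; [lra|].
intros s t _. destruct (Req_dec s t) as [->|Hne].
- rewrite Cmod_0_sub. apply Rmult_le_pos; [lra|apply Rlt_le, Rpower_pos].
- rewrite Rpower_1 by (apply Rabs_pos_lt; lra). apply H.
Qed.

Lemma nonzero_lower (f : R -> C) : (forall t, f (t + 1) = f t) -> (forall t, Rcont f t) -> (forall t, f t <> RtoC 0) ->
  exists m, 0 < m /\ forall t, m <= Cmod (f t).
Proof.
intros Hp Hc Hn. destruct (dist_curve f (RtoC 0)) as [m [Hm H]]; [intros t _; apply Hc|intros t _; apply Hn|].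
exists m; split; auto. intros t. destruct (reduce_mod1 t 0) as [n Hn'].
rewrite <- (periodic_Z f Hp n). specialize (H (t + IZR n) ltac:(lra)).
now replace (f (t + IZR n)%R - RtoC 0)%C with (f (t + IZR n)%R) in H by ring.
Qed.

(** A branch of the logarithm is a priori only continuous. Uniform continuity brings nearby values
    into the range of [Cexp_small_inv], which bounds their difference by that of the
    exponentials. *)
Lemma holder_log (l : R -> C) : (forall t, l (t + 1) = l t) -> (forall t, Rcont l t) ->
  holder (fun t => Cexp (l t)) -> holder l.
Proof.
intros Hp Hc Hh. destruct Cexp_small_inv as [r [Hr Hi]].
destruct (contI_unif l (-1) 2 (fun t _ => Hc t) r Hr) as [d [Hd Hu]].
destruct (nonzero_lower (fun t => Cexp (l t))) as [m [Hm Hlow]].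
- intros t. now rewrite Hp.
- intros t. now apply cont_Cexp.
- intros t. apply Cexp_neq0.
- assert (Him : 0 < 2 / m) by (apply Rdiv_lt_0_compat; lra).
  apply (holder_dom (fun t => Cexp (l t)) (fun t => Cexp (l t)) l (2 / m) 0); auto; try lra.
  exists (Rmin d 1). split; [apply Rmin_pos; lra|]. intros s t Hst.
  assert (H1 := Rlt_le_trans _ _ _ Hst (Rmin_l _ _)). assert (H2 := Rlt_le_trans _ _ _ Hst (Rmin_r _ _)).
  apply Rabs_def2 in H2.
  assert (Hsmall : Cmod (l s - l t) < r).
  { destruct (reduce_mod1 t 0) as [n Hn]. rewrite <- (periodic_Z l Hp n s), <- (periodic_Z l Hp n t).
    apply Hu; try lra. now replace (s + IZR n - (t + IZR n)) with (s - t) by ring. }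
  eapply Rle_trans; [apply Hi, Hsmall|]. rewrite Rmult_0_l, Rplus_0_r, Cexp_minus.
  assert (N := Cexp_neq0 (l t)).
  replace (Cexp (l s) / Cexp (l t) - RtoC 1)%C with ((Cexp (l s) - Cexp (l t)) / Cexp (l t))%C by (field; auto).
  rewrite Cmod_div by auto. unfold Rdiv. rewrite Rmult_assoc. apply Rmult_le_compat_l; [lra|].
  rewrite Rmult_comm. apply Rmult_le_compat_r; [apply Cmod_ge_0|]. apply Rinv_le_contravar; auto.
Qed.

(** * Painleve's theorem *)

(* [Wf], the primitive of [V] in the coordinates [(s, y)] of [chart], is obtained by
   integrating along the side [s = s0 - d] and then along the translate of the curve at
   height [y].  Off [y = 0] its [y]-derivative follows by differentiating under the
   integral; continuity in [y] carries this across [y = 0]. *)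
Lemma Painleve_local (gam : R -> C) (V : C -> C) (s0 : R) : smooth_closed_curve gam -> (forall z, Ccont V z) -> holo (off gam) V ->
  exists (rho : R) (W : C -> C), 0 < rho /\ forall z, Cmod (z - gam s0) < rho -> Cdiff W z (V z).
Proof.
intros Hg HVc [V' HV].
set (v := velocity gam).
assert (Hvc : forall t, Rcont v t) by now apply v_cont.
assert (Hgc : forall t, Rcont gam t) by now apply gam_cont.
destruct (local_chart gam Hg s0) as [d [r [rho [Hd [Hr [Hrho [Hv [Hlow [Hoff Hsurj]]]]]]]]].
set (b := velocity gam s0) in *.
assert (Hb : b <> RtoC 0) by now apply v_neq0. assert (Hm := proj1 (Cmod_gt_0 _) Hb). set (m := Cmod b) in *.
destruct (v_bound gam Hg) as [M [HM HvM]].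
set (Z := chart gam s0).
set (A := fun s y : R => cI (fun t => V (Z t y) * v t)%C (s0 - d) s).
set (Wf := fun s y : R => (A s y + Ci * b * cI (fun e : R => V (Z (s0 - d)%R e)) (- r)%R y)%C).
assert (HZs : forall y t, Rcont (fun t => Z t y) t).
{ intros y t. apply cont_Cplus; [apply Hgc|apply cont_const]. }
assert (HZy : forall s e, Rcont (fun e => Z s e) e).
{ intros s e. apply cont_Cplus; [apply cont_const|]. apply cont_Cmult; [apply cont_const|apply Rcont_RtoC]. }
assert (HVZs : forall y t, Rcont (fun t => V (Z t y)) t) by (intros y t; apply (cont_comp (U := R_UniformSpace)); auto).
assert (HVZy : forall s e, Rcont (fun e : R => V (Z s e)) e) by (intros s e; apply (cont_comp (U := R_UniformSpace)); auto).
assert (HVZv : forall y t, Rcont (fun t => V (Z t y) * v t)%C t) by (intros; apply cont_Cmult; auto).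
assert (HAs : forall s y, Rabs (s - s0) < d -> Rdiff (fun s => Wf s y) s (V (Z s y) * v s)%C).
{ intros s y Hs. apply Rabs_def2 in Hs. eapply Rdiff_val.
  - apply Rdiff_plus; [|apply Rdiff_const].
    apply (cI_deriv (fun t => V (Z t y) * v t)%C (s0 - d) (s0 + d)); [lra|intros t _; auto|lra].
  - cbv beta; ring. }
assert (HAcont : forall s y, s0 - d <= s -> Rcont (fun y => A s y) y).
{ intros s y Hs.
  assert (HC : Ccont (fun w => cI (fun t => V (gam t + Ci * b * w) * v t)%C (s0 - d) s) (RtoC y)).
  { apply (cI_cont_param (fun t w => V (gam t + Ci * b * w) * v t)%C (s0 - d) s (RtoC y) 1 Hs Rlt_0_1).
    - intros t w _ _. apply cont_Cmult; auto. apply (cont_comp (U := R_UniformSpace) (fun t => gam t + Ci * b * w)%C V); auto.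
      apply cont_Cplus; [auto|apply cont_const].
    - intros t _. apply cont_Cmult.
      + refine (cont_comp (fun p : RC => gam (fst p) + Ci * b * snd p)%C V (t, RtoC y) _ (HVc _)).
        apply cont_Cplus; [exact (cont_compR fst gam (t, RtoC y) (cont_fst _ _) (Hgc t))|].
        apply cont_Cmult; [apply cont_const|apply cont_snd].
      + exact (cont_compR fst v (t, RtoC y) (cont_fst _ _) (Hvc t)). }
  exact (cont_comp (U := R_UniformSpace) RtoC _ y (Rcont_RtoC y) HC). }
(* Off [y = 0], the [y]-derivative of [V (Z t y) * v t] equals the [t]-derivative of
   [Ci * b * V (Z t y)], so it integrates to boundary terms. *)
assert (HAy : forall s y, s0 - d <= s <= s0 + d -> 0 < Rabs y <= r ->
  Rdiff (fun y => A s y) y (Ci * b * (V (Z s y) - V (Z (s0 - d)%R y)))%C).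
{ intros s y Hs Hy.
  assert (Hoffy : forall t, s0 - d <= t <= s -> off gam (Z t y)).
  { intros t Ht. apply Hoff; auto. apply Rabs_le; lra. }
  destruct (compact_uniform (fun t e => forall w, Cmod (w - Z t y) < e -> off gam w) (s0 - d) s) as [e [He Hball]].
  { intros t e e' H He w Hw. apply H; lra. }
  { intros t Ht. destruct (off_open gam Hg _ (Hoffy t Ht)) as [e [He H]].
    assert (He2 : 0 < e / 2) by lra.
    destruct (proj1 (Rcont_iff _ t) (HZs y t) _ He2) as [e' [He' H']].
    exists (Rmin (e / 2) e'). split; [apply Rmin_pos; lra|]. intros t' Ht' Htt w Hw.
    apply H. generalize (Cmod_triangle_sub w (Z t' y) (Z t y)) (H' t' (Rlt_le_trans _ _ _ Htt (Rmin_r _ _)))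
      (Rmin_l (e / 2) e'). lra. }
  set (h := e / m). assert (Hh : 0 < h) by (now apply Rdiv_lt_0_compat).
  assert (Hoffw : forall t w, s0 - d <= t <= s -> Cmod (w - RtoC y) < h -> off gam (gam t + Ci * b * w)%C).
  { intros t w Ht Hw. apply (Hball t Ht). unfold Z, chart. fold b.
    replace (gam t + Ci * b * w - (gam t + Ci * b * RtoC y))%C with (Ci * b * (w - RtoC y))%C by ring.
    rewrite !Cmod_mult, Cmod_Ci. fold m. apply (Rmult_lt_compat_l m) in Hw; auto.
    replace (m * h) with e in Hw by (unfold h; field; lra). lra. }
  assert (HD : Cdiff (fun w => cI (fun t => V (gam t + Ci * b * w) * v t)%C (s0 - d) s) (RtoC y)
     (cI (fun t => V' (gam t + Ci * b * RtoC y) * (Ci * b) * v t)%C (s0 - d) s)).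
  { apply (Cdiff_cI_param (fun t w => V (gam t + Ci * b * w) * v t)%C
      (fun t w => V' (gam t + Ci * b * w) * (Ci * b) * v t)%C (s0 - d) s (RtoC y) h (proj1 Hs) Hh).
    - intros t w Ht Hw. eapply Cdiff_val.
      + apply Cdiff_mult; [|apply Cdiff_const].
        apply (Cdiff_comp V (fun w => gam t + Ci * b * w)%C); [apply HV; auto|].
        apply Cdiff_plus; [apply Cdiff_const|]. apply Cdiff_mult; [apply Cdiff_const|apply Cdiff_id].
      + cbv beta; ring.
    - intros t w _ _. apply cont_Cmult; auto. apply (cont_comp (U := R_UniformSpace) (fun t => gam t + Ci * b * w)%C V); auto.
      apply cont_Cplus; [auto|apply cont_const].
    - intros t Ht. apply cont_Cmult.
      + apply cont_Cmult; [|apply cont_const].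
        refine (cont_comp (fun p : RC => gam (fst p) + Ci * b * snd p)%C V' (t, RtoC y) _ _).
        * apply cont_Cplus; [exact (cont_compR fst gam (t, RtoC y) (cont_fst _ _) (Hgc t))|].
          apply cont_Cmult; [apply cont_const|apply cont_snd].
        * simpl. apply HV, Hoffw; auto. now rewrite Cmod_0_sub.
      + exact (cont_compR fst v (t, RtoC y) (cont_fst _ _) (Hvc t)). }
  rewrite (cI_FTC (fun t => Ci * b * V (Z t y))%C) in HD.
  - eapply Rdiff_val; [exact (Rdiff_comp _ RtoC y _ _ HD (Rdiff_RtoC y))|]. cbv beta; ring.
  - lra.
  - intros t Ht. eapply Rdiff_val.
    + apply Rdiff_mult; [apply Rdiff_const|].
      apply (Rdiff_comp V (fun t => Z t y)); [apply HV; auto|].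
      apply Rdiff_plus; [now apply gam_diff|apply Rdiff_const].
    + cbv beta. unfold Z, chart. fold b v. ring.
  - intros t Ht. apply cont_Cmult; auto. apply cont_Cmult; [|apply cont_const].
    apply (cont_comp (U := R_UniformSpace) (fun t => gam t + Ci * b * RtoC y)%C V'); [apply HZs|].
    apply HV. now apply Hoffy. }
assert (HIy : forall s y, - r < y < r -> Rdiff (fun y => cI (fun e : R => V (Z s e)) (- r) y) y (V (Z s y))).
{ intros s y Hy. apply (cI_deriv (fun e : R => V (Z s e)) (- r) r); [lra|intros t _; auto|lra]. }
assert (HWy : forall s y, Rabs (s - s0) < d -> Rabs y < r -> Rdiff (fun y => Wf s y) y (Ci * b * V (Z s y))%C).
{ intros s y Hs Hy. apply Rabs_def2 in Hs; apply Rabs_def2 in Hy.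
  set (r' := (r + Rabs y) / 2).
  (* [D] is continuous with derivative 0 off [y = 0], hence equal to [D 0] on both sides; so [Wf]
     has the expected derivative at [y = 0] too. *)
  set (D := fun y => (Wf s y - Ci * b * cI (fun e : R => V (Z s e)) (- r)%R y)%C).
  assert (HDc : forall y, - r < y < r -> Rcont D y).
  { intros e He. apply cont_Cminus.
    - apply cont_Cplus; [apply HAcont; lra|]. apply cont_Cmult; [apply cont_const|].
      eapply Rdiff_cont, HIy; lra.
    - apply cont_Cmult; [apply cont_const|]. eapply Rdiff_cont, HIy; lra. }
  assert (HD0 : forall y, - r < y < r -> y <> 0 -> Rdiff D y (RtoC 0)).
  { intros e He He0. eapply Rdiff_val.
    - apply Rdiff_minus; [apply Rdiff_plus|].
      + apply HAy; [lra|]. split; [now apply Rabs_pos_lt|apply Rabs_le; lra].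
      + apply Rdiff_mult; [apply Rdiff_const|apply HIy; lra].
      + apply Rdiff_mult; [apply Rdiff_const|apply HIy; lra].
    - cbv beta. ring. }
  assert (HDconst : forall y, - r < y < r -> D y = D 0).
  { intros e He. destruct (Rle_dec 0 e) as [Hp|Hp].
    - apply Rdiff_zero_const; [auto|intros t Ht; apply HDc; lra|intros t Ht; apply HD0; lra].
    - symmetry. apply Rdiff_zero_const; [lra|intros t Ht; apply HDc; lra|intros t Ht; apply HD0; lra]. }
  assert (Hq : 0 < Rmin (r - y) (y + r)) by (apply Rmin_pos; lra).
  apply (is_derive_ext_loc (K := R_AbsRing) (V := C_R_NormedModule) (fun y => D 0 + Ci * b * cI (fun e : R => V (Z s e)) (- r)%R y)%C).
  - apply locally_R_iff. exists (Rmin (r - y) (y + r)). split; [exact Hq|]. intros e He.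
    assert (H1 := Rlt_le_trans _ _ _ He (Rmin_l _ _)). assert (H2 := Rlt_le_trans _ _ _ He (Rmin_r _ _)).
    apply Rabs_def2 in H1; apply Rabs_def2 in H2.
    rewrite <- (HDconst e) by lra. unfold D. change ((Wf s e - Ci * b * cI (fun e : R => V (Z s e)) (- r)%R e + Ci * b * cI (fun e : R => V (Z s e)) (- r)%R e)%C = Wf s e). ring.
  - eapply Rdiff_val.
    + apply Rdiff_plus; [apply Rdiff_const|]. apply Rdiff_mult; [apply Rdiff_const|apply HIy; lra].
    + cbv beta. ring. }
set (par := fun z => epsilon (inhabits (0, 0)) (fun p : R * R => Rabs (fst p - s0) <= d /\ Rabs (snd p) <= r /\ z = Z (fst p) (snd p))).
set (rho' := Rmin rho (m / 4 * Rmin d r)).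
assert (Hdr : 0 < Rmin d r) by (apply Rmin_pos; lra).
assert (Hrho' : 0 < rho') by (apply Rmin_pos; nra).
assert (Hpar : forall z, Cmod (z - gam s0) < rho' ->
  z = Z (fst (par z)) (snd (par z)) /\ Rabs (fst (par z) - s0) < d /\ Rabs (snd (par z)) < r).
{ intros z Hz.
  assert (Hz1 := Rlt_le_trans _ _ _ Hz (Rmin_l _ _)). assert (Hz2 := Rlt_le_trans _ _ _ Hz (Rmin_r _ _)).
  assert (HP : Rabs (fst (par z) - s0) <= d /\ Rabs (snd (par z)) <= r /\ z = Z (fst (par z)) (snd (par z))).
  { unfold par. apply (epsilon_spec (inhabits (0, 0)) (fun p : R * R => Rabs (fst p - s0) <= d /\ Rabs (snd p) <= r /\ z = Z (fst p) (snd p))).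
    destruct (Hsurj z Hz1) as [s [y H]]. now exists (s, y). }
  destruct HP as [P1 [P2 P3]]. split; auto.
  assert (L := Hlow (fst (par z)) (snd (par z)) s0 0 P1 ltac:(rewrite Rminus_diag, Rabs_R0; lra)).
  fold Z in L. rewrite <- P3 in L. replace (Z s0 0) with (gam s0) in L by (unfold Z, chart; ring).
  rewrite Rminus_0_r in L.
  assert (Q : Rabs (fst (par z) - s0) + Rabs (snd (par z)) < Rmin d r).
  { apply (Rmult_lt_reg_l (m / 4)); lra. }
  generalize (Rmin_l d r) (Rmin_r d r) (Rabs_pos (fst (par z) - s0)) (Rabs_pos (snd (par z))). lra. }
exists rho', (fun z => Wf (fst (par z)) (snd (par z))). split; auto.
intros z Hz. apply Cdiff_iff. intros eps Heps.
(* [M] and [m] bound the two partial derivatives of the chart, and [4 / m] is a Lipschitz constant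
   of its inverse. *)
set (K := (M + m) * (4 / m)). assert (HK : 0 < K) by (apply Rmult_lt_0_compat; [lra|apply Rdiv_lt_0_compat; lra]).
assert (He' : 0 < eps / K) by (now apply Rdiv_lt_0_compat).
destruct (proj1 (Ccont_iff V z) (HVc z) _ He') as [d1 [Hd1 HVz]].
assert (Hd1K : 0 < d1 / K) by (now apply Rdiv_lt_0_compat).
exists (Rmin (rho' - Cmod (z - gam s0)) (d1 / K)). split; [apply Rmin_pos; lra|].
intros w Hw. assert (Hw1 := Rlt_le_trans _ _ _ Hw (Rmin_l _ _)). assert (Hw2 := Rlt_le_trans _ _ _ Hw (Rmin_r _ _)).
destruct (Hpar z Hz) as [Ez [Hzs Hzy]].
destruct (Hpar w) as [Ew [Hws Hwy]]; [generalize (Cmod_triangle_sub w z (gam s0)); lra|].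
set (s := fst (par z)) in *. set (y := snd (par z)) in *.
set (s' := fst (par w)) in *. set (y' := snd (par w)) in *.
assert (L := Hlow s' y' s y ltac:(lra) ltac:(lra)). fold Z in L. rewrite <- Ez, <- Ew in L.
set (a1 := Rabs (s' - s)) in *. set (a2 := Rabs (y' - y)) in *.
assert (Ha1 : 0 <= a1) by apply Rabs_pos. assert (Ha2 : 0 <= a2) by apply Rabs_pos.
assert (L2 : a1 + a2 <= 4 / m * Cmod (w - z)).
{ apply (Rmult_le_reg_l (m / 4)); [lra|]. replace (m / 4 * (4 / m * Cmod (w - z))) with (Cmod (w - z)) by (field; lra). exact L. }
assert (L3 : M * a1 + m * a2 <= K * Cmod (w - z)).
{ unfold K. rewrite Rmult_assoc. apply Rle_trans with ((M + m) * (a1 + a2)); [nra|]. apply Rmult_le_compat_l; lra. }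
assert (L4 : K * Cmod (w - z) < d1).
{ apply (Rmult_lt_compat_l K) in Hw2; auto. replace (K * (d1 / K)) with d1 in Hw2 by (field; lra). lra. }
destruct (gam_lip gam Hg) as [M2 _].
assert (HZZ : forall t e, Rabs (t - s) <= a1 -> Rabs (e - y) <= a2 -> Cmod (Z t e - z) <= M * a1 + m * a2).
{ intros t e Ht He. rewrite Ez. unfold Z, chart. fold b.
  replace (gam t + Ci * b * RtoC e - (gam s + Ci * b * RtoC y))%C with
   ((gam t - gam s - RtoC 0 * RtoC (t - s)) + Ci * b * RtoC (e - y))%C by (rewrite !RtoC_minus; ring).
  eapply Rle_trans; [apply Cmod_triangle|]. rewrite !Cmod_mult, Cmod_Ci, Cmod_R. fold m. apply Rplus_le_compat.
  - eapply Rle_trans; [apply (gam_lin gam Hg t s (RtoC 0) M)|].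
    + intros u _. replace (velocity gam u - RtoC 0)%C with (velocity gam u) by ring. apply HvM.
    + apply Rmult_le_compat_l; lra.
  - rewrite Rmult_1_l. apply Rmult_le_compat_l; lra. }
assert (HVV : forall t e, Rabs (t - s) <= a1 -> Rabs (e - y) <= a2 -> Cmod (V (Z t e) - V z) <= eps / K).
{ intros t e Ht He. apply Rlt_le, HVz. specialize (HZZ t e Ht He). lra. }
(* After subtraction of [V z * gam] the derivative along this leg is [(V (Z t y') - V z) * v t],
   which is small; the other leg is treated likewise. *)
assert (S1 : Cmod ((Wf s' y' - V z * gam s') - (Wf s y' - V z * gam s) - RtoC 0 * RtoC (s' - s)) <= eps / K * M * Rabs (s' - s)).
{ apply (Rdiff_mvt_abs (fun t => Wf t y' - V z * gam t)%C (fun t => V (Z t y') * v t - V z * v t)%C).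
  intros t Ht. assert (Hts := between_abs _ _ _ Ht). fold a1 in Hts. split.
  - eapply Rdiff_val.
    + apply Rdiff_minus; [apply HAs|].
      * apply (between_center s s'); auto.
      * apply Rdiff_mult; [apply Rdiff_const|now apply gam_diff].
    + cbv beta. fold v. ring.
  - replace (V (Z t y') * v t - V z * v t - RtoC 0)%C with ((V (Z t y') - V z) * v t)%C by ring.
    rewrite Cmod_mult. apply Rmult_le_compat; auto using Cmod_ge_0.
    apply HVV; auto. apply Rle_refl. }
assert (S2 : Cmod ((Wf s y' - Ci * b * V z * RtoC y') - (Wf s y - Ci * b * V z * RtoC y) - RtoC 0 * RtoC (y' - y)) <= eps / K * m * Rabs (y' - y)).
{ apply (Rdiff_mvt_abs (fun e => Wf s e - Ci * b * V z * RtoC e)%C (fun e => Ci * b * V (Z s e) - Ci * b * V z)%C).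
  intros t Ht. assert (Hts := between_abs _ _ _ Ht). fold a2 in Hts. split.
  - eapply Rdiff_val.
    + apply Rdiff_minus; [apply HWy; auto|].
      * replace t with (t - 0) by ring. apply (between_center y y'); auto; now rewrite Rminus_0_r.
      * apply Rdiff_mult; [apply Rdiff_const|apply Rdiff_RtoC].
    + cbv beta. ring.
  - replace (Ci * b * V (Z s t) - Ci * b * V z - RtoC 0)%C with ((V (Z s t) - V z) * (Ci * b))%C by ring.
    rewrite !Cmod_mult, Cmod_Ci, Rmult_1_l. fold m. apply Rmult_le_compat_r; [lra|].
    apply HVV; auto. rewrite Rminus_diag, Rabs_R0. auto. }
replace (Wf s' y' - Wf s y - V z * (w - z))%C with
  (((Wf s' y' - V z * gam s') - (Wf s y' - V z * gam s) - RtoC 0 * RtoC (s' - s)) +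
   ((Wf s y' - Ci * b * V z * RtoC y') - (Wf s y - Ci * b * V z * RtoC y) - RtoC 0 * RtoC (y' - y)))%C.
- eapply Rle_trans; [apply Cmod_triangle|]. fold a1 in S1. fold a2 in S2.
  apply Rle_trans with (eps / K * (M * a1 + m * a2)); [lra|].
  apply Rle_trans with (eps / K * (K * Cmod (w - z))); [apply Rmult_le_compat_l; lra|].
  right; field; lra.
- replace (w - z)%C with ((gam s' - gam s) + Ci * b * (RtoC y' - RtoC y))%C; [ring|].
  rewrite Ez, Ew. unfold Z, chart. fold b. ring.
Qed.

(** Near a point of the curve [V] is the derivative of a holomorphic function, so [holo_deriv]
    applies to it. *)
Lemma Painleve (gam : R -> C) (V : C -> C) : smooth_closed_curve gam -> (forall z, Ccont V z) -> holo (off gam) V -> holo everywhere V.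
Proof.
intros Hg Hc HV. apply holo_loc. intros z _.
destruct (classic (off gam z)) as [Hz|Hz].
- destruct (off_open gam Hg z Hz) as [d [Hd H]]. destruct HV as [V' HV].
  exists d; split; auto. exists V'. intros w Hw. auto.
- apply not_all_not_ex in Hz. destruct Hz as [s0 <-].
  destruct (Painleve_local gam V s0 Hg Hc HV) as [rho [W [Hr HW]]].
  destruct (holo_deriv (fun z => Cmod (z - gam s0) < rho) W V) as [V1 HV1].
  + intros w Hw. exists (rho - Cmod (w - gam s0)). split; [lra|]. intros u Hu.
    generalize (Cmod_triangle_sub u w (gam s0)). lra.
  + intros w Hw. split; auto.
  + exists rho; split; auto. exists V1. auto.
Qed.

(** * Boundary limits *)

Definition Clim (U : C -> Prop) (x : C) (f : C -> C) (l : C) : Prop :=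
  forall eps, 0 < eps -> exists d, 0 < d /\ forall z, U z -> Cmod (z - x) < d -> Cmod (f z - l) < eps.

Definition adherent (U : C -> Prop) (x : C) : Prop :=
  forall eps, 0 < eps -> exists z, U z /\ Cmod (z - x) < eps.

Lemma Clim_unique U x f l l' : adherent U x -> Clim U x f l -> Clim U x f l' -> l = l'.
Proof.
intros Ha H H'. apply Cmod_lt_all. intros eps He. assert (He2 : 0 < eps / 2) by lra.
destruct (H _ He2) as [d [Hd H1]]. destruct (H' _ He2) as [d' [Hd' H1']].
destruct (Ha (Rmin d d')) as [z [Wz Hz]]; [now apply Rmin_pos|].
specialize (H1 z Wz (Rlt_le_trans _ _ _ Hz (Rmin_l _ _))).
specialize (H1' z Wz (Rlt_le_trans _ _ _ Hz (Rmin_r _ _))).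
rewrite Cmod_sub_sym in H1. generalize (Cmod_triangle_sub l (f z) l'). lra.
Qed.

Lemma Clim_filterlim U x f l : Clim U x f l <->
  filterlim f (within U (locally (T := C_UniformSpace) x)) (locally (T := C_UniformSpace) l).
Proof.
rewrite (filterlim_C_iff (within U (locally (T := C_UniformSpace) x))).
unfold within. split; intros H eps He.
- apply locally_C_iff. destruct (H eps He) as [d [Hd H1]]. exists d; split; auto.
- generalize (H eps He); intros H1. apply locally_C_iff in H1. destruct H1 as [d [Hd H1]]. exists d; split; auto.
Qed.

Lemma Clim_cont U x (f : C -> C) : Ccont f x -> Clim U x f (f x).
Proof.
intros H eps He. destruct (proj1 (Ccont_iff f x) H eps He) as [d [Hd H1]]. exists d; split; auto.
Qed.

Lemma Clim_comp U x f l (h : C -> C) : Ccont h l -> Clim U x f l -> Clim U x (fun z => h (f z)) (h l).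
Proof.
intros Hh H eps He. destruct (proj1 (Ccont_iff h l) Hh eps He) as [d [Hd H1]].
destruct (H d Hd) as [d' [Hd' H2]]. exists d'; split; auto.
Qed.

Lemma Clim_plus U x f g l m : Clim U x f l -> Clim U x g m -> Clim U x (fun z => f z + g z)%C (l + m)%C.
Proof.
intros Hf Hg eps He. assert (He2 : 0 < eps / 2) by lra.
destruct (Hf _ He2) as [d [Hd H1]]. destruct (Hg _ He2) as [d' [Hd' H2]].
exists (Rmin d d'). split; [now apply Rmin_pos|]. intros z Uz Hz.
specialize (H1 z Uz (Rlt_le_trans _ _ _ Hz (Rmin_l _ _))).
specialize (H2 z Uz (Rlt_le_trans _ _ _ Hz (Rmin_r _ _))).
replace (f z + g z - (l + m))%C with ((f z - l) + (g z - m))%C by ring.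
eapply Rle_lt_trans; [apply Cmod_triangle|lra].
Qed.

Lemma Clim_mult U x f g l m : Clim U x f l -> Clim U x g m -> Clim U x (fun z => f z * g z)%C (l * m)%C.
Proof.
intros Hf Hg eps He.
set (K := Cmod l + Cmod m + 1). assert (HK : 1 <= K) by (unfold K; generalize (Cmod_ge_0 l) (Cmod_ge_0 m); lra).
set (e := Rmin 1 (eps / (2 * K))). assert (He0 : 0 < e) by (apply Rmin_pos; [lra|apply Rdiv_lt_0_compat; lra]).
destruct (Hf _ He0) as [d [Hd H1]]. destruct (Hg _ He0) as [d' [Hd' H2]].
exists (Rmin d d'). split; [now apply Rmin_pos|]. intros z Uz Hz.
specialize (H1 z Uz (Rlt_le_trans _ _ _ Hz (Rmin_l _ _))).
specialize (H2 z Uz (Rlt_le_trans _ _ _ Hz (Rmin_r _ _))).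
replace (f z * g z - l * m)%C with ((f z - l) * (g z - m) + (f z - l) * m + l * (g z - m))%C by ring.
assert (E1 : e <= 1) by apply Rmin_l. assert (E2 : e <= eps / (2 * K)) by apply Rmin_r.
eapply Rle_lt_trans; [apply Cmod_triangle|]. eapply Rle_lt_trans; [apply Rplus_le_compat_r, Cmod_triangle|].
rewrite !Cmod_mult.
assert (E3 : e * K <= eps / 2).
{ apply (Rmult_le_compat_r K) in E2; [|lra]. replace (eps / (2 * K) * K) with (eps / 2) in E2 by (field; lra). auto. }
generalize (Cmod_ge_0 l) (Cmod_ge_0 m) (Cmod_ge_0 (f z - l)) (Cmod_ge_0 (g z - m)). intros.
assert (Cmod (f z - l) * Cmod (g z - m) <= e * 1) by (apply Rmult_le_compat; lra).
assert (Cmod (f z - l) * Cmod m <= e * Cmod m) by (apply Rmult_le_compat_r; lra).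
assert (Cmod l * Cmod (g z - m) <= Cmod l * e) by (apply Rmult_le_compat_l; lra).
unfold K in E3. lra.
Qed.

Lemma Ccont_inv (l : C) : l <> RtoC 0 -> Ccont (fun z => / z)%C l.
Proof. intros H. apply (cont_Cinv (U := C_UniformSpace) (fun z => z)); [apply Ccont_id|auto]. Qed.

Lemma Clim_div U x f g l m : m <> RtoC 0 -> Clim U x f l -> Clim U x g m -> Clim U x (fun z => f z / g z)%C (l / m)%C.
Proof.
intros Hm Hf Hg. apply Clim_mult; auto. apply (Clim_comp U x g m (fun z => / z)%C); auto. now apply Ccont_inv.
Qed.

Lemma Clim_minus U x f g l m : Clim U x f l -> Clim U x g m -> Clim U x (fun z => f z - g z)%C (l - m)%C.
Proof.
intros Hf Hg. apply Clim_plus; auto. apply (Clim_comp U x g m Copp); auto.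
apply (cont_Copp (U := C_UniformSpace) (fun z => z)), Ccont_id.
Qed.

Lemma Clim_ext (U : C -> Prop) x f g l : (forall z, U z -> f z = g z) -> Clim U x f l -> Clim U x g l.
Proof.
intros E H eps He. destruct (H eps He) as [d [Hd H1]]. exists d; split; auto.
intros z Uz Hz. rewrite <- E; auto.
Qed.

Lemma Clim_sub (U V : C -> Prop) x f l : (forall z, U z -> V z) -> Clim V x f l -> Clim U x f l.
Proof. intros HUV H eps He. destruct (H eps He) as [d [Hd H1]]. exists d; split; auto. Qed.

Lemma Clim_or (U V : C -> Prop) x f l : Clim U x f l -> Clim V x f l -> Clim (fun z => U z \/ V z) x f l.
Proof.
intros HU HV eps He. destruct (HU eps He) as [d [Hd H1]]. destruct (HV eps He) as [d' [Hd' H2]].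
exists (Rmin d d'). split; [now apply Rmin_pos|]. intros z [Uz|Vz] Hz.
- apply H1; auto. apply (Rlt_le_trans _ _ _ Hz), Rmin_l.
- apply H2; auto. apply (Rlt_le_trans _ _ _ Hz), Rmin_r.
Qed.

(** On [L] the limits have to be compared among themselves: [l z] is approximated by a value of [f]
    at a point of [U] so close to [z] that it is also close to [x]. *)
Lemma extend_by_limits (U L : C -> Prop) (f l : C -> C) :
  (forall x, U x -> exists d, 0 < d /\ forall w, Cmod (w - x) < d -> U w) ->
  (forall x, U x -> Ccont f x) ->
  (forall x, L x -> ~ U x) -> (forall x, L x -> adherent U x) -> (forall x, L x -> Clim U x f (l x)) ->
  forall x, U x \/ L x ->
  Clim (fun z => U z \/ L z) x (fun z => if excluded_middle_informative (U z) then f z else l z)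
    (if excluded_middle_informative (U x) then f x else l x).
Proof.
intros HU Hc HLU Ha HL x Hx eps He.
destruct (excluded_middle_informative (U x)) as [Ux|Ux].
- destruct (HU x Ux) as [d [Hd H]]. destruct (proj1 (Ccont_iff f x) (Hc x Ux) eps He) as [d' [Hd' H']].
  exists (Rmin d d'). split; [now apply Rmin_pos|]. intros z _ Hz.
  destruct (excluded_middle_informative (U z)) as [Uz|Uz].
  + apply H', (Rlt_le_trans _ _ _ Hz), Rmin_r.
  + exfalso. apply Uz, H, (Rlt_le_trans _ _ _ Hz), Rmin_l.
- assert (Lx : L x) by tauto. assert (He2 : 0 < eps / 2) by lra.
  destruct (HL x Lx _ He2) as [d [Hd H]]. exists d. split; auto. intros z Hz Hzx.
  destruct (excluded_middle_informative (U z)) as [Uz|Uz].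
  + specialize (H z Uz Hzx). lra.
  + assert (Lz : L z) by tauto.
    destruct (HL z Lz _ He2) as [d' [Hd' H']].
    destruct (Ha z Lz (Rmin d' (d - Cmod (z - x)))) as [w [Uw Hw]]; [apply Rmin_pos; lra|].
    assert (Hw1 := Rlt_le_trans _ _ _ Hw (Rmin_l _ _)). assert (Hw2 := Rlt_le_trans _ _ _ Hw (Rmin_r _ _)).
    specialize (H' w Uw Hw1). specialize (H w Uw ltac:(generalize (Cmod_triangle_sub w z x); lra)).
    rewrite Cmod_sub_sym in H'. generalize (Cmod_triangle_sub (l z) (f w) (l x)). lra.
Qed.

(** * Integer powers and the growth of polynomials *)

Lemma Cexp_pow w n : Cexp (RtoC (INR n) * w) = (Cexp w ^ n)%C.
Proof.
induction n as [|n IH]; [simpl; rewrite Cmult_0_l; apply Cexp_0|].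
rewrite Cpow_S, <- IH, <- Cexp_plus, S_INR, RtoC_plus. f_equal; ring.
Qed.

Lemma Cexp_Czpow w a : Cexp (RtoC (IZR a) * w) = Czpow (Cexp w) a.
Proof.
unfold Czpow. destruct (Z.leb_spec 0 a).
- rewrite <- Cexp_pow, INR_IZR_INZ, Z2Nat.id by lia. reflexivity.
- rewrite <- Cexp_pow, INR_IZR_INZ, Z2Nat.id by lia. rewrite opp_IZR, RtoC_opp.
  assert (N := Cexp_neq0 (- RtoC (IZR a) * w)).
  assert (H1 := Cexp_opp (- RtoC (IZR a) * w)). replace (- (- RtoC (IZR a) * w))%C with (RtoC (IZR a) * w)%C in H1 by ring.
  replace (Cexp (RtoC (IZR a) * w)) with (/ Cexp (- RtoC (IZR a) * w) * (Cexp (- RtoC (IZR a) * w) * Cexp (RtoC (IZR a) * w)))%C by (field; auto).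
  rewrite H1; ring.
Qed.

Lemma Cexp_conj w : Cexp (Cconj w) = Cconj (Cexp w).
Proof. destruct w as [x y]. unfold Cexp, Cconj; simpl. rewrite cos_neg, sin_neg. f_equal; ring. Qed.

Lemma Czpow_neq0 z a : z <> RtoC 0 -> Czpow z a <> RtoC 0.
Proof.
intros Hz. unfold Czpow. destruct (0 <=? a)%Z; [now apply Cpow_nz|]. now apply Cinv_neq0, Cpow_nz.
Qed.

Lemma Czpow_0 z : Czpow z 0 = RtoC 1.
Proof. reflexivity. Qed.

Lemma Ccont_Czpow z a : (a <> 0%Z -> z <> RtoC 0) -> Ccont (fun w => Czpow w a) z.
Proof.
intros Hz. unfold Czpow. destruct (Z.leb_spec 0 a).
- apply (cont_Cpow (U := C_UniformSpace) (fun w => w)), Ccont_id.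
- apply (cont_Cinv (U := C_UniformSpace) (fun w => w ^ _)%C); [apply (cont_Cpow (U := C_UniformSpace) (fun w => w)), Ccont_id|].
  apply Cpow_nz, Hz; lia.
Qed.

Lemma holo_Czpow (U : C -> Prop) a : (forall z, U z -> a <> 0%Z -> z <> RtoC 0) -> holo U (fun w => Czpow w a).
Proof.
intros Hz. unfold Czpow. destruct (Z.leb_spec 0 a).
- apply (holo_pow U (fun w => w)), holo_id.
- apply (holo_inv U (fun w => w ^ _)%C); [apply (holo_pow U (fun w => w)), holo_id|].
  intros z Uz. apply Cpow_nz, Hz; auto; lia.
Qed.

Lemma Cmod_Czpow_pos z a : (0 <= a)%Z -> Cmod (Czpow z a) = Cmod z ^ Z.to_nat a.
Proof. intros Ha. unfold Czpow. destruct (Z.leb_spec 0 a); [apply Cmod_pow|lia]. Qed.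

Lemma Cmod_Czpow_neg z a : (a <= 0)%Z -> z <> RtoC 0 -> Cmod (Czpow z a) = / Cmod z ^ Z.to_nat (- a).
Proof.
intros Ha Hz. unfold Czpow. destruct (Z.leb_spec 0 a).
- replace a with 0%Z by lia. simpl. rewrite Cmod_1. field.
- rewrite Cmod_inv, Cmod_pow by (now apply Cpow_nz). reflexivity.
Qed.

Lemma Cpoly_growth l : forall eps, 0 < eps -> exists M, forall z, M < Cmod z -> Cmod (Cpoly l z) <= eps * Cmod z ^ length l.
Proof.
induction l as [|a l IH]; intros eps He.
- exists 0. intros z _. simpl. rewrite Cmod_0. lra.
- destruct (IH (eps / 2) ltac:(lra)) as [M HM].
  exists (Rmax M (Rmax 1 (2 * Cmod a / eps))). intros z Hz.
  assert (H1 := Rle_lt_trans _ _ _ (Rmax_l _ _) Hz). assert (H2 := Rle_lt_trans _ _ _ (Rmax_r _ _) Hz).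
  assert (H3 := Rle_lt_trans _ _ _ (Rmax_l _ _) H2). assert (H4 := Rle_lt_trans _ _ _ (Rmax_r _ _) H2).
  specialize (HM z H1).
  assert (H5 : 2 * Cmod a < eps * Cmod z).
  { apply (Rmult_lt_compat_r eps) in H4; auto. replace (2 * Cmod a / eps * eps) with (2 * Cmod a) in H4 by (field; lra). lra. }
  simpl. eapply Rle_trans; [apply Cmod_triangle|]. rewrite Cmod_mult.
  assert (H6 : 1 <= Cmod z ^ length l) by (apply pow_R1_Rle; lra).
  assert (H7 : eps * Cmod z * 1 <= eps * Cmod z * Cmod z ^ length l) by (apply Rmult_le_compat_l; nra).
  assert (H8 : Cmod z * Cmod (Cpoly l z) <= Cmod z * (eps / 2 * Cmod z ^ length l)) by (apply Rmult_le_compat_l; lra).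
  lra.
Qed.

Lemma cauchy_int_eq gam f z : cauchy_int gam f z = cauchyT gam (fun t => f (gam t)) z.
Proof.
unfold cauchy_int, cauchyT, cint, kernel. f_equal. apply (cI_ext _ _ 0 1 Rle_0_1).
intros t _. simpl. rewrite Cmult_1_r. unfold Cdiv. ring.
Qed.

(** * The scalar Riemann problem *)

Section Transform.
Variables (Op : R2 -> Prop) (gam : R -> C).
Hypotheses (Hopen : open Op) (Hbd : bounded_set Op) (HL : smooth_boundary_param Op gam).
Notation In := (onC Op).
Notation Ext := (onC (exterior Op)).
Let Hg : smooth_closed_curve gam := proj1 HL.

Lemma off_cases z : off gam z <-> In z \/ Ext z.
Proof.
rewrite (Ext_iff Op gam HL). split.
- intros Hz. destruct (classic (In z)); tauto.
- intros [H|H]; [now apply (In_off Op gam Hopen HL)|tauto].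
Qed.

Lemma Ext_open z : Ext z -> exists d, 0 < d /\ forall w, Cmod (w - z) < d -> Ext w.
Proof.
intros Hz. assert (Ho : off gam z) by (apply off_cases; auto).
destruct (Ext_locconst Op gam Hopen HL z Ho) as [d [Hd H]]. exists d; split; auto.
intros w Hw. now apply H.
Qed.

Lemma In_adherent s : adherent In (gam s).
Proof. intros eps He. now apply (In_adh Op gam HL). Qed.

Lemma Ext_adherent s : adherent Ext (gam s).
Proof. intros eps He. now apply (Ext_adh Op gam Hopen HL). Qed.

Lemma off_adherent s : adherent (off gam) (gam s).
Proof.
intros eps He. destruct (In_adherent s eps He) as [z [Hz H]]. exists z; split; auto. apply off_cases; auto.
Qed.

Lemma off_wind z : off gam z -> Cmod (wind gam z) <= 1.
Proof.
intros Hz. apply off_cases in Hz. destruct Hz as [Hz|Hz].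
- rewrite (wind_In Op gam Hopen HL z Hz), Cmod_1. lra.
- rewrite (wind_Ext Op gam Hopen Hbd HL z Hz), Cmod_0. lra.
Qed.

Section Density.
Variable phi : R -> C.
Hypotheses (Hper : forall t, phi (t + 1) = phi t) (Hh : holder phi).
Let bv := bval gam phi (off gam).
Let Hc := holder_cont phi Hh.

Let bv_spec s : is_bv gam phi (off gam) s (bv s).
Proof. apply (bval_spec gam Hg phi Hper Hc Hh (off gam) (fun z H => H) off_wind off_adherent). Qed.

(** With [cauchyT_Ext], these are the Sokhotski-Plemelj formulas: [bv] is the limit of the integral
    minus [phi] times the winding number, which is 1 inside and 0 outside. *)
Lemma cauchyT_In s : Clim In (gam s) (cauchyT gam phi) (phi s + bv s)%C.
Proof.
intros eps He. destruct (bv_spec s eps He) as [d [Hd H]]. exists d; split; auto.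
intros z Iz Hz. specialize (H z ltac:(apply off_cases; auto) Hz). unfold cauchyT_rest in H.
rewrite (wind_In Op gam Hopen HL z Iz) in H.
now replace (cauchyT gam phi z - (phi s + bv s))%C with (cauchyT gam phi z - phi s * RtoC 1 - bv s)%C by ring.
Qed.

Lemma cauchyT_Ext s : Clim Ext (gam s) (cauchyT gam phi) (bv s).
Proof.
intros eps He. destruct (bv_spec s eps He) as [d [Hd H]]. exists d; split; auto.
intros z Iz Hz. specialize (H z ltac:(apply off_cases; auto) Hz). unfold cauchyT_rest in H.
rewrite (wind_Ext Op gam Hopen Hbd HL z Iz) in H.
now replace (cauchyT gam phi z - bv s)%C with (cauchyT gam phi z - phi s * RtoC 0 - bv s)%C by ring.
Qed.

Lemma bv_holder : holder bv.
Proof. apply (bval_holder gam Hg phi Hper Hc Hh (off gam) (fun z H => H) off_wind off_adherent). Qed.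

Lemma bv_per s : bv (s + 1) = bv s.
Proof. apply (bval_per gam Hg phi Hper Hc Hh (off gam) (fun z H => H) off_wind off_adherent). Qed.

Let Hpv : contI (fun t => phi t * velocity gam t)%C 0 1.
Proof. intros t _. apply cont_Cmult; [apply Hc|now apply v_cont]. Qed.

Lemma cauchyT_holo : holo (off gam) (cauchyT gam phi).
Proof.
apply holo_mult; [apply holo_const|]. apply kernel_holo; auto.
intros t _. now apply gam_cont.
Qed.

Lemma cauchyT_far eps : 0 < eps -> exists M, forall z, M < Cmod z -> Cmod (cauchyT gam phi z) < eps.
Proof.
intros He. destruct (kernel_far Op gam HL _ Hpv eps He) as [M H]. exists M. intros z Hz.
unfold cauchyT. rewrite Cmod_mult, Cmod_inv, Cmod_twopii by apply twopii_neq0.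
specialize (H z Hz). assert (HP := PI2_3_2). unfold PI2 in HP.
assert (/ (2 * PI) < 1) by (rewrite <- Rinv_1; apply Rinv_lt_contravar; lra).
assert (0 < / (2 * PI)) by (apply Rinv_0_lt_compat; lra).
generalize (Cmod_ge_0 (kernel (fun s => phi s * velocity gam s)%C gam 1 z)). intros. nra.
Qed.

End Density.

(** This is [z / (tau - z) = tau / (tau - z) - 1] under the integral sign. *)
Lemma cauchyT_moment (phi : R -> C) (z : C) : (forall t, Rcont phi t) -> off gam z ->
  (z * cauchyT gam phi z)%C = (cauchyT gam (fun t => phi t * gam t) z -
     / (RtoC (2 * PI) * Ci) * cI (fun t => phi t * velocity gam t) 0 1)%C.
Proof.
intros Hc Hz. unfold cauchyT.
assert (Hv : forall t, Rcont (velocity gam) t) by now apply v_cont.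
assert (Hgc : forall t, Rcont gam t) by now apply gam_cont.
assert (Hk : forall psi, (forall t, Rcont psi t) -> contI (fun t => psi t / (gam t - z) ^ 1)%C 0 1).
{ intros psi Hp. apply kernel_contI; intros t _; auto. }
assert (H1 : forall t, Rcont (fun s => phi s * velocity gam s)%C t) by (intros; apply cont_Cmult; auto).
assert (H2 : forall t, Rcont (fun s => phi s * gam s * velocity gam s)%C t) by (intros t; apply cont_Cmult; [apply cont_Cmult|]; auto).
replace (z * (/ (RtoC (2 * PI) * Ci) * kernel (fun s => phi s * velocity gam s)%C gam 1 z))%C with
  (/ (RtoC (2 * PI) * Ci) * (z * kernel (fun s => phi s * velocity gam s)%C gam 1 z))%C by ring.
replace (z * kernel (fun s => phi s * velocity gam s)%C gam 1 z)%C with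
  (kernel (fun s => phi s * gam s * velocity gam s)%C gam 1 z - cI (fun t => phi t * velocity gam t) 0 1)%C; [ring|].
unfold kernel. rewrite <- cI_scal by (auto; lra). rewrite <- cI_minus; [|lra| |].
- apply cI_ext; [lra|]. intros t _. assert (N := Csub_neq0 _ _ (Hz t)). simpl. field; auto.
- now apply Hk.
- intros t _; auto.
Qed.

(** Each vanishing moment lets one factor [z] pass under the integral as [tau]; the result is again
    a Cauchy integral, to which decay at infinity applies. *)
Lemma cauchyT_moments n : forall phi : R -> C, (forall t, Rcont phi t) ->
  (forall k, (k < n)%nat -> cI (fun t => phi t * gam t ^ k * velocity gam t)%C 0 1 = RtoC 0) ->
  forall z, off gam z -> (z ^ n * cauchyT gam phi z)%C = cauchyT gam (fun t => phi t * gam t ^ n)%C z.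
Proof.
induction n as [|n IH]; intros phi Hc Hm z Hz.
- simpl. rewrite Cmult_1_l. unfold cauchyT, kernel. f_equal. apply cI_ext; [lra|]. intros t _. now rewrite Cmult_1_r.
- rewrite Cpow_S. replace (z * z ^ n * cauchyT gam phi z)%C with (z * (z ^ n * cauchyT gam phi z))%C by ring.
  rewrite IH; auto.
  rewrite cauchyT_moment; auto.
  + rewrite Hm by lia. rewrite Cmult_0_r.
    transitivity (cauchyT gam (fun t : R => phi t * gam t ^ n * gam t)%C z); [ring|].
    f_equal. apply functional_extensionality. intros t. rewrite Cpow_S. ring.
  + intros t. apply cont_Cmult; auto. apply cont_Cpow. now apply gam_cont.
Qed.

End Transform.

(** * The canonical function [X] and its boundary values *)

Section Scalar.
Variables (Op : R2 -> Prop) (gam : R -> C) (G : R2 -> Cl).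
Hypotheses (Hopen : open Op) (Hbd : bounded_set Op) (HL : smooth_boundary_param Op gam).
Notation In := (onC Op).
Notation Ext := (onC (exterior Op)).
Let Hg : smooth_closed_curve gam := proj1 HL.
Let hG := hat (fun x => even_part (G x)).
Let a := aleph gam G.
Let h := fun t => Cconj (hG (gam t)).
Hypotheses (HhG : holder (fun t => hG (gam t))) (HnG : forall t, hG (gam t) <> RtoC 0)
  (Horig : a <> 0%Z -> In (RtoC 0)).

Lemma per_gam (f : C -> C) t : f (gam (t + 1)) = f (gam t).
Proof. now rewrite (gam_per gam Hg). Qed.

Lemma gam_neq0 : a <> 0%Z -> forall t, gam t <> RtoC 0.
Proof. intros Ha. now apply (In_off Op gam Hopen HL), Horig. Qed.

Let hl := fun tau => (Czpow tau a * Cconj (hG tau))%C.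

Lemma hl_neq0 t : hl (gam t) <> RtoC 0.
Proof.
unfold hl. apply Cmult_neq_0.
- destruct (Z.eq_dec a 0) as [E|E].
  + rewrite E, Czpow_0. intros E1. apply RtoC_inj in E1. lra.
  + apply Czpow_neq0, gam_neq0, E.
- intros E. apply (HnG t). apply (f_equal Cmod) in E. rewrite Cmod_conj, Cmod_0 in E. now apply Cmod_eq_0.
Qed.

Lemma gam_bounded : Cbounded gam.
Proof. now apply gam_bound. Qed.

Lemma bounded_per (f : R -> C) : (forall t, f (t + 1) = f t) -> holder f -> Cbounded f.
Proof. intros Hp Hh. apply periodic_bounded; auto. now apply holder_cont. Qed.

Lemma holder_gam : holder gam.
Proof. destruct (gam_lip gam Hg) as [M [HM H]]. now apply (holder_lip gam M). Qed.

Lemma holder_gam_pow n : holder (fun t => gam t ^ n)%C.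
Proof.
induction n as [|n IH]; [apply (holder_const (RtoC 1))|].
apply (holder_mult gam (fun t => gam t ^ n)%C); auto.
- apply gam_bounded.
- apply bounded_per; auto. intros t. apply (per_gam (fun z => z ^ n)%C).
- apply holder_gam.
Qed.

Lemma holder_inv_per (f : R -> C) : (forall t, f (t + 1) = f t) -> (forall t, f t <> RtoC 0) -> holder f ->
  holder (fun t => / f t)%C.
Proof.
intros Hp Hn Hh. destruct (nonzero_lower f Hp (holder_cont f Hh) Hn) as [m [Hm H]].
now apply (holder_inv f m).
Qed.

Lemma holder_gam_Czpow : holder (fun t => Czpow (gam t) a).
Proof.
unfold Czpow. destruct (Z.leb_spec 0 a); [apply holder_gam_pow|].
apply (holder_inv_per (fun t => gam t ^ Z.to_nat (- a))%C).
- intros t. apply (per_gam (fun z => z ^ _)%C).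
- intros t. apply Cpow_nz, gam_neq0. lia.
- apply holder_gam_pow.
Qed.

Lemma h_holder : holder h.
Proof. now apply holder_conj. Qed.

Lemma hl_holder : holder (fun t => hl (gam t)).
Proof.
apply (holder_mult (fun t => Czpow (gam t) a) h).
- apply bounded_per; [|apply holder_gam_Czpow]. intros t; apply (per_gam (fun z => Czpow z a)).
- apply bounded_per; [|apply h_holder]. intros t; apply (per_gam (fun z => Cconj (hG z))).
- apply holder_gam_Czpow.
- apply h_holder.
Qed.

(** The curve winds once around the origin when [a <> 0], so [tau ^ a] has index [a]; conjugation
    turns the index [a] of [hG] into [- a]. *)
Lemma hl_index : Ind gam hl = 0%Z.
Proof.
assert (Hcl := gam_closed gam Hg).
destruct (lift_log (fun t => hG (gam t)) 0 1 Rlt_0_1 (holder_cont _ HhG) HnG) as [lG [HlG1 HlG2]].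
assert (IG := Ind_log gam hG lG Hcl (fun t _ => HlG1 t) HlG2).
change (Ind gam hG) with a in IG.
(* [lT] is a logarithm of [gam] and occurs only with the factor [a]; for [a = 0], when the curve may
   pass through the origin, it is set to 0. *)
assert (HT : exists lT : R -> C, (forall t, Rcont lT t) /\ (forall t, 0 <= t <= 1 -> Cexp (RtoC (IZR a) * lT t) = Czpow (gam t) a) /\
  (RtoC (IZR a) * (lT 1 - lT 0))%C = (RtoC (IZR a) * (RtoC (2 * PI) * Ci))%C).
{ destruct (Z.eq_dec a 0) as [E|E].
  - exists (fun _ => RtoC 0). split; [intros; apply cont_const|]. rewrite E. split.
    + intros t _. rewrite Cmult_0_l, Czpow_0. apply Cexp_0.
    + rewrite !Cmult_0_l. reflexivity.
  - assert (Hn0 : forall t, (gam t - RtoC 0)%C <> RtoC 0) by (intros t; apply Csub_neq0, gam_neq0, E).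
    destruct (lift_log (fun t => gam t - RtoC 0)%C 0 1 Rlt_0_1) as [lT [H1 H2]]; auto.
    { intros t. apply cont_Cminus; [now apply gam_cont|apply cont_const]. }
    exists lT. split; auto. split.
    + intros t Ht. rewrite Cexp_Czpow, H2 by auto. f_equal; ring.
    + rewrite (Ind_log gam (fun tau => tau - RtoC 0)%C lT Hcl (fun t _ => H1 t) H2).
      assert (Hind := proj2 (proj2 HL)). rewrite (Hind (RtoC 0) (Horig E)). ring. }
destruct HT as [lT [HT1 [HT2 HT3]]].
assert (HI := Ind_log gam hl (fun t => RtoC (IZR a) * lT t + Cconj (lG t))%C Hcl).
assert (E0 : (RtoC (IZR a) * lT 1 + Cconj (lG 1) - (RtoC (IZR a) * lT 0 + Cconj (lG 0)))%C = RtoC 0).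
{ replace (RtoC (IZR a) * lT 1 + Cconj (lG 1) - (RtoC (IZR a) * lT 0 + Cconj (lG 0)))%C with
   (RtoC (IZR a) * (lT 1 - lT 0) + Cconj (lG 1 - lG 0))%C by (apply C_eq; simpl; ring).
  rewrite HT3, IG. apply C_eq; simpl; ring. }
rewrite HI in E0.
- assert (E1 : RtoC (IZR (Ind gam hl)) = RtoC 0).
  { replace (RtoC (IZR (Ind gam hl))) with (/ (RtoC (2 * PI) * Ci) * (RtoC (2 * PI) * Ci * RtoC (IZR (Ind gam hl))))%C.
    - rewrite E0; ring.
    - rewrite Cmult_assoc, Cinv_l by apply twopii_neq0. ring. }
  apply RtoC_inj in E1. now apply eq_IZR.
- intros t _. apply cont_Cplus; [apply cont_Cmult; [apply cont_const|auto]|]. apply cont_Cconj; auto.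
- intros t Ht. rewrite Cexp_plus, HT2, Cexp_conj, HlG2 by auto. reflexivity.
Qed.

Let L := onC (boundary Op).
Let lam := log_branch L hl.

Lemma lam_spec : continuous_on L lam /\ forall tau, L tau -> Cexp (lam tau) = hl tau.
Proof.
apply (log_branch_ex gam Hg L hl).
- intros z. apply (bd_iff Op gam HL).
- intros t. apply (holder_cont _ hl_holder).
- apply hl_neq0.
- apply hl_index.
Qed.

Let pl := fun t => lam (gam t).

Lemma L_gam t : L (gam t).
Proof. apply (bd_iff Op gam HL). now exists t. Qed.

Lemma pl_exp t : Cexp (pl t) = hl (gam t).
Proof. apply lam_spec, L_gam. Qed.

Lemma pl_cont t : Rcont pl t.
Proof.
apply Rcont_iff. intros eps He.
assert (A := proj1 (filterlim_C_iff _ _ _) (proj1 lam_spec (gam t) (L_gam t)) eps He).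
unfold within in A. apply locally_C_iff in A. destruct A as [d [Hd A]].
destruct (proj1 (Rcont_iff gam t) (gam_cont gam Hg t) d Hd) as [d' [Hd' H']].
exists d'; split; auto. intros s Hs. apply A; auto. apply L_gam.
Qed.

Lemma pl_per t : pl (t + 1) = pl t.
Proof. apply per_gam. Qed.

Lemma pl_holder : holder pl.
Proof.
apply holder_log; [apply pl_per|apply pl_cont|].
replace (fun t => Cexp (pl t)) with (fun t => hl (gam t)); [apply hl_holder|].
apply functional_extensionality. intros t; symmetry; apply pl_exp.
Qed.

Let bl := bval gam pl (off gam).

Lemma Gamma_eq z : Gamma Op gam G z = cauchyT gam pl z.
Proof. unfold Gamma. now rewrite cauchy_int_eq. Qed.

Definition Xp (s : R) : C := Cexp (pl s + bl s).
Definition Xm (s : R) : C := (Czpow (gam s) a * Cexp (bl s))%C.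

Lemma Xp_neq0 s : Xp s <> RtoC 0.
Proof. apply Cexp_neq0. Qed.

Lemma Xm_neq0 s : Xm s <> RtoC 0.
Proof.
apply Cmult_neq_0; [|apply Cexp_neq0]. intros E.
apply (hl_neq0 s). unfold hl. rewrite E; ring.
Qed.

Lemma Xp_Xm s : Xp s = (h s * Xm s)%C.
Proof. unfold Xp, Xm. rewrite Cexp_plus, pl_exp. unfold hl, h. ring. Qed.

Lemma Ccont_Cexp z : Ccont Cexp z.
Proof. apply (cont_Cexp (U := C_UniformSpace) (fun z => z)), Ccont_id. Qed.

Lemma Xplus_lim s : Clim In (gam s) (Xplus Op gam G) (Xp s).
Proof.
apply (Clim_ext _ _ (fun z => Cexp (cauchyT gam pl z))); [intros; unfold Xplus; now rewrite Gamma_eq|].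
apply (Clim_comp _ _ _ _ Cexp); [apply Ccont_Cexp|].
apply (cauchyT_In Op gam Hopen Hbd HL pl pl_per pl_holder).
Qed.

Lemma X_In s : Clim In (gam s) (X Op gam G) (Xp s).
Proof.
apply (Clim_ext _ _ (Xplus Op gam G)); [|apply Xplus_lim]. intros z Hz. unfold X.
destruct (excluded_middle_informative (In z)); tauto.
Qed.

Lemma X_Ext s : Clim Ext (gam s) (X Op gam G) (Xm s).
Proof.
apply (Clim_ext _ _ (fun z => Czpow z a * Cexp (cauchyT gam pl z))%C).
- intros z Hz. unfold X. destruct (excluded_middle_informative (In z)) as [H|H].
  + apply (Ext_iff Op gam HL) in Hz. tauto.
  + unfold Xminus. now rewrite Gamma_eq.
- apply Clim_mult.
  + apply (Clim_cont _ _ (fun z => Czpow z a)). apply Ccont_Czpow. intros Ha. now apply gam_neq0.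
  + apply (Clim_comp _ _ _ _ Cexp); [apply Ccont_Cexp|].
    apply (cauchyT_Ext Op gam Hopen Hbd HL pl pl_per pl_holder).
Qed.

(** The value chosen by [epsilon] is a limit from inside, and such a limit is unique because the
    domain accumulates at [gam s]. *)
Lemma Xplus_bv_eq s : Xplus_bv Op gam G (gam s) = Xp s.
Proof.
apply (Clim_unique In (gam s) (Xplus Op gam G)); [apply (In_adherent Op gam HL)| |apply Xplus_lim].
apply Clim_filterlim. unfold Xplus_bv. apply epsilon_spec. exists (Xp s).
apply Clim_filterlim, Xplus_lim.
Qed.

Lemma Ext_neq0 z : Ext z -> a <> 0%Z -> z <> RtoC 0.
Proof. intros Hz Ha E. apply (Ext_iff Op gam HL) in Hz. apply Hz. rewrite E. auto. Qed.

Lemma X_holo : holo (off gam) (X Op gam G).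
Proof.
assert (HE : holo (off gam) (fun z => Cexp (cauchyT gam pl z)))
  by (apply holo_comp_exp, (cauchyT_holo Op gam HL pl pl_holder)).
apply holo_loc. intros z Hz. apply (off_cases Op gam Hopen HL) in Hz. destruct Hz as [Hz|Hz].
- destruct (In_open Op Hopen z Hz) as [d [Hd H]].
  assert (HI : holo (fun w => Cmod (w - z) < d) (X Op gam G)).
  { apply (holo_ext _ (fun z => Cexp (cauchyT gam pl z))).
    - intros w Hw. exists (d - Cmod (w - z)). split; [lra|]. intros u Hu. generalize (Cmod_triangle_sub u w z). lra.
    - intros w Hw. unfold X. destruct (excluded_middle_informative (In w)) as [_|N]; [|exfalso; apply N, H; auto].
      unfold Xplus. now rewrite Gamma_eq.
    - destruct HE as [f' Hf']. exists f'. intros w Hw. apply Hf', (off_cases Op gam Hopen HL). left; auto. }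
  destruct HI as [f' Hf']. exists d; split; auto. exists f'. auto.
- destruct (Ext_open Op gam Hopen HL z Hz) as [d [Hd H]].
  assert (HI : holo (fun w => Cmod (w - z) < d) (X Op gam G)).
  { apply (holo_ext _ (fun z => Czpow z a * Cexp (cauchyT gam pl z))%C).
    - intros w Hw. exists (d - Cmod (w - z)). split; [lra|]. intros u Hu. generalize (Cmod_triangle_sub u w z). lra.
    - intros w Hw. unfold X. destruct (excluded_middle_informative (In w)) as [N|_].
      + exfalso. specialize (H w Hw). apply (Ext_iff Op gam HL) in H. tauto.
      + unfold Xminus. now rewrite Gamma_eq.
    - apply holo_mult; [apply holo_Czpow; intros w Hw; now apply Ext_neq0, H|].
      destruct HE as [f' Hf']. exists f'. intros w Hw. apply Hf', (off_cases Op gam Hopen HL). right; auto. }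
  destruct HI as [f' Hf']. exists d; split; auto. exists f'. auto.
Qed.

Lemma X_neq0 z : off gam z -> X Op gam G z <> RtoC 0.
Proof.
intros Hz. unfold X. destruct (excluded_middle_informative (In z)) as [H|H].
- apply Cexp_neq0.
- apply Cmult_neq_0; [|apply Cexp_neq0].
  assert (He : Ext z) by (apply (Ext_iff Op gam HL); auto).
  change (aleph gam G) with a. destruct (Z.eq_dec a 0) as [E|E].
  + rewrite E, Czpow_0. intros E1. apply RtoC_inj in E1. lra.
  + now apply Czpow_neq0, Ext_neq0.
Qed.

(** The exponent is a Cauchy integral, so eventually its modulus is below 1, and the modulus of the
    exponential lies between [1 / 3] and [3] by [exp 1 <= 3]. *)
Lemma X_far : exists M, forall z, M < Cmod z -> Ext z /\ 1 < Cmod z /\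
  Cmod (X Op gam G z) <= 3 * Cmod (Czpow z a) /\ Cmod (Czpow z a) <= 3 * Cmod (X Op gam G z).
Proof.
destruct (far_Ext Op gam Hbd HL) as [M HM].
destruct (cauchyT_far Op gam HL pl pl_holder 1 Rlt_0_1) as [M' HM'].
exists (Rmax 1 (Rmax M M')). intros z Hz.
assert (H1 := Rle_lt_trans _ _ _ (Rmax_l _ _) Hz). assert (H2 := Rle_lt_trans _ _ _ (Rmax_r _ _) Hz).
assert (H3 := Rle_lt_trans _ _ _ (Rmax_l _ _) H2). assert (H4 := Rle_lt_trans _ _ _ (Rmax_r _ _) H2).
specialize (HM z H3). specialize (HM' z H4). split; [auto|]. split; [auto|].
assert (EX : X Op gam G z = (Czpow z a * Cexp (cauchyT gam pl z))%C).
{ unfold X. destruct (excluded_middle_informative (In z)) as [N|_].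
  - exfalso. apply (Ext_iff Op gam HL) in HM. tauto.
  - unfold Xminus. now rewrite Gamma_eq. }
rewrite EX, Cmod_mult, Cmod_Cexp.
assert (HR := re_le_Cmod (cauchyT gam pl z)). set (x := Re (cauchyT gam pl z)) in *.
assert (Hx : -1 <= x <= 1) by (apply Rabs_le_between; lra).
assert (E1 : exp x <= 3) by (eapply Rle_trans; [apply exp_le_mono, (proj2 Hx)|apply exp_le_3]).
assert (E2 : 1 <= 3 * exp x).
{ assert (P : exp x * exp (- x) = 1) by (rewrite <- exp_plus; replace (x + - x) with 0 by ring; apply exp_0).
  assert (Q : exp (- x) <= 3) by (eapply Rle_trans; [apply (exp_le_mono (- x) 1); lra|apply exp_le_3]).
  assert (0 < exp x) by apply exp_pos. nra. }
assert (0 <= Cmod (Czpow z a)) by apply Cmod_ge_0. split; nra.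
Qed.

Lemma Xp_holder : holder Xp.
Proof.
apply holder_exp.
- apply bounded_per.
  + intros t. rewrite pl_per. f_equal. apply (bv_per Op gam Hopen Hbd HL pl pl_per pl_holder).
  + apply holder_plus; [apply pl_holder|]. apply (bv_holder Op gam Hopen Hbd HL pl pl_per pl_holder).
- apply holder_plus; [apply pl_holder|]. apply (bv_holder Op gam Hopen Hbd HL pl pl_per pl_holder).
Qed.

Lemma Xp_per t : Xp (t + 1) = Xp t.
Proof.
unfold Xp. rewrite pl_per. do 2 f_equal. apply (bv_per Op gam Hopen Hbd HL pl pl_per pl_holder).
Qed.

(** * Solutions of the scalar problem with right-hand side [q] *)

Section Problem.
Variable q : C -> C.
Hypothesis Hq : holder (fun t => q (gam t)).
Let dens := fun tau => (q tau / Xplus_bv Op gam G tau)%C.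
Let Psi := cauchy_int gam dens.
Let pd := fun t => (q (gam t) / Xp t)%C.

Lemma dens_gam t : dens (gam t) = pd t.
Proof. unfold dens, pd. now rewrite Xplus_bv_eq. Qed.

Lemma pd_per t : pd (t + 1) = pd t.
Proof. unfold pd. now rewrite Xp_per, (gam_per gam Hg). Qed.

Lemma pd_holder : holder pd.
Proof.
assert (HI : holder (fun t => / Xp t)%C) by (apply holder_inv_per; [apply Xp_per|apply Xp_neq0|apply Xp_holder]).
apply (holder_mult (fun t => q (gam t)) (fun t => / Xp t)%C); auto.
- apply bounded_per; auto. intros t; apply per_gam.
- apply bounded_per; auto. intros t. now rewrite Xp_per.
Qed.

Lemma Psi_eq z : Psi z = cauchyT gam pd z.
Proof.
unfold Psi. rewrite cauchy_int_eq. f_equal.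
apply functional_extensionality, dens_gam.
Qed.

(** The coefficient [h] is the conjugate of [hG]. Boundary values are one-sided limits indexed by
    the parameter, so no extension to the closed regions has to be carried along. *)
Definition ssol (Y : C -> C) : Prop :=
  holo (off gam) Y /\
  (forall eps, 0 < eps -> exists M, forall z, Ext z -> M < Cmod z -> Cmod (Y z) < eps) /\
  exists yp ym : R -> C, (forall s, Clim In (gam s) Y (yp s)) /\ (forall s, Clim Ext (gam s) Y (ym s)) /\
    forall s, (yp s - h s * ym s)%C = q (gam s).

Let N := Z.to_nat (- a).
Let bd := bval gam pd (off gam).

Lemma Psi_In s : Clim In (gam s) Psi (pd s + bd s)%C.
Proof.
apply (Clim_ext _ _ (cauchyT gam pd)); [intros; symmetry; apply Psi_eq|].
apply (cauchyT_In Op gam Hopen Hbd HL pd pd_per pd_holder).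
Qed.

Lemma Psi_Ext s : Clim Ext (gam s) Psi (bd s).
Proof.
apply (Clim_ext _ _ (cauchyT gam pd)); [intros; symmetry; apply Psi_eq|].
apply (cauchyT_Ext Op gam Hopen Hbd HL pd pd_per pd_holder).
Qed.

Lemma Psi_holo : holo (off gam) Psi.
Proof.
replace Psi with (cauchyT gam pd).
- apply (cauchyT_holo Op gam HL pd pd_holder).
- apply functional_extensionality. intros; symmetry; apply Psi_eq.
Qed.

Lemma Psi_far eps : 0 < eps -> exists M, forall z, M < Cmod z -> Cmod (Psi z) < eps.
Proof.
intros He. destruct (cauchyT_far Op gam HL pd pd_holder eps He) as [M H].
exists M. intros z Hz. rewrite Psi_eq. auto.
Qed.

Lemma ssol_ext Y Y' : (forall z, off gam z -> Y z = Y' z) -> ssol Y -> ssol Y'.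
Proof.
intros E [H1 [H2 [yp [ym [H3 [H4 H5]]]]]]. split; [|split].
- apply (holo_ext _ Y); auto. intros z Hz. now apply off_open.
- intros eps He. destruct (H2 eps He) as [M H]. exists M. intros z Hz Hm. rewrite <- E; auto.
  now apply (Ext_iff Op gam HL).
- exists yp, ym. split; [|split]; auto.
  + intros s. apply (Clim_ext _ _ Y); auto. intros z Hz. apply E, (In_off Op gam Hopen HL z Hz).
  + intros s. apply (Clim_ext _ _ Y); auto. intros z Hz. apply E. now apply (Ext_iff Op gam HL).
Qed.

(** One inequality for both signs of the index: for [a > 0] the exponent [N] is 0 and [z ^ a] alone
    has modulus at least 1. *)
Lemma Czpow_le_pow z : 1 < Cmod z -> 1 <= Cmod (Czpow z a) * Cmod z ^ N.
Proof.
intros Hz. assert (Hz0 : z <> RtoC 0) by (apply Cmod_gt_0; lra). unfold N.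
destruct (Z_le_dec a 0) as [H|H].
- rewrite Cmod_Czpow_neg by auto. right. symmetry. apply Rinv_l. apply pow_nonzero; lra.
- replace (Z.to_nat (- a)) with 0%nat by lia. rewrite Cmod_Czpow_pos by lia. simpl. rewrite Rmult_1_r.
  apply pow_R1_Rle; lra.
Qed.

(** Both signs of the index are treated at once: for [a > 0] the length [N] is 0, and every solution
    is [X * Psi]. *)
Lemma ssol_poly Y : ssol Y -> exists P, length P = N /\ forall z, off gam z ->
  Y z = (X Op gam G z * (Psi z + Cpoly P z))%C.
Proof.
intros [HY [Hinf [yp [ym [Hyp [Hym Hjump]]]]]].
set (V0 := fun z => (Y z / X Op gam G z - Psi z)%C).
(* The exterior limit of [V0]; the interior one coincides with it because [Xp = h * Xm] and
   [yp - h * ym = q]. *)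
set (vb := fun s => (ym s / Xm s - bd s)%C).
assert (HV0 : holo (off gam) V0).
{ apply holo_minus; [|apply Psi_holo]. apply holo_mult; auto. apply holo_inv; [apply X_holo|apply X_neq0]. }
assert (HVE : forall s, Clim Ext (gam s) V0 (vb s)).
{ intros s. apply Clim_minus; [|apply Psi_Ext]. apply Clim_div; auto; [apply Xm_neq0|apply X_Ext]. }
assert (HVI : forall s, Clim In (gam s) V0 (vb s)).
{ intros s. replace (vb s) with (yp s / Xp s - (pd s + bd s))%C.
  - apply Clim_minus; [|apply Psi_In]. apply Clim_div; auto; [apply Xp_neq0|apply X_In].
  - assert (E : yp s = (h s * ym s + q (gam s))%C) by (rewrite <- Hjump; ring).
    unfold vb, pd. rewrite E, Xp_Xm. assert (N1 := Xm_neq0 s). assert (N2 := Xp_neq0 s). rewrite Xp_Xm in N2.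
    assert (N3 : h s <> RtoC 0) by (intros E3; apply N2; rewrite E3; ring).
    field; auto. }
set (par := fun z => epsilon (inhabits 0) (fun t => gam t = z)).
assert (Hpar : forall z, L z -> gam (par z) = z).
{ intros z Hz. apply (epsilon_spec (inhabits 0) (fun t => gam t = z)). now apply (bd_iff Op gam HL). }
set (V := fun z => if excluded_middle_informative (off gam z) then V0 z else vb (par z)).
assert (HL_off : forall z, L z -> ~ off gam z) by (intros z Hz Ho; apply (off_iff Op gam HL) in Ho; auto).
assert (Hall : forall z, off gam z \/ L z).
{ intros z. destruct (classic (L z)); auto. left. now apply (off_iff Op gam HL). }
assert (Hadh : forall z, L z -> adherent (off gam) z).
{ intros z Hz. rewrite <- (Hpar z Hz). apply (off_adherent Op gam Hopen HL). }
assert (HLim : forall x, L x -> Clim (off gam) x V0 (vb (par x))).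
{ intros x Hx. rewrite <- (Hpar x Hx) at 1.
  apply (Clim_sub _ (fun z => In z \/ Ext z)); [intros w; apply (off_cases Op gam Hopen HL)|].
  apply Clim_or; auto. }
assert (HVc : forall z, Ccont V z).
{ intros z. apply Ccont_iff. intros eps He.
  destruct (extend_by_limits (off gam) L V0 (fun z => vb (par z))
    (off_open gam Hg) (fun z Hz => holo_cont _ _ _ HV0 Hz) HL_off Hadh HLim z (Hall z) eps He) as [d [Hd H]].
  exists d; split; auto. intros w Hw. exact (H w (Hall w) Hw). }
assert (EV : forall z, off gam z -> V0 z = V z).
{ intros z Hz. unfold V. destruct (excluded_middle_informative (off gam z)); tauto. }
assert (HVh : holo everywhere V).
{ apply (Painleve gam V Hg HVc). apply (holo_ext _ V0); auto. now apply off_open. }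
destruct (Liouville_poly N V HVh) as [P [HP1 HP2]].
- intros eps He.
  (* [Y / X] costs [eps / 6] times the bound [3 * Cmod z ^ N] for [/ X], and [Psi] costs the other
     [eps / 2]. *)
  destruct (Hinf (eps / 6) ltac:(lra)) as [M1 H1]. destruct (Psi_far (eps / 2) ltac:(lra)) as [M2 H2].
  destruct X_far as [M3 H3].
  exists (Rmax M1 (Rmax M2 M3)). intros z Hz.
  assert (Hz1 := Rle_lt_trans _ _ _ (Rmax_l _ _) Hz). assert (Hz' := Rle_lt_trans _ _ _ (Rmax_r _ _) Hz).
  assert (Hz2 := Rle_lt_trans _ _ _ (Rmax_l _ _) Hz'). assert (Hz3 := Rle_lt_trans _ _ _ (Rmax_r _ _) Hz').
  destruct (H3 z Hz3) as [HE [Hz4 [_ HX]]]. specialize (H1 z HE Hz1). specialize (H2 z Hz2).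
  assert (Ho : off gam z) by now apply (Ext_iff Op gam HL).
  rewrite <- EV by auto. unfold V0.
  eapply Rle_trans; [apply Cmod_sub_le|]. rewrite Cmod_div by now apply X_neq0.
  assert (HXp : 0 < Cmod (X Op gam G z)) by (now apply Cmod_gt_0, X_neq0).
  assert (HW := Czpow_le_pow z Hz4). assert (HN : 1 <= Cmod z ^ N) by (apply pow_R1_Rle; lra).
  assert (HXi : / Cmod (X Op gam G z) <= 3 * Cmod z ^ N).
  { apply (Rmult_le_reg_l (Cmod (X Op gam G z))); auto. rewrite Rinv_r by lra. nra. }
  assert (Hd : Cmod (Y z) / Cmod (X Op gam G z) <= eps / 6 * (3 * Cmod z ^ N)).
  { apply Rmult_le_compat; [apply Cmod_ge_0|apply Rlt_le, Rinv_0_lt_compat; auto|lra|auto]. }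
  nra.
- exists P. split; auto. intros z Hz. rewrite <- HP2, <- EV by auto. unfold V0.
  assert (NX := X_neq0 z Hz). field; auto.
Qed.

(** The decay hypothesis bears on [z ^ a * Psi]; the polynomial part vanishes at infinity by itself,
    its degree being below [- a] when [a < 0] and the list being empty otherwise. *)
Lemma poly_ssol P : length P = N ->
  (forall eps, 0 < eps -> exists M, forall z, M < Cmod z -> Cmod (Czpow z a) * Cmod (Psi z) < eps) ->
  ssol (fun z => X Op gam G z * (Psi z + Cpoly P z))%C.
Proof.
intros HP Hdec. split; [|split].
- apply holo_mult; [apply X_holo|]. apply holo_plus; [apply Psi_holo|apply holo_poly].
- intros eps He.
  destruct (Hdec (eps / 6) ltac:(lra)) as [M1 H1]. destruct (Cpoly_growth P (eps / 12) ltac:(lra)) as [M2 H2].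
  destruct X_far as [M3 H3].
  exists (Rmax M1 (Rmax M2 M3)). intros z _ Hz.
  assert (Hz1 := Rle_lt_trans _ _ _ (Rmax_l _ _) Hz). assert (Hz' := Rle_lt_trans _ _ _ (Rmax_r _ _) Hz).
  assert (Hz2 := Rle_lt_trans _ _ _ (Rmax_l _ _) Hz'). assert (Hz3 := Rle_lt_trans _ _ _ (Rmax_r _ _) Hz').
  destruct (H3 z Hz3) as [HE [Hz4 [HX _]]]. specialize (H1 z Hz1). specialize (H2 z Hz2).
  rewrite Cmod_mult.
  assert (HQ : Cmod (Czpow z a) * Cmod (Cpoly P z) <= eps / 12).
  { rewrite HP in H2. unfold N in *. destruct (Z_le_dec a 0) as [Ha|Ha].
    - rewrite Cmod_Czpow_neg by (auto; apply Cmod_gt_0; lra).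
      assert (Hp : 0 < Cmod z ^ Z.to_nat (- a)) by (apply pow_lt; lra).
      apply (Rmult_le_reg_l (Cmod z ^ Z.to_nat (- a))); auto. rewrite <- Rmult_assoc, Rinv_r by lra. lra.
    - replace P with (@nil C) by (destruct P; [auto|simpl in HP; lia]). simpl. rewrite Cmod_0. lra. }
  eapply Rle_lt_trans; [apply Rmult_le_compat; [apply Cmod_ge_0|apply Cmod_ge_0|exact HX|apply Cmod_triangle]|].
  lra.
- exists (fun s => Xp s * (pd s + bd s + Cpoly P (gam s)))%C, (fun s => Xm s * (bd s + Cpoly P (gam s)))%C.
  assert (HPc : forall z, Ccont (Cpoly P) z) by (intros z; apply (holo_cont everywhere); [apply holo_poly|exact I]).
  split; [|split]; intros s.
  + apply Clim_mult; [apply X_In|]. apply Clim_plus; [apply Psi_In|now apply Clim_cont].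
  + apply Clim_mult; [apply X_Ext|]. apply Clim_plus; [apply Psi_Ext|now apply Clim_cont].
  + unfold pd. rewrite Xp_Xm. assert (N2 := Xp_neq0 s). rewrite Xp_Xm in N2.
    assert (N1 := Xm_neq0 s).
    assert (N3 : h s <> RtoC 0) by (intros E3; apply N2; rewrite E3; ring).
    field; auto.
Qed.

Lemma decay_of_nonpos_index : (a <= 0)%Z ->
  forall eps, 0 < eps -> exists M, forall z, M < Cmod z -> Cmod (Czpow z a) * Cmod (Psi z) < eps.
Proof.
intros Ha eps He. destruct (Psi_far eps He) as [M H]. exists (Rmax 1 M). intros z Hz.
assert (H1 := Rle_lt_trans _ _ _ (Rmax_l _ _) Hz). assert (H2 := Rle_lt_trans _ _ _ (Rmax_r _ _) Hz).
specialize (H z H2). rewrite Cmod_Czpow_neg by (auto; apply Cmod_gt_0; lra).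
assert (Hp : 1 <= Cmod z ^ Z.to_nat (- a)) by (apply pow_R1_Rle; lra).
assert (Hi : / Cmod z ^ Z.to_nat (- a) <= 1) by (rewrite <- Rinv_1; apply Rinv_le_contravar; lra).
assert (0 < / Cmod z ^ Z.to_nat (- a)) by (apply Rinv_0_lt_compat; lra).
assert (0 <= Cmod (Psi z)) by apply Cmod_ge_0. nra.
Qed.

(** The moments against [tau ^ 0, ..., tau ^ (a - 1)] vanish, so [z ^ a] can be absorbed into the
    Cauchy integral, which still tends to 0. *)
Lemma decay_of_moments : (0 < a)%Z ->
  (forall k : nat, (1 <= k)%nat -> (Z.of_nat k <= a)%Z ->
     cint gam (fun tau => Cmult (dens tau) (Cpow tau (k - 1))) = RtoC 0) ->
  forall eps, 0 < eps -> exists M, forall z, M < Cmod z -> Cmod (Czpow z a) * Cmod (Psi z) < eps.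
Proof.
intros Ha Hm eps He.
set (n := Z.to_nat a).
assert (Hn : holder (fun t => pd t * gam t ^ n)%C).
{ apply holder_mult.
  - apply bounded_per; [apply pd_per|apply pd_holder].
  - apply bounded_per; [|apply holder_gam_pow]. intros t; apply (per_gam (fun z => z ^ n)%C).
  - apply pd_holder.
  - apply holder_gam_pow. }
destruct (cauchyT_far Op gam HL _ Hn eps He) as [M H].
destruct (far_Ext Op gam Hbd HL) as [M' HM'].
exists (Rmax M M'). intros z Hz.
assert (H1 := Rle_lt_trans _ _ _ (Rmax_l _ _) Hz). assert (H2 := Rle_lt_trans _ _ _ (Rmax_r _ _) Hz).
specialize (H z H1). specialize (HM' z H2).
rewrite Cmod_Czpow_pos by lia. fold n. rewrite <- Cmod_pow, <- Cmod_mult, Psi_eq.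
rewrite (cauchyT_moments Op gam HL n pd); auto.
- apply holder_cont, pd_holder.
(* Moments are numbered from 1 in the solubility conditions and from 0 in [cauchyT_moments]. *)
- intros k Hk. rewrite <- (Hm (S k)) by (unfold n in Hk; lia).
  unfold cint. apply cI_ext; [lra|]. intros t _. rewrite dens_gam.
  replace (S k - 1)%nat with k by lia. reflexivity.
- now apply (Ext_iff Op gam HL).
Qed.

End Problem.
End Scalar.

(** * The Clifford algebra as a pair of complex numbers *)

(* [Y0] includes the conjugation of the formula for [Phi], which makes both [Y0 Phi] and
   [Y1 Phi] holomorphic when [Phi] is monogenic. *)
Definition Y0 (a : Cl) : C := Cconj (beta (even_part a)).
Definition Y1 (a : Cl) : C := beta (odd_part a).
(** The inverse of the pair [Y0], [Y1]: the signs undo the conjugation in [Y0] and the sign in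
    [odd_part]. *)
Definition toCl (w0 w1 : C) : Cl := (Re w0, Re w1, - Im w1, - Im w0).

Lemma toCl_Y a : toCl (Y0 a) (Y1 a) = a.
Proof. destruct a as [[[s p] q] t]. unfold toCl, Y0, Y1, Re, Im; simpl. now rewrite !Ropp_involutive. Qed.

Lemma Y0_toCl w0 w1 : Y0 (toCl w0 w1) = w0.
Proof. apply C_eq; unfold toCl, Y0; simpl; unfold Re, Im; ring. Qed.

Lemma Y1_toCl w0 w1 : Y1 (toCl w0 w1) = w1.
Proof. apply C_eq; unfold toCl, Y1; simpl; unfold Re, Im; ring. Qed.

Lemma Cl_eq a b : Y0 a = Y0 b -> Y1 a = Y1 b -> a = b.
Proof. intros H0 H1. now rewrite <- (toCl_Y a), <- (toCl_Y b), H0, H1. Qed.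

Lemma Y0_plus (a b : Cl) : Y0 (plus a b) = (Y0 a + Y0 b)%C.
Proof. destruct a as [[[? ?] ?] ?], b as [[[? ?] ?] ?]. apply C_eq; simpl; unfold plus; simpl; ring. Qed.
Lemma Y1_plus (a b : Cl) : Y1 (plus a b) = (Y1 a + Y1 b)%C.
Proof. destruct a as [[[? ?] ?] ?], b as [[[? ?] ?] ?]. apply C_eq; simpl; unfold plus; simpl; ring. Qed.
Lemma Y0_minus (a b : Cl) : Y0 (minus a b) = (Y0 a - Y0 b)%C.
Proof. destruct a as [[[? ?] ?] ?], b as [[[? ?] ?] ?]. apply C_eq; simpl; unfold plus, opp; simpl; ring. Qed.
Lemma Y1_minus (a b : Cl) : Y1 (minus a b) = (Y1 a - Y1 b)%C.
Proof. destruct a as [[[? ?] ?] ?], b as [[[? ?] ?] ?]. apply C_eq; simpl; unfold plus, opp; simpl; ring. Qed.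
Lemma Y0_scal (c : R) (a : Cl) : Y0 (scal c a) = (RtoC c * Y0 a)%C.
Proof. destruct a as [[[? ?] ?] ?]. apply C_eq; simpl; unfold scal; simpl; unfold mult; simpl; ring. Qed.
Lemma Y1_scal (c : R) (a : Cl) : Y1 (scal c a) = (RtoC c * Y1 a)%C.
Proof. destruct a as [[[? ?] ?] ?]. apply C_eq; simpl; unfold scal; simpl; unfold mult; simpl; ring. Qed.
Lemma Y0_zero : Y0 zero = RtoC 0.
Proof. apply C_eq; simpl; unfold zero; simpl; ring. Qed.
Lemma Y1_zero : Y1 zero = RtoC 0.
Proof. apply C_eq; simpl; unfold zero; simpl; ring. Qed.

Lemma norm_Cl (a : Cl) : norm a = sqrt (Cmod (Y0 a) ^ 2 + Cmod (Y1 a) ^ 2).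
Proof.
destruct a as [[[s p] q] t]. rewrite !Cmod2_alt. unfold Y0, Y1, Re, Im; simpl.
unfold norm; simpl. unfold prod_norm; simpl. unfold norm; simpl. unfold prod_norm; simpl. unfold norm; simpl.
unfold prod_norm; simpl. unfold norm; simpl. unfold abs; simpl.
f_equal.
assert (A : forall x, Rabs x * (Rabs x * 1) = x * x).
{ intros x. rewrite Rmult_1_r. rewrite <- Rabs_mult. apply Rabs_pos_eq. nra. }
assert (B : forall x, 0 <= x -> sqrt x * (sqrt x * 1) = x).
{ intros x Hx. rewrite Rmult_1_r. now apply sqrt_sqrt. }
rewrite !A, !B by nra. ring.
Qed.

Lemma norm_Cl_ge (a : Cl) : Cmod (Y0 a) <= norm a /\ Cmod (Y1 a) <= norm a.
Proof.
rewrite norm_Cl. split; [rewrite <- (sqrt_pow2 (Cmod (Y0 a))) at 1 by apply Cmod_ge_0|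
  rewrite <- (sqrt_pow2 (Cmod (Y1 a))) at 1 by apply Cmod_ge_0]; apply sqrt_le_1_alt;
  generalize (pow2_ge_0 (Cmod (Y0 a))) (pow2_ge_0 (Cmod (Y1 a))); lra.
Qed.

Lemma norm_Cl_le (a : Cl) : norm a <= Cmod (Y0 a) + Cmod (Y1 a).
Proof.
rewrite norm_Cl. assert (H0 := Cmod_ge_0 (Y0 a)). assert (H1 := Cmod_ge_0 (Y1 a)).
rewrite <- (sqrt_pow2 (Cmod (Y0 a) + Cmod (Y1 a))) by lra. apply sqrt_le_1_alt. simpl. nra.
Qed.

Lemma filterlim_Cl {T : Type} (F : (T -> Prop) -> Prop) {FF : Filter F} (f : T -> Cl) (l : Cl) :
  filterlim f F (locally l) <->
  filterlim (fun y => Y0 (f y)) F (locally (T := C_UniformSpace) (Y0 l)) /\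
  filterlim (fun y => Y1 (f y)) F (locally (T := C_UniformSpace) (Y1 l)).
Proof.
rewrite !(filterlim_C_iff F). split.
- intros H. assert (A : forall eps, 0 < eps -> F (fun y => Cmod (Y0 (f y) - Y0 l) < eps /\ Cmod (Y1 (f y) - Y1 l) < eps)).
  { intros eps He.
    assert (B : locally l (fun y : Cl => norm (minus y l) < eps)).
    { apply (locally_le_locally_norm l). exists (mkposreal eps He). intros y Hy. exact Hy. }
    specialize (H _ B). unfold filtermap in H. revert H. apply filter_imp. intros y Hy.
    rewrite <- Y0_minus, <- Y1_minus. generalize (norm_Cl_ge (minus (f y) l)). lra. }
  split; intros eps He; generalize (A eps He); apply filter_imp; tauto.
- intros [H0 H1] P HP.
  apply (locally_norm_le_locally l) in HP. destruct HP as [eps HP].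
  unfold filtermap.
  assert (He : 0 < eps / 2) by (generalize (cond_pos eps); lra).
  generalize (filter_and _ _ (H0 _ He) (H1 _ He)). apply filter_imp. intros y [A B]. apply HP.
  rewrite <- Y0_minus in A. rewrite <- Y1_minus in B.
  change (norm (minus (f y) l) < eps). generalize (norm_Cl_le (minus (f y) l)). lra.
Qed.

Lemma is_derive_norm_iff (f : R -> Cl) (t : R) (l : Cl) :
  is_derive f t l <-> forall eps, 0 < eps -> exists d, 0 < d /\
    forall s, Rabs (s - t) < d -> norm (minus (minus (f s) (f t)) (scal (s - t) l)) <= eps * Rabs (s - t).
Proof.
split.
- intros [_ H] eps He.
  destruct (H t (fun P HP => HP) (mkposreal eps He)) as [d Hd].
  exists d; split; [apply cond_pos|]; intros w Hw. exact (Hd w Hw).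
- intros H; split; [apply is_linear_scal_l|].
  intros x Hx eps. apply (is_filter_lim_locally_unique (K := R_AbsRing) (V := R_NormedModule)) in Hx; subst x.
  destruct (H eps (cond_pos eps)) as [d [Hd H1]].
  exists (mkposreal d Hd); intros w Hw. exact (H1 w Hw).
Qed.

Lemma is_derive_Cl (f : R -> Cl) (t : R) (l : Cl) :
  is_derive f t l <-> Rdiff (fun s => Y0 (f s)) t (Y0 l) /\ Rdiff (fun s => Y1 (f s)) t (Y1 l).
Proof.
rewrite is_derive_norm_iff, !Rdiff_iff.
assert (E0 : forall s, Y0 (minus (minus (f s) (f t)) (scal (s - t) l)) = (Y0 (f s) - Y0 (f t) - Y0 l * RtoC (s - t))%C)
  by (intros s; rewrite !Y0_minus, Y0_scal; ring).
assert (E1 : forall s, Y1 (minus (minus (f s) (f t)) (scal (s - t) l)) = (Y1 (f s) - Y1 (f t) - Y1 l * RtoC (s - t))%C)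
  by (intros s; rewrite !Y1_minus, Y1_scal; ring).
split.
- intros H; split; intros eps He; destruct (H eps He) as [d [Hd A]]; exists d; split; auto; intros s Hs;
  specialize (A s Hs); [rewrite <- E0|rewrite <- E1];
  generalize (norm_Cl_ge (minus (minus (f s) (f t)) (scal (s - t) l))); lra.
- intros [H0 H1] eps He.
  destruct (H0 (eps / 2)) as [d [Hd A]]; [lra|]. destruct (H1 (eps / 2)) as [d' [Hd' B]]; [lra|].
  exists (Rmin d d'). split; [now apply Rmin_pos|]. intros s Hs.
  specialize (A s (Rlt_le_trans _ _ _ Hs (Rmin_l _ _))). specialize (B s (Rlt_le_trans _ _ _ Hs (Rmin_r _ _))).
  rewrite <- E0 in A. rewrite <- E1 in B.
  generalize (norm_Cl_le (minus (minus (f s) (f t)) (scal (s - t) l))). lra.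
Qed.

(** These are the Cauchy-Riemann equations for [Y0 Phi] and [Y1 Phi], in the form used by
    [CR_Cdiff]. *)
Lemma dirac_Cl (d1 d2 : Cl) : plus (cl_mul e1 d1) (cl_mul e2 d2) = zero <->
  Y0 d2 = (Ci * Y0 d1)%C /\ Y1 d2 = (Ci * Y1 d1)%C.
Proof.
destruct d1 as [[[s1 p1] q1] t1], d2 as [[[s2 p2] q2] t2].
unfold cl_mul, e1, e2, plus, zero; simpl. unfold prod_plus, prod_zero, plus, zero; simpl.
unfold prod_plus, prod_zero, plus, zero; simpl. unfold prod_plus, prod_zero, plus, zero; simpl.
unfold Y0, Y1, Cmult; simpl. split.
- intros E. injection E. intros. split; apply C_eq; simpl; lra.
- intros [E1 E2]. assert (A1 := f_equal Re E1). assert (A2 := f_equal Im E1).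
  assert (A3 := f_equal Re E2). assert (A4 := f_equal Im E2). simpl in *.
  repeat apply (f_equal2 pair); lra.
Qed.

(** The conjugate appears in both components for different reasons: in [Y0] by its definition, in
    [Y1] because an even element is conjugated when it moves past [e1]. *)
Lemma mul_even_Cl (G a : Cl) : odd_part G = zero ->
  Y0 (cl_mul G a) = (Cconj (beta (even_part G)) * Y0 a)%C /\
  Y1 (cl_mul G a) = (Cconj (beta (even_part G)) * Y1 a)%C.
Proof.
destruct G as [[[s p] q] t], a as [[[s' p'] q'] t']. intros E. unfold odd_part, zero in E; simpl in E.
unfold prod_zero, zero in E; simpl in E. unfold prod_zero, zero in E; simpl in E.
injection E. intros E2 E1. assert (Hq : q = 0) by (apply (f_equal Ropp) in E2; rewrite Ropp_involutive in E2; rewrite E2; unfold zero; simpl; ring).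
assert (Hp : p = 0) by exact E1. subst p q.
split; apply C_eq; simpl; unfold zero; simpl; ring.
Qed.

Lemma Phi_formula_toCl Op gam G g P0 P1 x :
  Phi_formula Op gam G g P0 P1 x = toCl (Upsilon0 Op gam G g P0 x) (Upsilon1 Op gam G g P1 x).
Proof.
unfold Phi_formula. replace (alpha_inv x) with x by (destruct x; reflexivity).
set (u := Upsilon0 Op gam G g P0 x). set (w := Upsilon1 Op gam G g P1 x).
apply Cl_eq; [rewrite Y0_plus, Y0_toCl|rewrite Y1_plus, Y1_toCl]; apply C_eq; simpl; unfold Re, Im; ring.
Qed.

Lemma Rdiff_horizontal (y : R) t : Rdiff (fun s => (s, y) : C) t (RtoC 1).
Proof.
apply Rdiff_ReIm; simpl; split.
- apply (is_derive_id (K := R_AbsRing)).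
- apply (is_derive_const (K := R_AbsRing) (V := R_NormedModule)).
Qed.

Lemma Rdiff_vertical (x : R) t : Rdiff (fun s => (x, s) : C) t Ci.
Proof.
apply Rdiff_ReIm; simpl; split.
- apply (is_derive_const (K := R_AbsRing) (V := R_NormedModule)).
- apply (is_derive_id (K := R_AbsRing)).
Qed.

Lemma continuous_on_Ccont (U : C -> Prop) (f : C -> C) :
  (forall z, U z -> exists d, 0 < d /\ forall w, Cmod (w - z) < d -> U w) ->
  (forall z, U z -> filterlim f (within U (locally (T := C_UniformSpace) z)) (locally (T := C_UniformSpace) (f z))) ->
  forall z, U z -> Ccont f z.
Proof.
intros HU H z Hz. apply Ccont_iff. intros eps He.
assert (A := proj1 (filterlim_C_iff _ _ _) (H z Hz) eps He). unfold within in A.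
apply locally_C_iff in A. destruct A as [d [Hd A]]. destruct (HU z Hz) as [d' [Hd' B]].
exists (Rmin d d'). split; [now apply Rmin_pos|]. intros w Hw. apply A.
- apply (Rlt_le_trans _ _ _ Hw), Rmin_l.
- apply B, (Rlt_le_trans _ _ _ Hw), Rmin_r.
Qed.

Lemma continuous_on_Cl (U : R2 -> Prop) (f : R2 -> Cl) :
  continuous_on U f <-> forall z : C, U z ->
    filterlim (fun z => Y0 (f z)) (within U (locally (T := C_UniformSpace) z)) (locally (T := C_UniformSpace) (Y0 (f z))) /\
    filterlim (fun z => Y1 (f z)) (within U (locally (T := C_UniformSpace) z)) (locally (T := C_UniformSpace) (Y1 (f z))).
Proof.
split.
- intros H z Hz. apply (filterlim_Cl (within U (locally (T := C_UniformSpace) z))). exact (H z Hz).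
- intros H z Hz. apply (filterlim_Cl (within U (locally (T := C_UniformSpace) z))). exact (H z Hz).
Qed.

Lemma monogenic_holo (U : C -> Prop) (Phi : R2 -> Cl) :
  (forall z, U z -> exists d, 0 < d /\ forall w, Cmod (w - z) < d -> U w) ->
  (monogenic_on U Phi <-> holo U (fun z => Y0 (Phi z)) /\ holo U (fun z => Y1 (Phi z))).
Proof.
intros HU. split.
- intros [d1 [d2 [Hc1 [_ HD]]]].
  assert (C1 := proj1 (continuous_on_Cl U d1) Hc1).
  assert (K : forall Y : Cl -> C, (Y = Y0 \/ Y = Y1) -> holo U (fun z => Y (Phi z))).
  { intros Y HY. exists (fun z => Y (d1 z)).
    assert (HYc : forall z, U z -> Ccont (fun z => Y (d1 z)) z).
    { apply continuous_on_Ccont; auto. intros z Hz. destruct HY as [->| ->]; [exact (proj1 (C1 z Hz))|exact (proj2 (C1 z Hz))]. }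
    intros z Hz. split; auto.
    destruct (HU z Hz) as [d [Hd Hw]].
    apply (CR_Cdiff (fun z => Y (Phi z)) (fun z => Y (d1 z)) z d Hd); auto.
    intros w Hwz. destruct (HD w (Hw w Hwz)) as [A [B E]].
    apply dirac_Cl in E. apply is_derive_Cl in A. apply is_derive_Cl in B.
    change (fst w) with (Re w) in *. change (snd w) with (Im w) in *.
    destruct E as [E0 E1], A as [A0 A1], B as [B0 B1]. rewrite E0 in B0. rewrite E1 in B1.
    destruct HY as [->| ->]; split; auto. }
  split; apply K; auto.
- intros [[f0 H0] [f1 H1]].
  exists (fun z => toCl (f0 z) (f1 z)), (fun z => toCl (Ci * f0 z) (Ci * f1 z)).
  assert (W : forall (f : C -> C) z, Ccont f z -> filterlim f (within U (locally (T := C_UniformSpace) z)) (locally (T := C_UniformSpace) (f z))).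
  { intros f z H P HP. unfold filtermap, within. generalize (H P HP). unfold filtermap. apply filter_imp; auto. }
  assert (HC : forall a b : C -> C, (forall z, U z -> Ccont a z) -> (forall z, U z -> Ccont b z) ->
     continuous_on U (fun z => toCl (a z) (b z))).
  { intros a b Ha Hb. apply continuous_on_Cl. intros z Hz. rewrite Y0_toCl, Y1_toCl. split.
    - apply (filterlim_ext a); [intros; now rewrite Y0_toCl|]. apply W; auto.
    - apply (filterlim_ext b); [intros; now rewrite Y1_toCl|]. apply W; auto. }
  split; [|split].
  + apply HC; intros z Hz; [apply H0|apply H1]; auto.
  + apply HC; intros z Hz; (apply cont_Cmult; [apply cont_const|]); [apply H0|apply H1]; auto.
  + intros z Hz. split; [|split].
    * apply is_derive_Cl. rewrite Y0_toCl, Y1_toCl. split.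
      -- eapply Rdiff_val; [apply (Rdiff_comp (fun z => Y0 (Phi z)) (fun s => (s, snd z)) (fst z) (f0 z) (RtoC 1))|].
         ++ destruct z; now apply H0.
         ++ apply Rdiff_horizontal.
         ++ ring.
      -- eapply Rdiff_val; [apply (Rdiff_comp (fun z => Y1 (Phi z)) (fun s => (s, snd z)) (fst z) (f1 z) (RtoC 1))|].
         ++ destruct z; now apply H1.
         ++ apply Rdiff_horizontal.
         ++ ring.
    * apply is_derive_Cl. rewrite Y0_toCl, Y1_toCl. split.
      -- eapply Rdiff_val; [apply (Rdiff_comp (fun z => Y0 (Phi z)) (fun s => (fst z, s)) (snd z) (f0 z) Ci)|].
         ++ destruct z; now apply H0.
         ++ apply Rdiff_vertical.
         ++ ring.
      -- eapply Rdiff_val; [apply (Rdiff_comp (fun z => Y1 (Phi z)) (fun s => (fst z, s)) (snd z) (f1 z) Ci)|].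
         ++ destruct z; now apply H1.
         ++ apply Rdiff_vertical.
         ++ ring.
    * apply dirac_Cl. now rewrite !Y0_toCl, !Y1_toCl.
Qed.

(** * The Riemann problem in the Clifford algebra *)

Lemma onC_id (D : R2 -> Prop) (z : C) : onC D z = D z.
Proof. unfold onC. now rewrite alpha_id. Qed.

Lemma continuous_extension_ex (U L : C -> Prop) (Phi : R2 -> Cl) (y0 y1 : C -> C) :
  (forall x, U x -> exists d, 0 < d /\ forall w, Cmod (w - x) < d -> U w) ->
  (forall x, U x -> Ccont (fun z => Y0 (Phi z)) x) -> (forall x, U x -> Ccont (fun z => Y1 (Phi z)) x) ->
  (forall x, L x -> ~ U x) -> (forall x, L x -> adherent U x) ->
  (forall x, L x -> Clim U x (fun z => Y0 (Phi z)) (y0 x)) ->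
  (forall x, L x -> Clim U x (fun z => Y1 (Phi z)) (y1 x)) ->
  exists Psi : R2 -> Cl, continuous_extension U L Phi Psi /\
    forall x, L x -> Y0 (Psi x) = y0 x /\ Y1 (Psi x) = y1 x.
Proof.
intros HU H0 H1 HLU Ha L0 L1.
set (F := fun (Y : Cl -> C) (y : C -> C) (z : C) => if excluded_middle_informative (U z) then Y (Phi z) else y z).
assert (E0 := extend_by_limits U L (fun z => Y0 (Phi z)) y0 HU H0 HLU Ha L0).
assert (E1 := extend_by_limits U L (fun z => Y1 (Phi z)) y1 HU H1 HLU Ha L1).
exists (fun z => toCl (F Y0 y0 z) (F Y1 y1 z)). split; [split|].
- apply continuous_on_Cl. intros z Hz. split; apply Clim_filterlim.
  + apply (Clim_ext _ _ (F Y0 y0)); [intros; now rewrite Y0_toCl|]. rewrite Y0_toCl. now apply E0.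
  + apply (Clim_ext _ _ (F Y1 y1)); [intros; now rewrite Y1_toCl|]. rewrite Y1_toCl. now apply E1.
- intros x Hx. unfold F. destruct (excluded_middle_informative (U x)); [apply toCl_Y|tauto].
- intros x Hx. rewrite Y0_toCl, Y1_toCl. unfold F.
  destruct (excluded_middle_informative (U x)) as [Ux|]; [exfalso; now apply (HLU x)|auto].
Qed.

Lemma continuous_extension_lim (U L : C -> Prop) (Phi Psi : R2 -> Cl) (x : C) :
  continuous_extension U L Phi Psi -> L x ->
  Clim U x (fun z => Y0 (Phi z)) (Y0 (Psi x)) /\ Clim U x (fun z => Y1 (Phi z)) (Y1 (Psi x)).
Proof.
intros [Hc HE] Hx. assert (A := proj1 (continuous_on_Cl _ Psi) Hc x (or_intror Hx)).
destruct A as [A0 A1]. apply Clim_filterlim in A0. apply Clim_filterlim in A1. split.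
- apply (Clim_ext _ _ (fun z => Y0 (Psi z))); [intros z Hz; now rewrite HE|].
  apply (Clim_sub _ (fun z => U z \/ L z)); auto.
- apply (Clim_ext _ _ (fun z => Y1 (Psi z))); [intros z Hz; now rewrite HE|].
  apply (Clim_sub _ (fun z => U z \/ L z)); auto.
Qed.

(** Composition with the Lipschitz map [gam] preserves the exponent; [Rabs K + 1] makes the constant
    positive for every [K]. *)
Lemma holder_on_param (nu : R) (L : R2 -> Prop) (f : R2 -> Cl) gam : smooth_closed_curve gam ->
  0 < nu <= 1 -> (forall t, L (gam t)) -> holder_on nu L f ->
  holder (fun t => Y0 (f (gam t))) /\ holder (fun t => Y1 (f (gam t))).
Proof.
intros Hg Hnu HLg [K HK]. destruct (gam_lip gam Hg) as [M [HM HgM]].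
assert (Hb : forall s t, Rabs (s - t) < 1 -> norm (minus (f (gam s)) (f (gam t))) <= (Rabs K + 1) * Rpower M nu * Rpower (Rabs (s - t)) nu).
{ intros s t _. assert (HK0 := Rabs_pos K).
  assert (P0 : 0 <= (Rabs K + 1) * Rpower M nu * Rpower (Rabs (s - t)) nu).
  { repeat apply Rmult_le_pos; [lra|apply Rlt_le, Rpower_pos|apply Rlt_le, Rpower_pos]. }
  destruct (classic (gam s = gam t)) as [E|E].
  - rewrite E. eapply Rle_trans; [apply norm_Cl_le|]. rewrite Y0_minus, Y1_minus, !Cmod_0_sub. lra.
  - assert (Hst : s <> t) by (intros ->; auto).
    eapply Rle_trans; [apply HK; auto|].
    replace (norm (minus (gam s : R2) (gam t))) with (Cmod (gam s - gam t)) by (rewrite Cmod_norm; reflexivity).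
    assert (Hp : 0 < Cmod (gam s - gam t)) by now apply Cmod_sub_gt0.
    rewrite Rmult_assoc, Rpower_mult_distr by (auto; apply Rabs_pos_lt; lra).
    apply Rmult_le_compat; [|apply Rlt_le, Rpower_pos| |].
    (* A negative [K] would bound the norm of a difference by a negative number, as [gam s] and
       [gam t] are distinct. *)
    + destruct (Rle_dec 0 K); auto. exfalso.
      assert (A := HK (gam s) (gam t) (HLg s) (HLg t) E).
      assert (B := norm_ge_0 (minus (f (gam s)) (f (gam t)))).
      assert (D := Rpower_pos (norm (minus (gam s : R2) (gam t))) nu). nra.
    + generalize (Rle_abs K); lra.
    + apply Rpower_le_base; [|lra]. split; auto. }
assert (HP := Rpower_pos M nu).
assert (HKM : 0 < (Rabs K + 1) * Rpower M nu) by (apply Rmult_lt_0_compat; [generalize (Rabs_pos K); lra|auto]).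
split; exists ((Rabs K + 1) * Rpower M nu), nu, 1; (split; [auto|split; [auto|split; [lra|]]]); intros s t Hst;
  (eapply Rle_trans; [|exact (Hb s t Hst)]); [rewrite <- Y0_minus|rewrite <- Y1_minus]; apply norm_Cl_ge.
Qed.

Lemma Cpoly_snoc l a z : Cpoly (l ++ a :: nil) z = (Cpoly l z + a * z ^ length l)%C.
Proof.
induction l as [|b l IH]; simpl; [ring|]. rewrite IH. ring.
Qed.

(** For large [z] the leading term dominates the others, so the top coefficient vanishes; induction
    removes it. *)
Lemma Cpoly_zero l M : (forall z, M < Cmod z -> Cpoly l z = RtoC 0) -> forall j, nth j l (RtoC 0) = RtoC 0.
Proof.
induction l as [|a l IH] using rev_ind; intros H j; [destruct j; reflexivity|].
assert (Ha : a = RtoC 0).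
{ apply Cmod_lt_all. intros eps He. replace (a - RtoC 0)%C with a by ring.
  destruct (Cpoly_growth l (eps / 2) ltac:(lra)) as [M' HM'].
  set (r := Rabs M + Rabs M' + 1). generalize (Rabs_pos M) (Rabs_pos M') (Rle_abs M) (Rle_abs M'). intros.
  assert (Hr : Cmod (RtoC r) = r) by (rewrite Cmod_R, Rabs_pos_eq; unfold r; lra).
  assert (HM1 := HM' (RtoC r) ltac:(rewrite Hr; unfold r; lra)).
  assert (H4 := H (RtoC r) ltac:(rewrite Hr; unfold r; lra)). rewrite Cpoly_snoc in H4.
  assert (E : Cmod a * r ^ length l <= eps / 2 * r ^ length l).
  { rewrite <- Hr at 1. rewrite <- Cmod_pow, <- Cmod_mult.
    replace (a * RtoC r ^ length l)%C with (- Cpoly l (RtoC r))%C.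
    - rewrite Cmod_opp. rewrite Hr in HM1. exact HM1.
    - replace (a * RtoC r ^ length l)%C with ((Cpoly l (RtoC r) + a * RtoC r ^ length l) - Cpoly l (RtoC r))%C by ring.
      rewrite H4. ring. }
  assert (Hp : 0 < r ^ length l) by (apply pow_lt; unfold r; lra).
  apply Rmult_le_reg_r in E; lra. }
assert (Hl : forall z, M < Cmod z -> Cpoly l z = RtoC 0).
{ intros z Hz. rewrite <- (H z Hz), Cpoly_snoc, Ha. ring. }
destruct (Nat.lt_ge_cases j (length l)) as [Hj|Hj].
- rewrite app_nth1 by auto. now apply IH.
- rewrite app_nth2 by auto. rewrite Ha. now destruct (j - length l)%nat as [|[|?]].
Qed.

(** * Reduction of the Clifford problem to two scalar ones *)

Section Final.
Variables (Op : R2 -> Prop) (gam : R -> C) (nu : R) (G g : R2 -> Cl).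
Hypotheses (Hopen : open Op) (Hbd : bounded_set Op) (HL : smooth_boundary_param Op gam) (Hnu : 0 < nu <= 1)
  (G_holder : holder_on nu (boundary Op) G) (g_holder : holder_on nu (boundary Op) g)
  (G_even : forall x, boundary Op x -> odd_part (G x) = zero)
  (G_neq0 : forall x, boundary Op x -> G x <> zero)
  (origin_inside : aleph gam G <> 0%Z -> Op (0, 0)).
Let Hg : smooth_closed_curve gam := proj1 HL.
Let q0 := fun tau => Cconj (hat (fun x => even_part (g x)) tau).
Let q1 := fun tau => hat (fun x => odd_part (g x)) tau.
Notation S0 := (ssol Op gam G q0).
Notation S1 := (ssol Op gam G q1).

Lemma q0_gam z : q0 z = Y0 (g z).
Proof. unfold q0, hat. now rewrite alpha_id. Qed.

Lemma q1_gam z : q1 z = Y1 (g z).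
Proof. unfold q1, hat. now rewrite alpha_id. Qed.

Lemma q0_holder : holder (fun t => q0 (gam t)).
Proof.
replace (fun t => q0 (gam t)) with (fun t => Y0 (g (gam t))).
- apply (holder_on_param nu (boundary Op) g gam Hg Hnu); auto. intros; apply (bd_gam Op gam HL).
- apply functional_extensionality. intros; now rewrite q0_gam.
Qed.

Lemma q1_holder : holder (fun t => q1 (gam t)).
Proof.
replace (fun t => q1 (gam t)) with (fun t => Y1 (g (gam t))).
- apply (holder_on_param nu (boundary Op) g gam Hg Hnu); auto. intros; apply (bd_gam Op gam HL).
- apply functional_extensionality. intros; now rewrite q1_gam.
Qed.

Lemma hG_eq z : hat (fun x => even_part (G x)) z = Cconj (Y0 (G z)).
Proof. unfold hat, Y0. rewrite alpha_id. destruct (G z) as [[[s p] q] t]. apply C_eq; simpl; ring. Qed.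

Lemma G_conj z : Cconj (hat (fun x => even_part (G x)) z) = Cconj (beta (even_part (G z))).
Proof. unfold hat. now rewrite alpha_id. Qed.

Lemma hG_holder : holder (fun t => hat (fun x => even_part (G x)) (gam t)).
Proof.
replace (fun t => hat (fun x => even_part (G x)) (gam t)) with (fun t => Cconj (Y0 (G (gam t)))).
- apply holder_conj. apply (holder_on_param nu (boundary Op) G gam Hg Hnu); auto. intros; apply (bd_gam Op gam HL).
- apply functional_extensionality. intros; now rewrite hG_eq.
Qed.

Lemma hG_neq0 t : hat (fun x => even_part (G x)) (gam t) <> RtoC 0.
Proof.
rewrite hG_eq. intros E. apply (G_neq0 (gam t) (bd_gam Op gam HL t)). apply Cl_eq.
- rewrite Y0_zero. apply (f_equal Cmod) in E. rewrite Cmod_conj, Cmod_0 in E. now apply Cmod_eq_0.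
- unfold Y1 at 1. rewrite (G_even (gam t) (bd_gam Op gam HL t)). rewrite Y1_zero. reflexivity.
Qed.

Lemma Horig : aleph gam G <> 0%Z -> onC Op (RtoC 0).
Proof. exact origin_inside. Qed.

Lemma bd_param z : boundary Op z <-> exists t, gam t = z.
Proof. rewrite <- (onC_id (boundary Op)). apply (bd_iff Op gam HL). Qed.

Lemma off_bd z : off gam z <-> ~ boundary Op z.
Proof. rewrite <- (onC_id (boundary Op)). apply (off_iff Op gam HL). Qed.

(** The coordinates [Y0] and [Y1] decouple monogenicity, decay and the boundary condition.
    Conversely, limits indexed by the parameter become functions on the boundary through a chosen
    inverse [par] of [gam]. *)
Lemma is_solution_iff (Phi : R2 -> Cl) :
  is_solution Op G g Phi <-> S0 (fun z => Y0 (Phi z)) /\ S1 (fun z => Y1 (Phi z)).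
Proof.
assert (HUo : forall z, ~ boundary Op z -> exists d, 0 < d /\ forall w, Cmod (w - z) < d -> ~ boundary Op w).
{ intros z Hz. apply off_bd in Hz. destruct (off_open gam Hg z Hz) as [d [Hd H]]. exists d; split; auto.
  intros w Hw. apply off_bd; auto. }
assert (Hho : forall f, holo (fun z => ~ boundary Op z) f <-> holo (off gam) f).
{ intros f. split; intros [f' H]; exists f'; intros z Hz; apply H, off_bd, Hz. }
split.
- intros [Hmon [Hinf [PP [PM [HP [HM Hj]]]]]].
  apply (monogenic_holo (fun z => ~ boundary Op z)) in Hmon; auto.
  destruct Hmon as [M0 M1]. apply Hho in M0. apply Hho in M1.
  assert (Hbg := bd_gam Op gam HL).
  assert (HPl := fun s => continuous_extension_lim Op (boundary Op) Phi PP (gam s) HP (Hbg s)).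
  assert (HMl := fun s => continuous_extension_lim (exterior Op) (boundary Op) Phi PM (gam s) HM (Hbg s)).
  assert (HIn : forall s f l, Clim Op (gam s) f l -> Clim (onC Op) (gam s) f l)
    by (intros s f l; apply Clim_sub; intros z; now rewrite onC_id).
  assert (HEx : forall s f l, Clim (exterior Op) (gam s) f l -> Clim (onC (exterior Op)) (gam s) f l)
    by (intros s f l; apply Clim_sub; intros z; now rewrite onC_id).
  assert (Hv : forall Y : Cl -> C, (forall a, Cmod (Y a) <= norm a) -> forall eps, 0 < eps -> exists M, forall z, onC (exterior Op) z -> M < Cmod z -> Cmod (Y (Phi z)) < eps).
  { intros Y HY eps He. destruct (Hinf eps He) as [M H]. exists M. intros z Hz Hm. rewrite onC_id in Hz.
    eapply Rle_lt_trans; [apply HY|]. apply H; auto.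
    replace (norm (z : R2)) with (Cmod z); auto. apply Cmod_norm. }
  assert (HJ : forall s, (Y0 (PP (gam s)) - Cconj (hat (fun x => even_part (G x)) (gam s)) * Y0 (PM (gam s)))%C = q0 (gam s) /\
     (Y1 (PP (gam s)) - Cconj (hat (fun x => even_part (G x)) (gam s)) * Y1 (PM (gam s)))%C = q1 (gam s)).
  { intros s. rewrite q0_gam, q1_gam, <- (Hj (gam s) (Hbg s)), Y0_minus, Y1_minus, G_conj.
    destruct (mul_even_Cl (G (gam s)) (PM (gam s)) (G_even _ (Hbg s))) as [-> ->]. auto. }
  split; (split; [auto|split; [apply Hv; intros; apply norm_Cl_ge|]]).
  + exists (fun s => Y0 (PP (gam s))), (fun s => Y0 (PM (gam s))). split; [|split]; intros s.
    * apply HIn, HPl.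
    * apply HEx, HMl.
    * apply HJ.
  + exists (fun s => Y1 (PP (gam s))), (fun s => Y1 (PM (gam s))). split; [|split]; intros s.
    * apply HIn, HPl.
    * apply HEx, HMl.
    * apply HJ.
- intros [[M0 [V0 [yp0 [ym0 [P0 [N0 J0]]]]]] [M1 [V1 [yp1 [ym1 [P1 [N1 J1]]]]]]].
  split; [|split].
  + apply (monogenic_holo (fun z => ~ boundary Op z)); auto. split; apply Hho; auto.
  + intros eps He. destruct (V0 (eps / 2) ltac:(lra)) as [A0 B0]. destruct (V1 (eps / 2) ltac:(lra)) as [A1 B1].
    exists (Rmax A0 A1). intros z Hz Hm.
    assert (Hm' : Rmax A0 A1 < Cmod z) by (replace (Cmod z) with (norm (z : R2)); auto; symmetry; apply Cmod_norm).
    rewrite <- onC_id in Hz.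
    specialize (B0 z Hz (Rle_lt_trans _ _ _ (Rmax_l _ _) Hm')). specialize (B1 z Hz (Rle_lt_trans _ _ _ (Rmax_r _ _) Hm')).
    generalize (norm_Cl_le (Phi z)). lra.
  + set (par := fun z => epsilon (inhabits 0) (fun t => gam t = z)).
    assert (Hpar : forall z, boundary Op z -> gam (par z) = z).
    { intros z Hz. apply (epsilon_spec (inhabits 0) (fun t => gam t = z)). now apply bd_param. }
    assert (HcO : forall f, holo (off gam) f -> forall z, off gam z -> Ccont f z) by (intros f Hf z; now apply holo_cont).
    assert (Hoff : forall z, Op z -> off gam z) by (intros z Hz; apply (In_off Op gam Hopen HL); now rewrite onC_id).
    assert (Hoffe : forall z, exterior Op z -> off gam z) by (intros z Hz; rewrite <- onC_id in Hz; now apply (Ext_iff Op gam HL)).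
    destruct (continuous_extension_ex Op (boundary Op) Phi (fun z => yp0 (par z)) (fun z => yp1 (par z))) as [PP [HP1 HP2]].
    * intros x Hx. rewrite <- onC_id in Hx. destruct (In_open Op Hopen x Hx) as [d [Hd H]].
      exists d; split; auto. intros w Hw. rewrite <- onC_id. auto.
    * intros x Hx. apply (HcO (fun z => Y0 (Phi z))); auto.
    * intros x Hx. apply (HcO (fun z => Y1 (Phi z))); auto.
    * intros x Hx Hx'. apply Hoff in Hx'. now apply off_bd in Hx'.
    * intros x Hx. rewrite <- (Hpar x Hx). intros eps He.
      destruct (In_adherent Op gam HL (par x) eps He) as [z Hz]. exists z. now rewrite onC_id in Hz.
    * intros x Hx. rewrite <- (Hpar x Hx) at 1. apply (Clim_sub _ (onC Op)); [intros z; now rewrite onC_id|auto].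
    * intros x Hx. rewrite <- (Hpar x Hx) at 1. apply (Clim_sub _ (onC Op)); [intros z; now rewrite onC_id|auto].
    * destruct (continuous_extension_ex (exterior Op) (boundary Op) Phi (fun z => ym0 (par z)) (fun z => ym1 (par z))) as [PM [HM1 HM2]].
      -- intros x Hx. rewrite <- onC_id in Hx. destruct (Ext_open Op gam Hopen HL x Hx) as [d [Hd H]].
         exists d; split; auto. intros w Hw. rewrite <- onC_id. auto.
      -- intros x Hx. apply (HcO (fun z => Y0 (Phi z))); auto.
      -- intros x Hx. apply (HcO (fun z => Y1 (Phi z))); auto.
      -- intros x Hx Hx'. apply Hoffe in Hx'. now apply off_bd in Hx'.
      -- intros x Hx. rewrite <- (Hpar x Hx). intros eps He.
         destruct (Ext_adherent Op gam Hopen HL (par x) eps He) as [z Hz]. exists z. now rewrite onC_id in Hz.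
      -- intros x Hx. rewrite <- (Hpar x Hx) at 1. apply (Clim_sub _ (onC (exterior Op))); [intros z; now rewrite onC_id|auto].
      -- intros x Hx. rewrite <- (Hpar x Hx) at 1. apply (Clim_sub _ (onC (exterior Op))); [intros z; now rewrite onC_id|auto].
      -- exists PP, PM. split; [auto|split; auto]. intros x Hx.
         destruct (HP2 x Hx) as [A0 A1]. destruct (HM2 x Hx) as [B0 B1].
         destruct (mul_even_Cl (G x) (PM x) (G_even x Hx)) as [D0 D1].
         assert (K0 := J0 (par x)). assert (K1 := J1 (par x)). rewrite (Hpar x Hx) in K0, K1.
         rewrite G_conj in K0, K1. rewrite q0_gam in K0. rewrite q1_gam in K1.
         apply Cl_eq; [rewrite Y0_minus, D0, A0, B0|rewrite Y1_minus, D1, A1, B1]; auto.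
Qed.

(** What the sign of the index decides: this is automatic for a non-positive index and follows from
    the moment conditions for a positive one. *)
Definition decay (q : C -> C) : Prop :=
  forall eps, 0 < eps -> exists M, forall z, M < Cmod z ->
    Cmod (Czpow z (aleph gam G)) * Cmod (cauchy_int gam (fun tau => q tau / Xplus_bv Op gam G tau)%C z) < eps.

Lemma solution_formula (Phi : R2 -> Cl) : decay q0 -> decay q1 ->
  (is_solution Op G g Phi <-> exists P0 P1 : list C,
    length P0 = Z.to_nat (- aleph gam G) /\ length P1 = Z.to_nat (- aleph gam G) /\
    forall x, ~ boundary Op x -> Phi x = Phi_formula Op gam G g P0 P1 x).
Proof.
intros D0 D1. rewrite is_solution_iff. split.
- intros [H0 H1].
  destruct (ssol_poly Op gam G Hopen Hbd HL hG_holder hG_neq0 Horig q0 q0_holder _ H0) as [P0 [L0 E0]].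
  destruct (ssol_poly Op gam G Hopen Hbd HL hG_holder hG_neq0 Horig q1 q1_holder _ H1) as [P1 [L1 E1]].
  exists P0, P1. split; [auto|split; auto]. intros x Hx. apply off_bd in Hx.
  rewrite Phi_formula_toCl. apply Cl_eq; [rewrite Y0_toCl|rewrite Y1_toCl].
  + exact (E0 x Hx).
  + exact (E1 x Hx).
- intros [P0 [P1 [L0 [L1 E]]]].
  assert (E' : forall z, off gam z -> Phi z = toCl (Upsilon0 Op gam G g P0 z) (Upsilon1 Op gam G g P1 z)).
  { intros z Hz. rewrite E by (now apply off_bd). apply Phi_formula_toCl. }
  split.
  + apply (ssol_ext Op gam G Hopen HL q0 (Upsilon0 Op gam G g P0)).
    * intros z Hz. now rewrite E', Y0_toCl.
    * exact (poly_ssol Op gam G Hopen Hbd HL hG_holder hG_neq0 Horig q0 q0_holder P0 L0 D0).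
  + apply (ssol_ext Op gam G Hopen HL q1 (Upsilon1 Op gam G g P1)).
    * intros z Hz. now rewrite E', Y1_toCl.
    * exact (poly_ssol Op gam G Hopen Hbd HL hG_holder hG_neq0 Horig q1 q1_holder P1 L1 D1).
Qed.

Lemma decay_nonpos : (aleph gam G <= 0)%Z -> decay q0 /\ decay q1.
Proof.
intros Ha. split.
- exact (decay_of_nonpos_index Op gam G Hopen Hbd HL hG_holder hG_neq0 Horig q0 q0_holder Ha).
- exact (decay_of_nonpos_index Op gam G Hopen Hbd HL hG_holder hG_neq0 Horig q1 q1_holder Ha).
Qed.

Lemma decay_pos : (0 < aleph gam G)%Z ->
  (forall k : nat, (1 <= k)%nat -> (Z.of_nat k <= aleph gam G)%Z ->
        cint gam (fun tau => Cmult (density0 Op gam G g tau) (Cpow tau (k - 1))) = RtoC 0 /\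
        cint gam (fun tau => Cmult (density1 Op gam G g tau) (Cpow tau (k - 1))) = RtoC 0) ->
  decay q0 /\ decay q1.
Proof.
intros Ha Hk. split.
- exact (decay_of_moments Op gam G Hopen Hbd HL hG_holder hG_neq0 Horig q0 q0_holder Ha (fun k H1 H2 => proj1 (Hk k H1 H2))).
- exact (decay_of_moments Op gam G Hopen Hbd HL hG_holder hG_neq0 Horig q1 q1_holder Ha (fun k H1 H2 => proj2 (Hk k H1 H2))).
Qed.

(** * Counting the real constants *)

Let N := Z.to_nat (- aleph gam G).

(* Index [k = 4 j + i + 1] with [i < 4] stands for [z^j] and [i z^j] in the even part
   ([i = 0, 1]) and in the odd part ([i = 2, 3]). *)
Definition basis (k : nat) (z : C) : Cl :=
  let j := ((k - 1) / 4)%nat in let w := (X Op gam G z * z ^ j)%C in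
  match ((k - 1) mod 4)%nat with
  | 0%nat => toCl w (RtoC 0) | 1%nat => toCl (Ci * w) (RtoC 0)
  | 2%nat => toCl (RtoC 0) w | _ => toCl (RtoC 0) (Ci * w)
  end.

Definition coefs0 (c : nat -> R) (n : nat) : list C := map (fun j => (c (4 * j + 1)%nat, c (4 * j + 2)%nat)) (seq 0 n).
Definition coefs1 (c : nat -> R) (n : nat) : list C := map (fun j => (c (4 * j + 3)%nat, c (4 * j + 4)%nat)) (seq 0 n).

(** Four consecutive real coefficients form the two complex coefficients of one degree, so the
    induction adds four terms at a time. *)
Lemma basis_sum c n z : sum_n_m (fun k => scal (c k) (basis k z)) 1 (4 * n) =
  toCl (X Op gam G z * Cpoly (coefs0 c n) z) (X Op gam G z * Cpoly (coefs1 c n) z).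
Proof.
induction n as [|n IH].
- rewrite sum_n_m_zero by lia. apply Cl_eq; [rewrite Y0_toCl; transitivity (RtoC 0); [exact Y0_zero|]|rewrite Y1_toCl; transitivity (RtoC 0); [exact Y1_zero|]]; simpl; ring.
- replace (4 * S n)%nat with (S (S (S (S (4 * n))))) by lia.
  rewrite !sum_n_Sm by lia. rewrite IH.
  assert (Hdiv : forall i, (i < 4)%nat -> ((4 * n + i) / 4 = n /\ (4 * n + i) mod 4 = i)%nat).
  { intros i Hi. replace (4 * n + i)%nat with (i + n * 4)%nat by lia.
    rewrite Nat.div_add, Nat.Div0.mod_add, Nat.div_small, Nat.mod_small by lia. lia. }
  assert (B : forall i, (i < 4)%nat -> basis (S (4 * n + i)) z =
     match i with 0%nat => toCl (X Op gam G z * z ^ n) (RtoC 0) | 1%nat => toCl (Ci * (X Op gam G z * z ^ n)) (RtoC 0)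
     | 2%nat => toCl (RtoC 0) (X Op gam G z * z ^ n) | _ => toCl (RtoC 0) (Ci * (X Op gam G z * z ^ n)) end).
  { intros i Hi. unfold basis. replace (S (4 * n + i) - 1)%nat with (4 * n + i)%nat by lia.
    destruct (Hdiv i Hi) as [-> ->]. reflexivity. }
  assert (B0 := B 0%nat ltac:(lia)). assert (B1 := B 1%nat ltac:(lia)).
  assert (B2 := B 2%nat ltac:(lia)). assert (B3 := B 3%nat ltac:(lia)).
  replace (S (4 * n + 0)) with (S (4 * n)) in B0 by lia. replace (S (4 * n + 1)) with (S (S (4 * n))) in B1 by lia.
  replace (S (4 * n + 2)) with (S (S (S (4 * n)))) in B2 by lia. replace (S (4 * n + 3)) with (S (S (S (S (4 * n))))) in B3 by lia.
  rewrite B0, B1, B2, B3.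
  assert (EP0 : Cpoly (coefs0 c (S n)) z = (Cpoly (coefs0 c n) z + (c (S (4 * n)), c (S (S (4 * n)))) * z ^ n)%C).
  { unfold coefs0. rewrite seq_S, map_app. cbn [map]. rewrite Cpoly_snoc, length_map, length_seq.
    replace (4 * (0 + n) + 1)%nat with (S (4 * n)) by lia.
    replace (4 * (0 + n) + 2)%nat with (S (S (4 * n))) by lia. reflexivity. }
  assert (EP1 : Cpoly (coefs1 c (S n)) z = (Cpoly (coefs1 c n) z + (c (S (S (S (4 * n)))), c (S (S (S (S (4 * n)))))) * z ^ n)%C).
  { unfold coefs1. rewrite seq_S, map_app. cbn [map]. rewrite Cpoly_snoc, length_map, length_seq.
    replace (4 * (0 + n) + 3)%nat with (S (S (S (4 * n)))) by lia.
    replace (4 * (0 + n) + 4)%nat with (S (S (S (S (4 * n))))) by lia. reflexivity. }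
  rewrite EP0, EP1.
  assert (EC : forall x y : R, ((x, y) : C) = (RtoC x + Ci * RtoC y)%C) by (intros; apply C_eq; simpl; ring).
  rewrite !EC.
  apply Cl_eq; [rewrite !Y0_plus, !Y0_scal, !Y0_toCl|rewrite !Y1_plus, !Y1_scal, !Y1_toCl]; ring.
Qed.

Lemma coefs_ex P0 P1 n : length P0 = n -> length P1 = n ->
  exists c, coefs0 c n = P0 /\ coefs1 c n = P1.
Proof.
intros L0 L1.
exists (fun k => let j := ((k - 1) / 4)%nat in match ((k - 1) mod 4)%nat with
  | 0%nat => Re (nth j P0 (RtoC 0)) | 1%nat => Im (nth j P0 (RtoC 0))
  | 2%nat => Re (nth j P1 (RtoC 0)) | _ => Im (nth j P1 (RtoC 0)) end).
assert (Hdiv : forall j i, (i < 4)%nat -> ((4 * j + S i - 1) / 4 = j /\ (4 * j + S i - 1) mod 4 = i)%nat).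
{ intros j i Hi. replace (4 * j + S i - 1)%nat with (i + j * 4)%nat by lia.
  rewrite Nat.div_add, Nat.Div0.mod_add, Nat.div_small, Nat.mod_small by lia. lia. }
assert (Hs : forall P : list C, length P = n -> map (fun j => nth j P (RtoC 0)) (seq 0 n) = P).
{ intros P LP. apply (nth_ext _ _ (RtoC 0) (RtoC 0)); [now rewrite length_map, length_seq|].
  intros j Hj. rewrite length_map, length_seq in Hj.
  rewrite (nth_indep _ _ (nth 0 P (RtoC 0))) by (now rewrite length_map, length_seq).
  rewrite (map_nth (fun j => nth j P (RtoC 0))), seq_nth by auto. reflexivity. }
unfold coefs0, coefs1. split.
- transitivity (map (fun j => nth j P0 (RtoC 0)) (seq 0 n)); [|now apply Hs]. apply map_ext. intros j. cbv zeta.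
  destruct (Hdiv j 0%nat) as [-> ->]; [lia|]. destruct (Hdiv j 1%nat) as [-> ->]; [lia|].
  now destruct (nth j P0 (RtoC 0)).
- transitivity (map (fun j => nth j P1 (RtoC 0)) (seq 0 n)); [|now apply Hs]. apply map_ext. intros j. cbv zeta.
  destruct (Hdiv j 2%nat) as [-> ->]; [lia|]. destruct (Hdiv j 3%nat) as [-> ->]; [lia|].
  now destruct (nth j P1 (RtoC 0)).
Qed.

Lemma coefs_zero c n k : (forall j, nth j (coefs0 c n) (RtoC 0) = RtoC 0) ->
  (forall j, nth j (coefs1 c n) (RtoC 0) = RtoC 0) -> (1 <= k <= 4 * n)%nat -> c k = 0.
Proof.
intros H0 H1 Hk.
assert (A0 : forall j, (j < n)%nat -> c (4 * j + 1)%nat = 0 /\ c (4 * j + 2)%nat = 0).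
{ intros j Hj. specialize (H0 j). unfold coefs0 in H0.
  rewrite (nth_indep _ _ (c (4 * 0 + 1)%nat, c (4 * 0 + 2)%nat)) in H0 by (now rewrite length_map, length_seq).
  rewrite (map_nth (fun j => (c (4 * j + 1)%nat, c (4 * j + 2)%nat))), seq_nth in H0 by auto.
  apply (f_equal Re) in H0 as E1. apply (f_equal Im) in H0 as E2. auto. }
assert (A1 : forall j, (j < n)%nat -> c (4 * j + 3)%nat = 0 /\ c (4 * j + 4)%nat = 0).
{ intros j Hj. specialize (H1 j). unfold coefs1 in H1.
  rewrite (nth_indep _ _ (c (4 * 0 + 3)%nat, c (4 * 0 + 4)%nat)) in H1 by (now rewrite length_map, length_seq).
  rewrite (map_nth (fun j => (c (4 * j + 3)%nat, c (4 * j + 4)%nat))), seq_nth in H1 by auto.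
  apply (f_equal Re) in H1 as E1. apply (f_equal Im) in H1 as E2. auto. }
set (j := ((k - 1) / 4)%nat). assert (Ej := Nat.div_mod_eq (k - 1) 4). fold j in Ej.
assert (Hr := Nat.mod_upper_bound (k - 1) 4 ltac:(lia)). set (i := ((k - 1) mod 4)%nat) in *.
assert (Hj : (j < n)%nat) by lia.
destruct (A0 j Hj), (A1 j Hj).
destruct i as [|[|[|[|i]]]]; [replace k with (4 * j + 1)%nat by lia|replace k with (4 * j + 2)%nat by lia|
  replace k with (4 * j + 3)%nat by lia|replace k with (4 * j + 4)%nat by lia|lia]; auto.
Qed.

Lemma solution_dimension : (aleph gam G <= 0)%Z ->
  depends_on_real_constants (fun x => ~ boundary Op x) (is_solution Op G g) (Z.to_nat (- 4 * aleph gam G)).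
Proof.
intros Ha. destruct (decay_nonpos Ha) as [D0 D1].
replace (Z.to_nat (- 4 * aleph gam G)) with (4 * N)%nat by (unfold N; lia).
exists (Phi_formula Op gam G g nil nil), basis.
assert (Hsplit : forall P0 P1 x, Phi_formula Op gam G g P0 P1 x =
  plus (Phi_formula Op gam G g nil nil x) (toCl (X Op gam G x * Cpoly P0 x) (X Op gam G x * Cpoly P1 x))).
{ intros P0 P1 x. rewrite !Phi_formula_toCl. unfold Upsilon0, Upsilon1.
  apply Cl_eq; [rewrite Y0_plus, !Y0_toCl|rewrite Y1_plus, !Y1_toCl]; simpl; ring. }
split.
- intros Phi. rewrite (solution_formula Phi D0 D1). fold N. split.
  + intros [P0 [P1 [L0 [L1 E]]]]. destruct (coefs_ex P0 P1 N L0 L1) as [c [C0 C1]].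
    exists c. intros x Hx. rewrite basis_sum, C0, C1, <- Hsplit. auto.
  + intros [c Hc]. exists (coefs0 c N), (coefs1 c N). split; [|split].
    * unfold coefs0. now rewrite length_map, length_seq.
    * unfold coefs1. now rewrite length_map, length_seq.
    * intros x Hx. rewrite Hsplit, <- basis_sum. auto.
(* [X] has no zeros off the curve, so a vanishing combination makes both polynomials vanish for
   large [z], hence all their coefficients. *)
- intros c Hc k Hk.
  destruct (far_Ext Op gam Hbd HL) as [M HM].
  assert (HZ : forall z, M < Cmod z -> Cpoly (coefs0 c N) z = RtoC 0 /\ Cpoly (coefs1 c N) z = RtoC 0).
  { intros z Hz. apply HM in Hz. apply (Ext_iff Op gam HL) in Hz. destruct Hz as [Hz _].
    assert (E := Hc z (proj1 (off_bd z) Hz)). rewrite basis_sum in E.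
    assert (E0 := eq_trans (f_equal Y0 E) Y0_zero). assert (E1 := eq_trans (f_equal Y1 E) Y1_zero).
    rewrite Y0_toCl in E0. rewrite Y1_toCl in E1.
    assert (NX := X_neq0 Op gam G HL Horig z Hz).
    split.
    - replace (Cpoly (coefs0 c N) z) with (/ X Op gam G z * (X Op gam G z * Cpoly (coefs0 c N) z))%C by (field; auto).
      rewrite E0; ring.
    - replace (Cpoly (coefs1 c N) z) with (/ X Op gam G z * (X Op gam G z * Cpoly (coefs1 c N) z))%C by (field; auto).
      rewrite E1; ring. }
  apply (coefs_zero c N); auto.
  + apply (Cpoly_zero _ M). intros z Hz. now apply HZ.
  + apply (Cpoly_zero _ M). intros z Hz. now apply HZ.
Qed.

End Final.

Theorem theorem2 (Op : R2 -> Prop) (gam : R -> C) (nu : R) (G g : R2 -> Cl)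
  (Op_simply_connected : simply_connected_domain Op)
  (Op_bounded : bounded_set Op)
  (L_smooth : smooth_boundary_param Op gam)
  (nu_range : 0 < nu <= 1)
  (G_holder : holder_on nu (boundary Op) G)
  (g_holder : holder_on nu (boundary Op) g)
  (G_even : forall x, boundary Op x -> odd_part (G x) = zero)
  (G_neq0 : forall x, boundary Op x -> G x <> zero)
  (* needed for ln [tau ^ aleph * conj G0] to be single-valued on L *)
  (origin_inside : aleph gam G <> 0%Z -> Op (0, 0)) :
  ((aleph gam G <= 0)%Z ->
     (forall Phi : R2 -> Cl, is_solution Op G g Phi <->
        exists P0 P1 : list C,
          length P0 = Z.to_nat (- aleph gam G) /\
          length P1 = Z.to_nat (- aleph gam G) /\
          forall x : R2, ~ boundary Op x ->
            Phi x = Phi_formula Op gam G g P0 P1 x) /\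
     depends_on_real_constants (fun x => ~ boundary Op x) (is_solution Op G g)
       (Z.to_nat (- 4 * aleph gam G)))
  /\
  ((0 < aleph gam G)%Z ->
     (forall k : nat, (1 <= k)%nat -> (Z.of_nat k <= aleph gam G)%Z ->
        cint gam (fun tau => Cmult (density0 Op gam G g tau) (Cpow tau (k - 1)))
          = RtoC 0 /\
        cint gam (fun tau => Cmult (density1 Op gam G g tau) (Cpow tau (k - 1)))
          = RtoC 0) ->
     forall Phi : R2 -> Cl, is_solution Op G g Phi <->
       forall x : R2, ~ boundary Op x ->
         Phi x = Phi_formula Op gam G g nil nil x).
Proof.
assert (Hopen : open Op) by apply Op_simply_connected.
split.
- intros Ha.
  destruct (decay_nonpos Op gam nu G g Hopen Op_bounded L_smooth nu_range G_holder g_holder G_even G_neq0 origin_inside Ha) as [D0 D1].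
  split.
  + intros Phi.
    exact (solution_formula Op gam nu G g Hopen Op_bounded L_smooth nu_range G_holder g_holder G_even G_neq0 origin_inside Phi D0 D1).
  + exact (solution_dimension Op gam nu G g Hopen Op_bounded L_smooth nu_range G_holder g_holder G_even G_neq0 origin_inside Ha).
- intros Ha Hk Phi.
  destruct (decay_pos Op gam nu G g Hopen Op_bounded L_smooth nu_range G_holder g_holder G_even G_neq0 origin_inside Ha Hk) as [D0 D1].
  rewrite (solution_formula Op gam nu G g Hopen Op_bounded L_smooth nu_range G_holder g_holder G_even G_neq0 origin_inside Phi D0 D1).
  (* For a positive index the truncation to natural numbers gives 0, so both coefficient lists are
     empty. *)
  replace (Z.to_nat (- aleph gam G)) with 0%nat by lia. split.
  + intros [P0 [P1 [L0 [L1 E]]]]. apply length_zero_iff_nil in L0, L1. now subst.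
  + intros E. exists nil, nil. auto.
Qed.
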